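(* Suppose that $Z_0^{(1)},\ldots,Z_0^{(M)}\mid\mu_0$ are iid $\mathrm{IBP}(\mathsf{M}(1,\mathbf{p}_q)|\mu_0)$, where $\mu_0=(\mu_1,\ldots,\mu_q)$ is the multivariate CRM constructed from a Poisson random measure $N$ with intensity $\rho_q(d\mathbf{s}_q|\omega)B_0(d\omega)$, $\rho_q$ being concentrated on $\mathcal{S}_q$. Let $\omega_1,\ldots,\omega_K$ be the distinct features selected by at least one of $Z_0^{(1)},\ldots,Z_0^{(M)}$; let $b^{(i)}_{j,\ell}$ be the value assigned by $Z_j^{(i)}$ to $\omega_\ell$, and set $c_{j,\ell,M}=\sum_{i=1}^Mb^{(i)}_{j,\ell}$, $c_{\ell,M}=\sum_{j=1}^qc_{j,\ell,M}$, $\mathbf{c}_{\ell,M}=(c_{1,\ell,M},\ldots,c_{q,\ell,M})$, and $$\kappa_{\mathbf{c}_{\ell,M}}(\rho_{q,M}|\omega_\ell)=\int_{\mathcal{S}_q}\Big[\prod_{j=1}^qp_j^{c_{j,\ell,M}}\Big](1-p_\cdot)^{M-c_{\ell,M}}\rho_q(d\mathbf{p}_q|\omega_\ell),\qquad \rho_{q,M}(d\mathbf{s}_q|\omega)=(1-s_\cdot)^M\rho_q(d\mathbf{s}_q|\omega).$$ Then: (1) The posterior distribution of $N\mid Z_0^{(1)},\ldots,Z_0^{(M)}$ is equal to the distribution of the random measure $$N_M+\sum_{\ell=1}^K\delta_{(\mathbf{J}_{q,\ell},\omega_\ell)},$$ where $N_M$ is a $\mathrm{PRM}(\rho_{q,M}B_0)$,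 i.e. a Poisson random measure with mean intensity $(1-s_\cdot)^M\rho_q(d\mathbf{s}_q|\omega)B_0(d\omega)$, and, conditionally independent of $N_M$, the $(\mathbf{J}_{q,\ell})$ are an independent collection of random vectors such that $\mathbf{J}_{q,\ell}=(J_{1,\ell},\ldots,J_{q,\ell})$ has joint distribution $$\frac{\Big[\prod_{j=1}^qs_{j,\ell}^{c_{j,\ell,M}}\Big](1-s_{\cdot,\ell})^{M-c_{\ell,M}}\rho_q(d\mathbf{s}_{q,\ell}|\omega_\ell)}{\kappa_{\mathbf{c}_{\ell,M}}(\rho_{q,M}|\omega_\ell)}.$$ (2) $Z_0^{(M+1)}\mid Z_0^{(1)},\ldots,Z_0^{(M)}$ can be represented in terms of $\tilde Z_0^{(M+1)}=(\tilde Z_1^{(M+1)},\ldots,\tilde Z_q^{(M+1)})$, which is determined by $N_M$ and is an $\mathrm{IBP}(\mathsf{M}(1,\mathbf{p}_q),\rho_{q,M}B_0)$ vector, and $K$ vectors $b_0^{(\ell)}$, $\ell=1,\ldots,K$, where for each fixed $\ell$, $b_0^{(\ell)}\mid\mathbf{J}_{q,\ell}=\mathbf{s}_q$ has distribution $\mathsf{M}(1,\mathbf{s}_q)$. Specifically, component-wise $Z_0^{(M+1)}$ can be represented in distribution as $$\tilde Z_j^{(M+1)}+\sum_{\ell=1}^Kb_j^{(\ell)}\delta_{\omega_\ell},\qquad j=1,\ldots,q,$$ where $b_j^{(\ell)}$ is the $j$-th component of $b_0^{(\ell)}$. (3) Marginally for each $\ell$ (i.e. with $\mathbf{J}_{q,\ell}$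 integrated out), $b_0^{(\ell)}$ is $\mathsf{M}(1,\mathbf{r}_{q,\ell})$, where $\mathbf{r}_{q,\ell}=(r_{1,\ell},\ldots,r_{q,\ell})$ is defined for $k=1,\ldots,q$ by $$r_{k,\ell}=\mathbb{E}[J_{k,\ell}|\mathbf{c}_{\ell,M}]=\frac{\int_{\mathcal{S}_q}s_k\Big[\prod_{j=1}^qs_j^{c_{j,\ell,M}}\Big](1-s_\cdot)^{M-c_{\ell,M}}\rho_q(d\mathbf{s}_q|\omega_\ell)}{\kappa_{\mathbf{c}_{\ell,M}}(\rho_{q,M}|\omega_\ell)}.$$ (4) Hence $b_\cdot^{(\ell)}=\sum_{j=1}^qb_j^{(\ell)}$ is $\mathrm{Bernoulli}\big(\sum_{j=1}^qr_{j,\ell}\big)$. Given $b_\cdot^{(\ell)}=1$, $b_0^{(\ell)}$ has a simple multinomial distribution with joint probability mass function $$\mathbb{I}_{\{b_\cdot^{(\ell)}=1\}}\prod_{j=1}^qu_{j,\ell}^{b_j^{(\ell)}},\qquad u_{j,\ell}=\frac{r_{j,\ell}}{\sum_{k=1}^qr_{k,\ell}}.$$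
   Context: **Setting.** $\Omega$ is a Polish space with a probability measure $B_0$, taken non-atomic so that the features $\tilde\omega_k$ below are a.s. distinct. For a vector $\mathbf{s}_q=(s_1,\ldots,s_q)$ write $s_\cdot=\sum_{j=1}^qs_j$, and let $\mathcal{S}_q=\{\mathbf{s}_q:s_j>0,\ s_\cdot<1\}$. $\rho_q(d\mathbf{s}_q|\omega)$ is a sigma-finite Lévy measure (possibly depending on $\omega$) concentrated on $\mathcal{S}_q$ with $\int\min(s_\cdot,1)\rho_q(d\mathbf{s}_q|\omega)<\infty$. **Multivariate PRM and CRM.** $N=\sum_k\delta_{(\mathbf{p}_{q,k},\tilde\omega_k)}$, $\mathbf{p}_{q,k}=(p_{1,k},\ldots,p_{q,k})$, is a Poisson random measure on $\mathbb{R}_+^q\times\Omega$ with intensity $\rho_q(d\mathbf{s}_q|\omega)B_0(d\omega)$ (a $\mathrm{PRM}(\rho_qB_0)$), and $\mu_0=(\mu_1,\ldots,\mu_q)$ with $\mu_j=\sum_kp_{j,k}\delta_{\tilde\omega_k}$. **Multinomial IBP.** For $\mathbf{p}_q\in\mathcal{S}_q$, $\mathsf{M}(1,\mathbf{p}_q)$ denotes the distribution on vectors $(b_1,\ldots,b_q)\in\{0,1\}^q$ having at most one entry equal to $1$, with probability mass function $\big[\prod_{j=1}^qp_j^{b_j}\big](1-p_\cdot)^{1-b_\cdot}$, $b_\cdot=\sum_jb_j$. $Z_0^{(1)},Z_0^{(2)},\ldots\mid\mu_0$ are iid $\mathrm{IBP}(\mathsf{M}(1,\mathbf{p}_q)|\mu_0)$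 if $Z_0^{(i)}=(Z_1^{(i)},\ldots,Z_q^{(i)})$ with $Z_j^{(i)}=\sum_kb_{j,k}^{(i)}\delta_{\tilde\omega_k}$, where conditionally on $N$ the vectors $(b^{(i)}_{1,k},\ldots,b^{(i)}_{q,k})$ are independent over $(i,k)$ with distribution $\mathsf{M}(1,\mathbf{p}_{q,k})$. The marginal (unconditional) law of $Z_0^{(1)}$ is denoted $\mathrm{IBP}(\mathsf{M}(1,\mathbf{p}_q),\rho_qB_0)$; replacing $\rho_q$ by $\rho_{q,M}$ gives $\mathrm{IBP}(\mathsf{M}(1,\mathbf{p}_q),\rho_{q,M}B_0)$. In (2), $Z_0^{(M+1)}$ is a further member of the conditionally iid sequence, and, given $Z_0^{(1)},\ldots,Z_0^{(M)}$, the vectors $b_0^{(1)},\ldots,b_0^{(K)}$ are independent of each other and of $\tilde Z_0^{(M+1)}$. **Finiteness.** It is assumed that $\int_\Omega\int_{\mathcal{S}_q}s_\cdot\,\rho_q(d\mathbf{s}_q|\omega)B_0(d\omega)<\infty$, so that the number $K$ of selected features (those $\tilde\omega_k$ with some $b_{j,k}^{(i)}=1$, $i\le M$) is a.s. finite. *)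

(* Defs.v *)
From HB Require Import structures.
From mathcomp Require Import all_boot all_order all_algebra.
From mathcomp Require Import all_classical all_reals all_analysis.
From mathcomp Require Import measurable_realfun.

Set Implicit Arguments.
Unset Strict Implicit.
Unset Printing Implicit Defensive.

Import Order.TTheory GRing.Theory Num.Theory.

Local Open Scope classical_set_scope.
Local Open Scope ring_scope.
Local Open Scope ereal_scope.

Section rmeasure.
Context d (X : measurableType d) (R : realType).

(* The space of all measures on X, with the sigma-algebra generated by the
   evaluations mu |-> mu A (A measurable); a random measure on X is a random
   element of it. *)
Definition rmeasure : Type := {measure set X -> \bar R}.

HB.instance Definition _ := gen_eqMixin rmeasure.
HB.instance Definition _ := gen_choiceMixin rmeasure.
HB.instance Definition _ := isPointed.Build rmeasure mzero.

Definition rmeasure_ev (mu : rmeasure) (A : set X) : \bar R := mu A.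

Definition rmeasure_measurable : set_system rmeasure :=
  <<s \bigcup_(A in measurable)
        preimage_set_system [set: rmeasure] (rmeasure_ev ^~ A) measurable >>.

Let rmeasure_measurable0 : rmeasure_measurable set0.
Proof. exact: sigma_algebra0. Qed.

Let rmeasure_measurableC (U : set rmeasure) :
  rmeasure_measurable U -> rmeasure_measurable (~` U).
Proof. exact: sigma_algebraC. Qed.

Let rmeasure_measurableU (F : (set rmeasure)^nat) :
  (forall i, rmeasure_measurable (F i)) -> rmeasure_measurable (\bigcup_i F i).
Proof. exact: sigma_algebra_bigcup. Qed.

Definition rmeasure_display : measure_display.
Proof. by constructor. Qed.

HB.instance Definition _ :=
  @isMeasurable.Build rmeasure_display rmeasure rmeasure_measurable
    rmeasure_measurable0 rmeasure_measurableC rmeasure_measurableU.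

End rmeasure.

Section add_atoms.
Context d (X : measurableType d) (R : realType).
Variables (mu : rmeasure X R) (K : nat) (B : pred 'I_K) (x : 'I_K -> X).

Definition add_atoms_fun (A : set X) : \bar R :=
  mu A + \sum_(l < K | B l) \d_(x l) A.

Let add_atoms0 : add_atoms_fun set0 = 0.
Proof. by rewrite /add_atoms_fun measure0 add0e big1// => l _; rewrite measure0. Qed.

Let add_atoms_ge0 A : 0 <= add_atoms_fun A.
Proof. by apply: adde_ge0 => //; apply: sume_ge0. Qed.

Let add_atoms_sigma_additive : semi_sigma_additive add_atoms_fun.
Proof.
move=> F mF tF mUF.
pose m (k : nat) : {measure set X -> \bar R} :=
  match insub k with
  | Some l => match B l with
              | true => (\d_(x l) : {measure set X -> \bar R})
              | false => (mzero : {measure set X -> \bar R})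
              end
  | None => (mzero : {measure set X -> \bar R})
  end.
have E A : add_atoms_fun A = measure_add mu (msum m K) A.
  rewrite measure_addE /add_atoms_fun /msum big_mkcond/=; congr (_ + _).
  by apply: eq_bigr => l _; rewrite /m valK; case: (B l).
rewrite E; under eq_fun do under eq_bigr do rewrite E.
exact: measure_semi_sigma_additive.
Qed.

HB.instance Definition _ := isMeasure.Build _ _ _ add_atoms_fun
  add_atoms0 add_atoms_ge0 add_atoms_sigma_additive.

Definition add_atoms : rmeasure X R := add_atoms_fun.

End add_atoms.

(* the sigma-algebra generated by f *)
Definition sigma_of (T : Type) d (Y : measurableType d) (f : T -> Y)
  : set_system T := preimage_set_system [set: T] f measurable.

(* the sigma-algebra generated by a family of maps *)
Definition sigma_of_family (T I : Type) d (Y : measurableType d)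
  (f : I -> T -> Y) : set_system T := <<s \bigcup_i sigma_of (f i) >>.

Section probability_notions.
Context d (T : measurableType d) (R : realType) (P : probability T R).

Definition mutual_indep (I : finType) (F : I -> set_system T) : Prop :=
  forall (D : {set I}) (A : I -> set T), (forall i, F i (A i)) ->
    P (\bigcap_(i in [set` D]) A i) = \prod_(i in D) P (A i).

(* g is a version of P(B | F), for a sub-sigma-algebra F *)
Definition cond_prob (F : set_system T) (B : set T) (g : T -> \bar R) : Prop :=
  (forall U : set (\bar R), measurable U -> F (g @^-1` U)) /\
  (forall A, F A -> P (A `&` B) = \int[P]_(t in A) g t).

(* t |-> Q t is a regular conditional distribution of X given F *)
Definition cond_law (F : set_system T) d' (Y : measurableType d')
    (X : T -> Y) (Q : T -> probability Y R) : Prop :=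
  forall E, measurable E -> cond_prob F (X @^-1` E) (fun t => Q t E).

(* N is a Poisson random measure with mean intensity nu. The second argument
   of the library's poisson_prob is a dummy. *)
Record is_PRM d' (X : measurableType d') (nu : set X -> \bar R)
    (N : T -> rmeasure X R) : Prop := {
  prm_measurable : measurable_fun [set: T] N ;
  prm_poisson : forall A, measurable A -> nu A < +oo -> forall n : nat,
    P [set t | N t A = n%:R%:E] = poisson_prob (fine (nu A)) 0%N [set n] ;
  prm_infinite : forall A, measurable A -> nu A = +oo ->
    P [set t | N t A = +oo] = 1 ;
  prm_indep : forall (n : nat) (A : 'I_n -> set X),
    (forall i, measurable (A i)) -> trivIset [set: 'I_n] A ->
    mutual_indep (fun i => sigma_of (fun t => N t (A i))) }.

End probability_notions.

(* With completeness and the pseudometric carried by the type, this says that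
   Omega is a complete separable metric space. *)
Definition polish (R : realType) (Omega : completePseudoMetricType R) : Prop :=
  hausdorff_space Omega /\ exists2 D : set Omega, countable D & dense D.

Notation borel Omega := (g_sigma_algebraType (@open Omega)).

Definition nonatomic d (X : measurableType d) (R : realType)
    (mu : set X -> \bar R) : Prop := forall x, mu [set x] = 0.

Section multinomial.
Context (R : realType) (q : nat).
Implicit Types (s p : q.-tuple R) (b : q.-tuple bool) (c : 'I_q -> nat).

Definition tot s : R := (\sum_(j < q) tnth s j)%R.

Definition btot b : nat := (\sum_(j < q) tnth b j)%N.

Definition simplex : set (q.-tuple R) :=
  [set s | (forall j, (0 < tnth s j)%R) /\ (tot s < 1)%R].

(* probability mass function of M(1, p) *)
Definition mpmf p b : R :=
  if (btot b <= 1)%N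
  then ((\prod_(j < q) tnth p j ^+ tnth b j) * (1 - tot p) ^+ (1 - btot b))%R
  else 0%R.

(* [\prod_j s_j^(c_j)] (1 - s.)^(M - c.) *)
Definition weight (M : nat) c s : R :=
  ((\prod_(j < q) tnth s j ^+ c j) * (1 - tot s) ^+ (M - \sum_(j < q) c j))%R.

End multinomial.
Arguments simplex R q : clear implicits.

Section IBP.
Context (R : realType) (q : nat) (Omega : completePseudoMetricType R).
Local Notation V := (q.-tuple R).
Local Notation W := (borel Omega).

Definition levy_kernel (rho : R.-sigmafker W ~> V) : Prop :=
  forall w, rho w (~` simplex R q) = 0 /\
    \int[rho w]_(s in simplex R q) (Num.min (tot s) 1%R)%:E < +oo.

(* rho(ds | w) B0(dw), as a set function on V * Omega *)
Definition intensity (rho : W -> set V -> \bar R) (B0 : probability W R)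
    (A : set (V * W)) : \bar R :=
  \int[B0]_w rho w [set s | A (s, w)].

(* rho_{q,M}(ds | w) = (1 - s.)^M rho(ds | w) *)
Definition tilt (M : nat) (rho : R.-sigmafker W ~> V) (w : W) (A : set V)
  : \bar R := \int[rho w]_(s in A) ((1 - tot s) ^+ M)%:E.

(* Z^(1), ..., Z^(n) | mu_0 are iid IBP(M(1, p) | mu_0), where
   N = \sum_k delta_(p_k, omega_k) and Z^(i)_j = \sum_k b^(i)_(j,k) delta_omega_k.
   Since N may have finitely many atoms, the sums run over the indices k with
   act k t = true. Conditioning is on the sigma-algebra of the enumerated
   atoms of N. *)
Definition IBP_draws d (T : measurableType d) (P : probability T R)
    (N : T -> rmeasure (V * W)%type R) (n : nat)
    (Z : 'I_n -> T -> q.-tuple (rmeasure W R)) : Prop :=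
  exists (act : nat -> T -> bool) (p : nat -> T -> V) (omega : nat -> T -> W)
         (b : 'I_n -> nat -> T -> q.-tuple bool),
  let atom k t := (act k t, (p k t, omega k t)) in
  [/\ (forall k, measurable_fun [set: T] (atom k)),
      (forall i k, measurable_fun [set: T] (b i k)),
      (forall t A, measurable A ->
         N t A = \sum_(0 <= k <oo | act k t) \d_(p k t, omega k t) A),
      (forall i j t A, measurable A ->
         tnth (Z i t) j A =
         \sum_(0 <= k <oo | act k t && tnth (b i k t) j) \d_(omega k t) A) &
      (forall (m : nat) (beta : 'I_n -> 'I_m -> q.-tuple bool),
         cond_prob P (sigma_of_family atom)
           [set t | forall i (k : 'I_m), act k t -> b i k t = beta i k]
           (fun t => (\prod_(i < n) \prod_(k < m | act k t)
                        mpmf (p k t) (beta i k))%:E))].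

Section selected.
Context d (T : measurableType d) (M : nat)
  (Z : 'I_M -> T -> q.-tuple (rmeasure W R)).

(* {omega_1, ..., omega_K} *)
Definition selected (t : T) : set W :=
  [set w | exists i j, 0 < tnth (Z i t) j [set w]].

(* c_j = \sum_i b^(i)_j, where b^(i)_j = Z^(i)_j {w} *)
Definition feature_count (t : T) (w : W) (j : 'I_q) : nat :=
  (\sum_(i < M) Num.truncn (fine (tnth (Z i t) j [set w])))%N.

End selected.

Section updates.
Variables (M : nat) (rho : R.-sigmafker W ~> V) (B0 : probability W R).

Definition kappa (c : 'I_q -> nat) (w : W) : R :=
  (\int[rho w]_(s in simplex R q) weight M c s)%R.

Definition Jlaw (c : 'I_q -> nat) (w : W) (A : set V) : R :=
  ((\int[rho w]_(s in simplex R q `&` A) weight M c s) / kappa c w)%R.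

Definition rvec (c : 'I_q -> nat) (w : W) : V :=
  [tuple ((\int[rho w]_(s in simplex R q) (tnth s k * weight M c s))
          / kappa c w)%R | k < q].

Variables (K : nat) (w : 'I_K -> W) (c : 'I_K -> 'I_q -> nat).
Variables (d : measure_display) (T : measurableType d) (P : probability T R).

Record posterior_parts (NM : T -> rmeasure (V * W)%type R)
    (J : 'I_K -> T -> V) : Prop := {
  pp_prm : is_PRM P (intensity (tilt M rho) B0) NM ;
  pp_measurable : forall l, measurable_fun [set: T] (J l) ;
  pp_law : forall l A, measurable A ->
    P (J l @^-1` A) = (Jlaw (c l) (w l) A)%:E ;
  pp_indep : mutual_indep P (fun o : option 'I_K =>
    if o is Some l then sigma_of (J l)
    else sigma_of NM) }.

Record predictive_parts (NM : T -> rmeasure (V * W)%type R)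
    (J : 'I_K -> T -> V) (Zt : T -> q.-tuple (rmeasure W R))
    (b : 'I_K -> T -> q.-tuple bool) : Prop := {
  pr_parts : posterior_parts NM J ;
  pr_IBP : IBP_draws P NM (fun _ : 'I_1 => Zt) ;
  pr_measurable : forall l, measurable_fun [set: T] (b l) ;
  pr_cond : forall l beta,
    cond_prob P (sigma_of (J l)) (b l @^-1` [set beta])
      (fun t => (mpmf (J l t) beta)%:E) ;
  pr_indep : mutual_indep P (fun o : option 'I_K =>
    if o is Some l then sigma_of (b l)
    else sigma_of Zt) }.

End updates.
End IBP.

(* Main.v *)
(* A measure that is a sum of distinct unit atoms is a limit of the numbers of charged
   cells of finer and finer partitions, so the law of a random measure of this kind is
   determined by the events that given sets carry no mass. Conditional laws of N
   and of the next draw given the past draws are therefore determined by the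
   probabilities that both the past draws and the new object avoid given sets.

   Attach to each atom (s, v) of N the vector of its marks in the M + 1 draws. The
   Laplace functional of this marked Poisson random measure is
     E exp(- sum f) = exp(- int sum_m w(s, m) (1 - exp(- f((s, v), m))) nu(ds dv)),
   where w(s, m) is the probability of the marks m. For a void event the exponent
   splits into two parts. The marks that vanish in the first M draws have probability
   (1 - s.)^M, and give the exponent of a Poisson random measure of intensity
   (1 - s.)^M rho B0. For the other marks, with counts c, the integral over s at a
   fixed v is kappa_c(v) times the mean of an indicator under the law of J; the same
   exponent is obtained when each selected feature v is independently rejected with
   probability one minus this mean. Comparing Laplace functionals, the conditional void
   probability is that of N_M times the product of these means over the selected
   features, which is the void probability of the announced representation.

   The Poisson random measure N_M is realized by the atoms of N that are not selected
   by the first M draws, and its draw by their marks in the last one; the jumps and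
   their bits are added on a product space. *)
Require Import Defs.
From HB Require Import structures.
From mathcomp Require Import all_boot all_order all_algebra.
From mathcomp Require Import all_classical all_reals all_analysis.
From mathcomp Require Import measurable_realfun ring lra.

Set Implicit Arguments.
Unset Strict Implicit.
Unset Printing Implicit Defensive.

Import Order.TTheory GRing.Theory Num.Theory.
Import numFieldNormedType.Exports.

Local Open Scope classical_set_scope.
Local Open Scope ring_scope.
Local Open Scope ereal_scope.

(** * Densities and mixtures *)

(** The obstacle is measurability: the features selected by the past draws come without a measurable
    enumeration, while a conditional law must be measurable in the draws alone. Void probabilities
    are therefore written as [expN] of a sum over the selected features, which is an integral
    against the draws themselves; conditional laws are chosen separately for each [t] from these
    probabilities, and their measurability is derived afterwards. The number of charged cells gives
    [hits_limit], which makes sense for every measure, so that simplicity is an almost sure identity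
    with a measurable exceptional set. The representation is claimed for every [NM] of the right
    law, on any space and without a list of its atoms. Its simplicity is therefore drawn from the
    Poisson law: a set holds two points with probability at most its squared intensity. The finite
    mean of [tot] makes the selected features finitely many and the weight of any nonzero past marks
    integrable, although [rho] may be infinite near 0; hence [kappa] is almost surely positive at
    every selected feature. *)

Section ge0_induction.
Context d (T : measurableType d) (R : realType).
Import HBNNSimple.

(** Simple functions are finite sums of nonnegative multiples of indicators, and every nonnegative
    measurable function is an increasing limit of such sums. *)
Lemma ge0_measurable_ind (Q : (T -> \bar R) -> Prop) :
  (forall A, measurable A -> Q (fun x => (\1_A x)%:E)) ->
  (forall f g, measurable_fun setT f -> measurable_fun setT g ->
     (forall x, 0 <= f x) -> (forall x, 0 <= g x) -> Q f -> Q g ->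
     Q (fun x => f x + g x)) ->
  (forall (r : R) f, (0 <= r)%R -> measurable_fun setT f ->
     (forall x, 0 <= f x) -> Q f -> Q (fun x => r%:E * f x)) ->
  (forall f_ : (T -> \bar R)^nat, (forall n, measurable_fun setT (f_ n)) ->
     (forall n x, 0 <= f_ n x) ->
     (forall x, {homo f_ ^~ x : n m / (n <= m)%N >-> n <= m}) ->
     (forall n, Q (f_ n)) -> Q (fun x => limn (f_ ^~ x))) ->
  forall f, measurable_fun setT f -> (forall x, 0 <= f x) -> Q f.
Proof.
move=> Q1 QD QZ Qlim f mf f0.
pose f_ := nnsfun_approx measurableT mf.
have -> : f = fun x => limn (fun n => (f_ n x)%:E).
  by apply/funext => x; apply/esym/cvg_lim => //; exact: cvg_nnsfun_approx.
apply: (Qlim (fun n x => (f_ n x)%:E)).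
- by move=> n; exact/measurable_EFinP.
- by move=> n x; rewrite lee_fin.
- by move=> x m n mn; rewrite lee_fin; exact/lefP/nd_nnsfun_approx.
move=> n.
pose s := finmap.enum_fset (fset_set (range (f_ n))).
(* The guard [0 <= r] allows an induction on an arbitrary list [s], about whose levels nothing is
   known. It loses nothing, since a negative level has an empty preimage. *)
have -> : (fun x => (f_ n x)%:E) =
  (fun x => \sum_(r <- s) (if (0 <= r)%R then r%:E * (\1_(f_ n @^-1` [set r]) x)%:E else 0)).
  apply/funext => x; rewrite fimfunE -fsumEFin// fsbig_finite//=.
  apply: eq_bigr => r _; case: ifPn => r0; first by rewrite EFinM.
  by rewrite preimage_nnfun0 ?ltNge// indic0 mulr0.
have ms r : measurable_fun setT (fun x => if (0 <= r)%R then r%:E * (\1_(f_ n @^-1` [set r]) x)%:E else 0).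
  by case: (0 <= r)%R => //; apply: emeasurable_funM => //; exact/measurable_EFinP.
have s0 r x : 0 <= (if (0 <= r)%R then r%:E * (\1_(f_ n @^-1` [set r]) x)%:E else 0).
  by case: ifPn => // r0; rewrite mule_ge0// lee_fin.
elim: s => [|r s IH].
  under eq_fun do rewrite big_nil.
  have -> : (fun=> 0%R) = (fun x => (\1_(set0 : set T) x)%:E) :> (T -> \bar R).
    by apply/funext => x; rewrite indic0.
  exact: Q1.
under eq_fun do rewrite big_cons.
apply: QD => //.
- exact: emeasurable_sum.
- by move=> x; exact: sume_ge0.
have [r0|r0] := boolP (0 <= r)%R.
  apply: QZ => //; [exact/measurable_EFinP|exact: Q1].
have -> : (fun=> 0%R) = (fun x => (\1_(set0 : set T) x)%:E) :> (T -> \bar R).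
  by apply/funext => x; rewrite indic0.
exact: Q1.
Qed.

End ge0_induction.

Section density.
Context d (T : measurableType d) (R : realType).
Variables (mu : {measure set T -> \bar R}) (g : T -> \bar R).
Hypotheses (mg : measurable_fun setT g) (g0 : forall x, 0 <= g x).

Definition dens (A : set T) : \bar R := \int[mu]_(x in A) g x.

Let dens0 : dens set0 = 0. Proof. exact: integral_set0. Qed.

Let dens_ge0 A : 0 <= dens A. Proof. exact: integral_ge0. Qed.

Let dens_sigma_additive : semi_sigma_additive dens.
Proof.
move=> F mF tF mUF; rewrite /dens ge0_integral_bigcup//; last first.
  exact: measurable_funTS.
by apply: is_cvg_ereal_nneg_natsum => n _; exact: integral_ge0.
Qed.

HB.instance Definition _ := isMeasure.Build _ _ _ dens
  dens0 dens_ge0 dens_sigma_additive.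

Definition mdens : {measure set T -> \bar R} := dens.

Lemma mdensE A : mdens A = \int[mu]_(x in A) g x. Proof. by []. Qed.

Lemma integral_mdens f : measurable_fun setT f -> (forall x, 0 <= f x) ->
  \int[mdens]_x f x = \int[mu]_x (f x * g x).
Proof.
move: f; apply: ge0_measurable_ind.
- move=> A mA; rewrite integral_indic// setIT /= /dens integral_mkcond.
  apply: eq_integral => x _; rewrite patchE indicE.
  by case: ifPn; rewrite ?mul1e ?mul0e.
- move=> f h mf mh f0 h0 IHf IHh.
  rewrite ge0_integralD// IHf IHh -ge0_integralD//.
  + by apply: eq_integral => x _; rewrite ge0_muleDl.
  + by move=> x _; rewrite mule_ge0.
  + exact: emeasurable_funM.
  + by move=> x _; rewrite mule_ge0.
  + exact: emeasurable_funM.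
- move=> r f r0 mf f0 IHf.
  rewrite ge0_integralZl// IHf -ge0_integralZl//.
  + by apply: eq_integral => x _; rewrite muleA.
  + exact: emeasurable_funM.
  + by move=> x _; rewrite mule_ge0.
- move=> f_ mf f0 ndf IH.
  rewrite monotone_convergence//.
  transitivity (\int[mu]_x limn (fun n => f_ n x * g x)).
    rewrite monotone_convergence//.
    + by congr (limn _); apply/funext => n; exact: IH.
    + by move=> n; exact: emeasurable_funM.
    + by move=> n x _; rewrite mule_ge0.
    + by move=> x _ m n mn; rewrite lee_wpmul2r// ndf.
  apply: eq_integral => x _.
  have := g0 x; case gx : (g x) => [r| |]// r0.
    apply/cvg_lim => //; apply: cvgeZr => //.
    by apply: ereal_nondecreasing_is_cvgn => m n; exact: ndf.
  have cf : cvgn (f_ ^~ x).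
    by apply: ereal_nondecreasing_is_cvgn => m n; exact: ndf.
  (* Here [g x = +oo], and multiplication by it is not continuous at 0: either the whole increasing
     sequence vanishes, or the products are eventually [+oo]. *)
  have [fx|fx] := eqVneq (limn (f_ ^~ x)) 0.
    rewrite fx mul0e.
    rewrite (_ : (fun n => _) = fun=> 0) ?lim_cst//.
    apply/funext => n; suff -> : f_ n x = 0 by rewrite mul0e.
    apply/eqP; rewrite eq_le f0 andbT -fx.
    by apply: lime_ge => //; near=> m; apply: ndf; near: m; exact: nbhs_infty_ge.
  have fx0 : 0 < limn (f_ ^~ x).
    by rewrite lt_neqAle eq_sym fx/=; apply: lime_ge => //; exact: nearW.
  rewrite gt0_muley//; apply/cvg_lim => //.
  have [N fN] : exists N, 0 < f_ N x.
    apply: contrapT => /forallNP h; move: fx0; rewrite ltNge => /negP; apply.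
    by apply: lime_le => //; apply: nearW => n; rewrite leNgt; exact/negP/h.
  apply: cvg_near_cst; near=> n; rewrite gt0_muley//.
  rewrite (lt_le_trans fN)// ndf//; near: n; exact: nbhs_infty_ge.
Unshelve. all: by end_near. Qed.

End density.

Section integral_eq_on.
Context d d' (T : measurableType d) (S : measurableType d') (R : realType).

(** The measures of densities [g1] and [g2] have the same image under [X], so they integrate
    functions of [X] alike. With [X] the identity onto a coarser sigma-algebra, this extends the
    defining identity of a conditional probability from events to weights. *)
Lemma ge0_integral_mul_eq (mu : {measure set T -> \bar R}) (X : T -> S)
    (g1 g2 : T -> \bar R) :
  measurable_fun setT X -> measurable_fun setT g1 -> measurable_fun setT g2 ->
  (forall x, 0 <= g1 x) -> (forall x, 0 <= g2 x) ->
  (forall U, measurable U ->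
    \int[mu]_(x in X @^-1` U) g1 x = \int[mu]_(x in X @^-1` U) g2 x) ->
  forall phi : S -> \bar R, measurable_fun setT phi -> (forall y, 0 <= phi y) ->
  \int[mu]_x (phi (X x) * g1 x) = \int[mu]_x (phi (X x) * g2 x).
Proof.
move=> mX mg1 mg2 g10 g20 E phi mphi phi0.
have mphiX : measurable_fun setT (phi \o X) by exact: measurableT_comp.
have phiX0 x : 0 <= (phi \o X) x by exact: phi0.
rewrite -(integral_mdens mu mg1 g10 mphiX phiX0).
rewrite -(integral_mdens mu mg2 g20 mphiX phiX0).
have push (nu : {measure set T -> \bar R}) :
    \int[nu]_x phi (X x) = \int[pushforward nu X]_y phi y.
  by rewrite ge0_integral_pushforward// preimage_setT.
rewrite !push; apply: eq_measure_integral => U mU _.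
exact: E.
Qed.

End integral_eq_on.

Section expN.
Context (R : realType).
Implicit Types x y : \bar R.

(* [expN x] is exp (- x) with exp (- oo) = 0; it is only meant for [x >= 0] *)
Definition expN x : R := if x is r%:E then expR (- r) else 0%R.

Lemma expN0 : expN 0 = 1%R. Proof. by rewrite /expN /= oppr0 expR0. Qed.

Lemma expN_ge0 x : (0 <= expN x)%R.
Proof. by case: x => [r| |]//=; exact: expR_ge0. Qed.

Lemma expN_le1 x : 0 <= x -> (expN x <= 1)%R.
Proof.
case: x => [r| |]//= r0; first by rewrite -expR0 ler_expR oppr_le0.
Qed.

Lemma expND x y : 0 <= x -> 0 <= y -> expN (x + y) = (expN x * expN y)%R.
Proof.
case: x => [r| |]//; case: y => [s| |]//= _ _; rewrite ?mulr0 ?mul0r//.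
by rewrite opprD expRD.
Qed.

Lemma expN_sum (I : Type) (s : seq I) (p : pred I) (f : I -> \bar R) :
  (forall i, 0 <= f i) ->
  expN (\sum_(i <- s | p i) f i) = (\prod_(i <- s | p i) expN (f i))%R.
Proof.
move=> f0; elim: s => [|i s IH]; first by rewrite !big_nil expN0.
by rewrite !big_cons; case: ifPn => // pi; rewrite expND ?IH//; exact: sume_ge0.
Qed.

Lemma measurable_expN : measurable_fun [set: \bar R] expN.
Proof.
have -> : expN = (fun x => if x \is a fin_num then expR (- fine x) else 0%R).
  by apply/funext => -[r| |].
apply: measurable_fun_ifT => //.
  apply: (measurable_fun_bool true) => /=.
  rewrite setTI (_ : _ @^-1` _ = ~` [set +oo] `&` ~` [set -oo]).
    by apply: measurableI; apply: measurableC; exact: emeasurable_set1.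
  by apply/seteqP; split => -[r| |]//= [].
by apply: measurableT_comp => //; apply: measurableT_comp => //.
Qed.

(** Continuity on the closed half-line, [+oo] included, lets finite approximations pass to the limit
    even when the exponents become infinite. *)
Lemma cvg_expN (u : (\bar R)^nat) l : (forall n, 0 <= u n) ->
  u @ \oo --> l -> (fun n => (expN (u n))%:E) @ \oo --> (expN l)%:E.
Proof.
move=> u0 ul; apply: cvg_EFin; first exact: nearW.
rewrite /comp/=; case: l ul => [l| |] ul.
- have /fine_cvgP[uf ful] := ul.
  rewrite [X in _ --> X](_ : _ = expR (- l)) //.
  apply: (@cvg_trans _ ((fun n => expR (- fine (u n))) @ \oo)).
    apply: near_eq_cvg; near=> n.
    have : u n \is a fin_num by near: n.
    by case: (u n).
  apply: continuous_cvg; first exact: continuous_expR.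
  exact: cvgN.
- rewrite [X in _ --> X](_ : _ = 0%R) //.
  apply/cvgrPdist_le => e e0.
  move/cvgeyPge : ul => /(_ (- ln e)%R) ul.
  near=> n; rewrite sub0r normrN ger0_norm ?expN_ge0//.
  have : (- ln e)%:E <= u n by near: n.
  case: (u n) => [r| |]//=; last by move=> _; exact: ltW.
  rewrite lee_fin => er.
  by rewrite -[leRHS]lnK ?posrE// ler_expR lerNl.
- exfalso; have := ul; move/cvgeNyPle => /(_ (-1)%R) h.
  have [n _ /(_ n (leqnn _))/=] := h.
  by rewrite leNgt (lt_le_trans _ (u0 n))// lte_fin ltrN10.
Unshelve. all: by end_near. Qed.

(** The inverse of [expN] on [0, 1], with value [+oo] at 0: a product of factors in [0, 1], some
    possibly zero, becomes a nonnegative extended sum. *)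
Definition lnN (r : R) : \bar R := if (0 < r)%R then (- ln r)%:E else +oo.

Lemma lnN_ge0 (r : R) : (r <= 1)%R -> 0 <= lnN r.
Proof.
by rewrite /lnN; case: ifPn => // r0 r1; rewrite lee_fin oppr_ge0 ln_le0.
Qed.

Lemma lnNK (r : R) : (0 <= r)%R -> expN (lnN r) = r.
Proof.
rewrite le_eqVlt => /predU1P[<-|r0]; first by rewrite /lnN ltxx.
by rewrite /lnN r0/= opprK lnK.
Qed.

Lemma measurable_lnN : measurable_fun [set: R] lnN.
Proof.
apply: measurable_fun_ifT => //; first exact: measurable_fun_ltr.
apply/measurable_EFinP; apply: measurableT_comp => //; exact: measurable_ln.
Qed.

End expN.

Section mixture.
Context d d' (V : measurableType d) (W : measurableType d') (R : realType).
Variables (l : {measure set W -> \bar R}) (k : W -> {measure set V -> \bar R}).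
Hypothesis mk : forall A : set (V * W), measurable A ->
  measurable_fun setT (fun w => k w [set s | A (s, w)]).

Lemma measurable_section (A : set (V * W)) w : measurable A ->
  measurable [set s | A (s, w)].
Proof. by move=> mA; have := measurable_ysection w mA; rewrite ysectionE. Qed.

Definition mixture (A : set (V * W)) : \bar R := \int[l]_w k w [set s | A (s, w)].

Let mixture0 : mixture set0 = 0.
Proof. by apply: integral0_eq => w _; exact: measure0. Qed.

Let mixture_ge0 A : 0 <= mixture A. Proof. exact: integral_ge0. Qed.

Let mixture_sigma_additive : semi_sigma_additive mixture.
Proof.
move=> F mF tF mUF.
have E : mixture (\bigcup_n F n) = \sum_(0 <= i <oo) mixture (F i).
  rewrite /mixture -integral_nneseries//; last by move=> n; exact: mk.
  apply: eq_integral => w _.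
  rewrite (_ : [set s | _] = \bigcup_n [set s | F n (s, w)])//.
  rewrite measure_semi_bigcup//.
  - by move=> n; exact: measurable_section.
  - move=> i j _ _ [s [Fi Fj]]; apply: (tF i j) => //.
    by exists (s, w).
  - exact: bigcup_measurable (fun n _ => measurable_section w (mF n)).
by rewrite E; apply: is_cvg_ereal_nneg_natsum => n _.
Qed.

HB.instance Definition _ := isMeasure.Build _ _ _ mixture
  mixture0 mixture_ge0 mixture_sigma_additive.

Definition mmixture : {measure set (V * W) -> \bar R} := mixture.

Lemma mmixtureE A : mmixture A = \int[l]_w k w [set s | A (s, w)].
Proof. by []. Qed.

Let mfs (f : V * W -> \bar R) w : measurable_fun setT f ->
  measurable_fun setT (fun s => f (s, w)).
Proof. by move=> mf; exact: measurable_fun_pair1. Qed.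

Lemma measurable_integral_mixture f : measurable_fun setT f ->
  (forall x, 0 <= f x) -> measurable_fun setT (fun w => \int[k w]_s f (s, w)).
Proof.
move: f; apply: ge0_measurable_ind.
- move=> A mA; rewrite (_ : (fun w => _) = (fun w => k w [set s | A (s, w)])).
    exact: mk.
  apply/funext => w; rewrite (@integral_indic _ _ _ (k w) _ measurableT [set s | A (s, w)]) ?setIT//.
  exact: measurable_section.
- move=> f h mf mh f0 h0 IHf IHh.
  rewrite (_ : (fun w => _) =
    (fun w => \int[k w]_s f (s, w) + \int[k w]_s h (s, w))).
    exact: emeasurable_funD.
  apply/funext => w; apply: ge0_integralD => //; exact: mfs.
- move=> r f r0 mf f0 IHf.
  rewrite (_ : (fun w => _) = (fun w => r%:E * \int[k w]_s f (s, w))).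
    exact: measurable_funeM.
  apply/funext => w; apply: ge0_integralZl_EFin => //; exact: mfs.
- move=> f_ mf f0 ndf IH.
  apply: (emeasurable_fun_cvg (fun n w => \int[k w]_s f_ n (s, w))) => //.
  move=> w _; apply: cvg_monotone_convergence => // n.
  exact: mfs.
Qed.

Lemma integral_mixture f : measurable_fun setT f ->
  (forall x, 0 <= f x) -> \int[mmixture]_z f z = \int[l]_w \int[k w]_s f (s, w).
Proof.
have int0 (g : V * W -> \bar R) : (forall x, 0 <= g x) ->
    forall w, setT w -> 0 <= \int[k w]_s g (s, w).
  by move=> g0 w _; apply: integral_ge0 => s _; exact: g0.
move: f; apply: ge0_measurable_ind.
- move=> A mA; rewrite integral_indic// setIT mmixtureE.
  apply: eq_integral => w _.
  rewrite (@integral_indic _ _ _ (k w) _ measurableT [set s | A (s, w)]) ?setIT//.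
  exact: measurable_section.
- move=> f h mf mh f0 h0 IHf IHh.
  rewrite (ge0_integralD _ measurableT (fun x _ => f0 x) mf (fun x _ => h0 x) mh).
  rewrite IHf IHh -(ge0_integralD _ measurableT (int0 _ f0)
    (measurable_integral_mixture mf f0) (int0 _ h0)
    (measurable_integral_mixture mh h0)).
  by apply: eq_integral => w _; apply/esym/ge0_integralD => //; exact: mfs.
- move=> r f r0 mf f0 IHf.
  rewrite (ge0_integralZl_EFin _ measurableT (fun x _ => f0 x) mf r0).
  rewrite IHf -(ge0_integralZl_EFin _ measurableT (int0 _ f0)
    (measurable_integral_mixture mf f0) r0).
  by apply: eq_integral => w _; apply/esym/ge0_integralZl_EFin => //; exact: mfs.
- move=> f_ mf f0 ndf IH.
  rewrite monotone_convergence//.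
  transitivity (\int[l]_w limn (fun n => \int[k w]_s f_ n (s, w))).
    rewrite monotone_convergence.
    + by congr (limn _); apply/funext => n; exact: IH.
    + exact: measurableT.
    + by move=> n; exact: measurable_integral_mixture.
    + by move=> n; exact: int0.
    + move=> w _ m n mn; apply: ge0_le_integral => //.
      * exact: mfs.
      * exact: mfs.
      * by move=> s _; exact: ndf.
  apply: eq_integral => w _; rewrite monotone_convergence// => n.
  exact: mfs.
Qed.

End mixture.

(** * Simple point measures and void events *)

Section cells.
Context d (X : measurableType d) (R : realType) (U : nat -> set X).

(** The class of [x] in the partition generated by the first [n] sets, encoded by its membership
    vector. The partitions get finer as [n] grows. *)
Definition cell n (x : X) : {ffun 'I_n -> bool} := [ffun i : 'I_n => `[< U i x >]].

Definition separated_on (S : set X) : Prop :=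
  forall x y, S x -> S y -> (forall n, U n x <-> U n y) -> x = y.

(* the number of cells of the [n]-th partition charged by [mu] within [A] *)
Definition hits n (mu : set X -> \bar R) (A : set X) : nat :=
  #|[pred c | mu (A `&` cell n @^-1` [set c]) != 0]|.

(** An upper limit, so that it exists for every measure and is measurable in terms of void events
    alone; for a simple measure it is the mass. *)
Definition hits_limit (mu : set X -> \bar R) (A : set X) : \bar R :=
  limn_esup (fun n => (hits n mu A)%:R%:E).

Hypothesis mU : forall n, measurable (U n).

Lemma measurable_cell n c : measurable (cell n @^-1` [set c]).
Proof.
rewrite (_ : _ @^-1` _ =
    \bigcap_(i in [set: 'I_n]) (if c i then U i else ~` U i)).
  apply: fin_bigcap_measurable => // i _.
  by case: (c i) => //; exact: measurableC.
apply/seteqP; split => [x <- i _|x xc] /=.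
  by rewrite ffunE; case: asboolP.
apply/ffunP => i; rewrite ffunE; have := xc i I.
by case: (c i) => /= ?; [exact/asboolP|exact/asboolPn].
Qed.

(** Two points separated by some [U n] lie in different cells at every later level; a finite list
    leaves finitely many pairs, so a maximum of levels works for all. *)
Lemma cell_separates (s : seq X) : separated_on [set` s] ->
  exists n0, forall n, (n0 <= n)%N -> {in s &, injective (cell n)}.
Proof.
move=> sep.
have H x y : exists n0, x \in s -> y \in s -> x <> y -> forall n, (n0 <= n)%N ->
    cell n x <> cell n y.
  have [xs|] := boolP (x \in s); last by exists 0%N.
  have [ys|] := boolP (y \in s); last by exists 0%N.
  have [->|xy] := eqVneq x y; first by exists 0%N.
  have /existsNP[n nUn] : ~ (forall n, U n x <-> U n y).
    by move=> h; move/eqP : xy; apply; exact: sep.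
  exists n.+1 => _ _ _ m nm /ffunP /(_ (Ordinal nm)).
  rewrite !ffunE/= => E; apply: nUn.
  by split => h; apply/asboolP; [rewrite -E|rewrite E]; exact/asboolP.
have [f Hf] := choice (fun xy => H xy.1 xy.2).
pose n0 := (\max_(x <- s) \max_(y <- s) f (x, y))%N.
exists n0 => n n0n x y xs ys cxy; apply: contrapT => xy.
apply: (Hf (x, y) xs ys xy n _ cxy); apply: leq_trans n0n.
apply: leq_trans (leq_bigmax_seq _ xs _) => //.
exact: (@leq_bigmax_seq _ s xpredT (fun y => f (x, y)) y ys isT).
Qed.

(* an atomic measure with unit masses at the points of [S], which are pairwise
   separated by the partitions *)
Definition simple_measure (mu : set X -> \bar R) : Prop :=
  exists2 S : set X, separated_on S &
    forall A, measurable A -> mu A = counting (S `&` A).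

Lemma counting_neq0 (A : set X) : (counting A != 0 :> \bar R) <-> A !=set0.
Proof.
rewrite /counting; case: asboolP => [fA|nA]; last first.
  split => // _; apply/set0P/eqP => A0; apply: nA; rewrite A0; exact: finite_set0.
rewrite eqe pnatr_eq0 size_eq0; split => [|/set0P A0].
  by move=> h; apply/set0P/eqP => A0; move: h; rewrite A0 fset_set0 eqxx.
apply: contra_neq A0 => A0; apply/seteqP; split => // x Ax.
by have := in_fset_set fA x; rewrite -[LHS]/(x \in finmap.enum_fset _) A0 mem_set.
Qed.

Lemma hits_le n mu S A : (forall A, measurable A -> mu A = counting (S `&` A)) ->
  measurable A -> (hits n mu A)%:R%:E <= counting (S `&` A) :> \bar R.
Proof.
move=> muE mA; rewrite /counting; case: asboolP => [fA|nA]; last exact: leey.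
rewrite lee_fin ler_nat /hits -(size_map (cell n)) cardE.
apply: uniq_leq_size; first exact: enum_uniq.
move=> c; rewrite mem_enum inE muE; last first.
  by apply: measurableI => //; exact: measurable_cell.
move=> /counting_neq0[x [Sx [Ax /= <-]]].
by apply: map_f; rewrite in_fset_set// inE.
Qed.

Lemma hits_ge mu S A (s : seq X) :
  (forall A, measurable A -> mu A = counting (S `&` A)) ->
  measurable A -> separated_on S -> uniq s -> [set` s] `<=` S `&` A ->
  exists n0, forall n, (n0 <= n)%N -> (size s <= hits n mu A)%N.
Proof.
move=> muE mA sepS us sSA.
have [|n0 n0P] := @cell_separates s.
  by move=> x y /sSA[Sx _] /sSA[Sy _]; exact: sepS.
exists n0 => n /n0P inj.
rewrite /hits cardE -(size_map (cell n)).
apply: uniq_leq_size; first by rewrite map_inj_in_uniq.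
move=> c /mapP[x xs ->]; rewrite mem_enum inE muE; last first.
  by apply: measurableI => //; exact: measurable_cell.
apply/counting_neq0; exists x; have [Sx Ax] := sSA _ xs; by split.
Qed.

(** Every charged cell holds a point of [S], whence the upper bound; any finite part of [S] is
    eventually spread over distinct cells, whence the lower bound. *)
Lemma hits_cvg mu A : simple_measure mu -> measurable A ->
  (hits n mu A)%:R%:E @[n --> \oo] --> mu A.
Proof.
move=> [S sepS muE] mA; rewrite muE//.
have le n := hits_le n muE mA.
have [fA|nA] := pselect (finite_set (S `&` A)); last first.
  rewrite /counting asboolF//; apply/cvgeyPgey.
  near=> r.
  have [B BSA sB] := infinite_set_fset (Num.truncn r).+1 nA.
  have [||n0 n0P] := @hits_ge _ S _ (finmap.enum_fset B) muE mA sepS.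
  - exact: finmap.fset_uniq.
  - by [].
  exists n0 => // n /= /n0P h.
  rewrite lee_fin (le_trans (ltW (truncnS_gt _)))// ler_nat.
  exact: leq_trans h.
apply: cvg_near_cst.
have [||n0 n0P] := @hits_ge _ S _ (finmap.enum_fset (fset_set (S `&` A))) muE mA sepS.
- exact: finmap.fset_uniq.
- by move=> x /=; rewrite in_fset_set// inE.
exists n0 => // n /= /n0P h.
apply/eqP; rewrite eq_le le/= /counting asboolT// lee_fin ler_nat.
exact: h.
Unshelve. all: by end_near. Qed.

Lemma hits_limitE mu A : (hits n mu A)%:R%:E @[n --> \oo] --> mu A ->
  hits_limit mu A = mu A.
Proof.
move=> h; rewrite /hits_limit is_cvg_limn_esupE; first exact/cvg_lim.
by apply/cvg_ex; exists (mu A).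
Qed.

End cells.

Section simple_add.
Context d (X : measurableType d) (R : realType) (U : nat -> set X).

Lemma counting_esum (A : set X) : counting A = \esum_(x in A) 1 :> \bar R.
Proof.
rewrite /counting; case: asboolP => [fA|nA]; first by rewrite finite_card_sum.
rewrite -(@infinite_card_dirac _ _ _ A)//; apply: eq_esum => x Ax.
by rewrite diracE mem_set.
Qed.

Lemma esum_setI_dirac (S A : set X) :
  \esum_(x in S `&` A) 1 = \esum_(x in S) \d_x A :> \bar R.
Proof.
rewrite esum_mkcondr; apply: eq_esum => x _; rewrite diracE.
by case: (_ \in _).
Qed.

Lemma simple_dirac_series (mu : set X -> \bar R) (B : pred nat) (x : nat -> X) :
  (forall k l, B k -> B l -> (forall n, U n (x k) <-> U n (x l)) -> k = l) ->
  (forall A, measurable A -> mu A = \sum_(0 <= k <oo | B k) \d_(x k) A) ->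
  simple_measure U mu.
Proof.
move=> xinj muE; exists (x @` [set k | B k]).
  by move=> _ _ [k Bk <-] [l Bl <-] /(xinj _ _ Bk Bl) ->.
move=> A mA; rewrite muE// counting_esum esum_setI_dirac esum_image; last first.
  move=> k l /set_mem Bk /set_mem Bl xkl; apply: xinj => // n.
  by rewrite xkl.
by rewrite nneseries_esum.
Qed.

(** The intersection of all cells containing [x], a singleton when the sets [U n] separate
    points. *)
Definition atom_class x := [set y | forall n, U n y <-> U n x].

Lemma measurable_atom_class x : (forall n, measurable (U n)) ->
  measurable (atom_class x).
Proof.
move=> mU; rewrite (_ : atom_class x =
    \bigcap_n (if `[< U n x >] then U n else ~` U n)).
  apply: bigcap_measurable => [|n _]; first by exists 0%N.
  by case: asboolP => // _; exact: measurableC.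
apply/seteqP; split => [y yx n _|y yx n].
  by case: asboolP => [/yx//|nx /yx].
have := yx n I; case: asboolP => [ux uy|ux uy]; split => //.
Qed.

Lemma add_atomsE (mu : rmeasure X R) K (B : pred 'I_K) (x : 'I_K -> X) A :
  add_atoms mu B x A = mu A + \sum_(l < K | B l) \d_(x l) A.
Proof. by []. Qed.

(** If [mu] gives no mass to the class of [x l], then no atom of [mu] is inseparable from [x l]; the
    union of the two sets of atoms is thus still separated. *)
Lemma simple_add_atoms (mu : rmeasure X R) K (B : pred 'I_K) (x : 'I_K -> X) :
  (forall n, measurable (U n)) ->
  simple_measure U mu -> (forall l, B l -> mu (atom_class (x l)) = 0) ->
  (forall k l, B k -> B l -> atom_class (x l) (x k) -> k = l) ->
  simple_measure U (add_atoms mu B x).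
Proof.
move=> mU [S sepS muE] x0 xinj.
have Sx l : B l -> S `&` atom_class (x l) = set0.
  move=> /x0; rewrite muE; last exact: measurable_atom_class.
  move=> h; apply/eqP; apply: contraPT h => /set0P h; apply/eqP.
  exact/counting_neq0.
exists (S `|` x @` [set l | B l]).
  move=> y z [Sy|[k Bk <-]] [Sz|[l Bl <-]] yz.
  - exact: sepS.
  - by have : (S `&` atom_class (x l)) y by []; rewrite Sx.
  - have : (S `&` atom_class (x k)) z by split => // n; rewrite yz.
    by rewrite Sx.
  - by rewrite (xinj k l).
move=> A mA.
rewrite counting_esum (esumID S)//.
rewrite (_ : _ `&` S = S `&` A); last first.
  by apply/seteqP; split => y /=; tauto.
rewrite -counting_esum -muE//.
rewrite (_ : _ `&` ~` S = (x @` [set l | B l]) `&` A); last first.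
  apply/seteqP; split => y /=; first by tauto.
  move=> [[l Bl <-] Ax]; split; first by split => //; right; exists l.
  by move=> Sxl; have : (S `&` atom_class (x l)) (x l) by []; rewrite Sx.
rewrite esum_setI_dirac esum_image; last first.
  move=> k l /set_mem Bk /set_mem Bl xkl; apply: xinj => // n.
  by rewrite xkl.
rewrite add_atomsE; congr (_ + _); rewrite esum_fset//; last exact: finite_finset.
rewrite fsbig_finite//=.
rewrite -big_filter; apply: perm_big; apply: uniq_perm.
- exact/filter_uniq/index_enum_uniq.
- exact: finmap.fset_uniq.
- move=> l; rewrite mem_filter mem_index_enum andbT.
  have := in_fset_set (@finite_finset _ [set l | B l]) l.
  rewrite -[X in X = _ -> _]/(l \in finmap.enum_fset _) => ->.
  by apply/idP/idP => [Bl|/set_mem//]; exact/mem_set.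
Qed.

End simple_add.

(** * Laws determined by void events *)

Section sigma_approx.
Context (T : pointedType) (I : Type) (R : realType).
Variables (y y' : I -> T -> \bar R) (V : set_system T).
Hypothesis y'V : forall i B, measurable B -> <<s V >> (y' i @^-1` B).

(** An event depends on countably many coordinates only. Replacing each [y i] by [y' i] alters it
    only where one of these countably many replacements fails, and a countable union of null sets is
    null; [None] pads the list of indices. *)
Lemma sigma_approx E :
  <<s \bigcup_i preimage_set_system setT (y i) measurable >> E ->
  exists2 E', <<s V >> E' & exists idx : nat -> option I,
    forall x, (forall n i, idx n = Some i -> y i x = y' i x) -> (E x <-> E' x).
Proof.
move: E; apply: smallest_sub.
  split.
  - exists set0; first exact: sigma_algebra0.
    by exists (fun=> None).
  - move=> A [A' VA' [idx h]]; exists (~` A').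
      exact: sigma_algebraC.
    exists idx => x /h; rewrite setTD /setC/=; tauto.
  - move=> F hF.
    have {hF} hF n : {E'idx : set T * (nat -> option I) | <<s V >> E'idx.1 /\
      forall x, (forall n i, E'idx.2 n = Some i -> y i x = y' i x) ->
      (F n x <-> E'idx.1 x)}.
      by apply: cid; have [E' VE' [idx h]] := hF n; exists (E', idx).
    exists (\bigcup_n (sval (hF n)).1).
      by apply: sigma_algebra_bigcup => n; have [] := svalP (hF n).
    exists (fun m => if unpickle m is Some (k, n) then (sval (hF k)).2 n else None).
    move=> x hx; split => -[n _ Fn]; exists n => //.
      have [_ h] := svalP (hF n); apply/h => // m i e.
      by apply: (hx (pickle (n, m))); rewrite pickleK.
    have [_ h] := svalP (hF n); apply/h => // m i e.
    by apply: (hx (pickle (n, m))); rewrite pickleK.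
move=> _ [i _ [B mB <-]]; exists (y' i @^-1` B); first exact: y'V.
exists (fun=> Some i) => x /(_ 0%N i erefl) yx.
by rewrite setTI /preimage/= yx.
Qed.

End sigma_approx.

Section laws_equal.
Context d (T : measurableType d) (I : Type) (R : realType).
Variables (y y' : I -> T -> \bar R) (V : set_system T).
Hypothesis my : forall i, measurable_fun setT (y i).
Hypothesis VT : V setT.
Hypothesis VI : setI_closed V.
Hypothesis mV : V `<=` measurable.
Hypothesis y'V : forall i B, measurable B -> <<s V >> (y' i @^-1` B).

Lemma sigma_sub_measurable E : <<s V >> E -> measurable E.
Proof. by move: E; apply: smallest_sub => //; exact: sigma_algebra_measurable. Qed.

Lemma measure_ae_set (m : {measure set T -> \bar R}) E E' :
  measurable E -> measurable E' ->
  {ae m, forall x, E x <-> E' x} -> m E = m E'.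
Proof.
move=> mE mE' ae; rewrite -(setIT E) -(setIT E') -!integral_indic//.
apply: ge0_ae_eq_integral => //; try by move=> x _; rewrite lee_fin.
1,2: by apply/measurable_EFinP; exact: measurable_indic.
apply: filterS ae => x h _; congr EFin; rewrite !indicE.
by congr (nat_of_bool _)%:R; apply/idP/idP => /set_mem /h /mem_set.
Qed.

Lemma measure_sigma_approx (m : {measure set T -> \bar R}) E E'
    (idx : nat -> option I) :
  measurable E -> measurable E' ->
  (forall i, {ae m, forall x, y i x = y' i x}) ->
  (forall x, (forall n i, idx n = Some i -> y i x = y' i x) -> (E x <-> E' x)) ->
  m E = m E'.
Proof.
move=> mE mE' ae h; apply: measure_ae_set => //.
have : {ae m, forall x, forall n i, idx n = Some i -> y i x = y' i x}.
  apply: ae_foralln => n.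
  case: (idx n) => [i|]; last exact: aeW.
  by apply: filterS (ae i) => x yx _ [<-].
by apply: filterS => x; exact: h.
Qed.

Lemma sigma_evals_measurable E :
  <<s \bigcup_i preimage_set_system setT (y i) measurable >> E -> measurable E.
Proof.
move: E; apply: smallest_sub; first exact: sigma_algebra_measurable.
by move=> _ [i _ [B mB <-]]; exact: my.
Qed.

(** Up to null sets of both measures, an event of the coordinates [y] is one and the same event of
    the sigma-algebra generated by [V], where uniqueness on a pi-system applies. *)
Lemma laws_equal (m1 m2 : {measure set T -> \bar R}) :
  m1 setT < +oo ->
  (forall i, {ae m1, forall x, y i x = y' i x}) ->
  (forall i, {ae m2, forall x, y i x = y' i x}) ->
  (forall A, V A -> m1 A = m2 A) ->
  forall E, <<s \bigcup_i preimage_set_system setT (y i) measurable >> E ->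
  m1 E = m2 E.
Proof.
move=> m1T ae1 ae2 m12 E sE.
have [E' VE' [idx h]] := sigma_approx y'V sE.
have mE := sigma_evals_measurable sE.
have mE' := sigma_sub_measurable VE'.
rewrite (measure_sigma_approx mE mE' ae1 h) (measure_sigma_approx mE mE' ae2 h).
apply: (@g_sigma_algebra_measure_unique _ _ _ V mV (fun=> setT)) => //.
by apply/seteqP; split => // x _; exists 0%N.
Qed.

End laws_equal.

(* [ev j y] is the [j]-th coordinate of the tuple of measures [y] *)
Section void_events.
Context d (X : measurableType d) (R : realType) (U : nat -> set X).
Hypothesis mU : forall n, measurable (U n).
Context d' (T : measurableType d') (J : finType) (ev : J -> T -> rmeasure X R).

Definition void_event (D : J -> set X) : set T :=
  [set y | forall j, ev j y (D j) = 0].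

Definition void_system : set_system T :=
  [set void_event D | D in [set D : J -> set X | forall j, measurable (D j)]].

Definition evals_sigma : set_system T :=
  <<s \bigcup_(jA : J * {A : set X | measurable A})
        preimage_set_system setT (fun y => ev jA.1 y (sval jA.2)) measurable >>.

Lemma void_systemT : void_system setT.
Proof.
exists (fun=> set0) => //=; apply/seteqP; split => // y _ j.
by rewrite measure0.
Qed.

Lemma void_systemI : setI_closed void_system.
Proof.
move=> _ _ [D /= mD <-] [E /= mE <-]; exists (fun j => D j `|` E j).
  by move=> j; exact: measurableU.
apply/seteqP; split => [y h|y [h1 h2] j].
  by split => j; apply/eqP; rewrite -measure_le0 -(h j) le_measure// ?inE//;
    exact: measurableU.
apply/eqP; rewrite -measure_le0; apply: le_trans (measureU2 _ _ _) _ => //.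
by apply: adde_le0; rewrite le_eqVlt; apply/orP; left; apply/eqP; [exact: h1|exact: h2].
Qed.

Lemma hits_limit_void j A (B : set (\bar R)) : measurable A -> measurable B ->
  <<s void_system >> ((fun y => hits_limit U (ev j y) A) @^-1` B).
Proof.
move=> mA mB.
suff : measurable_fun setT (fun y : g_sigma_algebraType void_system =>
    hits_limit U (ev j y) A).
  by move=> /(_ measurableT B mB); rewrite setTI.
apply: measurable_fun_limn_esup => n; apply/measurable_EFinP.
rewrite (_ : (fun y => _) = (fun y => (\sum_(c : {ffun 'I_n -> bool})
    \1_[set y | ev j y (A `&` cell U n @^-1` [set c]) != 0%E] y)%R)); last first.
  apply/funext => y; rewrite /hits -sum1_card natr_sum big_mkcond/=.
  apply: eq_bigr => c _; rewrite indicE inE/=.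
  by case: ifPn => h; [rewrite mem_set|rewrite memNset//; exact/negP].
apply: measurable_sum => c; apply: measurable_indic.
(* Only the [j]-th coordinate is constrained: the others are asked to avoid the empty set. *)
rewrite (_ : [set y | _] = ~` void_event
    (fun i => if i == j then A `&` cell U n @^-1` [set c] else set0)); last first.
  apply/seteqP; split => y /=.
    by move=> /eqP h h'; apply: h; have := h' j; rewrite eqxx.
  move=> h; apply/eqP => h'; apply: h => i.
  by case: eqP => [->|_]//; rewrite measure0.
apply: measurableC; apply: sub_sigma_algebra.
eexists; last reflexivity.
move=> i; case: ifP => _ //; apply: measurableI => //.
exact: measurable_cell.
Qed.

Hypothesis mev : forall j A, measurable A -> measurable_fun setT (fun y => ev j y A).

Lemma measurable_void_system : void_system `<=` measurable.
Proof.
move=> _ [D /= mD <-]; rewrite (_ : void_event D =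
  \bigcap_(j in [set: J]) ((fun y => ev j y (D j)) @^-1` [set 0])).
  apply: fin_bigcap_measurable; first exact: finite_finset.
  by move=> j _; rewrite -[X in measurable X]setTI; exact: mev.
by apply/seteqP; split => [y h j _|y h j]; [exact: h|exact: (h j I)].
Qed.

(* a measure whose coordinates are almost surely determined by their void events *)
Definition ae_simple (m : set T -> \bar R) : Prop := forall j A, measurable A ->
  m.-negligible [set y | ev j y A <> hits_limit U (ev j y) A].

Lemma void_laws_equal (m1 m2 : {measure set T -> \bar R}) :
  m1 setT < +oo -> ae_simple m1 -> ae_simple m2 ->
  (forall D, (forall j, measurable (D j)) ->
     m1 (void_event D) = m2 (void_event D)) ->
  forall E, evals_sigma E -> m1 E = m2 E.
Proof.
move=> m1T s1 s2 m12 E.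
apply: (@laws_equal _ _ _ _ _
  (fun (jA : J * {A : set X | measurable A}) y => hits_limit U (ev jA.1 y) (sval jA.2))
  void_system) => //.
- by move=> [j [A mA]]; exact: mev.
- exact: void_systemT.
- exact: void_systemI.
- exact: measurable_void_system.
- by move=> [j [A mA]] B mB; exact: hits_limit_void.
- by move=> [j [A mA]]; exact: s1.
- by move=> [j [A mA]]; exact: s2.
- by move=> _ [D mD <-]; exact: m12.
Qed.

(** The event [E'] is chosen before the measure, so that one [E'] serves a whole family of simple
    laws; the measurability of a family of conditional laws rests on this order. *)
Lemma void_approx E : evals_sigma E ->
  exists2 E', <<s void_system >> E' & forall m : {measure set T -> \bar R},
    ae_simple m -> m E = m E'.
Proof.
move=> sE.
have H (i : J * {A : set X | measurable A}) B : measurable B ->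
    <<s void_system >> ((fun y => hits_limit U (ev i.1 y) (sval i.2)) @^-1` B).
  by case: i => j [A mA] mB; exact: hits_limit_void.
have [E' VE' [idx h]] := sigma_approx H sE.
exists E' => // m sm; apply: (measure_sigma_approx _ _ _ h).
- apply: (sigma_evals_measurable _ sE) => -[j [A mA]]; exact: mev.
- exact: (sigma_sub_measurable measurable_void_system VE').
- by move=> [j [A mA]]; exact: sm.
Qed.

End void_events.

Section rmeasure_sigma.
Context d (X : measurableType d) (R : realType).

Lemma measurable_rmeasure_ev A : measurable A ->
  measurable_fun setT (fun mu : rmeasure X R => mu A).
Proof.
move=> mA _ B mB; rewrite setTI; apply: sub_sigma_algebra.
by exists A => //; exists B => //; rewrite setTI.
Qed.

Lemma measurable_fun_rmeasure d' (T : measurableType d') (f : T -> rmeasure X R) :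
  (forall A, measurable A -> measurable_fun setT (fun t => f t A)) ->
  measurable_fun setT f.
Proof.
move=> mf; apply: (measurability (\bigcup_(A in measurable)
    preimage_set_system [set: rmeasure X R] (@rmeasure_ev _ X R ^~ A) measurable)).
  by [].
move=> _ [_ [A mA [B mB <-]] <-]; rewrite setTI.
by have := mf A mA measurableT B mB.
Qed.

Lemma measurable_rmeasure_sub E : measurable E ->
  evals_sigma (fun (_ : unit) (mu : rmeasure X R) => mu) E.
Proof.
apply: sub_smallest2r; first exact: smallest_sigma_algebra.
move=> _ [A mA [B mB <-]]; exists (tt, exist _ A mA) => //.
by exists B.
Qed.

Lemma measurable_tuple_rmeasure_sub q (E : set (q.-tuple (rmeasure X R))) :
  measurable E ->
  evals_sigma (fun (j : 'I_q) (z : q.-tuple (rmeasure X R)) => tnth z j) E.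
Proof.
move: E; apply: smallest_sub; first exact: smallest_sigma_algebra.
apply: (big_ind (fun S => S `<=` _)) => //.
  by move=> S1 S2 h1 h2 E [/h1|/h2].
move=> j _ E [B mB <-]; rewrite setTI.
have := measurable_rmeasure_sub mB; move: B {mB E}; apply: smallest_sub.
  split.
  - by rewrite /= preimage_set0; exact: sigma_algebra0.
  - by move=> B hB; rewrite /= setTD preimage_setC; exact: sigma_algebraC.
  - move=> F hF; rewrite /= preimage_bigcup; exact: sigma_algebra_bigcup.
move=> _ [[u A] _ [B mB <-]]; apply: sub_sigma_algebra.
by exists (j, A) => //; exists B => //; rewrite !setTI.
Qed.

End rmeasure_sigma.

(** * Countable separation in a Polish space *)

Section polish_separation.
Context (R : realType) (Omega : completePseudoMetricType R).

Lemma measurable_open_borel (A : set (borel Omega)) :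
  @open Omega A -> measurable A.
Proof. exact: sub_sigma_algebra. Qed.

(** The separating sets are the interiors of the balls of radius [1 / (n + 1)] centred at the points
    of a countable dense set. *)
Lemma polish_separating : polish Omega ->
  exists U : nat -> set (borel Omega), (forall n, measurable (U n)) /\
    separated_on U setT.
Proof.
move=> [hO [D cD dD]].
have /countable_injP[f finj] := cD.
(* The union is over at most one centre, the point of [D] with code [mk.1]; it replaces an
   enumeration of [D], which might be finite. *)
pose B (mk : nat * nat) : set Omega :=
  \bigcup_(x in [set x | D x /\ f x = mk.1]) (ball x mk.2.+1%:R^-1%R)^°.
exists (fun n => if unpickle n is Some mk then B mk else set0); split.
  move=> n; case: (unpickle n) => // mk; apply: measurable_open_borel.
  by apply: bigcup_open => x _; exact: open_interior.
move=> x y _ _ xy; apply: contrapT => /eqP neq.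
move: (hO); rewrite ball_hausdorff => /(_ x y neq)[[r1 r2] /= /eqP r12].
(* Then [e = 1 / (k + 1)] is less than half of [r1], which leaves room for the radius [e / 2 + e] of
   the last triangle inequality. *)
pose k := Num.truncn (2 / r1%:num)%R.
pose e : R := (k.+1%:R^-1)%R.
have e0 : (0 < e)%R by rewrite invr_gt0.
have e2r : (e * 2 < r1%:num)%R.
  rewrite /e mulrC ltr_pdivrMr// mulrC -ltr_pdivrMr//.
  exact: truncnS_gt.
have [z [bz Dz]] : (ball x (e / 2))%R^° `&` D !=set0.
  apply: dD; last exact: open_interior.
  by exists x; apply: nbhsx_ballx; rewrite divr_gt0.
have xz : (ball z e)^° x.
  apply/nbhs_ballP; exists (e / 2)%R => /=; first by rewrite divr_gt0.
  move=> t xt; rewrite [e]splitr; apply: ball_triangle xt.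
  by apply: ball_sym; exact: interior_subset bz.
have : B (f z, k) y.
  have := xy (pickle (f z, k)); rewrite pickleK => -[h _]; apply: h.
  by exists z.
move=> [z' [/= Dz' zz']]; have -> : z' = z by apply: finj; rewrite ?inE.
move=> /interior_subset yz.
suff : set0 y by [].
rewrite -r12; split; last exact: ballxx.
apply: (@le_ball _ _ _ (e / 2 + e)%R).
  by apply: le_trans (ltW e2r); lra.
by apply: ball_triangle yz; exact: interior_subset bz.
Qed.

End polish_separation.

Lemma preimage_measurable d d' (T : measurableType d) (S : measurableType d')
    (f : T -> S) (B : set S) :
  measurable_fun setT f -> measurable B -> measurable (f @^-1` B).
Proof. by move=> mf mB; rewrite -[X in measurable X]setTI; exact: mf. Qed.

Lemma mem_enum_fset_set (T : choiceType) (A : set T) x : finite_set A ->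
  (x \in finmap.enum_fset (fset_set A)) = (x \in A).
Proof. by move=> fA; exact: in_fset_set. Qed.

(** * Poisson random measures *)

Section indep_integral.
Context d (T : measurableType d) (R : realType) (P : probability T R).
Context (I : finType) (X : I -> T -> \bar R) (phi : I -> \bar R -> \bar R).
Hypothesis mX : forall i, measurable_fun setT (X i).
Hypothesis mphi : forall i, measurable_fun setT (phi i).
Hypothesis phi0 : forall i x, 0 <= phi i x.

Let mphiX i : measurable_fun setT (fun t => phi i (X i t)).
Proof. by apply: measurableT_comp. Qed.

(** The events of the product rule are replaced by functions one index at a time. The set [B] makes
    the induction work: the event on the index at hand is absorbed into it before the induction
    hypothesis is used. *)
Lemma indep_integral_seq (s : seq I) (B : set T) : measurable B -> uniq s ->
  (forall U : I -> set (\bar R), (forall i, measurable (U i)) ->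
    P (B `&` \bigcap_(i in [set` s]) (X i @^-1` U i)) =
    P B * \prod_(i <- s) P (X i @^-1` U i)) ->
  \int[P]_(t in B) (\prod_(i <- s) phi i (X i t)) =
  P B * \prod_(i <- s) \int[P]_t phi i (X i t).
Proof.
have mU U i : measurable U -> measurable (X i @^-1` U).
  by move=> mU; rewrite -[X in measurable X]setTI; exact: mX.
have prod0 t s' : 0 <= \prod_(i <- s') phi i (X i t) by exact: prode_ge0.
have mprod s' : measurable_fun setT (fun t => \prod_(i <- s') phi i (X i t)).
  elim: s' => [|i s' IH]; first by under eq_fun do rewrite big_nil; exact: measurable_cst.
  by under eq_fun do rewrite big_cons; exact: emeasurable_funM.
elim: s B => [|i s IH] B mB /=.
  move=> _ _; under eq_integral do rewrite big_nil.
  by rewrite integral_cst// mul1e big_nil mule1.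
move=> /andP[nis us] BU.
have EB U : measurable U -> P (B `&` X i @^-1` U) = P B * P (X i @^-1` U).
  move=> mU'; have := BU (fun j => if j == i then U else setT).
  rewrite big_cons eqxx (eq_big_seq (fun=> 1)); last first.
    move=> j js; case: ifPn => [/eqP ji|_]; first by rewrite -ji js in nis.
    by rewrite preimage_setT probability_setT.
  rewrite big1 ?mule1// => <- => [|j]; last by case: ifP.
  congr (P _); apply/seteqP; split => [t [Bt Xt]|t [Bt h]]; split => //.
    by move=> j /= _; case: eqP => // ->.
  by have /= := h i; rewrite eqxx; apply; rewrite mem_head.
pose c := P B * \prod_(i <- s) \int[P]_t phi i (X i t).
have c0 : 0 <= c.
  by rewrite mule_ge0//; apply: prode_ge0 => j _; exact: integral_ge0.
under eq_integral do rewrite big_cons.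
transitivity (\int[P]_t (phi i (X i t) * ((\1_B t)%:E * \prod_(j <- s) phi j (X j t)))).
  rewrite integral_mkcond; apply: eq_integral => t _.
  rewrite patchE indicE; case: ifPn => _; first by rewrite mul1e.
  by rewrite mul0e mule0.
rewrite (@ge0_integral_mul_eq _ _ _ _ _ P (X i) _ (fun=> c))//.
- rewrite ge0_integralZr//.
  by rewrite big_cons /c muleCA.
- by apply: emeasurable_funM => //; apply/measurable_EFinP; exact: measurable_indic.
- by move=> t; rewrite mule_ge0// lee_fin.
move=> U mU'; rewrite integral_cst; last exact: mU.
transitivity (\int[P]_(t in B `&` X i @^-1` U) \prod_(j <- s) phi j (X j t)).
  rewrite setIC [RHS]integral_mkcondr; apply: eq_integral => t _.
  by rewrite patchE indicE; case: ifPn; rewrite ?mul1e ?mul0e.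
rewrite IH//; first by rewrite EB// /c muleAC.
  by apply: measurableI => //; exact: mU.
move=> V mV; rewrite EB// -setIA.
have := BU (fun j => if j == i then U else V j).
rewrite big_cons eqxx (eq_big_seq (fun j => P (X j @^-1` V j))); last first.
  by move=> j js; case: ifPn => [/eqP ji|//]; rewrite -ji js in nis.
rewrite -muleA => <- => [|j]; last by case: ifP.
congr (P (_ `&` _)); apply/seteqP; split => [t [Ut Vt]|t h] /=.
  move=> j /=; rewrite inE => /orP[/eqP ->|js]; first by rewrite eqxx.
  by case: eqP => [-> //|_]; exact: Vt.
split; first by have /= := h i; rewrite eqxx; apply; rewrite mem_head.
move=> j /= js; have /= := h j; case: eqP => [ji|_]; first by rewrite -ji js in nis.
by apply; rewrite inE js orbT.
Qed.

Lemma indep_integral : mutual_indep P (fun i => sigma_of (X i)) ->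
  \int[P]_t (\prod_(i : I) phi i (X i t)) = \prod_(i : I) \int[P]_t phi i (X i t).
Proof.
move=> ind; have := @indep_integral_seq (index_enum I) setT measurableT.
rewrite probability_setT !mul1e; apply; first exact: index_enum_uniq.
move=> U mU; rewrite setTI mul1e.
have := ind [set: I]%SET (fun i => X i @^-1` U i).
rewrite (_ : [set` [set: I]%SET] = [set` index_enum I]); last first.
  by apply/seteqP; split => i /=; rewrite ?inE ?mem_index_enum.
move=> ->; first by apply: eq_bigl => i; rewrite inE.
by move=> i; exists (U i) => //; rewrite setTI.
Qed.

End indep_integral.

Section poisson_transform.
Context (R : realType).

Lemma poisson_prob_set1 (lam : R) k n : (0 <= lam)%R ->
  poisson_prob lam k [set n] = (lam ^+ n * n`!%:R^-1 * expR (- lam))%:E.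
Proof.
rewrite /poisson_prob => l0; case: ifPn => [lp|].
  by rewrite esum_set1 ?lee_fin ?poisson_pmf_ge0// /poisson_pmf lp.
rewrite -leNgt => ln0; have -> : lam = 0%R by apply/eqP; rewrite eq_le l0 ln0.
rewrite diracE oppr0 expR0 mulr1; case: n => [|n].
  by rewrite mem_set// expr0 fact0 invr1 mulr1.
by rewrite memNset ?expr0n ?mul0r//.
Qed.

Lemma poisson_total (lam : R) k : \sum_(n <oo) poisson_prob lam k [set n] = 1.
Proof.
rewrite -(probability_setT (poisson_prob lam k)).
have -> : [set: nat] = \bigcup_n [set n].
  by apply/seteqP; split => // n _; exists n.
rewrite measure_semi_bigcup//=.
by apply/trivIsetP => i j _ _ ij; apply/seteqP; split => // k' /= [-> ] /eqP; rewrite (negbTE ij).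
Qed.

Lemma poisson_generating (lam s : R) : (0 <= lam)%R -> (0 <= s)%R ->
  \sum_(n <oo) ((s ^+ n)%:E * poisson_prob lam 0%N [set n]) =
  (expR (- ((1 - s) * lam)))%:E.
Proof.
move=> l0 s0.
transitivity (\sum_(n <oo) ((expR (- ((1 - s) * lam)))%:E * poisson_prob (s * lam) 0%N [set n])).
  apply: eq_eseriesr => n _; rewrite !poisson_prob_set1 ?mulr_ge0// -!EFinM.
  congr EFin; rewrite exprMn.
  rewrite (_ : - lam = - ((1 - s) * lam) + - (s * lam))%R; last by ring.
  by rewrite expRD; ring.
rewrite nneseriesZl//.
by rewrite poisson_total mule1.
Qed.

Context d (T : measurableType d) (P : probability T R).

Lemma poisson_laplace (X : T -> \bar R) (lam v : R) : measurable_fun setT X ->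
  (0 <= lam)%R -> (0 <= v)%R ->
  (forall n, P [set t | X t = n%:R%:E] = poisson_prob lam 0%N [set n]) ->
  \int[P]_t (expN (v%:E * X t))%:E = (expR (- ((1 - expR (- v)) * lam)))%:E.
Proof.
move=> mX l0 v0 PX.
pose F n := [set t | X t = n%:R%:E].
have mF n : measurable (F n).
  by apply: (preimage_measurable mX (B := [set n%:R%:E])).
have tF : trivIset setT F.
  apply/trivIsetP => i j _ _ ij; apply/seteqP; split => // t [].
  by rewrite /F/= => -> -[] /eqP; rewrite eqr_nat (negbTE ij).
have mUF : measurable (\bigcup_n F n) by exact: bigcup_measurable.
have PF : P (~` \bigcup_n F n) = 0.
  rewrite probability_setC// measure_semi_bigcup//.
  rewrite (eq_eseriesr (g := fun n => poisson_prob lam 0%N [set n])); last first.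
    by move=> n _; exact: PX.
  by rewrite poisson_total subee.
have mf : measurable_fun setT (fun t => (expN (v%:E * X t))%:E).
  apply/measurable_EFinP; apply: measurableT_comp; first exact: measurable_expN.
  exact: measurable_funeM.
rewrite (@ge0_negligible_integral _ _ _ _ setT (~` \bigcup_n F n))//; last 2 first.
  exact: measurableC.
  by move=> t _; rewrite lee_fin expN_ge0.
rewrite setTD setCK ge0_integral_bigcup//; last 2 first.
  exact: measurable_funTS.
  by move=> t _; rewrite lee_fin expN_ge0.
rewrite -(@poisson_generating lam (expR (- v)))// ?expR_ge0//.
apply: eq_eseriesr => n _.
rewrite (eq_integral (fun=> (expR (- v) ^+ n)%:E)); last first.
  move=> t /set_mem; rewrite /F/= => ->; rewrite /expN/= -expRM_natr; congr (expR _)%:E.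
  by rewrite mulNr.
by rewrite integral_cst//; congr (_ * _); exact: PX.
Qed.

End poisson_transform.

Section laplace_functional.
Context d (T : measurableType d) (R : realType) (P : probability T R).
Context d' (X : measurableType d').
Import HBNNSimple.

Lemma is_PRM_eq (nu nu' : set X -> \bar R) N :
  (forall A, measurable A -> nu A = nu' A) -> is_PRM P nu N -> is_PRM P nu' N.
Proof.
move=> nuE [mN pN iN indN]; split => //.
- by move=> A mA; rewrite -nuE//; exact: pN.
- by move=> A mA; rewrite -nuE//; exact: iN.
Qed.

Variables (nu : {measure set X -> \bar R}) (N : T -> rmeasure X R).
Hypothesis prmN : is_PRM P nu N.

Lemma PRM_measurable_ev A : measurable A -> measurable_fun setT (fun t => N t A).
Proof.
move=> mA; apply: (measurableT_comp (measurable_rmeasure_ev mA)).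
exact: prm_measurable prmN.
Qed.

Lemma PRM_laplace_set (A : set X) (v : R) : measurable A -> (0 <= v)%R ->
  \int[P]_t (expN (v%:E * N t A))%:E = (expN ((1 - expR (- v))%:E * nu A))%:E.
Proof.
move=> mA v0; have [nuA|] := ltP (nu A) +oo.
  rewrite (poisson_laplace (PRM_measurable_ev mA) (lam := fine (nu A)))//.
  - rewrite -[in RHS](@fineK _ (nu A)) ?ge0_fin_numE//.
  by move=> n; exact: (prm_poisson prmN).
rewrite leye_eq => /eqP nuA; rewrite nuA.
have aeNA : {ae P, forall t, N t A = +oo}.
  have mNA : measurable [set t | N t A = +oo].
    by apply: (preimage_measurable (PRM_measurable_ev mA) (B := [set +oo])).
  exists (~` [set t | N t A = +oo]); split => //; first exact: measurableC.
  by rewrite probability_setC// (prm_infinite prmN)// subee.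
(* For [v = 0] both sides are 1, because [0 * +oo = 0]; the infinite mass is felt only for
   [v > 0]. *)
move: v0; rewrite le_eqVlt => /predU1P[<-|v0].
  rewrite oppr0 expR0 subrr mul0e expN0.
  under eq_integral do rewrite mul0e expN0.
  by rewrite integral_cst// mul1e; exact: probability_setT.
rewrite gt0_muley; last by rewrite lte_fin subr_gt0 -expR0 ltr_expR oppr_lt0.
rewrite (ae_eq_integral (fun=> 0))//; first by rewrite integral0.
  apply/measurable_EFinP; apply: measurableT_comp; first exact: measurable_expN.
  by apply: measurable_funeM; exact: PRM_measurable_ev.
by apply: filterS aeNA => t -> _; rewrite gt0_muley.
Qed.

(** The function [h] is the identity for the random measure and [fun r => 1 - expR (- r)] for the
    intensity, so that both sides of the Laplace functional are expanded over the same level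
    sets. *)
Lemma integral_nnsfun_level (mu : {measure set X -> \bar R}) (f : {nnsfun X >-> R})
    (h : R -> R) : (forall x, (0 <= x)%R -> (0 <= h x)%R) ->
  let s := finmap.enum_fset (fset_set (range f)) in
  \int[mu]_x (h (f x))%:E =
  \sum_(i < size s) (h s`_i)%:E * mu (f @^-1` [set s`_i]).
Proof.
move=> h0 s.
have fs x : f x \in s.
  by rewrite mem_enum_fset_set// inE; exists x.
have sf r : r \in s -> (0 <= r)%R.
  by rewrite mem_enum_fset_set// inE => -[x _ <-].
have us : uniq s by exact: finmap.fset_uniq.
transitivity (\int[mu]_x \sum_(i < size s) ((h s`_i)%:E * (\1_(f @^-1` [set s`_i]) x)%:E)).
  apply: eq_integral => x _.
  have ix : (index (f x) s < size s)%N by rewrite index_mem.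
  rewrite (bigD1 (Ordinal ix))//= nth_index// indicE mem_set//= mule1 big1 ?adde0//.
  move=> j jx; rewrite indicE memNset ?mule0//= => fxj.
  by move/eqP : jx; apply; apply: val_inj => /=; rewrite fxj index_uniq.
rewrite ge0_integral_sum//.
- apply: eq_bigr => i _; rewrite ge0_integralZl_EFin//.
  + by rewrite integral_indic// setIT.
  + by apply/measurable_EFinP.
  + by apply: h0; apply: sf; exact: mem_nth.
- by move=> i; apply: measurable_funeM; exact/measurable_EFinP.
- move=> i x _; rewrite mule_ge0// lee_fin.
  by apply: h0; apply: sf; exact: mem_nth.
Qed.

Lemma PRM_laplace_nnsfun (f : {nnsfun X >-> R}) :
  \int[P]_t (expN (\int[N t]_x (f x)%:E))%:E =
  (expN (\int[nu]_x (1 - expR (- f x))%:E))%:E.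
Proof.
pose s := finmap.enum_fset (fset_set (range f)).
pose A i := f @^-1` [set s`_i].
have mA i : measurable (A i) by exact: measurable_funPTI.
have sf (i : 'I_(size s)) : (0 <= s`_i)%R.
  have : s`_i \in s by exact: mem_nth.
  by rewrite mem_enum_fset_set// inE => -[x _ <-].
have us : uniq s by exact: finmap.fset_uniq.
transitivity (\int[P]_t \prod_(i < size s) (expN ((s`_i)%:E * N t (A i)))%:E).
  apply: eq_integral => t _.
  rewrite (@integral_nnsfun_level _ f id)//= expN_sum ?prodEFin// => i.
  by apply: mule_ge0 => //; exact: sf.
rewrite (@indep_integral _ _ _ P _ (fun (i : 'I_(size s)) t => N t (A i))
  (fun i x => (expN ((s`_i)%:E * x))%:E)).
- rewrite (@integral_nnsfun_level _ f (fun r => 1 - expR (- r)))%R; last first.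
    by move=> x x0; rewrite subr_ge0 -expR0 ler_expR oppr_le0.
  rewrite expN_sum -?prodEFin; last first.
    move=> i; rewrite mule_ge0// lee_fin subr_ge0 -expR0 ler_expR oppr_le0.
    exact: sf.
  by apply: eq_bigr => i _; rewrite PRM_laplace_set.
- by move=> i; exact: PRM_measurable_ev.
- move=> i; apply/measurable_EFinP; apply: measurableT_comp.
    exact: measurable_expN.
  exact: measurable_funeM.
- by move=> i x; rewrite lee_fin expN_ge0.
apply: (prm_indep prmN) => // i j _ _ [x [/= fi fj]].
by apply: val_inj => /=; apply/eqP; rewrite -(nth_uniq 0%R _ _ us)// -fi fj.
Qed.

Lemma measurable_PRM_integral f : measurable_fun setT f -> (forall x, 0 <= f x) ->
  measurable_fun setT (fun t => \int[N t]_x f x).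
Proof.
move=> mf f0; apply: measurable_fun_integral_kernel => // U mU.
exact: PRM_measurable_ev.
Qed.

(** Increasing simple approximations of [f] increase both exponents, so the formula for simple
    functions passes to the limit: under the expectation by domination by 1, in the intensity
    integral by monotone convergence. *)
Theorem PRM_laplace f : measurable_fun setT f -> (forall x, 0 <= f x) ->
  \int[P]_t (expN (\int[N t]_x f x))%:E =
  (expN (\int[nu]_x (1 - expN (f x))%:E))%:E.
Proof.
move=> mf f0; pose f_ := nnsfun_approx measurableT mf.
have f_cvg x : (f_ n x)%:E @[n --> \oo] --> f x by exact: cvg_nnsfun_approx.
have f_nd x m n : (m <= n)%N -> (f_ m x)%:E <= (f_ n x)%:E.
  by move=> mn; rewrite lee_fin; exact/lefP/nd_nnsfun_approx.
have cvg_int (mu : {measure set X -> \bar R}) :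
    \int[mu]_x (f_ n x)%:E @[n --> \oo] --> \int[mu]_x f x.
  rewrite (_ : \int[mu]_x f x = \int[mu]_x limn (fun n => (f_ n x)%:E)); last first.
    by apply: eq_integral => x _; exact/esym/cvg_lim.
  apply: cvg_monotone_convergence => //.
  - by move=> n; exact/measurable_EFinP.
  - by move=> n x _; rewrite lee_fin.
  - by move=> x _ m n; exact: f_nd.
have lhs : \int[P]_t (expN (\int[N t]_x (f_ n x)%:E))%:E @[n --> \oo] -->
    \int[P]_t (expN (\int[N t]_x f x))%:E.
  have mexpN g : measurable_fun setT g -> (forall x, 0 <= g x) ->
      measurable_fun setT (fun t => (expN (\int[N t]_x g x))%:E).
    move=> mg g0; apply/measurable_EFinP; apply: measurableT_comp.
      exact: measurable_expN.
    exact: measurable_PRM_integral.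
  have [|||||_ _ h] := @dominated_convergence _ _ _ P setT measurableT
    (fun n t => (expN (\int[N t]_x (f_ n x)%:E))%:E)
    (fun t => (expN (\int[N t]_x f x))%:E) (fun=> 1).
  - move=> n; apply: mexpN; first exact/measurable_EFinP.
    by move=> x; rewrite lee_fin.
  - exact: mexpN.
  - apply: aeW => t _; apply: cvg_expN; last exact: cvg_int.
    by move=> n; apply: integral_ge0 => x _; rewrite lee_fin.
  - exact: finite_measure_integrable_cst.
  - apply: aeW => t n _; rewrite abse_EFin ger0_norm ?expN_ge0// lee_fin expN_le1//.
    by apply: integral_ge0 => x _; rewrite lee_fin.
  exact: h.
have rhs : (expN (\int[nu]_x (1 - expR (- f_ n x))%:E))%:E @[n --> \oo] -->
    (expN (\int[nu]_x (1 - expN (f x))%:E))%:E.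
  apply: cvg_expN.
    move=> n; apply: integral_ge0 => x _.
    by rewrite lee_fin subr_ge0 -expR0 ler_expR oppr_le0.
  rewrite (_ : \int[nu]_x _ = \int[nu]_x limn (fun n => (1 - expR (- f_ n x))%:E)); last first.
    apply: eq_integral => x _; apply/esym/cvg_lim => //.
    rewrite (_ : (fun n => _) = (fun n => 1 - (expN (f_ n x)%:E)%:E))//.
    rewrite EFinB; apply: cvgeB => //; first exact: cvg_cst.
    by apply: cvg_expN => // n; rewrite lee_fin.
  apply: cvg_monotone_convergence => //.
  - move=> n; apply/measurable_EFinP; apply: measurable_funB => //.
    by apply: measurableT_comp => //; apply: measurableT_comp.
  - by move=> n x _; rewrite lee_fin subr_ge0 -expR0 ler_expR oppr_le0.
  - move=> x _ m n mn; rewrite lee_fin lerB// ler_expR lerN2 -lee_fin.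
    exact: f_nd.
apply: (cvg_unique _ lhs) => //.
rewrite (_ : (fun n => _) = (fun n => (expN (\int[nu]_x (1 - expR (- f_ n x))%:E))%:E))//.
by apply/funext => n; exact: PRM_laplace_nnsfun.
Qed.

End laplace_functional.

(** * Uniqueness of Laplace transforms of integer-valued variables *)

Section series_unique.
Context (R : realType).

Lemma fin_addeI (x a b : \bar R) : x + a = x + b -> x \is a fin_num -> a = b.
Proof. by move=> E xf; rewrite -(addeK a xf) [a + x]addeC E [x + b]addeC addeK. Qed.

Lemma nneseries_recl_shift (f : nat -> \bar R) : (forall n, 0 <= f n) ->
  \sum_(n <oo) f n = f 0%N + \sum_(n <oo) f n.+1.
Proof.
move=> f0; rewrite nneseries_recl//; congr (_ + _).
by rewrite -nneseries_addn//; apply: eq_eseriesr => n _; rewrite addn1.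
Qed.

Let series_shift (a : nat -> R) (s : R) : (0 <= s)%R -> (forall n, 0 <= a n)%R ->
  \sum_(n <oo) (a n * s ^+ n)%:E =
  (a 0%N)%:E + s%:E * \sum_(n <oo) (a n.+1 * s ^+ n)%:E.
Proof.
move=> s0 a0; have t0 n : (0 <= a n * s ^+ n)%R by rewrite mulr_ge0// exprn_ge0.
rewrite nneseries_recl_shift; last by move=> n; rewrite lee_fin.
rewrite expr0 mulr1; congr (_ + _); rewrite -nneseriesZl; last first.
  by move=> n _; rewrite lee_fin mulr_ge0// exprn_ge0.
by apply: eq_eseriesr => n _; rewrite -EFinM exprS mulrCA.
Qed.

(** Letting [s] tend to 0 identifies the constant terms; subtracting them and dividing by [s] leaves
    the shifted series, to which induction applies. *)
Lemma power_series_unique (a b : nat -> R) :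
  (forall n, 0 <= a n)%R -> (forall n, 0 <= b n)%R ->
  \sum_(n <oo) (a n)%:E < +oo -> \sum_(n <oo) (b n)%:E < +oo ->
  (forall s : R, (0 < s < 1)%R ->
    \sum_(n <oo) (a n * s ^+ n)%:E = \sum_(n <oo) (b n * s ^+ n)%:E) ->
  forall n, a n = b n.
Proof.
have le0 (u v : nat -> R) : (forall n, 0 <= u n)%R -> (forall n, 0 <= v n)%R ->
    \sum_(n <oo) (v n)%:E < +oo ->
    (forall s : R, (0 < s < 1)%R ->
      \sum_(n <oo) (u n * s ^+ n)%:E = \sum_(n <oo) (v n * s ^+ n)%:E) ->
    (u 0%N <= v 0%N)%R.
  move=> u0 v0 sv uv.
  have Vfin : \sum_(n <oo) (v n.+1)%:E \is a fin_num.
    rewrite ge0_fin_numE; last by apply: nneseries_ge0 => n _ _; rewrite lee_fin.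
    apply: le_lt_trans sv; rewrite [leRHS]nneseries_recl_shift.
      by rewrite leeDr// lee_fin.
    by move=> n; rewrite lee_fin.
  set V := \sum_(n <oo) _ in Vfin.
  have V0 : (0 <= fine V)%R by apply: fine_ge0; apply: nneseries_ge0 => n _ _; rewrite lee_fin.
  apply/ler_addgt0Pr => e e0.
  (* With [V] the sum of the later coefficients of [v], this choice gives [s * V <= e]; the other
     bound keeps [s] below 1. *)
  pose s : R := (Num.min (1 / 2) (e / (fine V + 1)))%R.
  have s0 : (0 < s)%R by rewrite lt_min; apply/andP; split => //; rewrite divr_gt0// ltr_wpDl.
  have s1 : (s < 1)%R by rewrite gt_min; apply/orP; left; lra.
  have := uv s; rewrite s0 s1 => /(_ isT).
  rewrite (@series_shift u s) ?(ltW s0)// (@series_shift v s) ?(ltW s0)// => E.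
  have : (u 0%N)%:E <= (v 0%N)%:E + s%:E * V.
    apply: (@le_trans _ _ ((u 0%N)%:E + s%:E * \sum_(n <oo) (u n.+1 * s ^+ n)%:E)).
      rewrite leeDl// mule_ge0 ?lee_fin ?(ltW s0)//.
      by apply: nneseries_ge0 => n _ _; rewrite lee_fin mulr_ge0// exprn_ge0// ltW.
    rewrite E leeD2l// lee_wpmul2l ?lee_fin ?(ltW s0)//.
    apply: lee_nneseries => [n _ _|n _].
      by rewrite lee_fin mulr_ge0// exprn_ge0// ltW.
    by rewrite lee_fin ler_piMr// exprn_ile1// ltW.
  rewrite -(fineK Vfin) -EFinM -EFinD lee_fin => /le_trans; apply.
  rewrite lerD2l (@le_trans _ _ (e / (fine V + 1) * fine V)%R)//.
    by rewrite ler_wpM2r// ge_min lexx orbT.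
  rewrite mulrAC ler_pdivrMr ?ltr_wpDl// ler_wpM2l ?(ltW e0)//.
  by rewrite lerDl.
move=> a0 b0 sa sb ab n; elim: n a b a0 b0 sa sb ab => [|n IH] a b a0 b0 sa sb ab.
  by apply/eqP; rewrite eq_le !le0// => s /ab.
have ab0 : a 0%N = b 0%N by apply/eqP; rewrite eq_le !le0// => s /ab.
have tail (u : nat -> R) : (forall n, 0 <= u n)%R ->
    \sum_(n <oo) (u n)%:E < +oo -> \sum_(n <oo) (u n.+1)%:E < +oo.
  move=> u0; apply: le_lt_trans; rewrite [leRHS]nneseries_recl_shift.
    by rewrite leeDr// lee_fin.
  by move=> k; rewrite lee_fin.
apply: (IH (fun n => a n.+1) (fun n => b n.+1)) => //; try exact: tail.
move=> s s01; have /andP[s0 _] := s01; have := ab s s01.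
rewrite (@series_shift a s) ?(ltW s0)// (@series_shift b s) ?(ltW s0)// ab0 => /fin_addeI -/(_ isT) /(congr1 (fun x => s^-1%:E * x)).
by rewrite !muleA -EFinM mulVf ?gt_eqF// !mul1e.
Qed.

End series_unique.

Section counting_variables.
Context d (T : measurableType d) (R : realType) (P : probability T R).

Definition count_valued (x : \bar R) : Prop := x = +oo \/ exists n, x = n%:R%:E.

(** Level 0 is the value [+oo] and level [n.+1] the value [n], so that a single sequence partitions
    the space. *)
Definition count_level (X : T -> \bar R) (k : nat) : set T :=
  if k is n.+1 then [set t | X t = n%:R%:E] else [set t | X t = +oo].

Section levels.
Variable X : T -> \bar R.
Hypothesis mX : measurable_fun setT X.
Hypothesis Xnat : forall t, count_valued (X t).

Let measurable_level k : measurable (count_level X k).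
Proof.
case: k => [|n] /=.
  exact: (preimage_measurable mX (B := [set +oo])).
exact: (preimage_measurable mX (B := [set n%:R%:E])).
Qed.

Let trivIset_level : trivIset setT (count_level X).
Proof.
apply/trivIsetP => -[|i] [|j] _ _ //= ij; apply/seteqP; split => // t /= [].
- by move=> ->.
- by move=> ->.
- by move=> -> -[] /eqP; rewrite eqr_nat -eqSS (negbTE ij).
Qed.

Let bigcup_level : \bigcup_k count_level X k = setT.
Proof.
apply/seteqP; split => // t _; case: (Xnat t) => [Xt|[n Xt]].
  by exists 0%N.
by exists n.+1.
Qed.

Lemma integral_level (A : set T) g : measurable A -> measurable_fun setT g ->
  (forall t, 0 <= g t) ->
  \int[P]_(t in A) g t = \sum_(k <oo) \int[P]_(t in A `&` count_level X k) g t.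
Proof.
move=> mA mg g0.
rewrite -[in LHS](setIT A) -bigcup_level setI_bigcupr ge0_integral_bigcup//.
- by move=> k; exact: measurableI.
- exact: measurable_funTS.
- exact: trivIset_setIl.
Qed.

Let integral_transform g v : (0 < v)%R -> measurable_fun setT g ->
  (forall t, 0 <= g t) ->
  \int[P]_t (g t * (expN (v%:E * X t))%:E) =
  \sum_(n <oo) ((expR (- v) ^+ n)%:E * \int[P]_(t in count_level X n.+1) g t).
Proof.
move=> v0 mg g0.
have me : measurable_fun setT (fun t => (expN (v%:E * X t))%:E).
  apply/measurable_EFinP; apply: measurableT_comp; first exact: measurable_expN.
  exact: measurable_funeM.
rewrite (@integral_level setT)//; last 2 first.
- exact: emeasurable_funM.
- by move=> t; rewrite mule_ge0// lee_fin expN_ge0.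
rewrite nneseries_recl_shift; last first.
  by move=> k; apply: integral_ge0 => t _; rewrite mule_ge0// lee_fin expN_ge0.
rewrite [X in X + _]integral0_eq ?add0e; last first.
  by move=> t [_ /= ->]; rewrite gt0_muley// mule0.
apply: eq_eseriesr => n _; rewrite setTI -ge0_integralZl//; last exact: measurable_funTS.
apply: eq_integral => t /set_mem /= ->; rewrite muleC; congr (_ * _).
by rewrite /expN/= -expRM_natr mulNr.
Qed.

(** For [v > 0] the transform is a power series in [expR (- v)] whose coefficients are the integrals
    over the finite levels. The level [+oo] contributes nothing to it and is recovered from the
    equality of the total integrals, which are finite. *)
Lemma laplace_unique (g1 g2 : T -> \bar R) :
  measurable_fun setT g1 -> measurable_fun setT g2 ->
  (forall t, 0 <= g1 t) -> (forall t, 0 <= g2 t) ->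
  \int[P]_t g1 t < +oo -> \int[P]_t g1 t = \int[P]_t g2 t ->
  (forall v, (0 < v)%R -> \int[P]_t (g1 t * (expN (v%:E * X t))%:E) =
                          \int[P]_t (g2 t * (expN (v%:E * X t))%:E)) ->
  forall U, measurable U ->
  \int[P]_(t in X @^-1` U) g1 t = \int[P]_(t in X @^-1` U) g2 t.
Proof.
move=> mg1 mg2 g10 g20 g1oo g12 lap.
pose a (g : T -> \bar R) k := \int[P]_(t in count_level X k) g t.
have a0 g k : (forall t, 0 <= g t) -> 0 <= a g k by move=> g0; exact: integral_ge0.
have sa g : measurable_fun setT g -> (forall t, 0 <= g t) ->
    \int[P]_t g t = \sum_(k <oo) a g k.
  move=> mg g0; rewrite (@integral_level setT)//.
  by apply: eq_eseriesr => k _; rewrite setTI.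
have fa g k : measurable_fun setT g -> (forall t, 0 <= g t) ->
    \int[P]_t g t < +oo -> a g k \is a fin_num.
  move=> mg g0 goo; rewrite ge0_fin_numE ?a0//; apply: le_lt_trans goo.
  exact: ge0_subset_integral.
have g2oo : \int[P]_t g2 t < +oo by rewrite -g12.
have aS n : a g1 n.+1 = a g2 n.+1.
  rewrite -[LHS]fineK ?fa// -[RHS]fineK ?fa//; congr EFin.
  have fin g : measurable_fun setT g -> (forall t, 0 <= g t) ->
      \int[P]_t g t < +oo -> \sum_(n <oo) (fine (a g n.+1))%:E < +oo.
    move=> mg g0 goo; apply: le_lt_trans (goo); rewrite sa//.
    rewrite [leRHS]nneseries_recl_shift; last by move=> k; exact: a0.
    rewrite (eq_eseriesr (g := fun k => a g k.+1)).
      by rewrite leeDr// a0.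
    by move=> k _; rewrite fineK// fa.
  apply: (power_series_unique (a := fun n => fine (a g1 n.+1))
    (b := fun n => fine (a g2 n.+1))) => //.
  - by move=> k; exact/fine_ge0/a0.
  - by move=> k; exact/fine_ge0/a0.
  - exact: fin.
  - exact: fin.
  move=> s /andP[s0 s1].
  have v0 : (0 < - ln s)%R by rewrite oppr_gt0 ln_lt0// s0.
  have := lap _ v0; rewrite !integral_transform// opprK lnK//.
  have E g : measurable_fun setT g -> (forall t, 0 <= g t) ->
      \int[P]_t g t < +oo ->
      \sum_(n <oo) ((s ^+ n)%:E * \int[P]_(t in count_level X n.+1) g t) =
      \sum_(n <oo) (fine (a g n.+1) * s ^+ n)%:E.
    move=> mg g0 goo; apply: eq_eseriesr => k _.
    by rewrite EFinM fineK ?fa// muleC.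
  by rewrite !E.
have aE k : a g1 k = a g2 k.
  case: k => [|n]; last exact: aS.
  have := g12; rewrite !sa// nneseries_recl_shift; last by move=> k; exact: a0.
  rewrite [RHS]nneseries_recl_shift; last by move=> k; exact: a0.
  rewrite (eq_eseriesr (g := fun n => a g2 n.+1)); last by move=> n _; exact: aS.
  rewrite addeC [RHS]addeC => /fin_addeI; apply.
  rewrite ge0_fin_numE; last by apply: nneseries_ge0 => n _ _; exact: a0.
  apply: le_lt_trans g2oo; rewrite (sa g2)// [leRHS]nneseries_recl_shift.
    by rewrite leeDr// a0.
  by move=> n; exact: a0.
move=> U mU; have mXU : measurable (X @^-1` U) by exact: preimage_measurable.
rewrite !integral_level//; apply: eq_eseriesr => k _.
have [kU|kU] : count_level X k `<=` X @^-1` U \/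
    X @^-1` U `&` count_level X k = set0.
- case: k => [|n] /=.
    have [Uy|Uy] := pselect (U +oo).
      by left => t /= ->.
    by right; apply/seteqP; split => // t /= [+ Xt]; rewrite Xt.
  have [Uy|Uy] := pselect (U n%:R%:E).
    by left => t /= ->.
  by right; apply/seteqP; split => // t /= [+ Xt]; rewrite Xt.
- by rewrite setIidr//; exact: aE.
- by rewrite kU !integral_set0.
Qed.

End levels.

End counting_variables.

Section poisson_identification.
Context d (T : measurableType d) (R : realType) (P : probability T R).

Lemma expectation_cst1 : \int[P]_t 1 = 1.
Proof. by rewrite integral_cst// mul1e; exact: probability_setT. Qed.

(** With [s = expR (- v)] the hypothesis gives the generating function on (0, 1). For finite [lam]
    its coefficients are the Poisson masses; for [lam = +oo] it vanishes, so every finite value is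
    null and all the mass sits at [+oo]. *)
Lemma poisson_of_laplace (X : T -> \bar R) (lam : \bar R) :
  measurable_fun setT X -> (forall t, count_valued (X t)) -> 0 <= lam ->
  (forall v, (0 < v)%R -> \int[P]_t (expN (v%:E * X t))%:E =
                          (expN ((1 - expR (- v))%:E * lam))%:E) ->
  (lam < +oo -> forall n, P [set t | X t = n%:R%:E] =
                          poisson_prob (fine lam) 0%N [set n]) /\
  (lam = +oo -> P [set t | X t = +oo] = 1).
Proof.
move=> mX Xnat lam0 lap.
pose a n := P (count_level X n.+1).
have mlev k : measurable (count_level X k).
  case: k => [|n] /=.
    exact: (preimage_measurable mX (B := [set +oo])).
  exact: (preimage_measurable mX (B := [set n%:R%:E])).
have total : 1 = P (count_level X 0%N) + \sum_(n <oo) a n.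
  rewrite -[LHS]expectation_cst1 (@integral_level _ _ _ P X mX Xnat setT)//.
  rewrite nneseries_recl_shift; last by move=> n; exact: integral_ge0.
  by congr (_ + _); [|apply: eq_eseriesr => n _]; rewrite setTI integral_cst// mul1e.
have lapa s : (0 < s < 1)%R -> \sum_(n <oo) ((s ^+ n)%:E * a n) =
    (expN ((1 - s)%:E * lam))%:E.
  move=> /andP[s0 s1].
  have v0 : (0 < - ln s)%R by rewrite oppr_gt0 ln_lt0// s0.
  have := lap _ v0; rewrite opprK lnK// => <-.
  rewrite (@integral_level _ _ _ P X mX Xnat setT)//; last 2 first.
  - apply/measurable_EFinP; apply: measurableT_comp; first exact: measurable_expN.
    exact: measurable_funeM.
  - by move=> t; rewrite lee_fin expN_ge0.
  rewrite [RHS]nneseries_recl_shift; last first.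
    by move=> n; apply: integral_ge0 => t _; rewrite lee_fin expN_ge0.
  rewrite [X in _ = X + _]integral0_eq ?add0e; last first.
    by move=> t [_ /= ->]; rewrite gt0_muley.
  apply: eq_eseriesr => n _; rewrite setTI.
  rewrite (eq_integral (fun=> (s ^+ n)%:E)); first by rewrite integral_cst.
  move=> t /set_mem /= ->; rewrite /expN/= -mulNr opprK.
  by rewrite expRM_natr lnK.
have afin n : a n \is a fin_num by exact: fin_num_measure.
have asum : \sum_(n <oo) (fine (a n))%:E < +oo.
  rewrite (eq_eseriesr (g := a)); last by move=> n _; rewrite fineK.
  by rewrite (@le_lt_trans _ _ 1) ?ltry// [leRHS]total leeDr.
split=> [lamoo n|lamoo].
  have lamE : lam = (fine lam)%:E by rewrite fineK// ge0_fin_numE.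
  have l0 : (0 <= fine lam)%R by exact: fine_ge0.
  have pfin k : poisson_prob (fine lam) 0%N [set k] \is a fin_num.
    exact: fin_num_measure.
  rewrite -[LHS](fineK (afin n)) -[RHS](fineK (pfin n)); congr EFin.
  apply: (power_series_unique (a := fun n => fine (a n))
    (b := fun n => fine (poisson_prob (fine lam) 0%N [set n]))) => //.
  - by move=> k; exact: fine_ge0.
  - by move=> k; exact: fine_ge0.
  - rewrite (eq_eseriesr (g := fun k => poisson_prob (fine lam) 0%N [set k])); last first.
      by move=> k _; rewrite fineK.
    by rewrite poisson_total ltry.
  move=> s s01; have /andP[s0 s1] := s01.
  transitivity (\sum_(n <oo) ((s ^+ n)%:E * a n)).
    by apply: eq_eseriesr => k _; rewrite EFinM fineK// muleC.
  rewrite lapa//.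
  transitivity (\sum_(n <oo) ((s ^+ n)%:E * poisson_prob (fine lam) 0%N [set n])).
    by rewrite poisson_generating// ?(ltW s0)// [in LHS]lamE.
  by apply: eq_eseriesr => k _; rewrite EFinM fineK// muleC.
have a0 n : a n = 0.
  rewrite -(fineK (afin n)); congr EFin.
  apply: (power_series_unique (a := fun n => fine (a n)) (b := fun n => 0%R)) => //.
  - by move=> k; exact: fine_ge0.
  - by rewrite eseries0.
  move=> s s01; have /andP[s0 s1] := s01.
  transitivity (\sum_(n <oo) ((s ^+ n)%:E * a n)).
    by apply: eq_eseriesr => k _; rewrite EFinM fineK// muleC.
  rewrite lapa// lamoo gt0_muley ?lte_fin ?subr_gt0//= eseries0//.
  by move=> k _ _; rewrite mul0r.
by rewrite [RHS]total eseries0 ?adde0.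
Qed.

End poisson_identification.

(** * Simplicity of Poisson random measures *)

Section separation.
Context d (T : measurableType d) (R : realType) (P : probability T R).
Context d' (X : measurableType d') (U : nat -> set X).
Hypothesis mU : forall n, measurable (U n).
Variables (nu : {measure set X -> \bar R}) (N : T -> rmeasure X R).
Hypothesis prmN : is_PRM P nu N.
Hypothesis nuU : forall x, nu (atom_class U x) = 0.

Let mN := PRM_measurable_ev prmN.

Let at_most_one (A : set X) := [set t | N t A = 0 \/ N t A = 1].

Let measurable_at_most_one A : measurable A -> measurable (at_most_one A).
Proof.
move=> mA; rewrite (_ : at_most_one A =
  (fun t => N t A) @^-1` [set 0] `|` (fun t => N t A) @^-1` [set 1])//.
by apply: measurableU; apply: (preimage_measurable (mN mA)).
Qed.

Let P_at_most_one A : measurable A -> nu A < +oo ->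
  P (~` at_most_one A) <= nu A * nu A.
Proof.
move=> mA nuA; rewrite probability_setC; last exact: measurable_at_most_one.
have -> : at_most_one A = [set t | N t A = 0%:R%:E] `|` [set t | N t A = 1%:R%:E] by [].
have nuE : nu A = (fine (nu A))%:E by rewrite fineK// ge0_fin_numE.
have l0 : (0 <= fine (nu A))%R by exact: fine_ge0.
have -> : P ([set t | N t A = 0%:R%:E] `|` [set t | N t A = 1%:R%:E]) =
    P [set t | N t A = 0%:R%:E] + P [set t | N t A = 1%:R%:E].
  apply: measureU.
  - exact: (preimage_measurable (mN mA) (B := [set 0%:R%:E])).
  - exact: (preimage_measurable (mN mA) (B := [set 1%:R%:E])).
  - apply/seteqP; split => // t /= [-> []] /eqP; by rewrite eqr_nat.
rewrite [X in 1 - (X + _)](prm_poisson prmN mA nuA 0).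
rewrite [X in 1 - (_ + X)](prm_poisson prmN mA nuA 1).
rewrite !poisson_prob_set1// [in leRHS]nuE; set l := fine _ in l0 *.
rewrite -[leLHS]/((1 - (l ^+ 0 * 0`!%:R^-1 * expR (- l) + l ^+ 1 * 1`!%:R^-1 * expR (- l)))%:E).
rewrite -EFinM lee_fin expr0 expr1 fact0 /= !invr1 !mulr1 mul1r.
(* Multiplied by [1 + l], it bounds the probability of at most one point from below by
   [1 - l ^+ 2]. *)
have : (1 + - l <= expR (- l))%R by exact: expR_ge1Dx.
by nra.
Qed.

Lemma cell_refine n m x y : (n <= m)%N -> cell U m x = cell U m y ->
  cell U n x = cell U n y.
Proof.
move=> nm /ffunP h; apply/ffunP => i; have := h (widen_ord nm i).
by rewrite !ffunE.
Qed.

Let cell_class (A : set X) x n := A `&` cell U n @^-1` [set cell U n x].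

Let cvg_cell_class A x : measurable A -> nu A < +oo ->
  nu (cell_class A x n) @[n --> \oo] --> 0.
Proof.
move=> mA nuA.
have mC n : measurable (cell_class A x n).
  by apply: measurableI => //; exact: measurable_cell.
have -> : 0 = nu (\bigcap_n cell_class A x n).
  apply/esym/eqP; rewrite -measure_le0 -(nuU x); apply: le_measure; rewrite ?inE.
  - exact: bigcap_measurable.
  - exact: measurable_atom_class.
  - move=> y h n; have [_ /= /ffunP /(_ ord_max)] := h n.+1 I.
    rewrite !ffunE/= => E; split => h'; apply/asboolP.
      by rewrite -E; exact/asboolP.
    by rewrite E; exact/asboolP.
apply: nonincreasing_cvg_mu => //.
- by apply: le_lt_trans nuA; apply: le_measure; rewrite ?inE//; exact: subIset (or_introl _).
- exact: bigcap_measurable.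
move=> n m nm; apply/subsetPset => y [Ay /= yx]; split => //.
exact: cell_refine yx.
Qed.

Let sum_square A n := \sum_(c : {ffun 'I_n -> bool})
  nu (A `&` cell U n @^-1` [set c]) * nu (A `&` cell U n @^-1` [set c]).

(** The sum of squares is the integral over [A] of the mass of the cell containing the point. This
    mass decreases to that of the class of the point, which is null, and is dominated by the finite
    [nu A]. *)
Let cvg_sum_square A : measurable A -> nu A < +oo ->
  sum_square A n @[n --> \oo] --> 0.
Proof.
move=> mA nuA.
have mC n (c : {ffun 'I_n -> bool}) : measurable (A `&` cell U n @^-1` [set c]).
  by apply: measurableI => //; exact: measurable_cell.
pose g n x := \sum_(c : {ffun 'I_n -> bool})
  (nu (A `&` cell U n @^-1` [set c]) * (\1_(cell U n @^-1` [set c]) x)%:E).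
have gE n x : g n x = nu (cell_class A x n).
  rewrite /g (bigD1 (cell U n x))//= indicE mem_set//= mule1 big1 ?adde0//.
  by move=> c /eqP cx; rewrite indicE memNset ?mule0//= => /esym.
have mg n : measurable_fun setT (g n).
  apply: emeasurable_sum => c; apply: measurable_funeM; apply/measurable_EFinP.
  by apply: measurable_indic; exact: measurable_cell.
have -> : sum_square A = (fun n => \int[nu]_(x in A) g n x).
  apply/funext => n; rewrite ge0_integral_sum//.
  - apply: eq_bigr => c _; rewrite ge0_integralZl//; last first.
      by apply: measurable_funTS; apply/measurable_EFinP; apply: measurable_indic; exact: measurable_cell.
    by rewrite integral_indic// 1?setIC//; exact: measurable_cell.
  - move=> c; apply: measurable_funeM; apply/measurable_EFinP.
    by apply: measurable_funTS; apply: measurable_indic; exact: measurable_cell.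
have <- : \int[nu]_(x in A) (fun=> 0) x = 0 by exact: integral0.
have [|||||_ _ h] := @dominated_convergence _ _ _ nu A mA g (fun=> 0) (fun=> nu A).
- by move=> n; exact: measurable_funTS.
- by [].
- by apply: aeW => x Ax; under eq_fun do rewrite gE; exact: cvg_cell_class.
- apply/integrableP; split => //; rewrite integral_cst//.
  by rewrite gee0_abs// lte_mul_pinfty// ge0_fin_numE.
- apply: aeW => x n Ax; rewrite gE gee0_abs// le_measure ?inE//.
    by apply: measurableI => //; exact: measurable_cell.
  exact: subIsetl.
exact: h.
Qed.

Lemma PRM_count_valued A : measurable A -> {ae P, forall t, count_valued (N t A)}.
Proof.
move=> mA; have [nuA|] := ltP (nu A) +oo; last first.
  rewrite leye_eq => /eqP nuA.
  have mE : measurable [set t | N t A = +oo].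
    exact: (preimage_measurable (mN mA) (B := [set +oo])).
  exists (~` [set t | N t A = +oo]); split.
  - exact: measurableC.
  - by rewrite probability_setC// (prm_infinite prmN)// subee.
  - by move=> t /= h h'; apply: h; left.
pose F n := [set t | N t A = n%:R%:E].
have mF n : measurable (F n).
  exact: (preimage_measurable (mN mA) (B := [set n%:R%:E])).
have tF : trivIset setT F.
  apply/trivIsetP => i j _ _ ij; apply/seteqP; split => // t [].
  by rewrite /F/= => -> -[] /eqP; rewrite eqr_nat (negbTE ij).
have mUF : measurable (\bigcup_n F n) by exact: bigcup_measurable.
exists (~` \bigcup_n F n); split; first exact: measurableC.
  rewrite probability_setC// measure_semi_bigcup//.
  rewrite (eq_eseriesr (g := fun n => poisson_prob (fine (nu A)) 0%N [set n])); last first.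
    by move=> n _; exact: (prm_poisson prmN).
  by rewrite poisson_total subee.
by move=> t /= h [n _ Fn]; apply: h; right; exists n.
Qed.

(** The probability that some cell of level [n] holds two points is at most the sum of the squared
    masses, which tends to 0; so almost surely some level has at most one point in each cell, and
    every finer level inherits this. *)
Lemma PRM_separated A : measurable A -> nu A < +oo ->
  {ae P, forall t, exists n0, forall n, (n0 <= n)%N ->
    forall c, N t (A `&` cell U n @^-1` [set c]) = 0 \/
              N t (A `&` cell U n @^-1` [set c]) = 1}.
Proof.
move=> mA nuA.
have mC n (c : {ffun 'I_n -> bool}) : measurable (A `&` cell U n @^-1` [set c]).
  by apply: measurableI => //; exact: measurable_cell.
have nuC n (c : {ffun 'I_n -> bool}) : nu (A `&` cell U n @^-1` [set c]) < +oo.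
  by apply: le_lt_trans nuA; rewrite le_measure ?inE.
pose E n := \bigcap_(c in [set: {ffun 'I_n -> bool}])
  at_most_one (A `&` cell U n @^-1` [set c]).
have mE n : measurable (E n).
  by apply: fin_bigcap_measurable => // c _; exact: measurable_at_most_one.
have mUE : measurable (\bigcup_n E n) by exact: bigcup_measurable.
have PE n : P (~` E n) <= sum_square A n.
  pose B (c : {ffun 'I_n -> bool}) := ~` at_most_one (A `&` cell U n @^-1` [set c]).
  have mB c : measurable (B c) by apply: measurableC; exact: measurable_at_most_one.
  have [mS PS] : measurable (\big[setU/set0]_c B c) /\
      P (\big[setU/set0]_c B c) <= sum_square A n.
    apply: (big_ind2 (fun S x => measurable S /\ P S <= x)).
    - by rewrite measure0.
    - move=> S1 x1 S2 x2 [mS1 S1x] [mS2 S2x]; split; first exact: measurableU.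
      by apply: le_trans (measureU2 _ _ _) _ => //; exact: leeD.
    - by move=> c _; split => //; exact: P_at_most_one.
  apply: le_trans PS; apply: le_measure; rewrite ?inE//; first exact: measurableC.
  by move=> t /existsNP[c /not_implyP[_ Bc]]; rewrite (bigD1 c)//; left.
have P0 : P (~` \bigcup_n E n) = 0.
  apply/eqP; rewrite -measure_le0.
  rewrite -(cvg_lim _ (cvg_sum_square mA nuA))//; apply: lime_ge.
    by apply/cvg_ex; exists 0; exact: cvg_sum_square.
  apply: nearW => n; apply: le_trans (PE n); apply: le_measure; rewrite ?inE.
  - exact: measurableC.
  - exact: measurableC.
  - by apply: subsetC => t Et; exists n.
have aeE : {ae P, forall t, (\bigcup_n E n) t}.
  by exists (~` \bigcup_n E n); split => //; exact: measurableC.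
have aeC : {ae P, forall t, forall n, forall c : {ffun 'I_n -> bool},
    count_valued (N t (A `&` cell U n @^-1` [set c]))}.
  apply: ae_foralln => n.
  have : {ae P, forall t, forall k, if unpickle k is Some c
      then count_valued (N t (A `&` cell U n @^-1` [set c])) else True}.
    apply: ae_foralln => k; case: unpickle => [c|]; last exact: aeW.
    exact: PRM_count_valued.
  by apply: filterS => t h c; have := h (pickle c); rewrite pickleK.
apply: filterS2 aeE aeC => t [n0 _ En0] cv; exists n0 => n n0n c.
have [-> |/set0P[x [Ax cx]]] := eqVneq (A `&` cell U n @^-1` [set c]) set0.
  by left; exact: measure0.
have : N t (A `&` cell U n @^-1` [set c]) <= 1.
  (* A nonempty cell of level [n] lies in a cell of level [n0], so its mass is at most 1; being
     integer-valued, it is 0 or 1. *)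
  apply: (@le_trans _ _ (N t (A `&` cell U n0 @^-1` [set cell U n0 x]))).
    rewrite le_measure ?inE// => y [Ay /= cy]; split => //=.
    by apply: (cell_refine n0n); rewrite cy cx.
  by have [->|->] := En0 (cell U n0 x) I.
case: (cv n c) => [->//|[[|[|k]] ->]].
- by left.
- by right.
- by rewrite lee_fin (ler_nat R k.+2 1).
Qed.

Lemma le_limn_esup (u v : (\bar R)^nat) : (forall n, u n <= v n) ->
  limn_esup u <= limn_esup v.
Proof.
move=> uv; rewrite !limn_esup_lim; apply: lee_lim.
- exact: is_cvg_esups.
- exact: is_cvg_esups.
apply: nearW => n; apply: ub_ereal_sup => _ [k /= nk <-].
apply: (le_trans (uv k)); apply: ereal_sup_ubound; by exists k.
Qed.

Hypothesis nu_sigma_finite : sigma_finite setT nu.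

Lemma measure_cells n (mu : {measure set X -> \bar R}) A : measurable A ->
  mu A = \sum_(c : {ffun 'I_n -> bool}) mu (A `&` cell U n @^-1` [set c]).
Proof.
move=> mA; have mC c := @measurable_cell _ X U mU n c.
transitivity (\int[mu]_(x in A) \sum_(c : {ffun 'I_n -> bool})
    (\1_(cell U n @^-1` [set c]) x)%:E).
  rewrite -[LHS]mul1e -integral_cst//; apply: eq_integral => x _.
  rewrite (bigD1 (cell U n x))//= indicE mem_set//= big1 ?adde0//.
  by move=> c /eqP cx; rewrite indicE memNset//= => /esym.
rewrite ge0_integral_sum//.
  by apply: eq_bigr => c _; rewrite integral_indic// setIC.
by move=> c; apply: measurable_funTS; apply/measurable_EFinP; exact: measurable_indic.
Qed.

Lemma hits_le_count n (mu : {measure set X -> \bar R}) A : measurable A ->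
  (forall c, count_valued (mu (A `&` cell U n @^-1` [set c]))) ->
  (hits U n mu A)%:R%:E <= mu A.
Proof.
move=> mA cv; rewrite (@measure_cells n)//.
rewrite /hits -sum1_card natr_sum -sumEFin big_mkcond/=; apply: lee_sum => c _.
have [/eqP|] := boolP (mu (A `&` cell U n @^-1` [set c]) == 0); rewrite inE => h.
  by rewrite h eqxx.
rewrite h; move: h; case: (cv c) => [->|[k ->]]; first by rewrite leey.
by case: k => [|k]; rewrite ?eqxx// => _; rewrite lee_fin ler1n.
Qed.

Lemma hits_mono n (mu : {measure set X -> \bar R}) A B : measurable A ->
  measurable B -> A `<=` B -> (hits U n mu A <= hits U n mu B)%N.
Proof.
move=> mA mB AB; apply/subset_leq_card/fintype.subsetP => c; rewrite !inE.
apply: contra => /eqP mu0; rewrite -measure_le0 -mu0; apply: le_measure; rewrite ?inE.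
- by apply: measurableI => //; exact: measurable_cell.
- by apply: measurableI => //; exact: measurable_cell.
- exact: setSI.
Qed.

Let hits_finite A : measurable A -> nu A < +oo ->
  {ae P, forall t, hits_limit U (N t) A = N t A}.
Proof.
move=> mA nuA; apply: filterS (PRM_separated mA nuA) => t [n0 hn0].
apply: hits_limitE; apply: cvg_near_cst; exists n0 => // n /= /hn0 h.
have -> : N t A = \sum_(c : {ffun 'I_n -> bool}) N t (A `&` cell U n @^-1` [set c]).
  exact: measure_cells.
rewrite /hits -sum1_card natr_sum -sumEFin big_mkcond/=; apply: eq_bigr => c _.
by rewrite inE; case: (h c) => ->; rewrite ?eqxx// onee_neq0.
Qed.

(** On sets of finite intensity the number of charged cells is eventually the mass; an exhaustion by
    such sets gives one inequality. For the other, a charged cell has mass at least 1, because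
    masses are integer-valued. *)
Lemma PRM_hits_limit A : measurable A ->
  {ae P, forall t, N t A = hits_limit U (N t) A}.
Proof.
move=> mA; have /sigma_finiteP[F [UF ndF mF]] := nu_sigma_finite.
have mAF j : measurable (A `&` F j) by apply: measurableI => //; have [] := mF j.
have ae1 : {ae P, forall t, forall j, hits_limit U (N t) (A `&` F j) = N t (A `&` F j)}.
  apply: ae_foralln => j; apply: hits_finite => //.
  have [mFj nuF] := mF j.
  by apply: le_lt_trans nuF; apply: le_measure; rewrite ?inE.
have ae2 : {ae P, forall t, forall n, forall c : {ffun 'I_n -> bool},
    count_valued (N t (A `&` cell U n @^-1` [set c]))}.
  apply: ae_foralln => n.
  have : {ae P, forall t, forall k, if unpickle k is Some c
      then count_valued (N t (A `&` cell U n @^-1` [set c])) else True}.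
    apply: ae_foralln => k; case: unpickle => [c|]; last exact: aeW.
    apply: PRM_count_valued; apply: measurableI => //; exact: measurable_cell.
  by apply: filterS => t h c; have := h (pickle c); rewrite pickleK.
apply: filterS2 ae1 ae2 => t h1 h2; apply/eqP; rewrite eq_le; apply/andP; split.
  have cvN : N t (A `&` F j) @[j --> \oo] --> N t A.
    rewrite -[in X in _ --> X](setIT A) UF setI_bigcupr.
    apply: nondecreasing_cvg_mu => //; first exact: bigcup_measurable.
    by move=> i j ij; apply/subsetPset; apply: setIS; apply/subsetPset; exact: ndF.
  rewrite -(cvg_lim _ cvN)//; apply: lime_le; first by apply/cvg_ex; exists (N t A).
  apply: nearW => j; rewrite -h1; apply: le_limn_esup => n.
  by rewrite lee_fin ler_nat; apply: hits_mono => //; exact: subIsetl.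
rewrite -[X in _ <= X](cvg_limn_einf_sup (cvg_cst (N t A))).2.
by apply: le_limn_esup => n; exact: hits_le_count.
Qed.

Lemma ae_simple_pushforward d1 (Y : measurableType d1) (J : finType)
    (ev : J -> Y -> rmeasure X R) (f : T -> Y) :
  (forall j A, measurable A -> measurable_fun setT (fun y => ev j y A)) ->
  measurable_fun setT f ->
  (forall j A, measurable A ->
    {ae P, forall t, ev j (f t) A = hits_limit U (ev j (f t)) A}) ->
  ae_simple U ev (pushforward P f).
Proof.
move=> mev mf aes j A mA.
have mh : measurable_fun setT (fun y => hits_limit U (ev j y) A).
  move=> _ B mB; rewrite setTI.
  apply: (sigma_sub_measurable (measurable_void_system mev)).
  exact: hits_limit_void.
have mE : measurable [set y | ev j y A != hits_limit U (ev j y) A].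
  rewrite -[X in measurable X]setTI; apply: measurable_neqe => //; exact: mev.
exists [set y | ev j y A != hits_limit U (ev j y) A]; split => //.
  rewrite /pushforward; have [B [mB PB AB]] := aes j A mA.
  apply/eqP; rewrite -measure_le0 -PB; apply: le_measure; rewrite ?inE//.
    exact: preimage_measurable.
  by move=> t /= /eqP h; apply: AB.
by move=> y /= /eqP.
Qed.

End separation.

Section PRM_law.
Context (R : realType) d' (X : measurableType d') (nu : {measure set X -> \bar R}).

Lemma PRM_void d (T : measurableType d) (P : probability T R) N A :
  is_PRM P nu N -> measurable A -> P [set t | N t A = 0] = (expN (nu A))%:E.
Proof.
move=> prmN mA; have [nuA|] := ltP (nu A) +oo.
  rewrite (prm_poisson prmN mA nuA 0) poisson_prob_set1 ?fine_ge0//.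
  rewrite expr0 fact0 invr1 !mul1r -[in RHS](@fineK _ (nu A))//.
  by rewrite ge0_fin_numE.
rewrite leye_eq => /eqP nuA; rewrite nuA /=.
have m0 : measurable [set t | N t A = 0].
  exact: (preimage_measurable (PRM_measurable_ev prmN mA) (B := [set 0])).
have moo : measurable [set t | N t A = +oo].
  exact: (preimage_measurable (PRM_measurable_ev prmN mA) (B := [set +oo])).
have P0 : P (~` [set t | N t A = +oo]) = 0.
  by rewrite probability_setC// (prm_infinite prmN)// subee.
apply/eqP; rewrite -measure_le0 -[leRHS]P0; apply: le_measure; rewrite ?inE//.
  exact: measurableC.
by move=> t /= ->.
Qed.

End PRM_law.

(** * Marked Poisson random measures *)

Section one_hot.
Context (R : realType) (q : nat).
Implicit Types (p : q.-tuple R) (b : q.-tuple bool).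

(* [one_hot None] is the zero vector *)
Definition one_hot (o : option 'I_q) : q.-tuple bool :=
  [tuple Some j == o | j < q].

Lemma tnth_one_hot o j : tnth (one_hot o) j = (Some j == o).
Proof. by rewrite tnth_mktuple. Qed.

Lemma btot_one_hot o : btot (one_hot o) = (o != None).
Proof.
rewrite /btot; under eq_bigr do rewrite tnth_one_hot.
case: o => [j|]; last by rewrite big1.
rewrite (bigD1 j)//= eqxx big1 ?addn0// => i /negbTE ij.
by rewrite (inj_eq Some_inj) ij.
Qed.

Lemma btot_le1 b : (btot b <= 1)%N -> exists o, b = one_hot o.
Proof.
move=> b1; have [j bj|b0] := pickP (fun j => tnth b j).
  exists (Some j); apply: eq_from_tnth => i; rewrite tnth_one_hot.
  rewrite (inj_eq Some_inj); have [->//|ij] := eqVneq i j.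
  apply/negbTE; apply: contraTN b1 => bi.
  by rewrite /btot (bigD1 i)//= (bigD1 j) 1?eq_sym//= bi bj.
exists None; apply: eq_from_tnth => i; rewrite tnth_one_hot.
exact: b0.
Qed.

Lemma mpmf_one_hot p o :
  mpmf p (one_hot o) = if o is Some j then tnth p j else (1 - tot p)%R.
Proof.
rewrite /mpmf btot_one_hot; case: o => [j|] /=.
  rewrite subnn expr0 mulr1 (bigD1 j)//= tnth_one_hot eqxx expr1.
  rewrite big1 ?mulr1// => i /negbTE ij.
  by rewrite tnth_one_hot (inj_eq Some_inj) ij expr0.
rewrite subn0 expr1 big1 ?mul1r// => j _.
by rewrite tnth_one_hot expr0.
Qed.

Lemma mpmf_gt1 p b : (1 < btot b)%N -> mpmf p b = 0%R.
Proof. by rewrite /mpmf ltnNge => /negbTE ->. Qed.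

Lemma sum_mpmf p (F : q.-tuple bool -> R) :
  (\sum_b mpmf p b * F b = (1 - tot p) * F (one_hot None) +
     \sum_(j < q) tnth p j * F (one_hot (Some j)))%R.
Proof.
rewrite (bigID (fun b => (btot b <= 1)%N))/= [X in (_ + X)%R]big1 ?addr0; last first.
  by move=> b; rewrite -ltnNge => /mpmf_gt1 ->; rewrite mul0r.
rewrite (reindex one_hot) /=; last first.
  have pickK o : [pick j | tnth (one_hot o) j] = o.
    case: pickP => [j|h]; first by rewrite tnth_one_hot => /eqP.
    by case: o h => // j h; have := h j; rewrite tnth_one_hot eqxx.
  exists (fun b => [pick j | tnth b j]); first by move=> o _; exact: pickK.
  by move=> b0 /btot_le1 [x ->]; rewrite pickK.
rewrite (eq_bigl xpredT); last by move=> o; rewrite btot_one_hot; case: o.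
rewrite (bigD1 None)//= mpmf_one_hot; congr (_ + _)%R.
rewrite (reindex_omap Some id)//=; last by case.
rewrite (eq_bigl xpredT); last by move=> j /=; rewrite eqxx.
by apply: eq_bigr => j _; rewrite mpmf_one_hot.
Qed.

(** An algebraic identity in [p], valid off the simplex too, where some terms may be negative. *)
Lemma sum_mpmf1 p : (\sum_b mpmf p b = 1)%R.
Proof.
have := sum_mpmf p (fun=> 1%R); under eq_bigr do rewrite mulr1.
by move=> ->; under eq_bigr do rewrite mulr1; rewrite mulr1 subrK.
Qed.

Lemma simplex_tot_ge0 p : simplex R q p -> (0 <= tot p)%R.
Proof. by move=> [p0 _]; apply: sumr_ge0 => j _; exact: ltW. Qed.

Lemma mpmf_ge0 p b : simplex R q p -> (0 <= mpmf p b)%R.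
Proof.
move=> [p0 p1]; rewrite /mpmf; case: ifP => // _.
rewrite mulr_ge0// ?exprn_ge0 ?subr_ge0 ?(ltW p1)//.
by apply: prodr_ge0 => j _; rewrite exprn_ge0// ltW.
Qed.

Lemma measurable_tot : measurable_fun setT (@tot R q).
Proof. by apply: measurable_sum => j; exact: measurable_tnth. Qed.

Lemma measurable_simplex : measurable (simplex R q).
Proof.
rewrite (_ : simplex R q = (\bigcap_(j in [set: 'I_q]) ((fun s => tnth s j) @^-1` `]0%R, +oo[%classic))
    `&` (@tot R q) @^-1` `]-oo, 1%R[%classic).
  apply: measurableI.
    apply: fin_bigcap_measurable => // j _.
    by apply: preimage_measurable => //; exact: measurable_tnth.
  by apply: preimage_measurable => //; exact: measurable_tot.
apply/seteqP; split => s /= [h1 h2]; split.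
- by move=> j _ /=; rewrite in_itv/= h1.
- by rewrite in_itv/=.
- by move=> j; have := h1 j I; rewrite /= in_itv/= andbT.
- by move: h2; rewrite in_itv.
Qed.

Lemma measurable_weight M (c : 'I_q -> nat) : measurable_fun setT (@weight R q M c).
Proof.
apply: measurable_funM.
  by apply: measurable_prod => j _; apply: measurable_funX; exact: measurable_tnth.
by apply: measurable_funX; apply: measurable_funB => //; exact: measurable_tot.
Qed.

Lemma measurable_mpmf b : measurable_fun setT (fun p => mpmf p b).
Proof.
rewrite /mpmf; case: (btot b <= 1)%N => //; apply: measurable_funM.
  by apply: measurable_prod => j _; apply: measurable_funX; exact: measurable_tnth.
by apply: measurable_funX; apply: measurable_funB => //; exact: measurable_tot.
Qed.

Lemma measurable_set1_bits b : measurable [set b].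
Proof.
rewrite (_ : [set b] = \bigcap_(j in [set: 'I_q])
    ((fun x : q.-tuple bool => tnth x j) @^-1` [set tnth b j])).
  apply: fin_bigcap_measurable => // j _.
  by apply: preimage_measurable => //; exact: measurable_tnth.
apply/seteqP; split => [x -> //|x h /=].
by apply: eq_from_tnth => j; exact: h.
Qed.

End one_hot.

Section mark_weight.
Context (R : realType) (q n : nat).
Local Notation mark := {ffun 'I_n -> q.-tuple bool}.

(* the probability of the marks [m] of an atom at [p], set to 0 off the simplex *)
Definition mark_weight (p : q.-tuple R) (m : mark) : R :=
  (\1_(simplex R q) p * \prod_(i < n) mpmf p (m i))%R.

Lemma mark_weight_ge0 p m : (0 <= mark_weight p m)%R.
Proof.
rewrite /mark_weight indicE; case: (boolP (p \in _)) => [/set_mem sp|_].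
  by rewrite mul1r; apply: prodr_ge0 => i _; exact: mpmf_ge0.
by rewrite mul0r.
Qed.

Lemma sum_mark_weight p : (\sum_m mark_weight p m = \1_(simplex R q) p)%R.
Proof.
rewrite /mark_weight -mulr_sumr.
rewrite -(bigA_distr_bigA (fun (_ : 'I_n) b => mpmf p b)) big1 ?mulr1// => i _.
exact: sum_mpmf1.
Qed.

Lemma measurable_mark_weight m : measurable_fun setT (fun p => mark_weight p m).
Proof.
apply: measurable_funM; first by apply: measurable_indic; exact: measurable_simplex.
by apply: measurable_prod => i _; exact: measurable_mpmf.
Qed.

Lemma mark_weight_in p m : simplex R q p ->
  mark_weight p m = (\prod_(i < n) mpmf p (m i))%R.
Proof. by move=> sp; rewrite /mark_weight indicE mem_set// mul1r. Qed.

Lemma mark_weight_out p m : ~ simplex R q p -> mark_weight p m = 0%R.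
Proof. by move=> sp; rewrite /mark_weight indicE memNset// mul0r. Qed.

End mark_weight.

Section marked_draws.
Context (R : realType) (q : nat) dW (W : measurableType dW).
Local Notation V := (q.-tuple R).
Local Notation X := (V * W)%type.
Context d (T : measurableType d) (P : probability T R) (n : nat).
Local Notation mark := {ffun 'I_n -> q.-tuple bool}.
Variables (act : nat -> T -> bool) (p : nat -> T -> V) (omega : nat -> T -> W)
  (b : 'I_n -> nat -> T -> q.-tuple bool).

Let atom k t := (act k t, (p k t, omega k t)).
Let marks k t : mark := [ffun i => b i k t].

Hypothesis matom : forall k, measurable_fun setT (atom k).
Hypothesis mb : forall i k, measurable_fun setT (b i k).
Hypothesis condb : forall (m : nat) (beta : 'I_n -> 'I_m -> q.-tuple bool),
  cond_prob P (sigma_of_family atom)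
    [set t | forall i (k : 'I_m), act k t -> b i k t = beta i k]
    (fun t => (\prod_(i < n) \prod_(k < m | act k t) mpmf (p k t) (beta i k))%:E).
Hypothesis simplexp : {ae P, forall t, forall k, act k t -> simplex R q (p k t)}.

Let F := sigma_of_family atom.
(** The space [T] with the sigma-algebra of the atoms: measurability with respect to that
    sigma-algebra is ordinary measurability on [TF]. *)
Let TF := g_sigma_algebraType (\bigcup_k sigma_of (atom k)).

Let F_measurable A : F A -> measurable A.
Proof.
move: A; apply: smallest_sub; first exact: sigma_algebra_measurable.
by move=> _ [k _ [B mB <-]]; rewrite setTI; exact: preimage_measurable.
Qed.

Let measurable_toTF : measurable_fun setT (idfun : T -> TF).
Proof. by move=> _ A FA; rewrite setTI; exact: F_measurable. Qed.

Let measurable_atomF k : measurable_fun setT (atom k : TF -> bool * X).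
Proof.
move=> _ B mB; rewrite setTI; apply: sub_sigma_algebra.
by exists k => //; exists B => //; rewrite setTI.
Qed.

Let measurable_act k : measurable_fun setT (act k).
Proof. exact: (measurableT_comp measurable_fst (matom k)). Qed.

Let measurable_px k : measurable_fun setT (fun t => (p k t, omega k t)).
Proof. exact: (measurableT_comp measurable_snd (matom k)). Qed.

Let measurable_marks k m : measurable [set t | marks k t = m].
Proof.
rewrite (_ : [set t | _] = \bigcap_(i in [set: 'I_n]) (b i k @^-1` [set m i])).
  apply: fin_bigcap_measurable => // i _.
  by apply: preimage_measurable => //; exact: measurable_set1_bits.
apply/seteqP; split => [t <- i _ /=|t h]; first by rewrite ffunE.
by apply/ffunP => i; rewrite ffunE; exact: (h i I).
Qed.

Let event r (beta : {ffun 'I_r -> mark}) :=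
  [set t | forall k : 'I_r, act k t -> marks k t = beta k].

Let measurable_event r (beta : {ffun 'I_r -> mark}) : measurable (event beta).
Proof.
rewrite (_ : event beta = \bigcap_(k in [set: 'I_r])
    ((act k @^-1` [set false]) `|` [set t | marks k t = beta k])).
  apply: fin_bigcap_measurable => // k _; apply: measurableU => //.
  exact: preimage_measurable.
apply/seteqP; split => [t h k _|t h k akt].
  by case akt: (act k t); [right; exact: h|left].
by have [/=|//] := h k I; rewrite akt.
Qed.

Let measurable_prod_weight r (beta : {ffun 'I_r -> mark}) :
  measurable_fun setT
    (fun t => \prod_(k < r | act k t) mark_weight (p k t) (beta k))%R.
Proof.
under eq_fun do rewrite big_mkcond/=.
apply: measurable_prod => k _; apply: measurable_fun_ifT => //.
apply: (measurableT_comp (measurable_mark_weight _)).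
exact: (measurableT_comp measurable_fst (measurable_px k)).
Qed.

(** Off the simplex the factors [mpmf] can be negative. Almost surely no active atom is there, so
    they may be replaced by the nonnegative [mark_weight], to which monotone arguments apply. *)
Let cond_marks r (beta : {ffun 'I_r -> mark}) A : F A ->
  P (A `&` event beta) =
  \int[P]_(t in A) (\prod_(k < r | act k t) mark_weight (p k t) (beta k))%:E.
Proof.
move=> FA; have mA := F_measurable FA.
have := (condb (fun i k => beta k i)).2 A FA.
rewrite (_ : [set t | _] = event beta); last first.
  apply/seteqP; split => [t h k akt|t h i k akt].
    by apply/ffunP => i; rewrite ffunE h.
  by rewrite -(h k akt) ffunE.
move=> ->; apply: ae_eq_integral => //.
- apply: measurable_funTS; apply/measurable_EFinP.
  apply: measurable_prod => i _; under eq_fun do rewrite big_mkcond/=.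
  apply: measurable_prod => k _; apply: measurable_fun_ifT => //.
  apply: (measurableT_comp (@measurable_mpmf R q (beta k i))).
  exact: (measurableT_comp measurable_fst (measurable_px k)).
- apply: measurable_funTS; apply/measurable_EFinP.
  exact: measurable_prod_weight.
apply: filterS simplexp => t sp _; congr EFin.
rewrite exchange_big/=; apply: eq_bigr => k akt.
by rewrite mark_weight_in//; exact: sp.
Qed.

Let cond_marks_integral r (beta : {ffun 'I_r -> mark}) (phi : T -> \bar R) :
  measurable_fun setT (phi : TF -> \bar R) -> (forall t, 0 <= phi t) ->
  \int[P]_t (phi t * (\1_(event beta) t)%:E) =
  \int[P]_t (phi t * (\prod_(k < r | act k t) mark_weight (p k t) (beta k))%:E).
Proof.
move=> mphi phi0.
apply: (@ge0_integral_mul_eq _ _ _ TF _ P idfun) => //.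
- apply/measurable_EFinP; apply: measurable_indic; exact: measurable_event.
- by apply/measurable_EFinP; exact: measurable_prod_weight.
- by move=> t; rewrite lee_fin; apply: prodr_ge0 => k _; exact: mark_weight_ge0.
move=> A FA; have mA := F_measurable FA.
by rewrite integral_indic// setIC; exact: cond_marks.
Qed.

(* averaging over the conditionally independent marks of the first [r] atoms;
   [g k (false, x)] must not depend on the mark *)
Lemma integral_prod_marks r (g : nat -> bool * X -> mark -> R) (m0 : mark) :
  (forall k m, measurable_fun setT (fun x => g k x m)) ->
  (forall k x m, (0 <= g k x m)%R) ->
  (forall k x m, g k (false, x) m = g k (false, x) m0) ->
  \int[P]_t (\prod_(k < r) g k (atom k t) (marks k t))%:E =
  \int[P]_t (\prod_(k < r) (if act k t
      then \sum_m mark_weight (p k t) m * g k (atom k t) m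
      else g k (atom k t) m0)%R)%:E.
Proof.
move=> mg g0 gF.
(* The event of [beta] leaves the mark of an inactive atom free, so a sum over all [beta] counts
   such an atom once for each mark; [c] compensates for this. *)
pose c : R := (#|{: mark}|%:R^-1)%R.
have c0 : (0 <= c)%R by rewrite invr_ge0.
have card0 : (0 < #|{: mark}|)%N by apply/card_gt0P; exists m0.
pose phi (beta : {ffun 'I_r -> mark}) t : R :=
  (\prod_(k < r) (if act k t then g k (atom k t) (beta k) else g k (atom k t) m0 * c))%R.
have phi0 beta t : (0 <= phi beta t)%R.
  by apply: prodr_ge0 => k _; case: ifP => _ //; rewrite mulr_ge0.
have mphi beta : measurable_fun setT (fun t : TF => (phi beta t)%:E).
  apply/measurable_EFinP; apply: measurable_prod => k _.
  apply: measurable_fun_ifT.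
  - exact: (measurableT_comp measurable_fst (measurable_atomF k)).
  - exact: (measurableT_comp (mg k _) (measurable_atomF k)).
  - apply: measurable_funM => //.
    exact: (measurableT_comp (mg k _) (measurable_atomF k)).
have mphiT beta : measurable_fun setT (fun t : T => (phi beta t)%:E).
  move=> _ B mB; rewrite setTI; apply: F_measurable.
  by have := mphi beta measurableT B mB; rewrite setTI.
transitivity (\sum_(beta : {ffun 'I_r -> mark})
    \int[P]_t ((phi beta t)%:E * (\1_(event beta) t)%:E)).
  rewrite -ge0_integral_sum//; last 2 first.
  - move=> beta; apply: emeasurable_funM => //; apply/measurable_EFinP.
    by apply: measurable_indic; exact: measurable_event.
  - by move=> beta t _; rewrite mule_ge0// lee_fin.
  apply: eq_integral => t _.
  under [RHS]eq_bigr do rewrite -EFinM.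
  rewrite sumEFin; congr EFin.
  transitivity (\sum_(beta : {ffun 'I_r -> mark}) \prod_(k < r)
    (if act k t then g k (atom k t) (beta k) * (marks k t == beta k)%:R
     else g k (atom k t) m0 * c))%R.
    rewrite -(bigA_distr_bigA (fun (k : 'I_r) m => if act k t
      then g k (atom k t) m * (marks k t == m)%:R else g k (atom k t) m0 * c)%R).
    apply: eq_bigr => k _.
    case akt : (act k t).
      rewrite (bigD1 (marks k t))//= eqxx mulr1 big1 ?addr0// => m /negbTE mm.
      by rewrite eq_sym mm mulr0.
    rewrite sumr_const -mulr_natr -mulrA mulVf ?mulr1; last by rewrite pnatr_eq0 -lt0n.
    by rewrite /atom akt gF.
  apply: eq_bigr => beta _; rewrite /phi.
  have -> : \1_(event beta) t = (\prod_(k < r) (if act k t then (marks k t == beta k)%:R else 1))%R :> R.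
    rewrite indicE; case: (boolP (t \in _)) => [/set_mem h|/negP h].
      rewrite big1// => k _; case: ifP => // akt.
      by rewrite (h k akt) eqxx.
    apply/esym/eqP; rewrite prodf_seq_eq0; apply/hasP.
    move: h; rewrite inE => /existsNP[k /not_implyP[akt /eqP mk]].
    by exists k; rewrite ?mem_index_enum//= akt (negbTE mk).
  rewrite -big_split/=; apply: eq_bigr => k _.
  by case: ifP => _; rewrite ?mulr1.
transitivity (\sum_(beta : {ffun 'I_r -> mark})
    \int[P]_t ((phi beta t)%:E *
      (\prod_(k < r | act k t) mark_weight (p k t) (beta k))%:E)).
  apply: eq_bigr => beta _; apply: cond_marks_integral; first exact: mphi.
  by move=> t; rewrite lee_fin.
rewrite -ge0_integral_sum//; last 2 first.
- move=> beta; apply: emeasurable_funM => //; apply/measurable_EFinP.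
  exact: measurable_prod_weight.
- move=> beta t _; rewrite mule_ge0// lee_fin//.
  by apply: prodr_ge0 => k _; exact: mark_weight_ge0.
apply: eq_integral => t _.
under eq_bigr do rewrite -EFinM.
rewrite sumEFin; congr EFin.
transitivity (\sum_(beta : {ffun 'I_r -> mark}) \prod_(k < r)
  (if act k t then mark_weight (p k t) (beta k) * g k (atom k t) (beta k)
   else g k (atom k t) m0 * c))%R.
  apply: eq_bigr => beta _; rewrite /phi [X in (_ * X)%R]big_mkcond/= -big_split/=.
  by apply: eq_bigr => k _; case: ifP => _; rewrite ?mulr1// mulrC.
rewrite -(bigA_distr_bigA (fun (k : 'I_r) m => if act k t
  then mark_weight (p k t) m * g k (atom k t) m else g k (atom k t) m0 * c)%R).
apply: eq_bigr => k _.
case akt : (act k t) => //.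
rewrite sumr_const -mulr_natr -mulrA mulVf ?mulr1//.
by rewrite pnatr_eq0 -lt0n.
Qed.


Variables (nu : {measure set X -> \bar R}) (N : T -> rmeasure X R).
Hypothesis prmN : is_PRM P nu N.
Hypothesis NE : forall t A, measurable A ->
  N t A = \sum_(0 <= k <oo | act k t) \d_(p k t, omega k t) A.

Lemma integral_atoms t f : measurable_fun setT f -> (forall x, 0 <= f x) ->
  \int[N t]_x f x = \sum_(0 <= k <oo | act k t) f (p k t, omega k t).
Proof.
move=> mf f0.
pose m k : {measure set X -> \bar R} :=
  if act k t then (\d_(p k t, omega k t) : {measure set X -> \bar R}) else mzero.
rewrite (eq_measure_integral (mseries m 0)); last first.
  move=> A mA _; rewrite NE// /mseries eseries_mkcond.
  by apply: eq_eseriesr => k _; rewrite /m; case: ifP.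
rewrite ge0_integral_measure_series// [RHS]eseries_mkcond.
apply: eq_eseriesr => k _; rewrite /m; case: ifP => _.
  by rewrite integral_dirac// diracT mul1e.
by rewrite integral_measure_zero.
Qed.

Hypothesis nu_simplex : nu (~` simplex R q `*` setT) = 0.

Let sum_weights (h : X -> mark -> R) x : (forall x m, (0 <= h x m <= 1)%R) ->
  (0 <= \sum_m mark_weight x.1 m * h x m <= 1)%R.
Proof.
move=> h01; apply/andP; split.
  apply: sumr_ge0 => m _; rewrite mulr_ge0 ?mark_weight_ge0//.
  by have /andP[] := h01 x m.
apply: (@le_trans _ _ (\sum_m mark_weight x.1 m)%R).
  apply: ler_sum => m _; rewrite ler_piMr ?mark_weight_ge0//.
  by have /andP[] := h01 x m.
by rewrite sum_mark_weight indicE lern1 leq_b1.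
Qed.

Lemma cvg_expN_series (c : pred nat) (u : nat -> \bar R) :
  (forall k, 0 <= u k) ->
  (expN (\sum_(0 <= k < r | c k) u k))%:E @[r --> \oo] -->
  (expN (\sum_(0 <= k <oo | c k) u k))%:E.
Proof.
move=> u0; apply: cvg_expN; first by move=> r; exact: sume_ge0.
by apply: is_cvg_nneseries_cond => k _ _.
Qed.

Lemma bounded_cvg_integral (u : (T -> R)^nat) (v : T -> R) :
  (forall r, measurable_fun setT (u r)) -> measurable_fun setT v ->
  (forall r t, (0 <= u r t <= 1)%R) ->
  (forall t, (u r t)%:E @[r --> \oo] --> (v t)%:E) ->
  \int[P]_t (u r t)%:E @[r --> \oo] --> \int[P]_t (v t)%:E.
Proof.
move=> mu mv u01 uv.
have [|||||_ _ h] := @dominated_convergence _ _ _ P setT measurableT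
    (fun r t => (u r t)%:E) (fun t => (v t)%:E) (fun=> 1).
- by move=> r; exact/measurable_EFinP.
- exact/measurable_EFinP.
- by apply: aeW => t _.
- exact: finite_measure_integrable_cst.
- apply: aeW => t r _; have /andP[u0 u1] := u01 r t.
  by rewrite abse_EFin ger0_norm// lee_fin.
exact: h.
Qed.

Lemma measurable_cond_series (u : nat -> T -> \bar R) :
  (forall k, measurable_fun setT (u k)) -> (forall k t, 0 <= u k t) ->
  measurable_fun setT (fun t => \sum_(0 <= k <oo | act k t) u k t).
Proof.
move=> mu u0; rewrite (_ : (fun t => _) =
    (fun t => \sum_(0 <= k <oo) (if act k t then u k t else 0))); last first.
  by apply/funext => t; rewrite eseries_mkcond.
apply: ge0_emeasurable_sum => [k t _ _|k _]; first by case: ifP.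
exact: measurable_fun_ifT.
Qed.

Lemma measurable_mark_eval (f : X -> mark -> \bar R) k :
  (forall m, measurable_fun setT (f ^~ m)) ->
  measurable_fun setT (fun t => f (p k t, omega k t) (marks k t)).
Proof.
move=> mf.
rewrite (_ : (fun t => _) = (fun t => \sum_m
    (if marks k t == m then f (p k t, omega k t) m else 0))); last first.
  apply/funext => t; rewrite (bigD1 (marks k t))//= eqxx big1 ?adde0//.
  by move=> m; rewrite eq_sym => /negbTE ->.
apply: emeasurable_sum => m; apply: measurable_fun_ifT => //.
- apply: (measurable_fun_bool true); rewrite setTI.
  rewrite (_ : _ @^-1` _ = [set t | marks k t = m])//.
  by apply/seteqP; split => t /= /eqP.
- exact: (measurableT_comp (mf m) (measurable_px k)).
Qed.

(** Given the atoms, an atom contributes on average the factor [hh], the mean of [expN f] over its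
    marks. Writing [hh] as [expN (lnN hh)] turns the product over the atoms into the Laplace
    functional of [N] at [lnN hh]. Finitely many atoms are averaged at a time, and bounded
    convergence does the rest. *)
Theorem marked_laplace (f : X -> mark -> \bar R) :
  (forall m, measurable_fun setT (f ^~ m)) -> (forall x m, 0 <= f x m) ->
  \int[P]_t (expN (\sum_(0 <= k <oo | act k t)
                     f (p k t, omega k t) (marks k t)))%:E =
  (expN (\int[nu]_x (\sum_m mark_weight x.1 m * (1 - expN (f x m)))%:E))%:E.
Proof.
move=> mf f0.
have mark0 : mark by exact: [ffun=> [tuple false | _ < q]].
pose h x m := expN (f x m).
have h01 x m : (0 <= h x m <= 1)%R by rewrite expN_ge0 expN_le1.
have mh m : measurable_fun setT (h ^~ m).
  by apply: measurableT_comp => //; exact: measurable_expN.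
pose hh x : R := (\sum_m mark_weight x.1 m * h x m)%R.
have hh01 x : (0 <= hh x <= 1)%R by exact: sum_weights.
have mhh : measurable_fun setT hh.
  apply: measurable_sum => m; apply: measurable_funM => //.
  exact: (measurableT_comp (measurable_mark_weight _) measurable_fst).
pose g (_ : nat) (ax : bool * X) m : R := if ax.1 then h ax.2 m else 1%R.
have g01 k ax m : (0 <= g k ax m <= 1)%R by rewrite /g; case: ifP; rewrite ?h01 ?ler01 ?lexx.
have mg k m : measurable_fun setT (fun x => g k x m).
  apply: measurable_fun_ifT => //; exact: (measurableT_comp (mh m) measurable_snd).
have fin r := @integral_prod_marks r g mark0 mg
  (fun k x m => (andP (g01 k x m)).1) (fun k x m => erefl).
have lhs : \int[P]_t (\prod_(k < r) g k (atom k t) (marks k t))%:E @[r --> \oo] -->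
    \int[P]_t (expN (\sum_(0 <= k <oo | act k t)
                     f (p k t, omega k t) (marks k t)))%:E.
  apply: bounded_cvg_integral.
  - move=> r; apply: measurable_prod => k _.
    apply: measurable_fun_ifT; [exact: measurable_act| |exact: measurable_cst].
    apply: measurableT_comp; first exact: measurable_expN.
    exact: (measurable_mark_eval k mf).
  - apply: measurableT_comp; first exact: measurable_expN.
    apply: measurable_cond_series => // k; exact: measurable_mark_eval.
  - move=> r t; apply/andP; split.
      by apply: prodr_ge0 => k _; have /andP[] := g01 k (atom k t) (marks k t).
    by apply: prodr_ile1 => k _; exact: g01.
  - move=> t; have := @cvg_expN_series (act ^~ t) _
      (fun k => f0 (p k t, omega k t) (marks k t)).
    apply: cvg_trans; apply: near_eq_cvg; apply: nearW => r.
    congr EFin; rewrite expN_sum// big_mkcond/= big_mkord.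
    by apply: eq_bigr => k _; rewrite /g /atom/=; case: ifP.
have rhs : \int[P]_t (\prod_(k < r) (if act k t
      then \sum_m mark_weight (p k t) m * g k (atom k t) m
      else g k (atom k t) mark0)%R)%:E @[r --> \oo] -->
    \int[P]_t (expN (\int[N t]_x lnN (hh x)))%:E.
  have E k t : (if act k t
      then \sum_m mark_weight (p k t) m * g k (atom k t) m
      else g k (atom k t) mark0)%R = (if act k t then hh (p k t, omega k t) else 1%R).
    rewrite /hh; case akt : (act k t); last by rewrite /g /atom akt.
    by apply: eq_bigr => m _; rewrite /g /atom akt.
  have ln0 x : 0 <= lnN (hh x) by apply: lnN_ge0; have /andP[] := hh01 x.
  have mln : measurable_fun setT (fun x => lnN (hh x)).
    by apply: measurableT_comp => //; exact: measurable_lnN.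
  apply: bounded_cvg_integral.
  - move=> r; apply: measurable_prod => k _; under eq_fun do rewrite E.
    apply: measurable_fun_ifT => //; exact: (measurableT_comp mhh (measurable_px k)).
  - apply: measurableT_comp; first exact: measurable_expN.
    exact: (measurable_PRM_integral prmN).
  - move=> r t; apply/andP; split.
      by apply: prodr_ge0 => k _; rewrite E; case: ifP => // _; have /andP[] := hh01 (p k t, omega k t).
    by apply: prodr_ile1 => k _; rewrite E; case: ifP; rewrite ?hh01 ?ler01 ?lexx.
  - move=> t; rewrite integral_atoms//.
    have := @cvg_expN_series (act ^~ t) _ (fun k => ln0 (p k t, omega k t)).
    apply: cvg_trans; apply: near_eq_cvg; apply: nearW => r.
    congr EFin; rewrite expN_sum// big_mkcond/= big_mkord.
    apply: eq_bigr => k _; rewrite E; case: ifP => // _.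
    by rewrite lnNK//; have /andP[] := hh01 (p k t, omega k t).
transitivity (\int[P]_t (expN (\int[N t]_x lnN (hh x)))%:E).
  apply: (cvg_unique _ lhs) => //; move: rhs.
  by apply: cvg_trans; apply: near_eq_cvg; apply: nearW => r; rewrite fin.
rewrite (PRM_laplace prmN); last 2 first.
- by apply: measurableT_comp => //; exact: measurable_lnN.
- by move=> x; apply: lnN_ge0; have /andP[] := hh01 x.
congr (expN _)%:E.
apply: ae_eq_integral => //.
- apply/measurable_EFinP; apply: measurable_funB => //.
  apply: measurableT_comp; first exact: measurable_expN.
  by apply: measurableT_comp => //; exact: measurable_lnN.
- apply/measurable_EFinP; apply: measurable_sum => m; apply: measurable_funM.
    exact: (measurableT_comp (measurable_mark_weight _) measurable_fst).
  by apply: measurable_funB => //; exact: mh.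
exists (~` simplex R q `*` setT); split => //.
  by apply: measurableX => //; apply: measurableC; exact: measurable_simplex.
move=> x /= h'; split => // sx; apply: h' => _; congr EFin.
rewrite lnNK; last by have /andP[] := hh01 x.
(* On the simplex the weights sum to 1, so that [1 - hh] is the mean of [1 - expN f]. *)
under [RHS]eq_bigr do rewrite mulrBr mulr1.
by rewrite sumrB sum_mark_weight indicE mem_set.
Qed.

Section bad_marks.
Variable bad : X -> mark -> bool.
Hypothesis mbad : forall m, measurable_fun setT (bad ^~ m).

Let good_event := [set t | forall k, act k t -> ~~ bad (p k t, omega k t) (marks k t)].

(** With the value [+oo] on bad marks, [expN] of the total is the indicator that no active atom is
    bad. *)
Let f x m : \bar R := if bad x m then +oo else 0.
Let mf m : measurable_fun setT (f ^~ m). Proof. exact: measurable_fun_ifT. Qed.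
Let f0 x m : 0 <= f x m. Proof. by rewrite /f; case: ifP. Qed.
Let total t := \sum_(0 <= k <oo | act k t) f (p k t, omega k t) (marks k t).

Let total_good t : good_event t -> total t = 0.
Proof.
move=> h; apply: eseries0 => k _ akt; rewrite /f.
by have := h k akt; case: (bad _ _).
Qed.

Let total_bad t : ~ good_event t -> total t = +oo.
Proof.
move=> /existsNP[k /not_implyP[akt /negP badk]].
apply/eqP; rewrite -leye_eq /total (@nneseriesD1 R _ k)//.
rewrite {1}/f; move: badk; rewrite negbK => ->.
by rewrite addye// gt_eqF// (lt_le_trans _ (nneseries_ge0 _))// ltNy0.
Qed.

Let good_eventE : good_event = total @^-1` [set 0].
Proof.
apply/seteqP; split => t /=; first exact: total_good.
by move=> t0; apply: contrapT => /total_bad; rewrite t0.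
Qed.

Lemma measurable_good_event : measurable good_event.
Proof.
rewrite good_eventE; apply: preimage_measurable => //.
by apply: measurable_cond_series => // k; exact: measurable_mark_eval.
Qed.

Lemma marked_void : P good_event =
  (expN (\int[nu]_x (\sum_m mark_weight x.1 m * (bad x m)%:R)%:E))%:E.
Proof.
rewrite -[LHS]mul1e -integral_cst//=; last exact: measurable_good_event.
rewrite [X in (expN X)%:E](_ : _ =
    \int[nu]_x (\sum_m mark_weight x.1 m * (1 - expN (f x m)))%:E); last first.
  apply: eq_integral => x _; congr EFin; apply: eq_bigr => m _.
  by rewrite /f; case: (bad x m); rewrite ?expN0 ?subrr// /expN subr0.
rewrite -(marked_laplace mf f0) integral_mkcond; apply: eq_integral => t _.
rewrite patchE -/(total t); case: (boolP (t \in _)) => [/set_mem|/negP] h.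
  by rewrite total_good// expN0.
by rewrite total_bad// => h'; apply: h; rewrite inE.
Qed.

(** Zero integrals make the exponent of the void probability vanish, hence that probability is 1. *)
Lemma marked_ae_good :
  (forall m, \int[nu]_x (mark_weight x.1 m * (bad x m)%:R)%:E = 0) ->
  {ae P, forall t, forall k, act k t -> ~~ bad (p k t, omega k t) (marks k t)}.
Proof.
move=> bad0.
have bad_sum : \int[nu]_x (\sum_m mark_weight x.1 m * (bad x m)%:R)%:E = 0.
  transitivity (\int[nu]_x \sum_m (mark_weight x.1 m * (bad x m)%:R)%:E).
    by apply: eq_integral => x _; rewrite sumEFin.
  rewrite ge0_integral_sum//; first by rewrite big1.
  - move=> m; apply/measurable_EFinP; apply: measurable_funM.
      exact: (measurableT_comp (measurable_mark_weight _) measurable_fst).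
    rewrite (_ : (fun x => _) = (fun x => if bad x m then 1 else 0)%R); last first.
      by apply/funext => x; case: (bad x m).
    exact: measurable_fun_ifT.
  - by move=> m x _; rewrite lee_fin mulr_ge0// mark_weight_ge0.
exists (~` good_event); split => //; first exact/measurableC/measurable_good_event.
rewrite probability_setC; last exact: measurable_good_event.
by rewrite marked_void bad_sum expN0 subee.
Qed.

End bad_marks.

End marked_draws.

(** * Levy intensities *)

Section kernel_section.
Context d d' (V : measurableType d) (W : measurableType d') (R : realType).
Variables (k : W -> {measure set V -> \bar R}).
Hypothesis mk : forall B, measurable B -> measurable_fun setT (fun w => k w B).

Let kk (w : W) : {measure set V -> \bar R} := k w.
HB.instance Definition _ := @isKernel.Build _ _ W V R kk mk.

Lemma finite_kernel_section (D : set V) (A : set (V * W)) : measurable D ->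
  (forall w, k w D < +oo) -> measurable A ->
  measurable_fun setT (fun w => k w ([set s | A (s, w)] `&` D)).
Proof.
move=> mD kD mA.
have kub w : exists M : R, forall B, measurable B -> mrestr (kk w) mD B < M%:E.
  exists (fine (k w D) + 1)%R => B mB.
  rewrite /mrestr (@le_lt_trans _ _ (k w D))//.
    by apply: le_measure; rewrite ?inE//; exact: measurableI.
  by rewrite -[ltLHS]fineK ?ge0_fin_numE// lte_fin ltrDl.
have mA' : measurable [set ws : W * V | A (ws.2, ws.1)].
  rewrite -[X in measurable X]/((fun ws : W * V => (ws.2, ws.1)) @^-1` A).
  apply: preimage_measurable => //.
  by apply/measurable_fun_pairP; split; [exact: measurable_snd|exact: measurable_fst].
have [_] := @measurable_prod_subset_xsection_kernel _ _ W V R kk D mD kub _ mA'.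
apply: eq_measurable_fun => w _; rewrite /mrestr/=; congr (k w (_ `&` _)).
by rewrite xsectionE.
Qed.

(** The fibres share one exhaustion by sets [D n] of finite mass, with no bound uniform in [w]; the
    mass of a section is the limit of its restrictions to these sets. *)
Lemma sigma_finite_kernel_section (D : nat -> set V) (A : set (V * W)) :
  (forall n, measurable (D n)) -> (forall n w, k w (D n) < +oo) ->
  (forall n m, (n <= m)%N -> D n `<=` D m) ->
  (forall w, k w (~` \bigcup_n D n) = 0) -> measurable A ->
  measurable_fun setT (fun w => k w [set s | A (s, w)]).
Proof.
move=> mD kD ndD k0 mA.
apply: (emeasurable_fun_cvg (fun n w => k w ([set s | A (s, w)] `&` D n))).
  by move=> n; exact: finite_kernel_section.
move=> w _; have mAw := measurable_section w mA.
rewrite (_ : k w [set s | A (s, w)] = k w (\bigcup_n ([set s | A (s, w)] `&` D n))).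
  apply: nondecreasing_cvg_mu.
  - by move=> n; exact: measurableI.
  - by apply: bigcup_measurable => n _; exact: measurableI.
  - by move=> n m nm; apply/subsetPset => s [As Ds]; split => //; exact: (ndD n m).
rewrite -setI_bigcupr; apply: measure_ae_set => //.
  by apply: measurableI => //; exact: bigcup_measurable.
exists (~` \bigcup_n D n); split => //.
  by apply: measurableC; exact: bigcup_measurable.
by move=> s /= h Ds; apply: h; split => // -[].
Qed.

End kernel_section.

Section features.
Context (R : realType) (q : nat) (Omega : completePseudoMetricType R).
Hypothesis q_gt0 : (0 < q)%N.
Local Notation V := (q.-tuple R).
Local Notation W := (borel Omega).
Local Notation X := (V * W)%type.

(** Only near the origin can the jump measure be infinite. These sets keep away from it, have finite
    mass and exhaust the simplex. *)
Definition big_tot n : set V := simplex R q `&` [set s | (n.+1%:R^-1 <= tot s)%R].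

Lemma measurable_big_tot n : measurable (big_tot n).
Proof.
apply: measurableI; first exact: measurable_simplex.
rewrite (_ : [set s | _] = @tot R q @^-1` `[n.+1%:R^-1%R, +oo[%classic).
  by apply: preimage_measurable => //; exact: measurable_tot.
by apply/seteqP; split => s /=; rewrite in_itv/= andbT.
Qed.

Lemma big_tot_mono n m : (n <= m)%N -> big_tot n `<=` big_tot m.
Proof.
move=> nm s [ss h]; split => //=; apply: le_trans h.
by rewrite lef_pV2 ?posrE// ler_nat.
Qed.

Lemma simplex_tot_gt0 (s : V) : simplex R q s -> (0 < tot s)%R.
Proof.
move=> [s0 _]; rewrite /tot (bigD1 (Ordinal q_gt0))//=.
by rewrite ltr_pwDl//; apply: sumr_ge0 => j _; exact: ltW.
Qed.

Lemma bigcup_big_tot : \bigcup_n big_tot n = simplex R q.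
Proof.
apply/seteqP; split => [s [n _ []]//|s ss].
have s0 := simplex_tot_gt0 ss.
exists (Num.truncn (tot s)^-1%R) => //; split => //=.
rewrite -[leRHS]invrK lef_pV2 ?posrE ?invr_gt0//.
exact/ltW/truncnS_gt.
Qed.

(* the properties of an intensity that make the features of its Poisson process
   distinct and those with large total weight finitely many *)
Record feature_intensity (nu : {measure set X -> \bar R}) : Prop := {
  fi_simplex : nu (~` simplex R q `*` setT) = 0 ;
  fi_tot : \int[nu]_x (\1_(simplex R q) x.1 * tot x.1)%:E < +oo ;
  fi_fiber : forall w, nu (setT `*` [set w]) = 0 }.

Lemma measurable_indic_tot :
  measurable_fun setT (fun x : X => (\1_(simplex R q) x.1 * tot x.1)%:E : \bar R).
Proof.
apply/measurable_EFinP.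
apply: (@measurableT_comp _ _ _ _ _ _ (fun s : V => (\1_(simplex R q) s * tot s)%R)
  _ (fun x : X => x.1)); last exact: measurable_fst.
apply: measurable_funM; last exact: measurable_tot.
by apply: measurable_indic; exact: measurable_simplex.
Qed.

Lemma indic_tot_ge0 (s : V) : (0 <= \1_(simplex R q) s * tot s)%R.
Proof.
rewrite indicE; case: (boolP (s \in _)) => [/set_mem ss|_]; last by rewrite mul0r.
by rewrite mul1r ltW// simplex_tot_gt0.
Qed.

Section intensity_theory.
Variables (nu : {measure set X -> \bar R}).
Hypothesis fi : feature_intensity nu.

(** Markov's inequality for [tot]. *)
Lemma fi_big n : nu (big_tot n `*` setT) < +oo.
Proof.
have mB : measurable (big_tot n `*` [set: W]).
  by apply: measurableX => //; exact: measurable_big_tot.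
have h : (n.+1%:R^-1)%:E * nu (big_tot n `*` setT) <=
    \int[nu]_x (\1_(simplex R q) x.1 * tot x.1)%:E.
  rewrite -integral_cst// integral_mkcond.
  apply: ge0_le_integral => //.
  - by move=> x _; apply: erestrict_ge0 => y _; rewrite lee_fin.
  - by apply/measurable_restrict => //; rewrite setTI.
  - exact: measurable_indic_tot.
  move=> x _; rewrite patchE; case: ifPn => [/set_mem[[ss st] _]|_].
    by rewrite lee_fin indicE mem_set// mul1r.
  by rewrite lee_fin indic_tot_ge0.
rewrite ltey; apply/eqP => E; have := le_lt_trans h (fi_tot fi).
by rewrite E gt0_muley// lte_fin invr_gt0.
Qed.

Lemma fi_sigma_finite : sigma_finite setT nu.
Proof.
(* The complement of the simplex, a null set, is adjoined so that the sets cover the whole space. *)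
exists (fun n => (big_tot n `|` ~` simplex R q) `*` setT).
  apply/seteqP; split => // -[s w] _.
  have [|ss] := pselect (simplex R q s); last by exists 0%N => //; split => //; right.
  by rewrite -bigcup_big_tot => -[n _ bs]; exists n => //; split => //; left.
have mC : measurable (~` simplex R q `*` [set: W]).
  by apply: measurableX => //; apply: measurableC; exact: measurable_simplex.
have mB n : measurable (big_tot n `*` [set: W]).
  by apply: measurableX => //; exact: measurable_big_tot.
move=> n; rewrite (_ : _ `*` _ = big_tot n `*` setT `|` ~` simplex R q `*` setT); last first.
  by apply/seteqP; split => -[s w] /=; tauto.
split; first exact: measurableU.
apply: le_lt_trans (measureU2 _ _ _) _ => //.
by rewrite [X in _ + X](fi_simplex fi) adde0; exact: fi_big.
Qed.

Variable (U : nat -> set W).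
Hypothesis mU : forall n, measurable (U n).
Hypothesis sepU : separated_on U setT.

Lemma atom_class_set1 w : atom_class U w = [set w].
Proof.
apply/seteqP; split => [y yw|y ->//]; apply: sepU => //.
Qed.

Lemma measurable_set1_feature (w : W) : measurable [set w].
Proof. by rewrite -atom_class_set1; exact: measurable_atom_class. Qed.

(** Cylinders over the feature space: they do not separate jumps, so simplicity relative to them
    says that distinct atoms have distinct features. Their classes are the fibres over single
    features. *)
Definition UX n : set X := setT `*` U n.

Lemma measurable_UX n : measurable (UX n).
Proof. exact: measurableX. Qed.

Lemma atom_class_UX x : atom_class UX x = setT `*` [set x.2].
Proof.
rewrite -atom_class_set1; apply/seteqP; split => [y yx|y [_ yx]].
  by split => // n; have := yx n; rewrite /UX/=; tauto.
by move=> n; have := yx n; rewrite /UX/=; tauto.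
Qed.

Lemma fi_atom_class x : nu (atom_class UX x) = 0.
Proof. by rewrite atom_class_UX; exact: (fi_fiber fi). Qed.

Context d (T : measurableType d) (P : probability T R).
Variable N : T -> rmeasure X R.
Hypothesis prmN : is_PRM P nu N.
Variables (act : nat -> T -> bool) (p : nat -> T -> V) (omega : nat -> T -> W).
Hypothesis NE : forall t A, measurable A ->
  N t A = \sum_(0 <= k <oo | act k t) \d_(p k t, omega k t) A.

Lemma PRM_null A : measurable A -> nu A = 0 -> {ae P, forall t, N t A = 0}.
Proof.
move=> mA A0; have mN0 : measurable [set t | N t A = 0].
  exact: (preimage_measurable (PRM_measurable_ev prmN mA) (B := [set 0])).
exists (~` [set t | N t A = 0]); split => //; first exact: measurableC.
by rewrite probability_setC// (PRM_void prmN)// A0 expN0 subee.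
Qed.

Lemma atom_charged t A k : measurable A -> act k t -> A (p k t, omega k t) -> 1 <= N t A.
Proof.
move=> mA ak Ak; rewrite NE// (@nneseriesD1 R _ k)// diracE mem_set//.
by rewrite leeDl//; exact: nneseries_ge0.
Qed.

Lemma ae_simplex_atoms : {ae P, forall t, forall k, act k t -> simplex R q (p k t)}.
Proof.
have mC : measurable (~` simplex R q `*` [set: W]).
  by apply: measurableX => //; apply: measurableC; exact: measurable_simplex.
apply: filterS (PRM_null mC (fi_simplex fi)) => t Nt k ak; apply: contrapT => pk.
by have := @atom_charged t _ k mC ak (conj pk I); rewrite Nt lee_fin ler10.
Qed.

(** Two atoms with the same feature share a cell at every level, which then has mass at least 2;
    this contradicts [PRM_separated] on a set [big_tot] containing both jumps. *)
Lemma ae_distinct_features : {ae P, forall t, forall k l, act k t -> act l t ->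
  omega k t = omega l t -> k = l}.
Proof.
have sep n := PRM_separated measurable_UX prmN fi_atom_class
  (measurableX (measurable_big_tot n) measurableT) (fi_big n).
apply: filterS2 ae_simplex_atoms (ae_foralln sep) => t sp {}sep k l ak al kl.
apply: contrapT => /eqP neq.
have [k' _ bk] : (\bigcup_n big_tot n) (p k t) by rewrite bigcup_big_tot; exact: sp.
have [l' _ bl] : (\bigcup_n big_tot n) (p l t) by rewrite bigcup_big_tot; exact: sp.
have [n0 /(_ n0 (leqnn _)) h] := sep (maxn k' l').
have mA : measurable (big_tot (maxn k' l') `*` setT `&`
    cell UX n0 @^-1` [set cell UX n0 (p k t, omega k t)]).
  apply: measurableI; last exact: (measurable_cell measurable_UX).
  by apply: measurableX => //; exact: measurable_big_tot.
have : 1 + 1 <= N t (big_tot (maxn k' l') `*` setT `&`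
    cell UX n0 @^-1` [set cell UX n0 (p k t, omega k t)]).
  rewrite NE// (@nneseriesD1 R _ k)// (@nneseriesD1 R _ l)//; last first.
    by rewrite al eq_sym.
  rewrite addeA !diracE !mem_set//.
  - by rewrite leeDl//; exact: nneseries_ge0.
  - split => /=; first by split => //; apply: big_tot_mono bl; exact: leq_maxr.
    by apply/ffunP => i; rewrite !ffunE /UX/= kl.
  - split => //=; split => //; apply: big_tot_mono bk; exact: leq_maxl.
have [->|->] := h (cell UX n0 (p k t, omega k t)); rewrite -EFinD lee_fin; lra.
Qed.

End intensity_theory.

Lemma feature_intensity_mdens (U : nat -> set W) (nu : {measure set X -> \bar R}) (g : X -> \bar R)
    (mg : measurable_fun setT g) (g0 : forall x, 0 <= g x) :
  (forall n, measurable (U n)) -> separated_on U setT ->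
  (forall x, g x <= 1) -> feature_intensity nu -> feature_intensity (mdens nu mg g0).
Proof.
move=> mU sepU g1 fi; have mset1 := measurable_set1_feature mU sepU.
have null A : measurable A -> nu A = 0 -> mdens nu mg g0 A = 0.
  by move=> mA A0; apply: null_set_integral => //; exact: measurable_funTS.
split.
- apply: null; last exact: fi_simplex.
  by apply: measurableX => //; apply: measurableC; exact: measurable_simplex.
- rewrite integral_mdens//; last 2 first.
  + exact: measurable_indic_tot.
  + by move=> x; rewrite lee_fin indic_tot_ge0.
  apply: le_lt_trans (fi_tot fi); apply: ge0_le_integral => //.
  + by move=> x _; rewrite mule_ge0// lee_fin indic_tot_ge0.
  + by apply: emeasurable_funM => //; exact: measurable_indic_tot.
  + exact: measurable_indic_tot.
  + by move=> x _; rewrite -[leRHS]mule1; apply: lee_wpmul2l => //; rewrite lee_fin indic_tot_ge0.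
- by move=> w; apply: null; [exact: measurableX|exact: fi_fiber].
Qed.

End features.

Section levy.
Context (R : realType) (q : nat) (Omega : completePseudoMetricType R).
Hypothesis q_gt0 : (0 < q)%N.
Local Notation V := (q.-tuple R).
Local Notation W := (borel Omega).
Local Notation X := (V * W)%type.
Variables (rho : R.-sigmafker W ~> V) (B0 : probability W R).
Hypothesis levy : levy_kernel rho.

Lemma levy_big w n : rho w (big_tot n) < +oo.
Proof.
have [_ fin] := levy w.
have mB := @measurable_big_tot R q n.
have h : (n.+1%:R^-1)%:E * rho w (big_tot n) <=
    \int[rho w]_(s in simplex R q) (Num.min (tot s) 1%R)%:E.
  rewrite -integral_cst//.
  apply: (@le_trans _ _ (\int[rho w]_(s in big_tot n) (Num.min (tot s) 1%R)%:E)).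
    apply: ge0_le_integral => //.
    - by move=> s _; rewrite lee_fin.
    - apply/measurable_EFinP; apply: measurable_funTS.
      by apply: measurable_minr => //; exact: measurable_tot.
    move=> s [ss st]; rewrite lee_fin le_min st/= invf_le1// ler1n//.
  apply: ge0_subset_integral => //; first exact: measurable_simplex.
  - apply/measurable_EFinP; apply: measurable_funTS.
    by apply: measurable_minr => //; exact: measurable_tot.
  - by move=> s ss; rewrite lee_fin le_min ler01 andbT; exact: simplex_tot_ge0.
  - by move=> s [].
rewrite ltey; apply/eqP => E; have := le_lt_trans h fin.
by rewrite E gt0_muley// lte_fin invr_gt0.
Qed.

Lemma levy_section (A : set X) : measurable A ->
  measurable_fun setT (fun w => rho w [set s | A (s, w)]).
Proof.
move=> mA; apply: (@sigma_finite_kernel_section _ _ V W R (fun w => rho w) _ (@big_tot R q)) => //.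
- by move=> B mB; exact: measurable_kernel.
- exact: measurable_big_tot.
- by move=> n w; exact: levy_big.
- exact: big_tot_mono.
- by move=> w; rewrite bigcup_big_tot//; have [] := levy w.
Qed.

Definition levy_intensity : {measure set X -> \bar R} := mmixture B0 levy_section.

Lemma levy_intensityE A : levy_intensity A = intensity (fun w => rho w) B0 A.
Proof. by []. Qed.

Lemma integral_levy (f : X -> \bar R) : measurable_fun setT f ->
  (forall x, 0 <= f x) ->
  \int[levy_intensity]_x f x = \int[B0]_w \int[rho w]_s f (s, w).
Proof. exact: integral_mixture. Qed.

Lemma integral_simplex w (f g : V -> \bar R) : measurable_fun setT f ->
  measurable_fun setT g -> (forall s, simplex R q s -> f s = g s) ->
  forall D, measurable D -> \int[rho w]_(s in D) f s = \int[rho w]_(s in D) g s.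
Proof.
move=> mf mg fg D mD; apply: ae_eq_integral => //; try exact: measurable_funTS.
exists (~` simplex R q); split.
- by apply: measurableC; exact: measurable_simplex.
- by have [] := levy w.
- by move=> s /= h ss; apply: h => _; exact: fg.
Qed.

Lemma levy_feature_intensity (U : nat -> set W) : (forall n, measurable (U n)) ->
  separated_on U setT -> nonatomic B0 ->
  \int[B0]_w \int[rho w]_(s in simplex R q) (tot s)%:E < +oo ->
  feature_intensity levy_intensity.
Proof.
move=> mU sepU na fin; split.
- rewrite levy_intensityE; apply: integral0_eq => w _.
  by rewrite (_ : [set s | _] = ~` simplex R q) ?(levy w).1//; apply/seteqP; split => s /=; tauto.
- rewrite integral_levy; last 2 first.
  + exact: measurable_indic_tot.
  + by move=> x; rewrite lee_fin indic_tot_ge0.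
  suff -> : (\int[B0]_w \int[rho w]_s (\1_(simplex R q) s * tot s)%:E =
      \int[B0]_w \int[rho w]_(s in simplex R q) (tot s)%:E) by exact: fin.
  apply: eq_integral => w _; rewrite [RHS]integral_mkcond.
  apply: eq_integral => s _; rewrite patchE indicE.
  by case: (s \in _); rewrite ?mul1r ?mul0r.
move=> w0; rewrite levy_intensityE /intensity.
have mw0 := measurable_set1_feature mU sepU w0.
have mA : measurable (setT `*` [set w0] : set X) by exact: measurableX.
transitivity (\int[B0]_w (0 : \bar R)); last by rewrite integral0.
apply: ge0_ae_eq_integral => //; first exact: levy_section.
exists [set w0]; split => //; first exact: na.
move=> w /= h; apply: contrapT => ww0; apply: h => _.
rewrite (_ : [set s | _] = set0)//; apply/seteqP; split => // s [].
by move=> _ /=.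
Qed.

Section tilted.
Variable M : nat.

(** The indicator keeps the density in [0, 1]: off the simplex the power may be negative or exceed
    1. *)
Definition tilt_density (x : X) : \bar R :=
  (\1_(simplex R q) x.1 * (1 - tot x.1) ^+ M)%:E.

Lemma measurable_tilt_density : measurable_fun setT tilt_density.
Proof.
apply/measurable_EFinP.
apply: (@measurableT_comp _ _ _ _ _ _
  (fun s : V => (\1_(simplex R q) s * (1 - tot s) ^+ M)%R)
  _ (fun x : X => x.1)); last exact: measurable_fst.
apply: measurable_funM; first by apply: measurable_indic; exact: measurable_simplex.
by apply: measurable_funX; apply: measurable_funB => //; exact: measurable_tot.
Qed.

Lemma tilt_density_bound x : 0 <= tilt_density x /\ tilt_density x <= 1.
Proof.
rewrite /tilt_density indicE; case: (boolP (x.1 \in _)) => [/set_mem ss|_]; last first.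
  by rewrite mul0r !lee_fin lexx ler01.
have s0 := simplex_tot_gt0 q_gt0 ss; have [_ s1] := ss.
have t0 : (0 <= 1 - tot x.1)%R by rewrite subr_ge0 ltW.
rewrite mul1r !lee_fin; split; first exact: exprn_ge0.
by apply: exprn_ile1 => //; rewrite lerBlDr lerDl ltW.
Qed.

Definition tilt_intensity : {measure set X -> \bar R} :=
  mdens levy_intensity measurable_tilt_density (fun x => (tilt_density_bound x).1).

Lemma tilt_intensityE A : measurable A ->
  tilt_intensity A = intensity (tilt M rho) B0 A.
Proof.
move=> mA; rewrite -[LHS]/(\int[levy_intensity]_(x in A) tilt_density x).
rewrite integral_mkcond integral_levy; last 2 first.
- apply/measurable_restrict => //; rewrite setTI; apply: measurable_funTS.
  exact: measurable_tilt_density.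
- by move=> x; apply: erestrict_ge0 => y _; exact: (tilt_density_bound y).1.
apply: eq_integral => w _; rewrite /tilt.
rewrite (@integral_simplex w (fun s => ((1 - tot s) ^+ M)%:E)
  (fun s => tilt_density (s, w))); last 4 first.
- apply/measurable_EFinP; apply: measurable_funX; apply: measurable_funB => //.
  exact: measurable_tot.
- exact: (measurableT_comp measurable_tilt_density (measurable_pair2 w)).
- by move=> s ss; rewrite /tilt_density indicE mem_set// mul1r.
- exact: measurable_section.
rewrite [RHS]integral_mkcond; apply: eq_integral => s _.
by rewrite !patchE.
Qed.

End tilted.

End levy.

(** * The law of the jumps *)

Section jump_law.
Context (R : realType) (q : nat) (Omega : completePseudoMetricType R).
Hypothesis q_gt0 : (0 < q)%N.
Local Notation V := (q.-tuple R).
Local Notation W := (borel Omega).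
Variables (rho : R.-sigmafker W ~> V).
Hypothesis levy : levy_kernel rho.
Variables (M : nat) (c : 'I_q -> nat) (w : W).
Local Notation S := (simplex R q).
Local Notation kappa := (kappa M rho c w).
Local Notation weight := (weight M c).

Lemma weight_ge0 (s : V) : S s -> (0 <= weight s)%R.
Proof.
move=> [s0 s1]; apply: mulr_ge0; last by rewrite exprn_ge0// subr_ge0 ltW.
by apply: prodr_ge0 => j _; rewrite exprn_ge0// ltW.
Qed.

Let sphi (phi : V -> R) (s : V) : \bar R := (\1_S s * phi s)%:E.

Let sphi_ge0 phi : (forall s, S s -> (0 <= phi s)%R) -> forall s, 0 <= sphi phi s.
Proof.
move=> phi0 s; rewrite lee_fin indicE; case: (boolP (s \in _)) => [/set_mem|_].
  by rewrite mul1r; exact: phi0.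
by rewrite mul0r.
Qed.

Let measurable_sphi phi : measurable_fun setT phi -> measurable_fun setT (sphi phi).
Proof.
move=> mphi; apply/measurable_EFinP; apply: measurable_funM => //.
by apply: measurable_indic; exact: measurable_simplex.
Qed.

Lemma integral_indic_simplex (mu : {measure set V -> \bar R}) (phi : V -> R) :
  \int[mu]_s (\1_S s * phi s)%:E = \int[mu]_(s in S) (phi s)%:E.
Proof.
rewrite [RHS]integral_mkcond; apply: eq_integral => s _.
by rewrite patchE indicE; case: (s \in _); rewrite ?mul1r ?mul0r.
Qed.

Lemma kappa_ge0 : (0 <= kappa)%R.
Proof.
by apply: fine_ge0; apply: integral_ge0 => s ss; rewrite lee_fin weight_ge0.
Qed.

(** When [kappa] is 0 the quotient is 0 by convention: the density is always defined and
    nonnegative, and is normalised once [kappa] is positive. *)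
Definition jump_density : V -> \bar R := sphi (fun s => weight s / kappa)%R.

Lemma jump_density_ge0 s : 0 <= jump_density s.
Proof.
by apply: sphi_ge0 => {}s ss; rewrite divr_ge0 ?kappa_ge0 ?weight_ge0.
Qed.

Lemma measurable_jump_density : measurable_fun setT jump_density.
Proof. by apply: measurable_sphi; apply: measurable_funM => //; exact: measurable_weight. Qed.

Definition jump_measure : {measure set V -> \bar R} :=
  mdens (rho w) measurable_jump_density jump_density_ge0.

Hypothesis kappa_gt0 : (0 < kappa)%R.

(** An infinite integral would be sent to 0 by [fine]; positivity of [kappa] therefore carries the
    finiteness of the integral as well. *)
Lemma kappaE : \int[rho w]_(s in S) (weight s)%:E = kappa%:E.
Proof.
rewrite /Defs.kappa /Rintegral fineK// fin_numElt.
rewrite (lt_le_trans (ltNyr 0) (integral_ge0 _ _))//=; last first.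
  by move=> s ss; rewrite lee_fin weight_ge0.
rewrite ltey; apply/eqP => E; move: kappa_gt0.
by rewrite /Defs.kappa /Rintegral E ltxx.
Qed.

Lemma integral_jump (phi : V -> R) : measurable_fun setT phi ->
  (forall s, S s -> (0 <= phi s <= 1)%R) ->
  \int[jump_measure]_s (\1_S s * phi s)%:E =
  (\int[rho w]_(s in S) (phi s * weight s) / kappa)%R%:E.
Proof.
move=> mphi phi01.
have phi0 s : S s -> (0 <= phi s)%R by move=> /phi01/andP[].
rewrite integral_mdens; [|exact: measurable_sphi|exact: sphi_ge0].
have pw0 s : S s -> (0 <= phi s * weight s)%R.
  by move=> ss; rewrite mulr_ge0 ?phi0 ?weight_ge0.
have mpw : measurable_fun setT (fun s => phi s * weight s)%R.
  by apply: measurable_funM => //; exact: measurable_weight.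
transitivity ((kappa^-1)%:E * \int[rho w]_s sphi (fun s => phi s * weight s)%R s).
  rewrite -ge0_integralZl_EFin//; last 3 first.
  - by move=> s _; exact: sphi_ge0.
  - exact: measurable_sphi.
  - by rewrite invr_ge0 kappa_ge0.
  apply: eq_integral => s _; rewrite /jump_density /sphi -!EFinM; congr EFin.
  by rewrite indicE; case: (s \in _); rewrite ?mul0r ?mulr0// !mul1r mulrA mulrC.
rewrite integral_indic_simplex EFinM muleC /Rintegral fineK//.
rewrite ge0_fin_numE; last by apply: integral_ge0 => s /pw0; rewrite lee_fin.
apply: (@le_lt_trans _ _ (\int[rho w]_(s in S) (weight s)%:E)); last first.
  by rewrite kappaE ltry.
apply: ge0_le_integral => //.
- exact: measurable_simplex.
- by apply/measurable_EFinP; exact: measurable_funTS.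
- by apply/measurable_EFinP; apply: measurable_funTS; exact: measurable_weight.
- move=> s ss; rewrite lee_fin ler_piMl ?weight_ge0//.
  by have /andP[] := phi01 s ss.
Qed.

Lemma jump_measure_out : jump_measure (~` S) = 0.
Proof.
apply: integral0_eq => s ss; rewrite /jump_density /sphi indicE.
by rewrite memNset// mul0r.
Qed.

Lemma jump_measureE A : measurable A -> jump_measure A = (Jlaw M rho c w A)%:E.
Proof.
move=> mA; have mS := @measurable_simplex R q.
transitivity (\int[jump_measure]_s (\1_S s * \1_A s)%:E).
  rewrite integral_indic_simplex integral_indic//.
  apply: measure_ae_set => //; first exact: measurableI.
  exists (~` S); split; [exact: measurableC|exact: jump_measure_out|].
  by move=> s /= h ss; apply: h; split => [|[]].
rewrite integral_jump; last 2 first.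
- exact: measurable_indic.
- by move=> s _; rewrite indicE; case: (_ \in _); rewrite ?ler01 ?lexx.
congr ((_ / _)%R%:E); rewrite /Rintegral; congr fine.
rewrite [LHS]integral_mkcond [RHS]integral_mkcond; apply: eq_integral => s _.
rewrite !patchE indicE; have -> : (s \in S `&` A) = (s \in S) && (s \in A).
  exact: in_setI.
case: (s \in S : bool); case: (s \in A : bool); rewrite ?mul1r ?mul0r//.
Qed.

Lemma jump_measureT : jump_measure setT = 1.
Proof.
rewrite jump_measureE// /Jlaw setIT divff//; exact: lt0r_neq0.
Qed.

Lemma jump_measure_in : jump_measure S = 1.
Proof.
have mS := @measurable_simplex R q.
rewrite -jump_measureT; apply: measure_ae_set => //.
exists (~` S); split; [exact: measurableC|exact: jump_measure_out|].
by move=> s /= h ss; apply: h; split.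
Qed.

(** A function positive on the simplex with zero integral would make the simplex null, though it has
    mass 1. Applied to the coordinates and to [1 - tot], this places the mean vector in the simplex
    with strict inequalities. *)
Lemma integral_jump_gt0 (phi : V -> R) : measurable_fun setT phi ->
  (forall s, S s -> (0 < phi s)%R) ->
  0 < \int[jump_measure]_s (\1_S s * phi s)%:E.
Proof.
move=> mphi phi0.
have phi0' s : S s -> (0 <= phi s)%R by move=> /phi0/ltW.
rewrite lt_neqAle integral_ge0 ?andbT; last by move=> s _; exact: sphi_ge0.
apply/negP => /eqP/esym E.
have mS := @measurable_simplex R q.
have : {ae jump_measure, forall s, sphi phi s = 0}.
  have := (ae_eq_integral_abs jump_measure measurableT (measurable_sphi mphi)).1.
  rewrite (eq_integral (sphi phi)); last by move=> s _; rewrite gee0_abs//; exact: sphi_ge0.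
  by move=> /(_ E); apply: filterS => s /(_ I).
move=> ae0; have : jump_measure S = jump_measure set0.
  apply: measure_ae_set => //; apply: filterS ae0 => s /eqP.
  rewrite /sphi eqe indicE; case: (boolP (s \in _)) => [/set_mem ss|/negP ns].
    by rewrite mul1r (gt_eqF (phi0 _ ss)).
  by move=> _; split => // ss; exfalso; apply: ns; rewrite inE.
rewrite measure0 [LHS]jump_measure_in => /eqP.
by rewrite eqe oner_eq0.
Qed.

Local Notation r := (rvec M rho c w).

Let simplex_le1 (s : V) k : S s -> (0 <= tnth s k <= 1)%R.
Proof.
move=> [s0 s1]; rewrite (ltW (s0 k))/=; apply: le_trans (ltW s1).
by rewrite /tot (bigD1 k)//= lerDl; apply: sumr_ge0 => j _; exact: ltW.
Qed.

Lemma integral_jump_coord k :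
  \int[jump_measure]_s (\1_S s * tnth s k)%:E = (tnth r k)%:E.
Proof.
rewrite integral_jump; first by rewrite tnth_mktuple.
- exact: measurable_tnth.
- by move=> s; exact: simplex_le1.
Qed.

Let tot_simplex (s : V) : S s -> (0 <= 1 - tot s <= 1)%R.
Proof.
move=> ss; have := simplex_tot_ge0 ss; case: ss => _ s1 t0.
by rewrite subr_ge0 ltW//= lerBlDr lerDl.
Qed.

Let measurable_1tot : measurable_fun setT (fun s : V => 1 - tot s)%R.
Proof. by apply: measurable_funB => //; exact: measurable_tot. Qed.

(** The means of [1 - tot] and of the coordinates add up to the mass of the simplex, which is 1. *)
Lemma integral_jump_none :
  \int[jump_measure]_s (\1_S s * (1 - tot s))%:E = (1 - tot r)%:E.
Proof.
have e : \int[jump_measure]_s (\1_S s * (1 - tot s))%:E +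
    \sum_(k < q) \int[jump_measure]_s (\1_S s * tnth s k)%:E = 1.
  rewrite -ge0_integral_sum//; last 2 first.
  - by move=> k; apply: (@measurable_sphi (fun s => tnth s k)); exact: measurable_tnth.
  - move=> k s _; apply: (@sphi_ge0 (fun s => tnth s k)) => {}s ss.
    by have /andP[] := simplex_le1 k ss.
  rewrite -ge0_integralD//; last 4 first.
  - by move=> s _; apply: (@sphi_ge0 (fun s => 1 - tot s)%R) => {}s /tot_simplex /andP[].
  - exact: (@measurable_sphi (fun s => 1 - tot s)%R).
  - move=> s _; apply: sume_ge0 => k _; apply: (@sphi_ge0 (fun s => tnth s k)) => {}s ss.
    by have /andP[] := simplex_le1 k ss.
  - apply: emeasurable_sum => k; apply: (@measurable_sphi (fun s => tnth s k)).
    exact: measurable_tnth.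
  have mS := @measurable_simplex R q.
  transitivity (jump_measure S).
    rewrite -[S in RHS]setIT -integral_indic//; apply: eq_integral => s _.
    rewrite sumEFin -EFinD; congr EFin.
    by rewrite -mulr_sumr -mulrDr subrK mulr1.
  exact: jump_measure_in.
move: e; under eq_bigr do rewrite integral_jump_coord.
rewrite [X in _ + X](_ : _ = (tot r)%:E); last exact: sumEFin.
case: (\int[_]_s _) => // x; rewrite -EFinD => -[<-].
by rewrite addrK.
Qed.

Lemma rvec_simplex : S r.
Proof.
split => [k|].
  rewrite -lte_fin -integral_jump_coord; apply: integral_jump_gt0.
    exact: measurable_tnth.
  by move=> s [].
rewrite -subr_gt0 -lte_fin -integral_jump_none; apply: integral_jump_gt0 => //.
by move=> s [_]; rewrite subr_gt0.
Qed.

(** On vectors with at most one bit [mpmf] is affine in [s], so that averaging over the jump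
    replaces [s] by its mean. *)
Lemma integral_jump_mpmf b :
  \int[jump_measure]_s (\1_S s * mpmf s b)%:E = (mpmf r b)%:E.
Proof.
have [b1|b1] := leqP (btot b) 1; last first.
  rewrite mpmf_gt1//; apply: integral0_eq => s _.
  by rewrite mpmf_gt1// mulr0.
case: (btot_le1 b1) => o ->; rewrite mpmf_one_hot.
under eq_integral do rewrite mpmf_one_hot.
by case: o => [k|]; [exact: integral_jump_coord|exact: integral_jump_none].
Qed.

End jump_law.

(** * Thinning *)

Section atoms_measure.
Context (R : realType) d (X : measurableType d).

(* [\sum_(k | act k) \d_(x k)] *)
Definition atoms_measure (act : pred nat) (x : nat -> X) : rmeasure X R :=
  mseries (fun k => if act k then (\d_(x k) : {measure set X -> \bar R}) else mzero) 0.

Lemma atoms_measureE act x A :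
  atoms_measure act x A = \sum_(0 <= k <oo | act k) \d_(x k) A.
Proof.
rewrite -[LHS]/(mseries _ 0 A) /mseries [RHS]eseries_mkcond.
by apply: eq_eseriesr => k _; case: ifP.
Qed.

Lemma count_valued_dirac_series (act : pred nat) (x : nat -> X) A :
  count_valued (\sum_(0 <= k <oo | act k) \d_(x k) A : \bar R).
Proof.
have -> : \sum_(0 <= k <oo | act k) \d_(x k) A =
    counting [set k | act k /\ A (x k)] :> \bar R.
  rewrite counting_esum nneseries_esum//.
  rewrite (_ : [set k | act k /\ A (x k)] = [set k | act k] `&` [set k | A (x k)])//.
  rewrite [RHS]esum_mkcondr; apply: eq_esum => k _.
  rewrite diracE; have [/set_mem h|h] := boolP (k \in [set k | A (x k)]).
    by rewrite mem_set.
  by rewrite memNset// => h'; move/negP: h; apply; rewrite inE.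
rewrite /counting; case: asboolP => _; last by left.
by right; eexists.
Qed.

End atoms_measure.

(** * Recognizing a Poisson random measure by its Laplace functional *)

Section PRM_of_laplace.
Context (R : realType) d (X : measurableType d) d' (T : measurableType d').
Variables (P : probability T R) (nu : {measure set X -> \bar R}).
Variable N : T -> rmeasure X R.
Hypothesis mN : measurable_fun setT N.
Hypothesis Nnat : forall t A, measurable A -> count_valued (N t A).
Hypothesis lapN : forall g, measurable_fun setT g -> (forall x, 0 <= g x) ->
  \int[P]_t (expN (\int[N t]_x g x))%:E = (expN (\int[nu]_x (1 - expN (g x))%:E))%:E.

Let mNA A : measurable A -> measurable_fun setT (fun t => N t A).
Proof. by move=> mA; exact: (measurableT_comp (measurable_rmeasure_ev mA) mN). Qed.

Let mexpNA A v : measurable A -> measurable_fun setT (fun t => expN (v%:E * N t A)).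
Proof.
move=> mA; apply: measurableT_comp; first exact: measurable_expN.
by apply: measurable_funeM; exact: mNA.
Qed.

Lemma laplace_sets (I : finType) (s : seq I) (A : I -> set X) (v : I -> R) :
  (forall i, measurable (A i)) -> (forall i, (0 <= v i)%R) -> uniq s ->
  trivIset [set` s] A ->
  \int[P]_t (\prod_(i <- s) expN ((v i)%:E * N t (A i)))%:E =
  (\prod_(i <- s) expN ((1 - expR (- v i))%:E * nu (A i)))%:E.
Proof.
move=> mA v0 us tA.
pose g x := \sum_(i <- s) ((v i)%:E * (\1_(A i) x)%:E).
have vA0 i x : 0 <= (v i)%:E * (\1_(A i) x)%:E :> \bar R.
  by rewrite mule_ge0// lee_fin.
have mvA i : measurable_fun setT (fun x => (v i)%:E * (\1_(A i) x)%:E : \bar R).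
  by apply: measurable_funeM; apply/measurable_EFinP; exact: measurable_indic.
have mg : measurable_fun setT g by exact: emeasurable_sum.
have g0 x : 0 <= g x by exact: sume_ge0.
have -> : (\prod_(i <- s) expN ((1 - expR (- v i))%:E * nu (A i)))%R =
    expN (\int[nu]_x (1 - expN (g x))%:E).
  have e0 i : (0 <= 1 - expR (- v i))%R by rewrite subr_ge0 -expR0 ler_expR oppr_le0.
  rewrite -expN_sum; last by move=> i; rewrite mule_ge0// lee_fin.
  congr expN.
  transitivity (\int[nu]_x \sum_(i <- s) ((1 - expR (- v i))%:E * (\1_(A i) x)%:E)).
    rewrite ge0_integral_sum//; last 2 first.
    - by move=> i; apply: measurable_funeM; apply/measurable_EFinP; exact: measurable_indic.
    - by move=> i x _; rewrite mule_ge0// lee_fin.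
    apply: eq_bigr => i _; rewrite ge0_integralZl_EFin//.
    - by rewrite integral_indic// setIT.
    - by apply/measurable_EFinP; exact: measurable_indic.
  apply: eq_integral => x _; rewrite /g.
  (* The sets being disjoint, at most one term of [g x] is nonzero, and [1 - expN] of the sum is the
     sum of the corresponding terms. *)
  have [[i [si Ai]]|nA] := pselect (exists i, i \in s /\ A i x).
    have o j : j \in s -> j != i -> \1_(A j) x = 0%R :> R.
      move=> sj ji; rewrite indicE memNset// => Aj; move/eqP: ji; apply.
      by apply: (tA j i sj si); exists x.
    have si' : perm_eq s (i :: rem i s) by exact: perm_to_rem.
    have ur j : j \in rem i s -> \1_(A j) x = 0%R :> R.
      by rewrite mem_rem_uniq// inE/= => /andP[ji sj]; exact: o.
    rewrite !(perm_big _ si')/= !big_cons.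
    rewrite big1_seq; last by move=> j /andP[_ /ur ->]; rewrite mule0.
    rewrite [X in expN (_ + X)]big1_seq; last by move=> j /andP[_ /ur ->]; rewrite mule0.
    by rewrite !adde0 indicE mem_set// !mule1.
  have o j : j \in s -> \1_(A j) x = 0%R :> R.
    by move=> sj; rewrite indicE memNset// => Aj; apply: nA; exists j.
  rewrite big1_seq; last by move=> j /andP[_ /o ->]; rewrite mule0.
  rewrite [X in expN X]big1_seq; last by move=> j /andP[_ /o ->]; rewrite mule0.
  by rewrite expN0 subrr.
rewrite -lapN//; apply: eq_integral => t _; congr EFin.
rewrite -expN_sum; last by move=> i; rewrite mule_ge0// lee_fin.
congr expN; rewrite /g ge0_integral_sum//.
apply: eq_bigr => i _; rewrite ge0_integralZl_EFin//.
- by rewrite integral_indic// setIT.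
- by apply/measurable_EFinP; exact: measurable_indic.
Qed.

Lemma laplace_set A v : measurable A -> (0 <= v)%R ->
  \int[P]_t (expN (v%:E * N t A))%:E = (expN ((1 - expR (- v))%:E * nu A))%:E.
Proof.
move=> mA v0; have := @laplace_sets unit [:: tt] (fun=> A) (fun=> v) (fun=> mA) (fun=> v0) isT.
rewrite !big_seq1 => <-; last by move=> [] [].
by apply: eq_integral => t _; rewrite big_seq1.
Qed.

Lemma laplace_replace (I : finType) (A : I -> set X) (B : I -> set (\bar R)) :
  (forall i, measurable (A i)) -> (forall i, measurable (B i)) ->
  trivIset setT A ->
  forall s1 s2 (v : I -> R), (forall i, (0 <= v i)%R) -> uniq (s1 ++ s2) ->
  \int[P]_t (\prod_(i <- s1) \1_(B i) (N t (A i)) *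
             \prod_(i <- s2) expN ((v i)%:E * N t (A i)))%:E =
  \prod_(i <- s1) P [set t | B i (N t (A i))] *
  (\prod_(i <- s2) expN ((1 - expR (- v i))%:E * nu (A i)))%:E.
Proof.
move=> mA mB tA; elim=> [|i s1 IH] s2 v v0 us.
  rewrite big_nil mul1e -laplace_sets//; last first.
    by move=> i j _ _; exact: tA.
  by apply: eq_integral => t _; rewrite big_nil mul1r.
have mBi j : measurable [set t | B j (N t (A j))].
  by apply: (preimage_measurable (mNA (mA j))).
pose g t : R := (\prod_(i <- s1) \1_(B i) (N t (A i)) *
             \prod_(i <- s2) expN ((v i)%:E * N t (A i)))%R.
have g0 t : (0 <= g t)%R.
  by rewrite mulr_ge0// prodr_ge0// => j _; rewrite expN_ge0.
have mg : measurable_fun setT (fun t => (g t)%:E).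
  apply/measurable_EFinP; apply: measurable_funM.
    apply: measurable_prod => j _.
    rewrite (_ : (fun t => _) = \1_[set t | B j (N t (A j))]); last first.
      by apply/funext => t; rewrite !indicE; congr (nat_of_bool _)%:R; apply/idP/idP => /set_mem h; exact/mem_set.
    exact: measurable_indic.
  by apply: measurable_prod => j _; exact: mexpNA.
pose C := \prod_(i <- s1) P [set t | B i (N t (A i))] *
  (\prod_(i <- s2) expN ((1 - expR (- v i))%:E * nu (A i)))%:E.
have us2 : uniq (s1 ++ i :: s2).
  by rewrite -(cat1s i s2) uniq_catCA.
have us1 : uniq (s1 ++ s2) by move: us => /= /andP[].
have Eg : \int[P]_t (g t)%:E = C by exact: IH.
have C0 : 0 <= C by rewrite -Eg; apply: integral_ge0 => t _; rewrite lee_fin.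
have Cfin : C < +oo.
  rewrite -Eg; apply: (@le_lt_trans _ _ (\int[P]_t 1)); last first.
    by rewrite expectation_cst1 ltry.
  apply: ge0_le_integral => //; first by move=> t _; rewrite lee_fin.
  move=> t _; rewrite lee_fin mulr_ile1//.
  - by apply: prodr_ge0.
  - by apply: prodr_ge0 => j _; exact: expN_ge0.
  - by apply: prodr_ile1 => j _; rewrite indicE; case: (_ \in _); rewrite ?ler01 ?lexx.
  - apply: prodr_ile1 => j _; rewrite expN_ge0 expN_le1//.
    by rewrite mule_ge0// lee_fin.
have lap w : (0 < w)%R -> \int[P]_t ((g t)%:E * (expN (w%:E * N t (A i)))%:E) =
    \int[P]_t (C * (expN (w%:E * N t (A i)))%:E).
  move=> w0; pose v' j := if j == i then w else v j.
  have v'0 j : (0 <= v' j)%R by rewrite /v'; case: ifP => // _; exact: ltW.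
  have is2 : i \notin s2 by move: us; rewrite /= mem_cat negb_or => /andP[/andP[]].
  have vv j : j \in s2 -> v' j = v j.
    by move=> js; rewrite /v'; case: eqP => // ji; move: is2; rewrite -ji js.
  have := IH (i :: s2) v' v'0 us2.
  rewrite [in X in _ = _ * X]big_cons {2}/v' eqxx EFinM -laplace_set//; last exact: ltW.
  rewrite ge0_integralZl//; last 2 first.
  - by apply/measurable_EFinP; exact: mexpNA.
  - by move=> t _; rewrite lee_fin expN_ge0.
  rewrite [X in _ * (_ * X)%E](_ : _ = (\prod_(j <- s2) expN ((1 - expR (- v j))%:E * nu (A j)))%:E); last first.
    by congr EFin; apply: eq_big_seq => j js; rewrite vv.
  rewrite muleCA [in X in _ = X]muleC => <-; apply: eq_integral => t _.
  rewrite -EFinM; congr EFin; rewrite /g big_cons {1}/v' eqxx.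
  rewrite [RHS]mulrCA mulrC; congr (_ * (_ * _))%R.
  by apply: eq_big_seq => j js; rewrite vv.
have := @laplace_unique _ _ _ P _ (mNA (mA i)) (fun t => Nnat t (mA i))
  (fun t => (g t)%:E) (fun=> C) mg (@measurable_cst _ _ _ _ _ C).
move=> /(_ (fun t => g0 t) (fun=> C0)); rewrite Eg => /(_ Cfin).
have CE : C = \int[P]_t C.
  rewrite integral_cst// [X in _ * X](_ : _ = 1) ?mule1//; exact: probability_setT.
move=> /(_ CE lap _ (mB i)) h.
rewrite big_cons -muleA -/C muleC -integral_cst// -h [RHS]integral_mkcond.
apply: eq_integral => t _; rewrite patchE big_cons -mulrA -/(g t).
rewrite indicE; case: (boolP (_ \in (fun t => N t (A i)) @^-1` B i)) => [/set_mem h'|/negP h'].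
  by rewrite mem_set// mul1r.
by rewrite memNset ?mul0r// => h''; apply: h'; exact/mem_set.
Qed.

Theorem PRM_of_laplace : is_PRM P nu N.
Proof.
have pois A (mA : measurable A) := poisson_of_laplace (mNA mA) (fun t => Nnat t mA)
  (measure_ge0 nu A) (fun v v0 => laplace_set mA (ltW v0)).
split=> //.
- by move=> A mA Afin n; exact: (pois A mA).1.
- by move=> A mA Ainf; exact: (pois A mA).2.
move=> n A mA tA D E FE.
have {}FE i : {B | measurable B & E i = [set t | B (N t (A i))]}.
  by apply: cid2; have [B mB <-] := FE i; exists B => //; rewrite setTI.
pose B i := s2val (FE i).
have mB i : measurable (B i) by exact: (s2valP (FE i)).
have EB i : E i = [set t | B i (N t (A i))] by exact: (s2valP' (FE i)).
have := @laplace_replace _ A B mA mB tA (enum D) [::] (fun=> 0%R) (fun=> lexx _).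
rewrite cats0 enum_uniq => /(_ isT); rewrite big_nil mule1 big_enum/=.
under [in X in _ = X -> _]eq_bigr do rewrite -EB.
move=> <-; rewrite -[LHS]mul1e -integral_cst//; last first.
  apply: fin_bigcap_measurable => // i _; rewrite EB.
  exact: (preimage_measurable (mNA (mA i))).
rewrite integral_mkcond; apply: eq_integral => t _.
rewrite big_nil mulr1 patchE.
case: (boolP (t \in _)) => [/set_mem h|/negP h].
  rewrite big1_seq// => i; rewrite mem_enum /= => iD.
  by have := h i iD; rewrite EB /= indicE => Bi; rewrite mem_set.
suff -> : (\prod_(i <- enum D) \1_(B i) (N t (A i)) = 0 :> R)%R by [].
have /existsNP[i /not_implyP[iD nE]] : ~ (forall i, i \in D -> E i t).
  by move=> h'; apply: h; rewrite inE => i; exact: h'.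
rewrite (big_rem i) ?mem_enum//= indicE memNset ?mul0r//.
by move: nE; rewrite EB.
Qed.

End PRM_of_laplace.

Section unselected.
Context (R : realType) (q M : nat).
Local Notation mark := {ffun 'I_M.+1 -> q.-tuple bool}.

(* no feature is drawn by the first [M] of the [M.+1] draws *)
Definition unselected (m : mark) : bool :=
  [forall i : 'I_M, m (widen_ord (leqnSn M) i) == one_hot None].

(** The sum over the marks factorizes over the draws: each of the first [M] is forced to be the zero
    vector, of probability [1 - tot p], and the last one is free. *)
Lemma sum_mark_unselected (p : q.-tuple R) (h : q.-tuple bool -> R) :
  (\sum_m mark_weight p m * (if unselected m then h (m ord_max) else 0) =
   \1_(simplex R q) p * (1 - tot p) ^+ M * \sum_b mpmf p b * h b)%R.
Proof.
pose G (i : 'I_M.+1) b : R := (mpmf p b *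
  (if i == ord_max then h b else (b == one_hot None)%:R))%R.
transitivity (\1_(simplex R q) p * \sum_(m : mark) \prod_(i < M.+1) G i (m i))%R.
  rewrite mulr_sumr; apply: eq_bigr => m _; rewrite /mark_weight -mulrA; congr (_ * _)%R.
  rewrite big_split/=; congr (_ * _)%R.
  rewrite big_ord_recr/= eqxx; case: ifPn => [/forallP un|/forallPn[i ni]].
    rewrite big1 ?mul1r// => i _; have /eqP -> := un i.
    by rewrite eqxx; case: eqP => // /(congr1 val)/= E; have := ltn_ord i; rewrite E ltnn.
  rewrite (bigD1 i)//= (negbTE ni) ifF ?mul0r//.
  by apply/eqP => /(congr1 val)/= E; have := ltn_ord i; rewrite E ltnn.
rewrite -mulrA; congr (_ * _)%R.
rewrite -(bigA_distr_bigA (fun i b => G i b)) big_ord_recr/=; congr (_ * _)%R.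
  rewrite (eq_bigr (fun=> 1 - tot p)%R); first by rewrite prodr_const card_ord.
  move=> i _; rewrite (bigD1 (one_hot None))//= /G eqxx ifF; last first.
    by apply/eqP => /(congr1 val)/= E; have := ltn_ord i; rewrite E ltnn.
  rewrite mulr1 mpmf_one_hot big1 ?addr0// => b /negbTE ->.
  rewrite ifF ?mulr0//.
  by apply/eqP => /(congr1 val)/= E; have := ltn_ord i; rewrite E ltnn.
by apply: eq_bigr => b _; rewrite /G eqxx.
Qed.

End unselected.

Section thinning.
Context (R : realType) (q M : nat) dW (W : measurableType dW).
Local Notation V := (q.-tuple R).
Local Notation X := (V * W)%type.
Context d (T : measurableType d) (P : probability T R).
Local Notation mark := {ffun 'I_M.+1 -> q.-tuple bool}.
Variables (act : nat -> T -> bool) (p : nat -> T -> V) (omega : nat -> T -> W)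
  (b : 'I_M.+1 -> nat -> T -> q.-tuple bool).

Let atom k t := (act k t, (p k t, omega k t)).
Let marks k t : mark := [ffun i => b i k t].

Hypothesis matom : forall k, measurable_fun setT (atom k).
Hypothesis mb : forall i k, measurable_fun setT (b i k).
Hypothesis condb : forall (m : nat) (beta : 'I_M.+1 -> 'I_m -> q.-tuple bool),
  cond_prob P (sigma_of_family atom)
    [set t | forall i (k : 'I_m), act k t -> b i k t = beta i k]
    (fun t => (\prod_(i < M.+1) \prod_(k < m | act k t) mpmf (p k t) (beta i k))%:E).
Hypothesis simplexp : {ae P, forall t, forall k, act k t -> simplex R q (p k t)}.
Variables (nu nuM : {measure set X -> \bar R}) (N : T -> rmeasure X R).
Hypothesis prmN : is_PRM P nu N.
Hypothesis NE : forall t A, measurable A ->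
  N t A = \sum_(0 <= k <oo | act k t) \d_(p k t, omega k t) A.
Hypothesis nu_simplex : nu (~` simplex R q `*` setT) = 0.
Hypothesis nuME : forall f, measurable_fun setT f -> (forall x, 0 <= f x) ->
  \int[nuM]_x f x =
  \int[nu]_x (f x * (\1_(simplex R q) x.1 * (1 - tot x.1) ^+ M)%:E).

Definition thin k t : bool := act k t && unselected (marks k t).

Definition thinned t : rmeasure X R :=
  atoms_measure R (thin ^~ t) (fun k => (p k t, omega k t)).

Definition thinned_draw t : q.-tuple (rmeasure W R) :=
  [tuple atoms_measure R (fun k => thin k t && tnth (b ord_max k t) j)
     (omega ^~ t) | j < q].

Let measurable_px k : measurable_fun setT (fun t => (p k t, omega k t)).
Proof. exact: (measurableT_comp measurable_snd (matom k)). Qed.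

Let measurable_act k : measurable_fun setT (act k).
Proof. exact: (measurableT_comp measurable_fst (matom k)). Qed.

Lemma thin_seriesE (f : nat -> \bar R) t :
  \sum_(0 <= k <oo | thin k t) f k =
  \sum_(0 <= k <oo | act k t) (if unselected (marks k t) then f k else 0).
Proof.
rewrite eseries_mkcond [RHS]eseries_mkcond; apply: eq_eseriesr => k _.
by rewrite /thin; case: (act k t); case: (unselected _).
Qed.

Lemma measurable_thinned : measurable_fun setT thinned.
Proof.
apply: measurable_fun_rmeasure => A mA.
rewrite (_ : (fun t => _) = (fun t => \sum_(0 <= k <oo | act k t)
    (if unselected (marks k t) then \d_(p k t, omega k t) A else 0))); last first.
  by apply/funext => t; rewrite atoms_measureE thin_seriesE.
apply: (measurable_cond_series matom) => [k|k t]; last by case: ifP.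
apply: (measurable_mark_eval matom mb
  (f := fun x m => if unselected m then \d_x A else 0)) => m.
case: (unselected m) => //.
rewrite (_ : (fun x => _) = (fun x => (\1_A x)%:E)); last first.
  by apply/funext => x; rewrite diracE indicE.
by apply/measurable_EFinP; exact: measurable_indic.
Qed.

(** The thinned measure is integrated by giving the value 0 to selected marks; summing over the
    marks then turns [nu] into the tilted intensity. *)
Lemma thinned_laplace g : measurable_fun setT g -> (forall x, 0 <= g x) ->
  \int[P]_t (expN (\int[thinned t]_x g x))%:E =
  (expN (\int[nuM]_x (1 - expN (g x))%:E))%:E.
Proof.
move=> mg g0; pose f x (m : mark) := if unselected m then g x else 0.
have f0 x m : 0 <= f x m by rewrite /f; case: ifP.
have mf m : measurable_fun setT (f ^~ m) by rewrite /f; case: (unselected m).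
transitivity (\int[P]_t (expN (\sum_(0 <= k <oo | act k t)
    f (p k t, omega k t) (marks k t)))%:E).
  apply: eq_integral => t _; congr (expN _)%:E.
  rewrite (@integral_atoms _ _ _ _ _ _ thin p omega thinned)//.
    exact: thin_seriesE.
  by move=> u A mA; rewrite atoms_measureE.
rewrite (marked_laplace matom mb condb simplexp prmN NE nu_simplex mf f0).
congr (expN _)%:E; rewrite nuME; last 2 first.
- apply/measurable_EFinP; apply: measurable_funB => //.
  by apply: measurableT_comp => //; exact: measurable_expN.
- by move=> x; rewrite lee_fin subr_ge0 expN_le1.
apply: eq_integral => x _; rewrite -EFinM; congr EFin.
have := sum_mark_unselected M x.1 (fun=> (1 - expN (g x))%R).
rewrite -mulr_suml sum_mpmf1 mul1r mulrC => <-.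
apply: eq_bigr => m _; rewrite /f; case: ifP => // _.
by rewrite expN0 subrr.
Qed.

Theorem thinned_PRM : is_PRM P nuM thinned.
Proof.
apply: PRM_of_laplace; first exact: measurable_thinned.
  by move=> t A mA; rewrite atoms_measureE; exact: count_valued_dirac_series.
exact: thinned_laplace.
Qed.

Let atom' k t := (thin k t, (p k t, omega k t)).

Lemma measurable_thin k : measurable_fun setT (thin k).
Proof.
apply: measurable_and => //.
apply: (measurable_fun_bool true); rewrite setTI.
rewrite (_ : _ @^-1` _ = \bigcup_(m in [set m | unselected m]) [set t | marks k t = m]).
  apply: fin_bigcup_measurable => // m _.
  rewrite (_ : [set t | _] = \bigcap_(i in [set: 'I_M.+1]) (b i k @^-1` [set m i])).
    apply: fin_bigcap_measurable => // i _.
    by apply: preimage_measurable => //; exact: measurable_set1_bits.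
  apply/seteqP; split => [t <- i _ /=|t h]; first by rewrite ffunE.
  by apply/ffunP => i; rewrite ffunE; exact: (h i I).
apply/seteqP; split => [t /= h|t [m /= um tm]]; first by exists (marks k t).
by rewrite /= tm.
Qed.

Lemma measurable_thinned_atom k : measurable_fun setT (atom' k).
Proof. by apply/measurable_fun_pairP; split; [exact: measurable_thin|exact: measurable_px]. Qed.

Section conditional_marks.
Variables (m0 : nat) (beta : 'I_m0 -> q.-tuple bool).

Let ev := [set t | forall k : 'I_m0, thin k t -> b ord_max k t = beta k].
(** Extended by 1 to all indices from [m0] on, so that products over ranges of different lengths can
    be identified. *)
Let wt (x : V) (k : nat) : R :=
  if insub k is Some k' then (\1_(simplex R q) x * mpmf x (beta k'))%R else 1%R.
Let hit (c : q.-tuple bool) (k : nat) : R :=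
  if insub k is Some k' then ((c == beta k')%:R)%R else 1%R.

Let wt_ge0 x k : (0 <= wt x k)%R.
Proof.
rewrite /wt; case: insubP => [k' _ _|_ //].
rewrite indicE; case: (boolP (x \in _)) => [/set_mem sx|_]; last by rewrite mul0r.
by rewrite mul1r mpmf_ge0.
Qed.

Let measurable_wt k : measurable_fun setT (wt ^~ k).
Proof.
rewrite /wt; case: insubP => [k' _ _|_]; last exact: measurable_cst.
apply: measurable_funM; last exact: measurable_mpmf.
by apply: measurable_indic; exact: measurable_simplex.
Qed.

(** A pi-system generating the sigma-algebra of the thinned atoms. *)
Let cylinders : set_system T :=
  [set A | exists (r : nat) (B : nat -> set (bool * X)), (forall k, measurable (B k)) /\
     A = [set t | forall k, (k < r)%N -> B k (atom' k t)]].

(** The factor of the [k]-th atom: the cylinder condition on its thinned version, times [f] at its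
    last mark if the atom survives the thinning. *)
Let gen (f : X -> q.-tuple bool -> nat -> R) (B : nat -> set (bool * X)) k
    (ax : bool * X) (m : mark) : R :=
  (\1_(B k) (ax.1 && unselected m, ax.2) *
   (if ax.1 && unselected m then f ax.2 (m ord_max) k else 1))%R.

Let avg r (f : X -> q.-tuple bool -> nat -> R) B :
  (forall k, measurable (B k)) -> (forall c k, measurable_fun setT (fun x => f x c k)) ->
  (forall x c k, (0 <= f x c k)%R) ->
  \int[P]_t (\prod_(k < r) gen f B k (atom k t) (marks k t))%:E =
  \int[P]_t (\prod_(k < r) (if act k t then
     \sum_m mark_weight (p k t) m * gen f B k (atom k t) m
   else gen f B k (atom k t) [ffun=> one_hot None]))%R%:E.
Proof.
move=> mB mf f0; have := @integral_prod_marks _ _ _ _ _ _ _ _ _ _ _ _ matom mb condb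
  simplexp r (gen f B) [ffun=> one_hot None]; apply.
- move=> k m; apply: measurable_funM.
    have mh : measurable_fun setT (fun ax : bool * X => (ax.1 && unselected m, ax.2)).
      apply/measurable_fun_pairP; split; last exact: measurable_snd.
      by apply: measurable_and => //; exact: measurable_fst.
    exact: (measurableT_comp (measurable_indic (mB k)) mh).
  apply: measurable_fun_ifT => //.
    by apply: measurable_and => //; exact: measurable_fst.
  exact: (measurableT_comp (mf _ k) measurable_snd).
- by move=> k x m; rewrite mulr_ge0//; case: ifP => //.
- by move=> k x m.
Qed.

(** Both sides are means of products whose factors depend on one atom and its marks each; averaging
    the marks out reduces the claim to an identity at each atom. *)
Let cyl_eq A : cylinders A ->
  P (A `&` ev) = \int[P]_(t in A) (\prod_(k < m0 | thin k t) wt (p k t) k)%:E.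
Proof.
move=> [r [B [mB AE]]].
pose B' k := if (k < r)%N then B k else setT.
have mB' k : measurable (B' k) by rewrite /B'; case: ifP.
(* A common length for the cylinder condition and the product over the marks; both are padded
   trivially up to it. *)
pose r' := maxn r m0.
have {}AE : A = [set t | forall k, (k < r')%N -> B' k (atom' k t)].
  rewrite AE; apply/seteqP; split => [t h k _|t h k kr].
    by rewrite /B'; case: ifP => [/h|].
  by have := h k (leq_trans kr (leq_maxl _ _)); rewrite /B' kr.
have mA : measurable A.
  rewrite AE (_ : [set t | _] = \bigcap_(k in `I_r') (atom' k @^-1` B' k))//.
  apply: bigcap_measurableType => k _.
  by apply: preimage_measurable => //; exact: measurable_thinned_atom.
have mev : measurable ev.
  rewrite (_ : ev = \bigcap_(k in [set: 'I_m0]) ((thin k @^-1` [set false]) `|`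
      (b ord_max k @^-1` [set beta k]))).
    apply: fin_bigcap_measurable => // k _; apply: measurableU.
      by apply: preimage_measurable => //; exact: measurable_thin.
    by apply: preimage_measurable => //; exact: measurable_set1_bits.
  apply/seteqP; split => [t h k _|t h k kt].
    by case kt: (thin k t); [right; exact: h|left].
  by have [/=|//] := h k I; rewrite kt.
have indA t : \1_A t = (\prod_(k < r') \1_(B' k) (atom' k t))%R :> R.
  rewrite indicE; case: (boolP (t \in A)) => [/set_mem|/negP nA].
    by rewrite AE => h; rewrite big1// => k _; rewrite indicE mem_set//; exact: h.
  have /existsNP[k /not_implyP[kr nB]] : ~ (forall k, (k < r')%N -> B' k (atom' k t)).
    by move=> h; apply: nA; rewrite inE AE.
  by rewrite (bigD1 (Ordinal kr))//= indicE memNset// mul0r.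
have restr (F : nat -> R) : (forall k, (m0 <= k)%N -> F k = 1%R) ->
    (\prod_(k < m0) F k = \prod_(k < r') F k)%R.
  move=> F1; rewrite -(big_mkord xpredT F) -(big_mkord xpredT F).
  rewrite [RHS](@big_cat_nat _ _ _ m0)//= ?leq_maxr// [X in _ = (_ * X)%R]big1_seq ?mulr1//.
  by move=> k /andP[_]; rewrite mem_index_iota => /andP[k0 _]; exact: F1.
have lhs : P (A `&` ev) =
    \int[P]_t (\prod_(k < r') gen (fun _ c k => hit c k) B' k (atom k t) (marks k t))%:E.
  rewrite -(setIT (A `&` ev)) -integral_indic//; last exact: measurableI.
  apply: eq_integral => t _; congr EFin.
  rewrite /gen big_split/= -indA -(restr (fun k => if thin k t then hit (marks k t ord_max) k else 1%R)).
    rewrite !indicE in_setI -mulnb natrM; congr (_ * _)%R.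
    case: (boolP (t \in ev)) => [/set_mem evt|/negP nev].
      rewrite big1// => k _; case: ifP => // kt; rewrite /hit valK ffunE.
      by rewrite (evt k kt) eqxx.
    have /existsNP[k /not_implyP[kt nb]] : ~ (forall k : 'I_m0, thin k t -> b ord_max k t = beta k).
      by move=> h; apply: nev; rewrite inE.
    by rewrite (bigD1 k)//= kt /hit valK ffunE (introF eqP nb) mul0r.
  by move=> k k0; case: ifP => // _; rewrite /hit insubF// ltnNge k0.
rewrite lhs avg//; last first.
  by move=> x c k; rewrite /hit; case: insubP.
have -> : \int[P]_(t in A) (\prod_(k < m0 | thin k t) wt (p k t) k)%:E =
    \int[P]_t (\prod_(k < r') gen (fun x _ k => wt x.1 k) B' k (atom k t) (marks k t))%:E.
  rewrite integral_mkcond; apply: eq_integral => t _; rewrite patchE.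
  rewrite [X in (if _ then X else _)](_ : _ = (\prod_(k < r') (if thin k t then wt (p k t) k else 1))%R%:E); last first.
    congr EFin; rewrite big_mkcond/=.
    apply: (restr (fun k => if thin k t then wt (p k t) k else 1%R)).
    by move=> k k0; case: ifP => // _; rewrite /wt insubF// ltnNge k0.
  rewrite /gen big_split/= -indA indicE.
  by case: (t \in A); rewrite ?mul1r ?mul0r.
rewrite avg//; last first.
  by move=> c k; exact: (measurableT_comp (measurable_wt k) measurable_fst).
apply: eq_integral => t _; congr EFin; apply: eq_bigr => k _.
case akt : (act k t); last by rewrite /gen /atom akt/=.
(* A selected atom is removed by the thinning and contributes equally to both sides. On unselected
   marks the last draw is summed freely, which leaves its probability at [beta k]. *)
have split (h : mark -> R) : (\sum_m mark_weight (p k t) m * h m =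
    \sum_m mark_weight (p k t) m * (if unselected m then h m else 0) +
    \sum_m mark_weight (p k t) m * (if unselected m then 0 else h m))%R.
  rewrite -big_split/=; apply: eq_bigr => m _.
  by case: ifP => _; rewrite mulr0 ?addr0 ?add0r.
rewrite split [RHS]split; congr (_ + _)%R; last first.
  by apply: eq_bigr => m _; rewrite /gen /atom akt/=; case: (unselected m).
pose c0 : R := \1_(B' k) (true, (p k t, omega k t)).
transitivity (c0 * (\sum_(m : mark) mark_weight (p k t) m *
    (if unselected m then hit (m ord_max) k else 0)))%R.
  rewrite mulr_sumr; apply: eq_bigr => m _; rewrite /gen /atom akt/=.
  by case: (unselected m) => /=; rewrite ?mulr0// mulrCA.
transitivity (c0 * (\sum_(m : mark) mark_weight (p k t) m *
    (if unselected m then wt (p k t) k else 0)))%R; last first.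
  rewrite mulr_sumr; apply: eq_bigr => m _; rewrite /gen /atom akt/=.
  by case: (unselected m) => /=; rewrite ?mulr0// mulrCA.
congr (_ * _)%R; rewrite (sum_mark_unselected _ _ (fun c => hit c k)).
rewrite (sum_mark_unselected _ _ (fun=> wt (p k t) k)) -mulr_suml sum_mpmf1 mul1r.
rewrite /hit /wt; case: insubP => [k' _ _|_]; last first.
  by rewrite mulr1; under eq_bigr do rewrite mulr1; rewrite sum_mpmf1 mulr1.
rewrite (bigD1 (beta k'))//= eqxx mulr1 big1 ?addr0; last first.
  by move=> c /negbTE ->; rewrite mulr0.
by rewrite indicE; case: (_ \in _); rewrite ?mul0r// !mul1r.
Qed.

Let F' := sigma_of_family atom'.
Let TF := g_sigma_algebraType (\bigcup_k sigma_of (atom' k)).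

Let F'_measurable A : F' A -> measurable A.
Proof.
move: A; apply: smallest_sub; first exact: sigma_algebra_measurable.
move=> _ [k _ [B mB <-]]; rewrite setTI; apply: preimage_measurable => //.
exact: measurable_thinned_atom.
Qed.

Let cylindersI : setI_closed cylinders.
Proof.
move=> _ _ [r1 [B1 [mB1 ->]]] [r2 [B2 [mB2 ->]]].
exists (maxn r1 r2), (fun k => (if (k < r1)%N then B1 k else setT) `&`
  (if (k < r2)%N then B2 k else setT)); split.
  by move=> k; apply: measurableI; case: ifP.
apply/seteqP; split => [t [h1 h2] k _|t h].
  by split; case: ifP => // kr; [exact: h1|exact: h2].
split => k kr.
  by have [] := h k (leq_trans kr (leq_maxl _ _)); rewrite kr.
by have [_] := h k (leq_trans kr (leq_maxr _ _)); rewrite kr.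
Qed.

Let F'_cylinders A : F' A -> <<s cylinders >> A.
Proof.
apply: sub_smallest2r; first exact: smallest_sigma_algebra.
move=> _ [k _ [B mB <-]]; rewrite setTI.
exists k.+1, (fun l => if l == k then B else setT); split.
  by move=> l; case: ifP.
apply/seteqP; split => [t Bt l _|t h]; first by case: eqP => [->|].
by have := h k (ltnSn k); rewrite eqxx.
Qed.

Let cylinders_measurable : cylinders `<=` measurable.
Proof.
move=> _ [r [B [mB ->]]].
rewrite (_ : [set t | _] = \bigcap_(k in `I_r) (atom' k @^-1` B k))//.
apply: bigcap_measurableType => k _.
by apply: preimage_measurable => //; exact: measurable_thinned_atom.
Qed.

Let measurable_ev : measurable ev.
Proof.
rewrite (_ : ev = \bigcap_(k in [set: 'I_m0]) ((thin k @^-1` [set false]) `|`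
    (b ord_max k @^-1` [set beta k]))).
  apply: fin_bigcap_measurable => // k _; apply: measurableU.
    by apply: preimage_measurable => //; exact: measurable_thin.
  by apply: preimage_measurable => //; exact: measurable_set1_bits.
apply/seteqP; split => [t h k _|t h k kt].
  by case kt: (thin k t); [right; exact: h|left].
by have [/=|//] := h k I; rewrite kt.
Qed.

Let dens_wt t : \bar R := (\prod_(k < m0 | thin k t) wt (p k t) k)%:E.

Let measurable_dens_wt : measurable_fun setT dens_wt.
Proof.
apply/measurable_EFinP; under eq_fun do rewrite big_mkcond/=.
apply: measurable_prod => k _; apply: measurable_fun_ifT => //.
  exact: measurable_thin.
apply: (measurableT_comp (measurable_wt k)).
exact: (measurableT_comp measurable_fst (measurable_px k)).
Qed.

Let dens_wt_ge0 t : 0 <= dens_wt t.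
Proof. by rewrite lee_fin prodr_ge0. Qed.

(** Conditioning is on the thinned atoms, whose activity depends on the first [M] marks. Given the
    atoms these are independent of the last mark, which thus keeps its law. Uniqueness of finite
    measures on a pi-system extends the identity from the cylinders. *)
Lemma thinned_cond_prob :
  cond_prob P (sigma_of_family atom') ev
    (fun t => (\prod_(k < m0 | thin k t) mpmf (p k t) (beta k))%:E).
Proof.
have matomF k : measurable_fun setT (atom' k : TF -> bool * X).
  move=> _ B mB; rewrite setTI; apply: sub_sigma_algebra.
  by exists k => //; exists B => //; rewrite setTI.
have mF : measurable_fun setT (fun t : TF =>
    (\prod_(k < m0 | thin k t) mpmf (p k t) (beta k))%:E).
  apply/measurable_EFinP; apply: (eq_measurable_fun (fun t : TF =>
      \prod_(k < m0) (if thin k t then mpmf (p k t) (beta k) else 1))%R).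
    by move=> t _; rewrite [RHS]big_mkcond.
  apply: measurable_prod => k _; apply: measurable_fun_ifT => //.
    exact: (measurableT_comp measurable_fst (matomF k)).
  apply: (measurableT_comp (@measurable_mpmf R q (beta k))).
  exact: (measurableT_comp measurable_fst (measurableT_comp measurable_snd (matomF k))).
split => [U mU|A FA]; first by have := mF measurableT U mU; rewrite setTI.
have mA := F'_measurable FA.
transitivity (\int[P]_(t in A) dens_wt t); last first.
  apply: ae_eq_integral => //.
  - exact: measurable_funTS.
  - move=> _ B mB; apply: measurableI => //; apply: F'_measurable.
    by have := mF measurableT B mB; rewrite setTI.
  apply: filterS simplexp => t sp _; congr EFin; apply: eq_bigr => k /andP[akt _].
  rewrite /wt valK indicE mem_set ?mul1r//; exact: sp.
pose m2 := mdens P measurable_dens_wt dens_wt_ge0.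
have := @g_sigma_algebra_measure_unique _ R T cylinders cylinders_measurable (fun=> setT)
  _ _ (mrestr P measurable_ev) m2 cylindersI.
apply => //.
- by move=> _; exists 0%N, (fun=> setT); split => //; apply/seteqP; split.
- by apply/seteqP; split => // t _; exists 0%N.
- move=> _; apply: (@le_lt_trans _ _ (P setT)); last by rewrite probability_setT ltry.
  by apply: le_measure; rewrite ?inE//; exact: measurableI.
- exact: F'_cylinders.
Qed.

End conditional_marks.

End thinning.

Lemma ge0_integral_law (R : realType) d d' (T : measurableType d) (X : measurableType d')
    (P : {measure set T -> \bar R}) (m : {measure set X -> \bar R}) (f : T -> X) :
  measurable_fun setT f -> (forall B, measurable B -> P (f @^-1` B) = m B) ->
  forall h : X -> \bar R, measurable_fun setT h -> (forall x, 0 <= h x) ->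
  forall A, measurable A -> \int[P]_(t in f @^-1` A) h (f t) = \int[m]_(x in A) h x.
Proof.
move=> mf law h mh h0 A mA; rewrite -(ge0_integral_pushforward mf)//.
  by apply: eq_measure_integral => B mB _; exact: law.
exact: measurable_funTS.
Qed.

(** * Construction of the predictive model *)

Section product_model.
Context (R : realType) d (T : measurableType d) (P : probability T R).
Context dS (S : measurableType dS).

(* an extension of the probability space carrying independent variables with
   prescribed laws *)
Record extension d' (T' : measurableType d') (P' : probability T' R) (K : nat)
    (mu : 'I_K -> probability S R) (phi : T' -> T) (xi : 'I_K -> T' -> S) : Prop := {
  ext_phi : measurable_fun setT phi ;
  ext_xi : forall l, measurable_fun setT (xi l) ;
  ext_law : forall B (C : 'I_K -> set S), measurable B -> (forall l, measurable (C l)) ->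
    P' (phi @^-1` B `&` [set t | forall l, C l (xi l t)]) = P B * \prod_(l < K) mu l (C l) }.

(** Each variable adjoins one factor to a product, so the space and its display change with [K];
    hence the existential quantification over both. *)
Lemma extension_exists K (mu : 'I_K -> probability S R) :
  exists d' (T' : measurableType d') (P' : probability T' R) phi xi,
    extension P' mu phi xi.
Proof.
elim: K mu => [|K IH] mu.
  exists d, T, P, id, (fun (l : 'I_0) _ => (match l with Ordinal m h => False_rect S (notF h) end)).
  split; [exact: measurable_id|by move=> l; case: l|].
  move=> B C mB _; rewrite big_ord0 mule1; congr (P _).
  by apply/seteqP; split => [t []//|t Bt]; split => // -[].
have [d' [T' [P' [phi [xi [mphi mxi law]]]]]] := IH (fun l => mu (widen_ord (leqnSn K) l)).
pose xi' (l : 'I_K.+1) (ts : T' * S) : S :=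
  if unlift ord_max l is Some l' then xi l' ts.1 else ts.2.
have xi'w (l : 'I_K) : xi' (widen_ord (leqnSn K) l) = fun ts => xi l ts.1.
  rewrite /xi' (_ : widen_ord _ _ = lift ord_max l) ?liftK//.
  by apply: val_inj => /=; rewrite /bump leqNgt ltn_ord.
have xi'm : xi' ord_max = snd by rewrite /xi' unlift_none.
exists _, (T' * S)%type, (P' \x mu ord_max), (phi \o fst), xi'; split.
- exact: (measurableT_comp mphi measurable_fst).
- move=> l; rewrite /xi'; case: (unlift _ _) => [l'|]; last exact: measurable_snd.
  exact: (measurableT_comp (mxi l') measurable_fst).
move=> B C mB mC.
rewrite (_ : _ `&` _ = (phi @^-1` B `&`
    [set t | forall l : 'I_K, C (widen_ord (leqnSn K) l) (xi l t)]) `*` C ord_max).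
  set E1 := _ `&` _; transitivity (P' E1 * mu ord_max (C ord_max)).
    apply: product_measure1E => //.
    apply: measurableI; first exact: preimage_measurable.
    rewrite (_ : [set t | _] = \bigcap_(l in [set: 'I_K]) (xi l @^-1` C (widen_ord (leqnSn K) l))).
      by apply: fin_bigcap_measurable => // l _; exact: preimage_measurable.
    by apply/seteqP; split => [t h l _|t h l]; [exact: h|exact: (h l I)].
  by rewrite big_ord_recr/= muleA -law.
apply/seteqP; split => [[t s] [Bt h]|[t s] [[Bt h] Cs]].
  split; last by have := h ord_max; rewrite xi'm.
  by split => // l; have := h (widen_ord (leqnSn K) l); rewrite xi'w.
split => // l; case: (unliftP ord_max l) => [l' ->|->]; last by rewrite xi'm.
have -> : lift ord_max l' = widen_ord (leqnSn K) l'.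
  by apply: val_inj => /=; rewrite /bump leqNgt ltn_ord.
by rewrite xi'w; exact: h.
Qed.

Section extension_theory.
Context d' (T' : measurableType d') (P' : probability T' R) (K : nat)
    (mu : 'I_K -> probability S R) (phi : T' -> T) (xi : 'I_K -> T' -> S).
Hypothesis ext : extension P' mu phi xi.

Lemma ext_phiE B : measurable B -> P' (phi @^-1` B) = P B.
Proof.
move=> mB; have := ext_law ext mB (fun=> measurableT).
rewrite big1 ?mule1 => [<-|l _]; last exact: probability_setT.
by congr (P' _); apply/seteqP; split => [t Bt|t []].
Qed.

Lemma ext_xiE l C : measurable C -> P' (xi l @^-1` C) = mu l C.
Proof.
move=> mC.
have := @ext_law _ _ _ _ _ _ _ ext setT (fun k => if k == l then C else setT) measurableT.
rewrite probability_setT mul1e (bigD1 l)//= eqxx big1 ?mule1 => [|k /negbTE ->]; last first.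
  exact: probability_setT.
move=> <-; last by move=> k; case: ifP.
congr (P' _); apply/seteqP; split => [t Ct|t [_ /(_ l)]]; last by rewrite eqxx.
by split => // k; case: eqP => // ->.
Qed.

Lemma ext_indep (F : option 'I_K -> set_system T') :
  (forall A, F None A -> exists2 B, measurable B & A = phi @^-1` B) ->
  (forall l A, F (Some l) A -> exists2 C, measurable C & A = xi l @^-1` C) ->
  mutual_indep P' F.
Proof.
move=> FN FS D A FA.
have [B0 mB0 AN] := FN _ (FA None).
have /choice[C0 HC] : forall l, exists C, measurable C /\ A (Some l) = xi l @^-1` C.
  by move=> l; have [C mC e] := FS l _ (FA (Some l)); exists C.
pose B := if None \in D then B0 else setT.
pose C l := if Some l \in D then C0 l else setT.
have mB : measurable B by rewrite /B; case: ifP.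
have mC l : measurable (C l) by rewrite /C; case: ifP => // _; exact: (HC l).1.
transitivity (P' (phi @^-1` B `&` [set t | forall l, C l (xi l t)])).
  congr (P' _); apply/seteqP; split => [t h|t [h1 h2]].
    split; first by rewrite /B; case: ifPn => //= ND; have := h None ND; rewrite AN.
    move=> l; rewrite /C; case: ifPn => // lD.
    by have := h (Some l) lD; rewrite (HC l).2.
  case => [l|] oD; first by have := h2 l; rewrite /C oD (HC l).2.
  by move: h1; rewrite /B; move: oD => /= ->; rewrite AN.
rewrite (ext_law ext)//.
rewrite [RHS]big_mkcond/= (bigD1 None)//= /B; congr (_ * _).
  by case: ifP => _; [rewrite AN ext_phiE|rewrite probability_setT].
rewrite [RHS](reindex_omap Some id)//=; last by case.
rewrite [RHS](eq_bigl xpredT); last by move=> l /=; rewrite eqxx.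
apply: eq_bigr => l _; rewrite /C; case: ifP => _; last exact: probability_setT.
by rewrite (HC l).2 ext_xiE//; exact: (HC l).1.
Qed.

Let phi_pre dY (Y : measurableType dY) (f : T -> Y) A : measurable_fun setT f ->
  sigma_of (f \o phi) A -> exists2 B, sigma_of f B & A = phi @^-1` B.
Proof.
move=> mf [B mB <-]; exists (f @^-1` B); last by rewrite setTI.
by exists B => //; rewrite setTI.
Qed.

Lemma ext_PRM dX (X : measurableType dX) (nu : set X -> \bar R) (N : T -> rmeasure X R) :
  is_PRM P nu N -> is_PRM P' nu (N \o phi).
Proof.
move=> prmN; have mphi := ext_phi ext.
have mN A : measurable A -> measurable_fun setT (fun t => N t A).
  by move=> mA; exact: (measurableT_comp (measurable_rmeasure_ev mA) (prm_measurable prmN)).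
split.
- exact: (measurableT_comp (prm_measurable prmN) mphi).
- move=> A mA Afin n; rewrite -(prm_poisson prmN mA Afin) -ext_phiE//.
  exact: (preimage_measurable (mN A mA) (B := [set n%:R%:E])).
- move=> A mA Ainf; rewrite -(prm_infinite prmN mA Ainf) -ext_phiE//.
  exact: (preimage_measurable (mN A mA) (B := [set +oo])).
move=> n A mA tA D E FE.
have /choice[B HB] : forall i, exists B, sigma_of (fun t => N t (A i)) B /\ E i = phi @^-1` B.
  by move=> i; have [B sB EB] := phi_pre (mN _ (mA i)) (FE i); exists B.
have mB i : measurable (B i).
  by have [[C mC <-] _] := HB i; rewrite setTI; apply: preimage_measurable => //; exact: mN.
have := prm_indep prmN mA tA D (fun i => (HB i).1).
rewrite -ext_phiE; last first.
  by apply: fin_bigcap_measurable => //; exact: finite_finset.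
rewrite (_ : phi @^-1` _ = \bigcap_(i in [set` D]) E i); last first.
  by apply/seteqP; split => t h i iD; have := h i iD; rewrite (HB i).2.
by move=> ->; apply: eq_bigr => i _; rewrite (HB i).2 ext_phiE.
Qed.

Lemma ext_integral (g : T -> \bar R) A : measurable_fun setT g -> measurable A ->
  \int[P']_(t in phi @^-1` A) g (phi t) = \int[P]_(t in A) g t.
Proof.
have ge0 (h : T -> \bar R) : measurable_fun setT h -> (forall t, 0 <= h t) ->
    measurable A -> \int[P']_(t in phi @^-1` A) h (phi t) = \int[P]_(t in A) h t.
  by move=> mh h0 mA; apply: (ge0_integral_law (ext_phi ext) ext_phiE).
move=> mg mA; rewrite integralE [RHS]integralE; congr (_ - _).
- rewrite -(ge0 (g^\+)); [|exact: measurable_funepos|exact: funepos_ge0|by []].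
  by apply: eq_integral => x _; rewrite -[fun x0 => g (phi x0)]/(g \o phi) funepos_comp.
- rewrite -(ge0 (g^\-)); [|exact: measurable_funeneg|exact: funeneg_ge0|by []].
  by apply: eq_integral => x _; rewrite -[fun x0 => g (phi x0)]/(g \o phi) funeneg_comp.
Qed.

(** Every event generated by the lifted maps is the preimage of an event generated by the original
    ones, so the identity is carried over by the law of [phi]. *)
Lemma ext_cond_prob dY (Y : measurableType dY) (I : Type) (f : I -> T -> Y) B g :
  (forall k, measurable_fun setT (f k)) -> measurable B ->
  cond_prob P (sigma_of_family f) B g ->
  cond_prob P' (sigma_of_family (fun k => f k \o phi)) (phi @^-1` B) (g \o phi).
Proof.
move=> mf mB [mg Pg].
have mF A : sigma_of_family f A -> measurable A.
  move: A; apply: smallest_sub; first exact: sigma_algebra_measurable.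
  by move=> _ [k _ [C mC <-]]; rewrite setTI; exact: preimage_measurable.
have mgT : measurable_fun setT g.
  by move=> _ C mC; rewrite setTI; apply: mF; exact: mg.
have Fphi A : sigma_of_family f A -> sigma_of_family (fun k => f k \o phi) (phi @^-1` A).
  move: A; apply: smallest_sub.
    split.
    - by rewrite /= preimage_set0; exact: sigma_algebra0.
    - by move=> A hA; rewrite /= setTD preimage_setC; exact: sigma_algebraC.
    - by move=> C hC; rewrite /= preimage_bigcup; exact: sigma_algebra_bigcup.
  move=> _ [k _ [C mC <-]]; apply: sub_sigma_algebra.
  by exists k => //; exists C => //; rewrite !setTI.
split; first by move=> C mC; exact: Fphi (mg C mC).
have phiF A : sigma_of_family (fun k => f k \o phi) A ->
    exists2 C, sigma_of_family f C & A = phi @^-1` C.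
  move: A; apply: smallest_sub.
    split.
    - by exists set0; [exact: sigma_algebra0|rewrite preimage_set0].
    - move=> _ [C FC ->]; exists (~` C); first exact: sigma_algebraC.
      by rewrite setTD preimage_setC.
    - move=> G hG.
      have /choice[C HC] : forall n, exists C, sigma_of_family f C /\ G n = phi @^-1` C.
        by move=> n; have [C FC GC] := hG n; exists C.
      exists (\bigcup_n C n); first by apply: sigma_algebra_bigcup => n; exact: (HC n).1.
      by rewrite preimage_bigcup; apply: eq_bigcupr => n _; exact: (HC n).2.
  move=> _ [k _ [C mC <-]]; exists (f k @^-1` C); last by rewrite !setTI.
  by apply: sub_sigma_algebra; exists k => //; exists C => //; rewrite setTI.
move=> A /phiF[C FC ->]; rewrite ext_integral//; last exact: mF.
by rewrite -Pg// -ext_phiE//; apply: measurableI => //; exact: mF.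
Qed.

End extension_theory.

End product_model.

(** * Joint law of a jump and its bits *)

Section bits_law.
Context (R : realType) (q : nat).
Local Notation V := (q.-tuple R).
Local Notation bits := (q.-tuple bool).
Local Notation S := (simplex R q).

Lemma measurable_bits (B : set bits) : measurable B.
Proof.
rewrite (_ : B = \bigcup_(b in B) [set b]).
  by apply: fin_bigcup_measurable => // b _; exact: measurable_set1_bits.
by apply/seteqP; split => [b Bb|_ [b Bb ->]//]; exists b.
Qed.

(** Counting measure on the finitely many bit vectors, so that the joint law with a jump is an
    instance of [mmixture]. *)
Definition bits_counting : {measure set bits -> \bar R} :=
  msum (fun k => \d_(nth (one_hot None) (enum {: bits}) k)) (size (enum {: bits})).

Lemma integral_bits_counting (f : bits -> \bar R) : (forall b, 0 <= f b) ->
  \int[bits_counting]_b f b = \sum_(b : bits) f b.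
Proof.
move=> f0; have mf : measurable_fun setT f.
  by move=> _ B mB; exact: measurable_bits.
rewrite ge0_integral_measure_sum// -[RHS]big_enum (big_nth (one_hot None)) big_mkord.
by apply: eq_bigr => k _; rewrite integral_dirac// diracT mul1e.
Qed.

Variable J : {measure set V -> \bar R}.
Hypothesis Jin : J S = 1.
Hypothesis Jout : J (~` S) = 0.

Definition bits_density (b : bits) (s : V) : \bar R := (\1_S s * mpmf s b)%:E.

Lemma bits_density_ge0 b s : 0 <= bits_density b s.
Proof.
rewrite /bits_density indicE; case: (boolP (s \in S)) => [/set_mem ss|_].
  by rewrite mul1r lee_fin mpmf_ge0.
by rewrite mul0r.
Qed.

Lemma measurable_bits_density b : measurable_fun setT (bits_density b).
Proof.
apply/measurable_EFinP; apply: measurable_funM; last exact: measurable_mpmf.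
by apply: measurable_indic; exact: measurable_simplex.
Qed.

Let slice b := mdens J (measurable_bits_density b) (bits_density_ge0 b).

Let measurable_slice (A : set (V * bits)) : measurable A ->
  measurable_fun setT (fun b => slice b [set s | A (s, b)]).
Proof. by move=> mA _ B mB; exact: measurable_bits. Qed.

(* the law of [(s, b)] with [s] of law [J] and [b] of law [M(1, s)] given [s] *)
Definition bits_joint : set (V * bits) -> \bar R :=
  mmixture bits_counting measurable_slice.

HB.instance Definition _ := Measure.on bits_joint.

Lemma bits_jointE A : measurable A ->
  bits_joint A = \sum_b \int[J]_(s in [set s | A (s, b)]) bits_density b s.
Proof.
move=> mA; rewrite -[LHS]/(\int[bits_counting]_b slice b [set s | A (s, b)]).
by rewrite integral_bits_counting// => b; exact: measure_ge0.
Qed.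

Lemma sum_bits_density s : \sum_b bits_density b s = (\1_S s)%:E.
Proof. by rewrite sumEFin -mulr_sumr sum_mpmf1 mulr1. Qed.

Lemma bits_joint_fst A : measurable A -> bits_joint (A `*` setT) = J A.
Proof.
move=> mA; rewrite bits_jointE; last exact: measurableX.
rewrite (eq_bigr (fun b => \int[J]_(s in A) bits_density b s)); last first.
  move=> b _; congr (integral _ _ _); apply/seteqP; split => s /=; tauto.
rewrite -ge0_integral_sum//; last 2 first.
- by move=> b; apply: measurable_funTS; exact: measurable_bits_density.
- by move=> b s _; exact: bits_density_ge0.
under eq_integral do rewrite sum_bits_density.
have mS := @measurable_simplex R q.
rewrite integral_indic//; apply: measure_ae_set => //; first exact: measurableI.
exists (~` S); split; [exact: measurableC|exact: Jout|].
by move=> s /= h ss; apply: h; split => [[]|].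
Qed.

Lemma bits_jointT : bits_joint setT = 1.
Proof.
rewrite -setXTT bits_joint_fst// -Jin; apply: measure_ae_set => //.
  exact: measurable_simplex.
exists (~` S); split; [|exact: Jout|].
  by apply: measurableC; exact: measurable_simplex.
by move=> s /= h ss; apply: h; split.
Qed.

HB.instance Definition _ := Measure_isProbability.Build _ _ _ bits_joint bits_jointT.

Definition bits_joint_prob : probability (V * bits)%type R := bits_joint.

Lemma bits_joint_snd A b : measurable A ->
  bits_joint (A `*` [set b]) = \int[J]_(s in A) bits_density b s.
Proof.
move=> mA; rewrite bits_jointE; last first.
  by apply: measurableX => //; exact: measurable_set1_bits.
rewrite (bigD1 b)//= big1 ?adde0; last first.
  move=> c /eqP cb; rewrite (_ : [set s | _] = set0) ?integral_set0//.
  by apply/seteqP; split => // s [_].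
congr (integral _ _ _); apply/seteqP; split => s /=; first by case.
by move=> As; split.
Qed.

End bits_law.

Section draws_measurable.
Context (R : realType) (q : nat) (Omega : completePseudoMetricType R).
Local Notation V := (q.-tuple R).
Local Notation W := (borel Omega).

Lemma IBP_draws_measurable d (T : measurableType d) (P : probability T R)
    (N : T -> rmeasure (V * W)%type R) n (Z : 'I_n -> T -> q.-tuple (rmeasure W R)) :
  IBP_draws P N Z -> forall i, measurable_fun setT (Z i).
Proof.
move=> [act [p [omega [b [matom mb _ ZE _]]]]] i.
apply/measurable_fun_tnthP => j; apply: measurable_fun_rmeasure => A mA.
rewrite (_ : (fun t => _) = (fun t => \sum_(0 <= k <oo | act k t)
    (if tnth (b i k t) j then \d_(omega k t) A else 0))); last first.
  apply/funext => t /=; rewrite ZE// eseries_mkcond [RHS]eseries_mkcond.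
  by apply: eq_eseriesr => k _; case: (act k t); case: (tnth _ _).
apply: (measurable_cond_series matom) => [k|k t]; last by case: ifP.
apply: measurable_fun_ifT => //.
  exact: (measurableT_comp (measurable_tnth j) (mb i k)).
rewrite (_ : (fun t => _) = (fun t => (\1_A (omega k t))%:E)); last first.
  by apply/funext => t; rewrite diracE indicE.
apply/measurable_EFinP; apply: (measurableT_comp (measurable_indic mA)).
exact: (measurableT_comp measurable_snd (measurableT_comp measurable_snd (matom k))).
Qed.

End draws_measurable.

Section predictive_model.
Context (R : realType) (q M : nat) (Omega : completePseudoMetricType R).
Local Notation V := (q.-tuple R).
Local Notation W := (borel Omega).
Variables (rho : R.-sigmafker W ~> V) (B0 : probability W R).
Context d (T : measurableType d) (P : probability T R).
Variables (NM : T -> rmeasure (V * W)%type R) (Zt : T -> q.-tuple (rmeasure W R)).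
Hypothesis prmNM : is_PRM P (intensity (tilt M rho) B0) NM.
Hypothesis ibpZt : IBP_draws P NM (fun _ : 'I_1 => Zt).
Variables (K : nat) (w : 'I_K -> W) (c : 'I_K -> 'I_q -> nat).
Hypothesis kappa_gt0 : forall l, (0 < kappa M rho (c l) (w l))%R.

Let Jm l := jump_measure rho M (c l) (w l).
Let Jin l : Jm l (simplex R q) = 1 := jump_measure_in (kappa_gt0 l).
Let Jout l : Jm l (~` simplex R q) = 0 := jump_measure_out rho M (c l) (w l).
Let mu l := bits_joint_prob (Jin l) (Jout l).

Let cond_bits d' (T' : measurableType d') (P' : probability T' R) l
    (xi : T' -> V * q.-tuple bool) beta :
  measurable_fun setT xi -> (forall C, measurable C -> P' (xi @^-1` C) = mu l C) ->
  cond_prob P' (sigma_of (fst \o xi)) ((snd \o xi) @^-1` [set beta])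
    (fun t => (mpmf (xi t).1 beta)%:E).
Proof.
move=> mxi law; split.
  move=> U mU; exists ((fun s => (mpmf s beta)%:E) @^-1` U); last by rewrite setTI.
  apply: (preimage_measurable (f := fun s => (mpmf s beta)%:E)) => //.
  by apply/measurable_EFinP; exact: measurable_mpmf.
move=> _ [A mA <-]; rewrite setTI.
rewrite (_ : _ `&` _ = xi @^-1` (A `*` [set beta]))//.
rewrite law; last by apply: measurableX => //; exact: measurable_set1_bits.
rewrite [LHS](@bits_joint_snd _ _ (Jm l) _ beta mA).
have mfst : measurable_fun setT (fst \o xi) by exact: (measurableT_comp measurable_fst mxi).
have lawfst B : measurable B -> P' ((fst \o xi) @^-1` B) = Jm l B.
  move=> mB; rewrite -(bits_joint_fst (Jout l) mB) -[RHS]law; last exact: measurableX.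
  by congr (P' _); apply/seteqP; split => t /=; tauto.
rewrite -(ge0_integral_law mfst lawfst (measurable_bits_density beta)
  (bits_density_ge0 beta) mA).
apply: ae_eq_integral => //.
- exact: preimage_measurable.
- apply: measurable_funTS.
  exact: (measurableT_comp (measurable_bits_density beta) mfst).
- apply: measurable_funTS; apply/measurable_EFinP.
  exact: (measurableT_comp (measurable_mpmf _) mfst).
have mC : measurable (~` simplex R q) by apply: measurableC; exact: measurable_simplex.
exists ((fst \o xi) @^-1` (~` simplex R q)); split.
- exact: preimage_measurable.
- by rewrite [LHS]lawfst.
- move=> t /= h ss; apply: h => _; rewrite /bits_density indicE mem_set ?mul1r//.
Qed.

(** For each feature the extension carries a pair of law [mu l]; [J] and [b] are its two components.
    The measure [NM] and its draw are pulled back from the original space, so both independence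
    statements follow from that of the adjoined pairs. *)
Lemma predictive_parts_exist :
  exists d' (T' : measurableType d') (P' : probability T' R) NM' J Zt' b,
    predictive_parts M rho B0 w c P' NM' J Zt' b.
Proof.
have [d' [T' [P' [phi [xi ext]]]]] := extension_exists P mu.
have mxi l := ext_xi ext l; have mphi := ext_phi ext.
exists d', T', P', (NM \o phi), (fun l => fst \o xi l), (Zt \o phi), (fun l => snd \o xi l).
have mZt : measurable_fun setT Zt by exact: (IBP_draws_measurable ibpZt ord0).
split.
- split.
  + exact: (ext_PRM ext prmNM).
  + by move=> l; exact: (measurableT_comp measurable_fst (mxi l)).
  + move=> l A mA; rewrite -(jump_measureE (kappa_gt0 l) mA).
    rewrite -(bits_joint_fst (Jout l) mA) -[RHS](ext_xiE ext); last exact: measurableX.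
    by congr (P' _); apply/seteqP; split => t /=; tauto.
  + apply: (ext_indep ext) => [A [B mB <-]|l A [B mB <-]].
      exists (NM @^-1` B); last by rewrite setTI.
      by apply: preimage_measurable => //; exact: (prm_measurable prmNM).
    exists (fst @^-1` B); last by rewrite setTI.
    by apply: preimage_measurable => //; exact: measurable_fst.
- have [act [p [omega [b [matom mb NE ZE condb]]]]] := ibpZt.
  exists (fun k => act k \o phi), (fun k => p k \o phi), (fun k => omega k \o phi),
    (fun i k => b i k \o phi); split.
  + by move=> k; exact: (measurableT_comp (matom k) mphi).
  + by move=> i k; exact: (measurableT_comp (mb i k) mphi).
  + by move=> t A mA; exact: NE.
  + by move=> i j t A mA; exact: (ZE i j).
  + move=> m beta; apply: (ext_cond_prob ext matom _ (condb m beta)).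
    rewrite (_ : [set t | _] = \bigcap_(ik in [set: 'I_1 * 'I_m])
      ((act ik.2 @^-1` [set false]) `|` (b ik.1 ik.2 @^-1` [set beta ik.1 ik.2]))).
      apply: fin_bigcap_measurable => // ik _; apply: measurableU.
        by apply: preimage_measurable => //; exact: (measurableT_comp measurable_fst (matom ik.2)).
      by apply: preimage_measurable => //; exact: measurable_set1_bits.
    apply/seteqP; split => [t h [i k] _|t h i k akt].
      by case akt : (act k t); [right; exact: h|left].
    by have [/=|//] := h (i, k) I; rewrite akt.
- by move=> l; exact: (measurableT_comp measurable_snd (mxi l)).
- move=> l beta; apply: (@cond_bits _ _ _ l) => //.
  by move=> C mC; exact: (ext_xiE ext).
- apply: (ext_indep ext) => [A [B mB <-]|l A [B mB <-]].
    exists (Zt @^-1` B); last by rewrite setTI.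
    exact: preimage_measurable.
  exists (snd @^-1` B); last by rewrite setTI.
  by apply: preimage_measurable => //; exact: measurable_snd.
Qed.

End predictive_model.

(** * Laws of the posterior and predictive models *)

Section hits_add_atoms.
Context (R : realType) d (X : measurableType d) (U : nat -> set X).
Hypothesis mU : forall n, measurable (U n).

Lemma hits_nondecreasing n m (mu : {measure set X -> \bar R}) A : measurable A ->
  (n <= m)%N -> (hits U n mu A <= hits U m mu A)%N.
Proof.
move=> mA nm.
pose psi (c : {ffun 'I_m -> bool}) : {ffun 'I_n -> bool} := [ffun i => c (widen_ord nm i)].
have psiE x : psi (cell U m x) = cell U n x.
  by apply/ffunP => i; rewrite !ffunE.
have mAc k c : measurable (A `&` cell U k @^-1` [set c]).
  by apply: measurableI => //; exact: measurable_cell.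
have sub : {subset [pred c | mu (A `&` cell U n @^-1` [set c]) != 0] <=
    [seq psi c | c in [pred c | mu (A `&` cell U m @^-1` [set c]) != 0]]}.
  move=> c; rewrite inE (measure_cells mU m _ (mAc n c)) => h.
  have [c' hc'] : exists c', mu (A `&` cell U n @^-1` [set c] `&` cell U m @^-1` [set c']) != 0.
    apply: contrapT => /forallNP h'; move/eqP: h; apply; apply: big1 => c' _.
    by apply/eqP; rewrite -[X in is_true X]negbK; exact/negP.
  have [x [[Ax xc] xc']] : A `&` cell U n @^-1` [set c] `&` cell U m @^-1` [set c'] !=set0.
    by apply/set0P; apply: contra_neq hc' => ->; rewrite measure0.
  apply/fintype.imageP; exists c'; last by rewrite -xc' psiE.
  rewrite inE; apply: contra_neq hc' => h'; apply/eqP; rewrite -measure_le0 -h'.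
  apply: le_measure; rewrite ?inE//.
    by apply: measurableI => //; exact: measurable_cell.
  by move=> y [[]].
rewrite /hits; apply: leq_trans (leq_image_card psi _).
exact/subset_leq_card/fintype.subsetP.
Qed.

Lemma cvg_hits (mu : {measure set X -> \bar R}) A : measurable A ->
  (hits U n mu A)%:R%:E @[n --> \oo] --> (hits_limit U mu A : \bar R).
Proof.
move=> mA; have cv : cvgn (fun n => (hits U n mu A)%:R%:E : \bar R).
  apply: ereal_nondecreasing_is_cvgn => n m nm.
  by rewrite lee_fin ler_nat; exact: hits_nondecreasing.
by rewrite /hits_limit is_cvg_limn_esupE.
Qed.

(** The masses of the cells around [x] decrease to that of its class, which is 0; being
    integer-valued, they are eventually 0. *)
Lemma cell_null (mu : {measure set X -> \bar R}) A x : measurable A ->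
  mu A < +oo -> (forall n, count_valued (mu (A `&` cell U n @^-1` [set cell U n x]))) ->
  mu (atom_class U x) = 0 ->
  exists n0, forall n, (n0 <= n)%N -> mu (A `&` cell U n @^-1` [set cell U n x]) = 0.
Proof.
move=> mA fin cnt null.
pose F n := A `&` cell U n @^-1` [set cell U n x].
have mF n : measurable (F n) by apply: measurableI => //; exact: measurable_cell.
have FA n : F n `<=` A by move=> y [].
have cv : mu (F n) @[n --> \oo] --> mu (\bigcap_n F n).
  apply: nonincreasing_cvg_mu => //.
  - by apply: le_lt_trans fin; apply: le_measure; rewrite ?inE.
  - exact: bigcap_measurable.
  - move=> n m nm; apply/subsetPset => y [Ay yc]; split => //.
    exact: cell_refine nm yc.
have E : mu (\bigcap_n F n) = 0.
  apply/eqP; rewrite -measure_le0 -null; apply: le_measure; rewrite ?inE.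
  - exact: bigcap_measurable.
  - exact: measurable_atom_class.
  - move=> y h n; have [_ /= /ffunP /(_ (Ordinal (ltnSn n)))] := h n.+1 I.
    rewrite !ffunE/= => e; split => h'; apply/asboolP.
      by rewrite -e; exact/asboolP.
    by rewrite e; exact/asboolP.
rewrite E in cv.
have [n0 _ h] : \forall n \near \oo, mu (F n) < 1.
  move/fine_cvgP : cv => -[fn /cvgr_lt /(_ 1%R ltr01)].
  by move: fn; apply: filterS2 => n fn h; rewrite -[X in X < _]fineK// lte_fin.
exists n0 => n n0n; have := h n n0n.
have [->//|[k ->]] := cnt n.
by rewrite lte_fin -[1%R]/(1%:R) ltr_nat ltnS leqn0 => /eqP ->.
Qed.

(** Nothing is known of [mu] as a sum of atoms: the identity with [hits_limit] is all there is. If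
    [mu A] is finite, the new points eventually lie in distinct cells not charged by [mu], and add
    to the count exactly the number of them in [A]; if it is infinite, both sides are [+oo]. *)
Lemma hits_limit_add_atoms (mu : rmeasure X R) K (x : 'I_K -> X) A : measurable A ->
  (forall n c, count_valued (mu (A `&` cell U n @^-1` [set c]))) ->
  mu A = hits_limit U mu A -> (forall l, mu (atom_class U (x l)) = 0) ->
  (forall k l, atom_class U (x l) (x k) -> k = l) ->
  add_atoms mu xpredT x A = hits_limit U (add_atoms mu xpredT x) A.
Proof.
move=> mA cnt muA null sep; apply/esym.
have [fin|] := ltP (mu A) +oo; last first.
  rewrite leye_eq => /eqP inf; rewrite add_atomsE inf addye; last first.
    by rewrite gt_eqF// (lt_le_trans (ltNyr 0))// sume_ge0.
  apply/eqP; rewrite -leye_eq -inf muA; apply: le_limn_esup => n.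
  rewrite lee_fin ler_nat; apply/subset_leq_card/fintype.subsetP => c; rewrite !inE.
  apply: contra_neq; rewrite add_atomsE => /eqP.
  by rewrite padde_eq0// ?sume_ge0// => /andP[/eqP].
have [n1 hn1] : exists n1, forall n, (n1 <= n)%N -> {in codom x &, injective (cell U n)}.
  apply: cell_separates => _ _ /= /codomP[k ->] /codomP[l ->] h.
  by rewrite (sep k l).
have [n2 hn2] : exists n2, forall n, (n2 <= n)%N -> forall l,
    mu (A `&` cell U n @^-1` [set cell U n (x l)]) = 0.
  have /choice[f hf] := fun l => cell_null mA fin (fun n => cnt n _) (null l).
  exists (\max_l f l)%N => n hn l; apply: hf; apply: leq_trans hn.
  exact: leq_bigmax.
pose k0 := #|[pred l | x l \in A]|.
have ev n : (maxn n1 n2 <= n)%N ->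
    hits U n (add_atoms mu xpredT x) A = (hits U n mu A + k0)%N.
  rewrite geq_max => /andP[n1n n2n]; rewrite /hits.
  rewrite -(@cardID _ [pred c | mu (A `&` cell U n @^-1` [set c]) != 0]); congr addn.
    apply: eq_card => c; rewrite !inE; apply/andb_idl.
    apply: contra_neq; rewrite add_atomsE => /eqP.
    by rewrite padde_eq0// ?sume_ge0// => /andP[/eqP].
  rewrite /k0 -(card_in_image (f := cell U n \o x)); last first.
    move=> k l _ _ /= /(hn1 n n1n _ _ (codom_f _ _) (codom_f _ _)) kl.
    by apply: sep; rewrite kl.
  apply: eq_card => c; rewrite !inE negbK.
  apply/andP/fintype.imageP => [[/eqP c0]|[l]].
    rewrite add_atomsE c0 add0e => h.
    have [l hl] : exists l, \d_(x l) (A `&` cell U n @^-1` [set c]) != 0 :> \bar R.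
      apply: contrapT => /forallNP h'; move/eqP: h; apply; apply: big1 => l _.
      by apply/eqP; rewrite -[X in is_true X]negbK; exact/negP.
    have [Ax xc] : (A `&` cell U n @^-1` [set c]) (x l).
      apply: contrapT => nx; move/eqP: hl; apply.
      by rewrite diracE memNset.
    by exists l; [exact: (mem_set Ax)|exact/esym].
  move=> xA ->; rewrite hn2//; split => //.
  rewrite add_atomsE hn2// add0e (bigD1 l)//= diracE mem_set; last first.
    by split => //; exact: (set_mem xA).
  by rewrite gt_eqF// (@lt_le_trans _ _ 1)// leeDl// sume_ge0.
apply: hits_limitE.
rewrite add_atomsE [X in _ --> _ + X](_ : _ = k0%:R%:E); last first.
  rewrite (eq_bigr (fun l => (x l \in A)%:R%:E)); last by move=> l _; rewrite diracE.
    rewrite sumEFin -natr_sum /k0 -sum1_card [in RHS]big_mkcond/=.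
  by congr (_%:R%:E); apply: eq_bigr => l _; rewrite inE; case: (_ \in _).
rewrite muA.
have cv : (hits U n mu A)%:R%:E + k0%:R%:E @[n --> \oo] -->
    hits_limit U mu A + k0%:R%:E.
  apply: cvgeD; [|exact: cvg_hits|exact: cvg_cst].
  by rewrite -muA fin_num_adde_defl.
apply: cvg_trans cv.
apply: near_eq_cvg; exists (maxn n1 n2) => // n /= hn.
by rewrite ev// natrD EFinD.
Qed.

End hits_add_atoms.

Section countable_indices.
Context (R : realType) d (T : measurableType d).

Lemma ae_forall_count (P : {measure set T -> \bar R}) (I : countType) (Q : I -> T -> Prop) :
  (forall i, {ae P, forall t, Q i t}) -> {ae P, forall t, forall i, Q i t}.
Proof.
move=> ae; suff : {ae P, forall t, forall k : nat, forall i, unpickle k = Some i -> Q i t}.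
  by apply: filterS => t h i; apply: (h (pickle i)); rewrite pickleK.
apply: ae_foralln => k; case: (unpickle k) => [i|]; last exact: aeW.
by apply: filterS (ae i) => t h _ [<-].
Qed.

Lemma option_indep (P : probability T R) K (F : option 'I_K -> set_system T)
    (A : option 'I_K -> set T) : mutual_indep P F -> (forall o, F o (A o)) ->
  P (A None `&` [set t | forall l, A (Some l) t]) =
  P (A None) * \prod_(l < K) P (A (Some l)).
Proof.
move=> ind FA; have := ind [set: option 'I_K]%SET A FA.
rewrite (_ : \bigcap_(i in _) A i = A None `&` [set t | forall l, A (Some l) t]); last first.
  apply/seteqP; split => [t h|t [h1 h2] [l _|_]]; [|exact: h2|exact: h1].
  by split => [|l]; apply: h; rewrite /= inE.
move=> ->; rewrite (eq_bigl xpredT); last by move=> o; rewrite inE.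
rewrite (bigD1 None)//=; congr (_ * _).
rewrite (reindex_omap Some id)//=; last by case.
by apply: eq_bigl => l /=; rewrite eqxx.
Qed.

End countable_indices.

Section random_atoms.
Context (R : realType) dX (X : measurableType dX) d (T : measurableType d).

Lemma dirac_series0 (B : pred nat) (x : nat -> X) A :
  \sum_(0 <= k <oo | B k) \d_(x k) A = 0 :> \bar R <-> forall k, B k -> ~ A (x k).
Proof.
split => [h k Bk Ak|h].
  have : (1 : \bar R) <= \sum_(0 <= k <oo | B k) \d_(x k) A.
    rewrite (@nneseriesD1 R _ k)// diracE mem_set// leeDl//.
    exact: nneseries_ge0.
  by rewrite h lee_fin ler10.
apply: eseries0 => k _ Bk; rewrite diracE memNset//; exact: h.
Qed.

Lemma measurable_dirac (x : T -> X) A : measurable_fun setT x -> measurable A ->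
  measurable_fun setT (fun t => \d_(x t) A : \bar R).
Proof.
move=> mx mA; rewrite (_ : (fun t => _) = (fun t => (\1_A (x t))%:E)); last first.
  by apply/funext => t; rewrite diracE indicE.
by apply/measurable_EFinP; exact: (measurableT_comp (measurable_indic mA) mx).
Qed.

Lemma measurable_add_atoms (mu : T -> rmeasure X R) K (B : 'I_K -> T -> bool)
    (x : 'I_K -> T -> X) :
  measurable_fun setT mu -> (forall l, measurable_fun setT (B l)) ->
  (forall l, measurable_fun setT (x l)) ->
  measurable_fun setT (fun t => add_atoms (mu t) (B ^~ t) (x ^~ t)).
Proof.
move=> mmu mB mx; apply: measurable_fun_rmeasure => A mA.
apply: emeasurable_funD; first exact: (measurableT_comp (measurable_rmeasure_ev mA) mmu).
under eq_fun do rewrite big_mkcond/=.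
apply: emeasurable_sum => l; apply: measurable_fun_ifT => //.
exact: measurable_dirac.
Qed.

Lemma add_atoms0 (mu : rmeasure X R) K (B : pred 'I_K) (x : 'I_K -> X) A :
  add_atoms mu B x A = 0 <-> mu A = 0 /\ forall l, B l -> ~ A (x l).
Proof.
rewrite add_atomsE; split => [/eqP|[-> h]].
  rewrite padde_eq0// ?sume_ge0// => /andP[/eqP -> /eqP s0]; split => // l Bl Al.
  have : (1 : \bar R) <= \sum_(l < K | B l) \d_(x l) A.
    by rewrite (bigD1 l)//= diracE mem_set// leeDl// sume_ge0.
  by rewrite s0 lee_fin ler10.
by rewrite add0e big1// => l Bl; rewrite diracE memNset//; exact: h.
Qed.

End random_atoms.

Section avoids.
Context (q : nat) (W : Type).

(** The feature [v], drawn with the bits [beta], charges the set [D j] in no component [j]. *)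
Definition avoids (D : 'I_q -> set W) (v : W) (beta : q.-tuple bool) : bool :=
  [forall j, tnth beta j ==> (v \notin D j)].

Lemma avoidsP D v (beta : q.-tuple bool) : reflect (forall j : 'I_q, tnth beta j -> ~ D j v) (avoids D v beta).
Proof.
apply: (iffP forallP) => [h j bj|h j]; have := h j.
  by rewrite bj/= => /negP nD Dv; apply: nD; rewrite inE.
move=> {}h; apply/implyP => /h nD; apply/negP => Dv; apply: nD.
exact: set_mem Dv.
Qed.

End avoids.

Section posterior_model.
Context (R : realType) (q M : nat) (Omega : completePseudoMetricType R).
Hypothesis q_gt0 : (0 < q)%N.
Local Notation V := (q.-tuple R).
Local Notation W := (borel Omega).
Local Notation X := (V * W)%type.
Variables (U : nat -> set W).
Hypothesis mU : forall n, measurable (U n).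
Hypothesis sepU : separated_on U setT.
Variables (rho : R.-sigmafker W ~> V) (B0 : probability W R).
Variable nuM : {measure set X -> \bar R}.
Hypothesis nuME : forall A, measurable A -> intensity (tilt M rho) B0 A = nuM A.
Hypothesis fi : feature_intensity nuM.
Variables (K : nat) (w : 'I_K -> W) (c : 'I_K -> 'I_q -> nat).
Hypothesis w_inj : injective w.
Hypothesis kappa_gt0 : forall l, (0 < kappa M rho (c l) (w l))%R.

Let Jm l := jump_measure rho M (c l) (w l).

Context d (T : measurableType d) (P : probability T R).

Section posterior.
Variables (NM : T -> rmeasure X R) (J : 'I_K -> T -> V).
Hypothesis pp : posterior_parts M rho B0 w c P NM J.

Let prmNM : is_PRM P nuM NM := is_PRM_eq nuME (pp_prm pp).

Let post t := add_atoms (NM t) xpredT (fun l => (J l t, w l)).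

Lemma jump_law l A : measurable A -> P (J l @^-1` A) = Jm l A.
Proof. by move=> mA; rewrite (pp_law pp)// -jump_measureE. Qed.

Lemma measurable_posterior : measurable_fun setT post.
Proof.
apply: (@measurable_add_atoms _ _ _ _ _ _ _ (fun _ _ => true)) => //.
  exact: prm_measurable prmNM.
move=> l; apply/measurable_fun_pairP; split; last exact: measurable_cst.
exact: pp_measurable pp l.
Qed.

Lemma posterior_void D : measurable D ->
  P [set t | post t D = 0] =
  (expN (nuM D))%:E * \prod_(l < K) Jm l (~` [set s | D (s, w l)]).
Proof.
move=> mD.
pose A (o : option 'I_K) : set T := if o is Some l
  then J l @^-1` (~` [set s | D (s, w l)]) else [set t | NM t D = 0].
have mDw l : measurable (~` [set s | D (s, w l)]).
  by apply: measurableC; exact: measurable_section.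
rewrite (_ : [set t | _] = A None `&` [set t | forall l, A (Some l) t]); last first.
  by apply/seteqP; split => [t /add_atoms0[h1 h2]|t [h1 h2]]; [split => // l; exact: h2|
    apply/add_atoms0; split => // l _; exact: h2].
rewrite (option_indep (pp_indep pp)); last first.
  move=> [l|]; first by exists (~` [set s | D (s, w l)]) => //; rewrite setTI.
  exists [set m : rmeasure X R | m D = 0]; last by rewrite setTI.
  exact: (preimage_measurable (measurable_rmeasure_ev mD) (B := [set 0])).
rewrite (PRM_void prmNM mD); congr (_ * _).
by apply: eq_bigr => l _; rewrite jump_law.
Qed.

(** Fibres over a fixed feature are null for the intensity, so almost surely [NM] has no mass over
    the features [w l]. *)
Lemma posterior_hits A : measurable A ->
  {ae P, forall t, post t A = hits_limit (UX U) (post t) A}.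
Proof.
move=> mA.
have mUX : forall n, measurable (UX U n : set X) by exact: measurable_UX.
have cnt : {ae P, forall t, forall n c, count_valued (NM t (A `&` cell (UX U) n @^-1` [set c]))}.
  apply: ae_foralln => n; apply: ae_forall_count => c'.
  apply: (PRM_count_valued prmNM); apply: measurableI => //.
  exact: (measurable_cell mUX).
have null : {ae P, forall t, forall l : 'I_K, NM t (setT `*` [set w l]) = 0}.
  apply: ae_forall_count => l; apply: (PRM_null prmNM); last exact: (fi_fiber fi).
  by apply: measurableX => //; exact: (measurable_set1_feature mU sepU).
have hl := PRM_hits_limit mUX prmNM (fi_atom_class fi sepU) (fi_sigma_finite q_gt0 fi) mA.
apply: filterS3 cnt null hl => t cnt null hl.
apply: hits_limit_add_atoms => //.
- by move=> l; rewrite (atom_class_UX sepU); exact: null.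
- by move=> k l; rewrite (atom_class_UX sepU) => -[_ /w_inj].
Qed.

End posterior.

Section predictive.
Variables (NM : T -> rmeasure X R) (J : 'I_K -> T -> V).
Variables (Zt : T -> q.-tuple (rmeasure W R)) (b : 'I_K -> T -> q.-tuple bool).
Hypothesis pr : predictive_parts M rho B0 w c P NM J Zt b.

Let pp := pr_parts pr.
Let prmNM : is_PRM P nuM NM := is_PRM_eq nuME (pp_prm pp).

Local Notation r l := (rvec M rho (c l) (w l)).

Lemma jump_integral l (phi : V -> R) : measurable_fun setT phi ->
  \int[P]_t (phi (J l t))%:E = \int[P]_t (\1_(simplex R q) (J l t) * phi (J l t))%:E.
Proof.
move=> mphi; have mJ := pp_measurable pp l; have mS := @measurable_simplex R q.
apply: ae_eq_integral => //.
- by apply/measurable_EFinP; exact: (measurableT_comp mphi mJ).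
- apply/measurable_EFinP; apply: measurable_funM; last exact: (measurableT_comp mphi mJ).
  exact: (measurableT_comp (measurable_indic mS) mJ).
exists (J l @^-1` (~` simplex R q)); split.
- by apply: preimage_measurable => //; exact: measurableC.
- by rewrite [LHS](jump_law pp)//; [exact: jump_measure_out|exact: measurableC].
- by move=> t /= h sJ; apply: h => _; rewrite indicE mem_set// mul1r.
Qed.

Lemma jump_integral_ge0 l (phi : V -> R) : measurable_fun setT phi ->
  (forall s, simplex R q s -> (0 <= phi s)%R) ->
  \int[P]_t (phi (J l t))%:E = \int[Jm l]_s (\1_(simplex R q) s * phi s)%:E.
Proof.
move=> mphi phi0; rewrite jump_integral//.
have mS := @measurable_simplex R q.
pose g s : \bar R := (\1_(simplex R q) s * phi s)%:E.
rewrite -(ge0_integral_law (pp_measurable pp l) (@jump_law _ _ pp l) (h := g))//.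
- by apply/measurable_EFinP; apply: measurable_funM => //; exact: measurable_indic.
- move=> s; rewrite lee_fin indicE; case: (boolP (s \in _)) => [/set_mem ss|_].
    by rewrite mul1r; exact: phi0.
  by rewrite mul0r.
Qed.

Lemma jump_mean l k : 'E_P[fun t => tnth (J l t) k] = (tnth (r l) k)%:E.
Proof.
rewrite unlock -integral_jump_coord//; apply: (jump_integral_ge0 l (measurable_tnth k)).
by move=> s [s0 _]; exact: ltW.
Qed.

Lemma bits_law l beta : P (b l @^-1` [set beta]) = (mpmf (r l) beta)%:E.
Proof.
have [_ /(_ setT)] := pr_cond pr l beta.
rewrite setTI => ->; last by exists setT => //; rewrite preimage_setT setTI.
rewrite -integral_jump_mpmf//; apply: (jump_integral_ge0 l (@measurable_mpmf _ _ beta)).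
by move=> s ss; exact: mpmf_ge0.
Qed.

Lemma bits_event l (B : set (q.-tuple bool)) :
  P (b l @^-1` B) = (\sum_beta mpmf (r l) beta * (`[< B beta >])%:R)%:E.
Proof.
have mb := pr_measurable pr l.
have m1 beta : measurable (b l @^-1` [set beta]).
  by apply: preimage_measurable => //; exact: measurable_set1_bits.
transitivity (\int[P]_t \sum_(beta : q.-tuple bool)
    ((`[< B beta >])%:R%:E * (\1_(b l @^-1` [set beta]) t)%:E)).
  rewrite -(setIT (b l @^-1` B)) -integral_indic//; last first.
    by apply: preimage_measurable => //; exact: measurable_bits.
  apply: eq_integral => t _; rewrite [RHS](bigD1 (b l t))//=.
  rewrite [X in _ = X + _](_ : _ = (`[< B (b l t) >])%:R%:E); last first.
    by rewrite indicE mem_set// mule1.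
  rewrite big1 ?adde0; last first.
    by move=> beta /eqP bt; rewrite indicE memNset ?mule0//= => /esym.
  by congr EFin; rewrite indicE; congr (nat_of_bool _)%:R.
rewrite ge0_integral_sum//; last first.
  by move=> beta; apply: measurable_funeM; apply/measurable_EFinP; exact: measurable_indic.
rewrite -sumEFin; apply: eq_bigr => beta _; rewrite ge0_integralZl_EFin//; last first.
  by apply/measurable_EFinP; exact: measurable_indic.
by rewrite integral_indic// setIT [X in _ * X](bits_law l beta) muleC.
Qed.

Lemma btot_bernoulli l (B : set nat) :
  P [set t | B (btot (b l t))] =
  bernoulli_prob (tot (r l)) [set x : bool | B (nat_of_bool x)].
Proof.
have sr := rvec_simplex (kappa_gt0 l).
have r01 : (0 <= tot (r l) <= 1)%R.
  by rewrite simplex_tot_ge0//= ltW//; case: sr.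
rewrite [LHS](bits_event l [set beta | B (btot beta)]) bernoulli_probE//.
rewrite (sum_mpmf _ (fun beta => (`[< B (btot beta) >])%:R)).
under eq_bigr do rewrite btot_one_hot/=.
by rewrite -mulr_suml -/(tot (r l)) btot_one_hot/= EFinD addeC !diracE; congr (_ + _).
Qed.

Lemma bits_given_btot l beta :
  (fine (P [set t | b l t = beta /\ btot (b l t) = 1%N])
   / fine (P [set t | btot (b l t) = 1%N]))%R =
  (if btot beta == 1%N then
     \prod_(j < q) (tnth (r l) j / tot (r l)) ^+ tnth beta j
   else 0)%R.
Proof.
have sr := rvec_simplex (kappa_gt0 l).
have r0 := simplex_tot_gt0 q_gt0 sr.
have -> : P [set t | btot (b l t) = 1%N] = (tot (r l))%:E.
  rewrite [LHS](bits_event l [set beta | btot beta = 1%N]).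
  rewrite (sum_mpmf _ (fun beta => (`[< btot beta = 1%N >])%:R)).
  rewrite btot_one_hot/= asboolF// mulr0 add0r; congr EFin.
  by apply: eq_bigr => j _; rewrite btot_one_hot asboolT// mulr1.
case: eqP => [b1|b1]; last first.
  rewrite (_ : [set t | _] = set0) ?measure0 ?mul0r//.
  by apply/seteqP; split => // t [bt]; rewrite bt.
rewrite (_ : [set t | _] = b l @^-1` [set beta]); last first.
  by apply/seteqP; split => [t []//|t /= bt]; rewrite bt.
rewrite bits_law/=.
have {}b1 : (btot beta <= 1)%N /\ btot beta = 1%N by rewrite b1.
case: b1 => /btot_le1; case; case=> [j|] ->; rewrite btot_one_hot// => _.
rewrite mpmf_one_hot (bigD1 j)//= tnth_one_hot eqxx expr1 big1 ?mulr1// => i ij.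
by rewrite tnth_one_hot (inj_eq Some_inj) (negbTE ij) expr0.
Qed.

Let pred t : q.-tuple (rmeasure W R) :=
  [tuple add_atoms (tnth (Zt t) j) (fun l => tnth (b l t) j) w | j < q].

Lemma measurable_predictive : measurable_fun setT pred.
Proof.
have mZt := IBP_draws_measurable (pr_IBP pr) ord0.
apply/measurable_fun_tnthP => j.
rewrite (_ : _ \o pred = fun t => add_atoms (tnth (Zt t) j) (fun l => tnth (b l t) j) w); last first.
  by apply/funext => t /=; rewrite tnth_mktuple.
apply: (@measurable_add_atoms _ _ _ _ _ _ _ (fun l t => tnth (b l t) j) (fun l _ => w l)).
- exact: (measurableT_comp (measurable_tnth j) mZt).
- by move=> l; exact: (measurableT_comp (measurable_tnth j) (pr_measurable pr l)).
- by move=> l; exact: measurable_cst.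
Qed.

Lemma draw_void (D : 'I_q -> set W) : (forall j, measurable (D j)) ->
  P [set t | forall j, tnth (Zt t) j (D j) = 0] =
  (expN (\int[nuM]_x (\1_(simplex R q) x.1 *
     \sum_beta mpmf x.1 beta * (~~ avoids D x.2 beta)%:R)%:E))%:E.
Proof.
move=> mD; have [act [p [omega [bb [matom mb NE ZE condb]]]]] := pr_IBP pr.
have simp := ae_simplex_atoms fi prmNM NE.
pose bad (x : X) (m : {ffun 'I_1 -> q.-tuple bool}) := ~~ avoids D x.2 (m ord_max).
have mbad m : measurable_fun setT (bad ^~ m).
  apply: (measurable_fun_bool false); rewrite setTI.
  rewrite (_ : _ @^-1` _ = \bigcap_(j in [set j | tnth (m ord_max) j]) (setT `*` ~` D j)).
    apply: fin_bigcap_measurable => [|j _]; first exact: finite_finset.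
    by apply: measurableX => //; exact: measurableC.
  apply/seteqP; split => [x /= /negbFE /avoidsP h j mj|x h /=].
    by split => //; exact: h.
  by apply/negbF/avoidsP => j mj; have [] := h j mj.
rewrite -[RHS](_ : (expN (\int[nuM]_x (\sum_m mark_weight x.1 m * (bad x m)%:R)%:E))%:E = _); last first.
  congr (expN _)%:E; apply: eq_integral => x _; congr EFin.
  (* With no earlier draw every mark is unselected, and the formula becomes an average over the
     single draw. *)
  have := sum_mark_unselected 0 x.1 (fun beta => (~~ avoids D x.2 beta)%:R).
  rewrite expr0 mulr1 => <-; apply: eq_bigr => m _; rewrite ifT//.
  by apply/forallP => -[].
rewrite -(marked_void matom mb condb simp prmNM NE (fi_simplex fi) mbad).
congr (P _); apply/seteqP; split => t.
  move=> h k akt; rewrite /bad negbK; apply/avoidsP => j.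
  rewrite ffunE => bj; have := h j; rewrite (ZE ord0)// => /dirac_series0 /(_ k).
  by apply; rewrite akt (_ : ord0 = ord_max)//; exact: val_inj.
move=> h j; rewrite (ZE ord0)//; apply/dirac_series0 => k /andP[akt bj].
have := h k akt; rewrite /bad negbK => /avoidsP; apply.
by rewrite ffunE (_ : ord_max = ord0)//; exact: val_inj.
Qed.

Lemma predictive_void (D : 'I_q -> set W) : (forall j, measurable (D j)) ->
  P [set t | forall j, tnth (pred t) j (D j) = 0] =
  (expN (\int[nuM]_x (\1_(simplex R q) x.1 *
     \sum_beta mpmf x.1 beta * (~~ avoids D x.2 beta)%:R)%:E))%:E *
  \prod_(l < K) (\sum_beta mpmf (r l) beta * (avoids D (w l) beta)%:R)%:E.
Proof.
move=> mD.
pose A (o : option 'I_K) : set T := if o is Some l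
  then b l @^-1` [set beta | avoids D (w l) beta]
  else [set t | forall j, tnth (Zt t) j (D j) = 0].
rewrite (_ : [set t | _] = A None `&` [set t | forall l, A (Some l) t]); last first.
  apply/seteqP; split => [t h|t [h1 h2] j].
    split => [j|l]; first by have := h j; rewrite tnth_mktuple => /add_atoms0[].
    by apply/avoidsP => j bj; have := h j; rewrite tnth_mktuple => /add_atoms0[_]; apply.
  rewrite tnth_mktuple; apply/add_atoms0; split => // l bj.
  by have /avoidsP := h2 l; apply.
rewrite (option_indep (pr_indep pr)); last first.
  move=> [l|].
    by exists [set beta | avoids D (w l) beta]; [exact: measurable_bits|rewrite setTI].
  exists (void_event (fun (j : 'I_q) (z : q.-tuple (rmeasure W R)) => tnth z j) D).
    apply: (@measurable_void_system _ W); last by exists D.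
    move=> j B mB; exact: (measurableT_comp (measurable_rmeasure_ev mB) (measurable_tnth j)).
  by rewrite setTI.
rewrite draw_void//; congr (_ * _); apply: eq_bigr => l _.
rewrite bits_event; congr EFin; apply: eq_bigr => beta _; congr (_ * (nat_of_bool _)%:R)%R.
by apply/asboolP/idP.
Qed.

(** The draw comes with an enumeration of the atoms of [NM], whose features are almost surely
    distinct and different from every [w l]; the sum is thus a simple measure outright. *)
Lemma predictive_hits j A : measurable A ->
  {ae P, forall t, tnth (pred t) j A = hits_limit U (tnth (pred t) j) A}.
Proof.
move=> mA; have [act [p [omega [bb [matom mb NE ZE condb]]]]] := pr_IBP pr.
have dist := ae_distinct_features q_gt0 fi mU sepU prmNM NE.
have null : {ae P, forall t, forall l : 'I_K, NM t (setT `*` [set w l]) = 0}.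
  apply: ae_forall_count => l; apply: (PRM_null prmNM); last exact: (fi_fiber fi).
  by apply: measurableX => //; exact: (measurable_set1_feature mU sepU).
apply: filterS2 dist null => t dist null; rewrite tnth_mktuple; apply/esym.
apply: hits_limitE; apply: hits_cvg => //; apply: simple_add_atoms => //.
- apply: (simple_dirac_series (B := fun k => act k t && tnth (bb ord0 k t) j)
    (x := fun k => omega k t)).
    move=> k k' /andP[ak _] /andP[ak' _] h; apply: dist => //.
    exact: sepU.
  by move=> B mB; exact: (ZE ord0).
- move=> l _; rewrite (atom_class_set1 sepU) (ZE ord0); last first.
    exact: (measurable_set1_feature mU sepU).
  apply/dirac_series0 => k /andP[ak _] /= kl.
  have := null l; rewrite NE; last first.
    by apply: measurableX => //; exact: (measurable_set1_feature mU sepU).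
  by move=> /dirac_series0 /(_ k ak); apply.
- by move=> k l _ _; rewrite (atom_class_set1 sepU) => /w_inj.
Qed.

End predictive.

End posterior_model.

(** * Sums over the selected features *)

Section joint_measurability.
Context (R : realType) dW (W : measurableType dW) (U : nat -> set W).
Hypothesis mU : forall n, measurable (U n).
Hypothesis sepU : separated_on U setT.

Lemma set1_atom_class w : [set w] = atom_class U w.
Proof. by apply/seteqP; split => [y ->//|y yw]; apply: sepU. Qed.

Lemma measurable_separated1 (w : W) : measurable [set w].
Proof. by rewrite set1_atom_class; exact: measurable_atom_class. Qed.

Lemma integral_finite_support (mu : {measure set W -> \bar R}) (S : set W)
    (f : W -> \bar R) : finite_set S -> mu (~` S) = 0 -> measurable_fun setT f ->
  (forall v, 0 <= f v) -> \int[mu]_v f v = \esum_(v in S) (f v * mu [set v]).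
Proof.
move=> fS S0 mf f0.
pose s := finmap.enum_fset (fset_set S).
have SE : S = \big[setU/set0]_(v <- s) [set v].
  rewrite -bigcup_seq; apply/seteqP; split => [v Sv|_ [v vs ->]].
    by exists v => //=; rewrite mem_enum_fset_set// mem_set.
  by move: vs; rewrite /= mem_enum_fset_set// => /set_mem.
have mS : measurable S.
  by rewrite SE; apply: bigsetU_measurable => v _; exact: measurable_separated1.
transitivity (\int[mu]_(v in S) f v).
  have mC : measurable (~` S) by exact: measurableC.
  rewrite -(setvU S) ge0_integral_setU//; last 2 first.
  - by rewrite setvU.
  - by apply/disj_setPS; rewrite setICl.
  by rewrite null_set_integral ?add0e//; exact: measurable_funTS.
rewrite esum_fset//; last by move=> v _; rewrite mule_ge0.
rewrite fsbig_finite//= [in LHS]SE ge0_integral_bigsetU//; last 4 first.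
- by move=> v; exact: measurable_separated1.
- exact: finmap.fset_uniq.
- by move=> v1 v2 _ _ [x [-> ->]].
- exact: measurable_funTS.
apply: eq_bigr => v _; rewrite -integral_cst//; last exact: measurable_separated1.
by apply: eq_integral => x /set_mem ->.
Qed.

Context d (T : measurableType d).

(** A singleton is the decreasing limit of the cells containing it. The mass of the cell of [v] is a
    finite sum of products, each measurable in [v] and [t] separately; finite masses give continuity
    from above. *)
Lemma measurable_eval_set1 (k : T -> {measure set W -> \bar R}) :
  (forall A, measurable A -> measurable_fun setT (fun t => k t A)) ->
  (forall t, k t setT < +oo) ->
  measurable_fun setT (fun vt : W * T => k vt.2 [set vt.1]).
Proof.
move=> mk kfin.
pose u n (vt : W * T) : \bar R := \sum_(c : {ffun 'I_n -> bool})
  ((\1_(cell U n @^-1` [set c]) vt.1)%:E * k vt.2 (cell U n @^-1` [set c])).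
have uE n v t : u n (v, t) = k t (cell U n @^-1` [set cell U n v]).
  rewrite /u (bigD1 (cell U n v))//= indicE mem_set// mul1e big1 ?adde0// => c /eqP cv.
  by rewrite indicE memNset ?mul0e// => /= /esym.
apply: (emeasurable_fun_cvg u).
  move=> n; apply: emeasurable_sum => c.
  have mc := measurable_cell mU c.
  apply: emeasurable_funM.
    apply/measurable_EFinP; exact: (measurableT_comp (measurable_indic mc) measurable_fst).
  exact: (measurableT_comp (mk _ mc) measurable_snd).
move=> [v t] _ /=; under eq_fun do rewrite uE.
rewrite set1_atom_class (_ : atom_class U v = \bigcap_n (cell U n @^-1` [set cell U n v])).
  apply: nonincreasing_cvg_mu.
  - apply: le_lt_trans (kfin t); apply: le_measure; rewrite ?inE//.
    exact: measurable_cell.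
  - by move=> n; exact: measurable_cell.
  - by apply: bigcap_measurable => // n _; exact: measurable_cell.
  - by move=> n m nm; apply/subsetPset => y yc; exact: cell_refine nm yc.
apply/seteqP; split => [y yv n _|y h n].
  by apply/ffunP => i; rewrite !ffunE; apply/asbool_equiv_eq; exact: yv.
have /= /ffunP /(_ (Ordinal (ltnSn n))) := h n.+1 I.
rewrite !ffunE/= => e; split => h'; apply/asboolP.
  by rewrite -e; exact/asboolP.
by rewrite e; exact/asboolP.
Qed.

End joint_measurability.

Lemma measurable_fiber d (T : measurableType d) (I : countType) (f : T -> I) :
  (forall i, measurable (f @^-1` [set i])) -> forall B : set I, measurable (f @^-1` B).
Proof.
move=> mf B; rewrite (_ : f @^-1` B = \bigcup_k
    (if unpickle k is Some i then (if `[< B i >] then f @^-1` [set i] else set0) else set0)).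
  apply: bigcup_measurable => k _; case: (unpickle k) => [i|]; last exact: measurable0.
  by case: asboolP => // _; exact: measurable0.
apply/seteqP; split => [t Bt|t [k _]].
  by exists (pickle (f t)) => //; rewrite pickleK asboolT.
case: (unpickle k) => // i; case: asboolP => // Bi /= it.
by rewrite /= it.
Qed.

Lemma measurable_truncn_eq (R : realType) n : measurable [set x : R | Num.truncn x = n].
Proof.
have mge k : measurable [set x : R | (k.+1%:R <= x)%R].
  rewrite (_ : [set x | _] = `[k.+1%:R, +oo[%classic)//.
  by apply/seteqP; split => x /=; rewrite in_itv/= andbT.
case: n => [|n].
  rewrite (_ : [set x | _] = ~` [set x : R | (1%:R <= x)%R]); first exact: measurableC.
  apply/seteqP; split => x /=; rewrite -truncn_gt_nat; first by move=> ->.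
  by move/negP; rewrite -leqNgt leqn0 => /eqP.
rewrite (_ : [set x | _] = [set x : R | (n.+1%:R <= x)%R] `\` [set x : R | (n.+2%:R <= x)%R]).
  exact: measurableD.
apply/seteqP; split => x /=; rewrite -!truncn_gt_nat; first by move=> ->; rewrite ltnn.
by move=> [h1 /negP h2]; apply/eqP; rewrite eqn_leq h1 leqNgt h2.
Qed.

Section feature_sum.
Context (R : realType) (q M : nat) (Omega : completePseudoMetricType R).
Local Notation W := (borel Omega).
Variable U : nat -> set W.
Hypothesis mU : forall n, measurable (U n).
Hypothesis sepU : separated_on U setT.
Context d (T : measurableType d) (Z : 'I_M -> T -> q.-tuple (rmeasure W R)).

Definition finitely_many (t : T) : Prop := forall i j, tnth (Z i t) j setT < +oo.

Hypothesis Zatoms : forall t, finitely_many t -> finite_set (selected Z t) /\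
  forall i j, tnth (Z i t) j (~` selected Z t) = 0.

Let TF := g_sigma_algebraType (\bigcup_i sigma_of (Z i)).

Let mZ i j A : measurable A -> measurable_fun setT (fun t : TF => tnth (Z i t) j A).
Proof.
move=> mA; have mZi : measurable_fun setT (Z i : TF -> _).
  move=> _ B mB; rewrite setTI; apply: sub_sigma_algebra.
  by exists i => //; exists B => //; rewrite setTI.
exact: (measurableT_comp (measurable_rmeasure_ev mA) (measurableT_comp (measurable_tnth j) mZi)).
Qed.

Lemma measurable_finitely_many : measurable (finitely_many : set TF).
Proof.
rewrite (_ : finitely_many = \bigcap_(ij in [set: 'I_M * 'I_q])
    ((fun t => tnth (Z ij.1 t) ij.2 setT) @^-1` [set x | x < +oo])).
  apply: fin_bigcap_measurable => // -[i j] _.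
  apply: (preimage_measurable (f := fun t : TF => tnth (Z i t) j setT)).
    exact: mZ.
  rewrite (_ : [set x | _] = ~` [set +oo]); first exact: measurableC.
  by apply/seteqP; split => x /=; rewrite ltey => /eqP.
by apply/seteqP; split => [t h [i j] _|t h i j]; [exact: h|exact: (h (i, j))].
Qed.

(** The draws, replaced by the zero measure where some mass is infinite: finite kernels, for which
    sections are measurable. *)
Let kappa_ i j (t : TF) : {measure set W -> \bar R} :=
  if `[< finitely_many t >] then tnth (Z i t) j else mzero.

Let mkappa i j A : measurable A -> measurable_fun setT (fun t => kappa_ i j t A).
Proof.
move=> mA; rewrite (_ : (fun t => _) =
    (fun t => if `[< finitely_many t >] then tnth (Z i t) j A else 0)); last first.
  by apply/funext => t; rewrite /kappa_; case: asboolP.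
apply: measurable_fun_ifT => //; last exact: mZ.
apply: (measurable_fun_bool true); rewrite setTI.
rewrite (_ : _ @^-1` _ = finitely_many); first exact: measurable_finitely_many.
by apply/seteqP; split => t /= /asboolP.
Qed.

Let kappa_fin i j t : kappa_ i j t setT < +oo.
Proof. by rewrite /kappa_; case: asboolP => [h|_]; [exact: h|rewrite ltry]. Qed.

Let mass (vt : W * TF) : \bar R := \sum_ij kappa_ ij.1 ij.2 vt.2 [set vt.1].

Let mset1 i j : measurable_fun setT (fun vt : W * TF => kappa_ i j vt.2 [set vt.1]).
Proof.
by apply: (measurable_eval_set1 mU sepU); [exact: mkappa|exact: kappa_fin].
Qed.

Variable h : ('I_q -> nat) -> W -> \bar R.
Hypothesis mh : forall c, measurable_fun setT (h c).
Hypothesis h0 : forall c v, 0 <= h c v.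

Let count_ff (vt : W * TF) : {ffun 'I_q -> nat} :=
  [ffun j => (\sum_(i < M) Num.truncn (fine (kappa_ i j vt.2 [set vt.1])))%N].

Let measurable_count (c : {ffun 'I_q -> nat}) : measurable (count_ff @^-1` [set c]).
Proof.
pose g (vt : W * TF) : {ffun 'I_M * 'I_q -> nat} :=
  [ffun ij => Num.truncn (fine (kappa_ ij.1 ij.2 vt.2 [set vt.1]))].
rewrite (_ : _ @^-1` _ = g @^-1` [set e : {ffun 'I_M * 'I_q -> nat} |
    [ffun j => (\sum_(i < M) e (i, j))%N] = c]); last first.
  apply/seteqP; split => vt /= <-; apply/ffunP => j; rewrite !ffunE.
    by apply: eq_bigr => i _; rewrite ffunE.
  by apply: eq_bigr => i _; rewrite ffunE.
apply: measurable_fiber => e.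
rewrite (_ : _ @^-1` _ = \bigcap_(ij in [set: 'I_M * 'I_q])
    ((fun vt => fine (kappa_ ij.1 ij.2 vt.2 [set vt.1])) @^-1` [set x : R | Num.truncn x = e ij])).
  apply: fin_bigcap_measurable => // ij _.
  apply: (preimage_measurable (f := fun vt : W * TF => fine (kappa_ ij.1 ij.2 vt.2 [set vt.1]))).
    exact: (measurableT_comp (fine_measurable measurableT) (mset1 ij.1 ij.2)).
  exact: measurable_truncn_eq.
apply/seteqP; split => [vt <- ij _ /=|vt hv]; first by rewrite ffunE.
by apply/ffunP => ij; rewrite ffunE; exact: (hv ij I).
Qed.

Let measurable_h : measurable_fun setT (fun vt : W * TF => h (count_ff vt) vt.1).
Proof.
move=> _ B mB; rewrite setTI.
rewrite (_ : _ @^-1` _ = \bigcup_k (if unpickle k is Some c then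
    count_ff @^-1` [set c] `&` (fun vt : W * TF => h (c : {ffun _ -> _}) vt.1) @^-1` B else set0)).
  apply: bigcup_measurable => k _; case: (unpickle k) => [c|]; last exact: measurable0.
  apply: measurableI; first exact: measurable_count.
  exact: (preimage_measurable (measurableT_comp (mh c) measurable_fst) mB).
apply/seteqP; split => [vt Bvt|vt [k _]].
  by exists (pickle (count_ff vt)) => //; rewrite pickleK.
by case: (unpickle k) => // c [/= <-].
Qed.

(** For a positive finite mass [m], [expR (- ln m)] is its inverse, written so as to be measurable
    by composition. *)
Let integrand (vt : W * TF) : \bar R := h (count_ff vt) vt.1 * (expR (- ln (fine (mass vt))))%:E.

Let mass_ge0 vt : 0 <= mass vt. Proof. exact: sume_ge0. Qed.

Let measurable_mass : measurable_fun setT mass.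
Proof. by apply: emeasurable_sum => ij; exact: mset1. Qed.

Let measurable_integrand : measurable_fun setT integrand.
Proof.
apply: emeasurable_funM; first exact: measurable_h.
apply/measurable_EFinP; apply: measurableT_comp => //; apply: measurableT_comp => //.
apply: measurableT_comp => //.
exact: (measurableT_comp (fine_measurable measurableT) measurable_mass).
Qed.

Let integrand_ge0 vt : 0 <= integrand vt.
Proof. by rewrite mule_ge0// lee_fin expR_ge0. Qed.

(* When finite, it is an integral against the draws themselves (each selected feature
   being weighted by the inverse of its mass), hence measurable in the draws. *)
Definition feature_sum (t : T) : \bar R :=
  if `[< finitely_many t >] then
    \esum_(v in selected Z t) h (feature_count Z t v) v
  else 0.

Theorem measurable_feature_sum : measurable_fun setT (feature_sum : TF -> \bar R).
Proof.
rewrite (_ : feature_sum = fun t => \sum_ij \int[kappa_ ij.1 ij.2 t]_v integrand (v, t)).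
  apply: emeasurable_sum => ij.
  apply: (@measurable_integral_mixture _ _ W TF R (kappa_ ij.1 ij.2)) => // A mA.
  have := @finite_kernel_section _ _ W TF R (kappa_ ij.1 ij.2) (mkappa ij.1 ij.2) setT A
    measurableT (kappa_fin ij.1 ij.2) mA.
  by apply: eq_measurable_fun => t _; rewrite setIT.
apply/funext => t; rewrite /feature_sum; case: asboolP => fin; last first.
  rewrite big1// => ij _; rewrite /kappa_ asboolF//.
  exact: integral_measure_zero.
have [fS S0] := Zatoms fin.
have kE i j : kappa_ i j t = tnth (Z i t) j by rewrite /kappa_ asboolT.
have cE v : count_ff (v, t) = feature_count Z t v :> ('I_q -> nat).
  apply/funext => j; rewrite ffunE; apply: eq_bigr => i _.
  by rewrite /= kE.
transitivity (\sum_(ij : 'I_M * 'I_q) \esum_(v in selected Z t)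
    (integrand (v, t) * kappa_ ij.1 ij.2 t [set v])); last first.
  apply: eq_bigr => ij _; rewrite (integral_finite_support mU sepU fS)//.
    by rewrite kE S0.
  exact: (measurableT_comp measurable_integrand (measurable_pair2 (t : TF))).
(* Summed over draws and components, the masses at a selected feature [v] add up to [mass (v, t)],
   which the inverse weight cancels. *)
rewrite -esum_sum//; last by move=> v ij _ _; rewrite mule_ge0.
apply: eq_esum => v [i [j vij]].
rewrite -ge0_sume_distrr//.
rewrite -/(mass (v, t)) /integrand cE.
have mfin : mass (v, t) \is a fin_num.
  rewrite ge0_fin_numE//; apply: lte_sum_pinfty => -[i' j'] _ /=.
  apply: le_lt_trans (kappa_fin i' j' t); apply: le_measure; rewrite ?inE//.
  exact: (measurable_separated1 mU sepU).
have mgt0 : 0 < mass (v, t).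
  rewrite /mass (bigD1 (i, j))//= (@lt_le_trans _ _ (kappa_ i j t [set v]))//.
    by rewrite kE.
  by rewrite leeDl// sume_ge0.
have m0 : (0 < fine (mass (v, t)))%R by rewrite fine_gt0// mgt0 -ge0_fin_numE.
by rewrite -muleA -{2}(fineK mfin) -EFinM expRN lnK ?posrE// mulVf ?mule1// gt_eqF.
Qed.

End feature_sum.

(** * The past draws *)

Section past_marks.
Context (R : realType) (q M : nat).
Local Notation bits := (q.-tuple bool).
Local Notation mark := {ffun 'I_M.+1 -> bits}.
Local Notation pmark := {ffun 'I_M -> bits}.

Definition past (m : mark) : pmark := [ffun i => m (widen_ord (leqnSn M) i)].

Definition extend_mark (mb : pmark * bits) : mark :=
  [ffun i => if unlift ord_max i is Some i' then mb.1 i' else mb.2].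

Let widen_lift (i : 'I_M) : widen_ord (leqnSn M) i = lift ord_max i.
Proof. by apply: val_inj => /=; rewrite /bump leqNgt ltn_ord. Qed.

Lemma past_extend mb : past (extend_mark mb) = mb.1.
Proof. by apply/ffunP => i; rewrite !ffunE widen_lift liftK. Qed.

Lemma last_extend mb : extend_mark mb ord_max = mb.2.
Proof. by rewrite ffunE unlift_none. Qed.

Lemma sum_past_last (F : pmark -> bits -> R) :
  (\sum_(m : mark) F (past m) (m ord_max) = \sum_(m' : pmark) \sum_(b : bits) F m' b)%R.
Proof.
rewrite pair_big/= (reindex extend_mark)/=.
  by apply: eq_bigr => mb _; rewrite past_extend last_extend.
exists (fun m => (past m, m ord_max)) => [[m b] _|m _].
  by rewrite past_extend last_extend.
apply/ffunP => i; rewrite ffunE/=; case: unliftP => [i' ->|->//].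
by rewrite ffunE widen_lift.
Qed.

Lemma mark_weight_past (p : q.-tuple R) (m : mark) :
  mark_weight p m = (mark_weight p (past m) * mpmf p (m ord_max))%R.
Proof.
rewrite /mark_weight big_ord_recr/= mulrA; congr (_ * _ * _)%R.
by apply: eq_bigr => i _; rewrite ffunE.
Qed.

Lemma unselected_past (m : mark) :
  unselected m = [forall i, past m i == one_hot None].
Proof. by apply: eq_forallb => i; rewrite ffunE. Qed.

Definition mark_count (m : pmark) (j : 'I_q) : nat := (\sum_(i < M) tnth (m i) j)%N.

(** A draw without a bit contributes [1 - tot p], and the number of such draws is [M] minus the
    total count. *)
Lemma mark_weightE (p : q.-tuple R) (m : pmark) : (forall i, (btot (m i) <= 1)%N) ->
  mark_weight p m = (\1_(simplex R q) p * weight M (mark_count m) p)%R.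
Proof.
move=> m1; rewrite /mark_weight /weight; congr (_ * _)%R.
rewrite (eq_bigr (fun i => (\prod_(j < q) tnth p j ^+ tnth (m i) j) *
    (1 - tot p) ^+ (1 - btot (m i)))%R); last first.
  by move=> i _; rewrite /mpmf m1.
rewrite big_split/=; congr (_ * _)%R.
  rewrite exchange_big/=; apply: eq_bigr => j _.
  exact: prodrXr.
rewrite prodrXr; congr (_ ^+ _)%R.
apply/eqP; rewrite -(eqn_add2r (\sum_(j < q) mark_count m j)) subnK; last first.
  rewrite exchange_big/= (leq_trans (n := \sum_(i < M) 1)%N)//.
    by apply: leq_sum => i _; exact: m1.
  by rewrite sum1_card card_ord.
rewrite exchange_big/= -big_split/= (eq_bigr (fun=> 1%N)) ?sum1_card ?card_ord//.
by move=> i _; rewrite subnK.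
Qed.

Lemma mark_weight_gt1 (p : q.-tuple R) (m : pmark) i : (1 < btot (m i))%N ->
  mark_weight p m = 0%R.
Proof. by move=> mi; rewrite /mark_weight (bigD1 i)//= mpmf_gt1// mul0r mulr0. Qed.

Lemma mpmf_le1 (p : q.-tuple R) b : simplex R q p -> (mpmf p b <= 1)%R.
Proof.
move=> sp; rewrite -(sum_mpmf1 p) (bigD1 b)//= lerDl.
by apply: sumr_ge0 => b' _; exact: mpmf_ge0.
Qed.

(** Some draw is not the zero vector. Its factor is 0 or a single coordinate of [p], hence at most
    [tot p], and the other factors are at most 1. The weights of selected marks are therefore
    integrable even if the jump measure is infinite. *)
Lemma mark_weight_le_tot (p : q.-tuple R) (m : pmark) :
  ~~ [forall i, m i == one_hot None] ->
  (mark_weight p m <= \1_(simplex R q) p * tot p)%R.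
Proof.
move=> /forallPn[i mi]; rewrite /mark_weight indicE.
case: (boolP (p \in _)) => [/set_mem sp|_]; last by rewrite !mul0r.
rewrite !mul1r (bigD1 i)//=.
apply: (@le_trans _ _ (mpmf p (m i))).
  rewrite ler_piMr ?mpmf_ge0//; apply: prodr_ile1 => k _.
  by rewrite mpmf_ge0// mpmf_le1.
have [m1|m1] := leqP (btot (m i)) 1; last by rewrite mpmf_gt1// simplex_tot_ge0.
case: (btot_le1 m1) => -[j|] E; last by move: mi; rewrite E eqxx.
rewrite E mpmf_one_hot /tot (bigD1 j)//= lerDl.
by apply: sumr_ge0 => k _; have [s0 _] := sp; exact: ltW.
Qed.

End past_marks.

(** * Integrating the jump out at a fixed feature *)

Section jump_factor.
Context (R : realType) (q M : nat) (Omega : completePseudoMetricType R).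
Local Notation V := (q.-tuple R).
Local Notation W := (borel Omega).
Local Notation S := (simplex R q).
Variables (rho : R.-sigmafker W ~> V) (c : 'I_q -> nat) (v : W).
Local Notation kappa := (kappa M rho c v).
Local Notation weight := (weight M c).
Variable phi : V -> R.
Hypothesis mphi : measurable_fun setT phi.
Hypothesis phi01 : forall s, S s -> (0 <= phi s <= 1)%R.

(* [\int phi dJlaw], with the inverse of [kappa] written as an exponential so that
   measurability in [v] is immediate; only meaningful when [kappa > 0] *)
Definition jump_factor : R :=
  Num.min (fine (\int[rho v]_s (\1_S s * (phi s * weight s))%:E) * expR (- ln kappa))%R 1%R.

Lemma jump_factorE : (0 < kappa)%R ->
  jump_factor%:E = \int[jump_measure rho M c v]_s (\1_S s * phi s)%:E.
Proof.
move=> k0; have I := integral_jump k0 mphi phi01; rewrite I.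
have le1 : \int[jump_measure rho M c v]_s (\1_S s * phi s)%:E <= 1.
  rewrite -(jump_measureT k0) -[leRHS]mul1e -integral_cst//.
  apply: ge0_le_integral => //.
  - move=> s _; rewrite lee_fin indicE; case: (boolP (s \in _)) => [/set_mem ss|_].
      by rewrite mul1r; have /andP[] := phi01 ss.
    by rewrite mul0r.
  - apply/measurable_EFinP; apply: measurable_funM => //.
    by apply: measurable_indic; exact: measurable_simplex.
  - move=> s _; rewrite lee_fin indicE; case: (boolP (s \in _)) => [/set_mem ss|_].
      by rewrite mul1r; have /andP[] := phi01 ss.
    by rewrite mul0r.
rewrite /jump_factor integral_indic_simplex expRN lnK ?posrE//.
rewrite I lee_fin /Rintegral in le1.
by congr EFin; apply/min_idPl.
Qed.

Let sw s : R := (\1_S s * weight s)%R.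

Let sw_ge0 s : (0 <= sw s)%R.
Proof.
rewrite /sw indicE; case: (boolP (s \in _)) => [/set_mem ss|_]; last by rewrite mul0r.
by rewrite mul1r weight_ge0.
Qed.

Let msw : measurable_fun setT sw.
Proof.
apply: measurable_funM; last exact: measurable_weight.
by apply: measurable_indic; exact: measurable_simplex.
Qed.

Let swphi_ge0 s : (0 <= sw s * phi s)%R /\ (0 <= sw s * (1 - phi s))%R.
Proof.
rewrite /sw indicE; case: (boolP (s \in _)) => [/set_mem ss|_]; last by rewrite !mul0r.
rewrite !mul1r; have /andP[p0 p1] := phi01 ss.
by split; rewrite mulr_ge0 ?weight_ge0 ?subr_ge0.
Qed.

Lemma jump_factor01 : (0 <= jump_factor <= 1)%R.
Proof.
rewrite /jump_factor ge_min lexx orbT andbT le_min ler01 andbT mulr_ge0 ?expR_ge0//.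
apply: fine_ge0; apply: integral_ge0 => s _; rewrite lee_fin.
by have [h _] := swphi_ge0 s; move: h; rewrite /sw -mulrA [(weight s * _)%R]mulrC.
Qed.

(** Both sides are [kappa] times one minus the mean of [phi] under the jump law. Finiteness of the
    integral of the weight makes [kappa] its true value, instead of the truncation of an infinite
    one, and justifies the subtraction. *)
Lemma jump_exchange : \int[rho v]_s (sw s)%:E < +oo ->
  \int[rho v]_s (sw s * (1 - phi s))%:E = \int[rho v]_s (sw s * (1 - jump_factor))%:E.
Proof.
move=> fin.
have kE : \int[rho v]_s (sw s)%:E = kappa%:E.
  rewrite /Defs.kappa /Rintegral -integral_indic_simplex fineK// ge0_fin_numE//.
  by apply: integral_ge0 => s _; rewrite lee_fin; exact: sw_ge0.
have m1 : measurable_fun setT (fun s => (sw s * phi s)%:E).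
  by apply/measurable_EFinP; exact: measurable_funM.
have m2 : measurable_fun setT (fun s => (sw s * (1 - phi s))%:E).
  by apply/measurable_EFinP; apply: measurable_funM => //; exact: measurable_funB.
have msE : measurable_fun setT (fun s => (sw s)%:E) by exact/measurable_EFinP.
have /andP[f0 f1] := jump_factor01.
have rhsE : \int[rho v]_s (sw s * (1 - jump_factor))%:E = (kappa * (1 - jump_factor))%:E.
  under eq_integral do rewrite EFinM.
  rewrite ge0_integralZr//; last 2 first.
  - by move=> s _; rewrite lee_fin.
  - by rewrite lee_fin subr_ge0.
  by rewrite kE -EFinM.
have sumE : \int[rho v]_s (sw s * (1 - phi s))%:E + \int[rho v]_s (sw s * phi s)%:E = kappa%:E.
  rewrite -ge0_integralD//; last 2 first.
  - by move=> s _; rewrite lee_fin; exact: (swphi_ge0 s).2.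
  - by move=> s _; rewrite lee_fin; exact: (swphi_ge0 s).1.
  rewrite -kE; apply: eq_integral => s _; rewrite -EFinD; congr EFin.
  by rewrite -mulrDr subrK mulr1.
(* If [kappa] vanishes, the weight is null and both sides are 0, whatever the value of
   [jump_factor]. *)
rewrite rhsE; move: (kappa_ge0 rho M c v); rewrite le_eqVlt => /predU1P[k0|k0].
  apply/eqP; rewrite -k0 mul0r eq_le integral_ge0 ?andbT; last first.
    by move=> s _; rewrite lee_fin; exact: (swphi_ge0 s).2.
  rewrite -[leRHS]/(0%:E) k0 -sumE leeDl//.
  by apply: integral_ge0 => s _; rewrite lee_fin; exact: (swphi_ge0 s).1.
have phiE : \int[rho v]_s (sw s * phi s)%:E = (kappa * jump_factor)%:E.
  have I := integral_jump k0 mphi phi01; rewrite -(jump_factorE k0) in I.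
  case: I => ->; rewrite mulrCA mulfV ?mulr1 ?gt_eqF// /Rintegral -integral_indic_simplex.
  rewrite fineK; last first.
    rewrite ge0_fin_numE; last first.
      apply: integral_ge0 => s _; rewrite lee_fin.
      by have [h _] := swphi_ge0 s; move: h; rewrite /sw -mulrA [(weight s * _)%R]mulrC.
    apply: le_lt_trans (ltry kappa); rewrite -sumE addeC.
    rewrite (eq_integral (fun s => (sw s * phi s)%:E)); last first.
      by move=> s _; rewrite /sw -mulrA [(weight s * _)%R]mulrC.
    by rewrite leeDl// integral_ge0// => s _; rewrite lee_fin; exact: (swphi_ge0 s).2.
  by apply: eq_integral => s _; rewrite /sw -mulrA [(weight s * _)%R]mulrC.
move: sumE; rewrite phiE; case: (\int[rho v]_s _) => // x.
by rewrite -EFinD => -[e]; congr EFin; apply/esym/eqP; rewrite mulrBr mulr1 subr_eq e.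
Qed.

End jump_factor.

Section finite_counts.
Context (R : realType) d (T : measurableType d) (P : probability T R).

Lemma ae_finite_poisson (Y : T -> \bar R) (lam : \bar R) :
  measurable_fun setT Y -> (forall t, count_valued (Y t)) -> 0 <= lam -> lam < +oo ->
  (forall v, (0 < v)%R -> \int[P]_t (expN (v%:E * Y t))%:E =
                          (expN ((1 - expR (- v))%:E * lam))%:E) ->
  {ae P, forall t, Y t < +oo}.
Proof.
move=> mY Yc lam0 lamfin lap.
have [/(_ lamfin) h _] := poisson_of_laplace mY Yc lam0 lap.
have mn n : measurable [set t | Y t = n%:R%:E].
  exact: (preimage_measurable mY (B := [set n%:R%:E])).
have PU : P (\bigcup_n [set t | Y t = n%:R%:E]) = 1.
  rewrite measure_semi_bigcup//; last 2 first.
  - by move=> m n _ _ [t [/= -> /eqP]]; rewrite eqe eqr_nat => /eqP.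
  - by apply: bigcup_measurable => n _.
  rewrite -(poisson_total (fine lam) 0); apply: eq_eseriesr => n _; exact: h.
exists (~` \bigcup_n [set t | Y t = n%:R%:E]); split.
- by apply: measurableC; apply: bigcup_measurable => n _.
- by rewrite probability_setC ?PU ?subee//; apply: bigcup_measurable => n _.
- by move=> t /= nY [n _ Yn]; apply: nY; rewrite Yn ltry.
Qed.

End finite_counts.

Lemma bigcup_set1_id (Y : Type) (A : set Y) : \bigcup_(y in A) [set y] = A.
Proof. by apply/seteqP; split => [y [z Az ->]|y Ay]; [|exists y]. Qed.

Section levy_functionals.
Context (R : realType) (q M : nat) (Omega : completePseudoMetricType R).
Hypothesis q_gt0 : (0 < q)%N.
Local Notation V := (q.-tuple R).
Local Notation W := (borel Omega).
Local Notation X := (V * W)%type.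
Local Notation S := (simplex R q).
Variables (rho : R.-sigmafker W ~> V) (B0 : probability W R).
Hypothesis levy : levy_kernel rho.
Local Notation nu := (levy_intensity q_gt0 B0 levy).

Lemma measurable_indic_simplex : measurable_fun setT (fun s : V => \1_S s : R).
Proof. by apply: measurable_indic; exact: measurable_simplex. Qed.

Lemma measurable_kappa c : measurable_fun setT (kappa M rho c).
Proof.
rewrite (_ : kappa M rho c = fun v => fine (\int[rho v]_s (\1_S s * weight M c s)%:E)); last first.
  by apply/funext => v; rewrite integral_indic_simplex.
apply: (measurableT_comp (fine_measurable measurableT)).
apply: (measurable_integral_mixture (levy_section q_gt0 levy)
  (f := fun x : X => (\1_S x.1 * weight M c x.1)%:E)).
  apply/measurable_EFinP; apply: (measurableT_comp (f := fun s => \1_S s * weight M c s)%R) => //.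
  by apply: measurable_funM; [exact: measurable_indic_simplex|exact: measurable_weight].
move=> x; rewrite lee_fin indicE; case: (boolP (_ \in _)) => [/set_mem sx|_].
  by rewrite mul1r weight_ge0.
by rewrite mul0r.
Qed.

Lemma measurable_jump_factor c (phi : X -> R) : measurable_fun setT phi ->
  (forall x, S x.1 -> (0 <= phi x <= 1)%R) ->
  measurable_fun setT (fun v => jump_factor M rho c v (fun s => phi (s, v))).
Proof.
move=> mphi phi01; apply: measurable_minr; last exact: measurable_cst.
apply: measurable_funM.
  apply: (measurableT_comp (fine_measurable measurableT)).
  apply: (measurable_integral_mixture (levy_section q_gt0 levy)
    (f := fun x : X => (\1_S x.1 * (phi x * weight M c x.1))%:E)).
    apply/measurable_EFinP; apply: measurable_funM.
      exact: (measurableT_comp measurable_indic_simplex measurable_fst).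
    apply: measurable_funM => //.
    exact: (measurableT_comp (@measurable_weight _ _ M c) measurable_fst).
  move=> x; rewrite lee_fin indicE; case: (boolP (_ \in _)) => [/set_mem sx|_].
    by rewrite mul1r mulr_ge0 ?weight_ge0//; have /andP[] := phi01 _ sx.
  by rewrite mul0r.
apply: measurableT_comp => //; apply: measurableT_comp => //; apply: measurableT_comp => //.
exact: measurable_kappa.
Qed.

Hypothesis fi : feature_intensity nu.

Lemma ae_fin_tot : {ae B0, forall v, \int[rho v]_s (\1_S s * tot s)%:E < +oo}.
Proof.
have m1 := @measurable_indic_tot R q Omega.
have t0 (x : X) : 0 <= (\1_S x.1 * tot x.1)%:E by rewrite lee_fin indic_tot_ge0.
have mI := measurable_integral_mixture (levy_section q_gt0 levy) m1 t0.
have h : B0.-integrable setT (fun v => \int[rho v]_s (\1_S s * tot s)%:E).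
  apply/integrableP; split => //.
  rewrite (eq_integral (fun v => \int[rho v]_s (\1_S s * tot s)%:E)); last first.
    by move=> v _; rewrite gee0_abs// integral_ge0// => s _; exact: (t0 (s, v)).
  by rewrite -(integral_levy q_gt0 B0 levy m1 t0); exact: (fi_tot fi).
apply: filterS (integrable_ae measurableT h) => v /(_ I).
by case: (\int[_]_s _) => // r _; rewrite ltry.
Qed.

Lemma ae_fin_weight : {ae B0, forall v, forall m : {ffun 'I_M -> q.-tuple bool},
  ~~ [forall i, m i == one_hot None] -> \int[rho v]_s (mark_weight s m)%:E < +oo}.
Proof.
apply: filterS ae_fin_tot => v h m m0; apply: le_lt_trans h.
apply: ge0_le_integral => //.
- by move=> s _; rewrite lee_fin mark_weight_ge0.
- by apply/measurable_EFinP; exact: measurable_mark_weight.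
- apply/measurable_EFinP; apply: measurable_funM; [exact: measurable_indic_simplex|exact: measurable_tot].
- by move=> s _; rewrite lee_fin mark_weight_le_tot.
Qed.

End levy_functionals.

Section posterior_draws.
Context (R : realType) (q M : nat) (Omega : completePseudoMetricType R).
Hypothesis q_gt0 : (0 < q)%N.
Local Notation V := (q.-tuple R).
Local Notation W := (borel Omega).
Local Notation X := (V * W)%type.
Local Notation S := (simplex R q).
Local Notation mark := {ffun 'I_M.+1 -> q.-tuple bool}.
Variables (U : nat -> set W).
Hypothesis mU : forall n, measurable (U n).
Hypothesis sepU : separated_on U setT.
Variables (rho : R.-sigmafker W ~> V) (B0 : probability W R).
Hypothesis levy : levy_kernel rho.
Local Notation nu := (levy_intensity q_gt0 B0 levy).
Local Notation nuM := (tilt_intensity q_gt0 B0 levy M).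
Hypothesis fi : feature_intensity nu.
Context d (T : measurableType d) (P : probability T R).
Variable N : T -> rmeasure X R.
Hypothesis prmN : is_PRM P nu N.
Variable Z : 'I_M.+1 -> T -> q.-tuple (rmeasure W R).
Variables (act : nat -> T -> bool) (p : nat -> T -> V) (omega : nat -> T -> W)
  (b : 'I_M.+1 -> nat -> T -> q.-tuple bool).
Let atom k t := (act k t, (p k t, omega k t)).
Hypothesis matom : forall k, measurable_fun setT (atom k).
Hypothesis mb : forall i k, measurable_fun setT (b i k).
Hypothesis NE : forall t A, measurable A ->
  N t A = \sum_(0 <= k <oo | act k t) \d_(p k t, omega k t) A.
Hypothesis ZE : forall i j t A, measurable A -> tnth (Z i t) j A =
  \sum_(0 <= k <oo | act k t && tnth (b i k t) j) \d_(omega k t) A.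
Hypothesis condb : forall (m : nat) (beta : 'I_M.+1 -> 'I_m -> q.-tuple bool),
  cond_prob P (sigma_of_family atom)
    [set t | forall i (k : 'I_m), act k t -> b i k t = beta i k]
    (fun t => (\prod_(i < M.+1) \prod_(k < m | act k t) mpmf (p k t) (beta i k))%:E).

Hypothesis mZ : forall i, measurable_fun setT (Z i).

Definition marks k t : mark := [ffun i => b i k t].
Definition Zpast : 'I_M -> T -> q.-tuple (rmeasure W R) :=
  fun i => Z (widen_ord (leqnSn M) i).

Let simp := ae_simplex_atoms fi prmN NE.
Let dist := ae_distinct_features q_gt0 fi mU sepU prmN NE.
Let mset1 := measurable_set1_feature mU sepU.

Lemma selected_unselected (m : mark) :
  ~~ unselected m <-> exists i j, tnth (past m i) j.
Proof.
rewrite unselected_past; split => [/forallPn[i /eqP mi]|[i [j mij]]].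
  exists i; apply: contrapT => /forallNP h; apply: mi.
  by apply: eq_from_tnth => j; rewrite tnth_one_hot; apply/negbTE/negP.
by apply/forallPn; exists i; apply: contraTneq mij => ->; rewrite tnth_one_hot.
Qed.

Lemma Zpast_set0 i j t A : measurable A -> tnth (Zpast i t) j A = 0 <->
  forall k, act k t -> tnth (past (marks k t) i) j -> ~ A (omega k t).
Proof.
move=> mA; rewrite /Zpast ZE// dirac_series0; split => h k.
  by move=> ak; rewrite !ffunE => bk; apply: h; rewrite ak.
by move=> /andP[ak bk]; apply: h => //; rewrite !ffunE.
Qed.

Lemma selectedE t : selected Zpast t =
  [set omega k t | k in [set k | act k t && ~~ unselected (marks k t)]].
Proof.
apply/seteqP; split => [v [i [j]]|_ [k /= /andP[ak /selected_unselected[i [j mij]]] <-]].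
  move=> Zv; apply: contrapT => nv; move: Zv; rewrite ltNge => /negP; apply.
  rewrite le_eqVlt; apply/orP; left; apply/eqP/Zpast_set0; first exact: mset1.
  move=> k ak bk /= kv; apply: nv; exists k => //=; rewrite ak/=.
  by apply/selected_unselected; exists i, j.
exists i, j; rewrite lt0e measure_ge0 andbT; apply/eqP => /Zpast_set0.
by move=> /(_ (mset1 _) k ak mij); apply.
Qed.

Lemma Zpast_atoms t : finitely_many Zpast t ->
  finite_set (selected Zpast t) /\
  forall i j, tnth (Zpast i t) j (~` selected Zpast t) = 0.
Proof.
move=> fin.
have fS : finite_set (selected Zpast t).
  rewrite selectedE (_ : [set k | _] = \bigcup_(ij in [set: 'I_M * 'I_q])
      [set k | act k t && tnth (b (widen_ord (leqnSn M) ij.1) k t) ij.2]).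
    apply: finite_image; apply: bigcup_finite => // -[i j] _ /=.
    have := fin i j; rewrite /Zpast ZE// (eq_eseriesr (g := fun=> 1)); last first.
      by move=> k _; rewrite diracT.
    rewrite nneseries_esum// -counting_esum /counting; case: asboolP => //.
  apply/seteqP; split => [k /andP[ak /selected_unselected[i [j mij]]]|k [[i j] _ /= /andP[ak bk]]].
    by exists (i, j) => //=; rewrite ak; move: mij; rewrite !ffunE.
  by rewrite /= ak; apply/selected_unselected; exists i, j; rewrite !ffunE.
split => // i j; apply/Zpast_set0.
  apply: measurableC; rewrite -[selected _ _]bigcup_set1_id.
  by apply: fin_bigcup_measurable => // v _; exact: mset1.
move=> k ak bk; apply; rewrite selectedE; exists k => //=; rewrite ak.
by apply/selected_unselected; exists i, j.
Qed.

(** As the features are distinct, the mass of a draw at [omega k t] is the bit of the [k]-th atom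
    alone. *)
Lemma feature_countE t k :
  (forall k l, act k t -> act l t -> omega k t = omega l t -> k = l) -> act k t ->
  feature_count Zpast t (omega k t) = mark_count (past (marks k t)).
Proof.
move=> inj ak; apply/funext => j; apply: eq_bigr => i _.
rewrite /Zpast ZE; last exact: mset1.
have [bk|bk] := boolP (tnth (b (widen_ord (leqnSn M) i) k t) j).
  rewrite !ffunE bk (@nneseriesD1 R _ k)//; last by rewrite ak bk.
  rewrite diracE mem_set// eseries0 ?adde0; last first.
    move=> l _ /andP[/andP[al bl] lk]; rewrite diracE memNset//= => E.
    by move: lk; rewrite (inj l k)// eqxx.
  by rewrite /= -[1%R]/(1%:R) natrK.
rewrite !ffunE (negbTE bk) [X in fine X](_ : _ = 0) ?fine0 ?truncn0//.
apply/dirac_series0 => l /andP[al bl] /= E.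
by move: bl; rewrite (inj l k) ?(negbTE bk).
Qed.

Let laplace (f : X -> mark -> \bar R) := marked_laplace matom mb condb simp prmN NE (fi_simplex fi) (f := f).
Let void (bad : X -> mark -> bool) := marked_void matom mb condb simp prmN NE (fi_simplex fi) (bad := bad).
Let ae_good (bad : X -> mark -> bool) := marked_ae_good matom mb condb simp prmN NE (fi_simplex fi) (bad := bad).

(** The mass of one component counts the atoms with a given bit set. Its Laplace transform is that
    of a Poisson variable, whose mean is at most the number of marks times the integral of [tot]. *)
Lemma ae_finitely_many : {ae P, forall t, finitely_many Zpast t}.
Proof.
suff h : {ae P, forall t (ij : 'I_M * 'I_q), tnth (Zpast ij.1 t) ij.2 setT < +oo}.
  by apply: filterS h => t h i j; exact: (h (i, j)).
apply: ae_forall_count => -[i j] /=.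
pose n (m : mark) : R := (tnth (past m i) j)%:R.
pose lam := \int[nu]_x (\sum_m mark_weight x.1 m * n m)%:E.
have mmw (m : mark) : measurable_fun setT (fun x : X => mark_weight x.1 m).
  exact: (measurableT_comp (measurable_mark_weight _) measurable_fst).
have mlam : measurable_fun setT (fun x : X => (\sum_m mark_weight x.1 m * n m)%:E).
  by apply/measurable_EFinP; apply: measurable_sum => m; exact: measurable_funM.
have lam0 (x : X) : (0 <= \sum_m mark_weight x.1 m * n m)%R.
  by apply: sumr_ge0 => m _; rewrite mulr_ge0 ?mark_weight_ge0 ?ler0n.
apply: (@ae_finite_poisson _ _ _ _ _ lam).
- exact: (measurableT_comp (measurable_rmeasure_ev measurableT)
    (measurableT_comp (measurable_tnth j) (mZ _))).
- by move=> t; rewrite ZE//; exact: count_valued_dirac_series.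
- by apply: integral_ge0 => x _; rewrite lee_fin.
- apply: (@le_lt_trans _ _ (\int[nu]_x (#|{: mark}|%:R%:E * (\1_S x.1 * tot x.1)%:E))).
    apply: ge0_le_integral => //.
    + by move=> x _; rewrite lee_fin.
    + by apply: emeasurable_funM => //; exact: measurable_indic_tot.
    + move=> x _; rewrite -EFinM lee_fin -mulr_natl mulr1 -sumr_const mulr_suml.
      apply: ler_sum => m _; rewrite mul1r /n; case: (boolP (tnth _ j)) => h.
        rewrite mulr1 mark_weight_le_tot//.
        apply/forallPn; exists (widen_ord (leqnSn M) i).
        by apply: contraTneq h; rewrite ffunE => ->; rewrite tnth_one_hot.
      by rewrite mulr0 indic_tot_ge0.
  rewrite ge0_integralZl_EFin//.
  + by rewrite lte_mul_pinfty ?lee_fin ?ler0n//; exact: (fi_tot fi).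
  + by move=> x _; rewrite lee_fin indic_tot_ge0.
  + exact: measurable_indic_tot.
- move=> v v0.
  have := @laplace (fun _ m => (v * n m)%:E) (fun=> measurable_cst _).
  rewrite (_ : (1 - expR (- v))%:E * lam =
      \int[nu]_x (\sum_m mark_weight x.1 m * (1 - expN (v * n m)%:E))%:E); last first.
    rewrite /lam -ge0_integralZl_EFin//; last 2 first.
    + by move=> x _; rewrite lee_fin.
    + by rewrite subr_ge0 -expR0 ler_expR oppr_le0 ltW.
    apply: eq_integral => x _; rewrite -EFinM mulr_sumr; congr EFin.
    apply: eq_bigr => m _; rewrite mulrCA; congr (_ * _)%R; rewrite /n /=.
    by case: (tnth _ _); rewrite ?mulr1 ?mulr0 ?oppr0 ?expR0 ?subrr.
  move=> <-; last by move=> _ m; rewrite lee_fin mulr_ge0 ?ler0n// ltW.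
  apply: eq_integral => t _; congr (expN _)%:E.
  rewrite /Zpast ZE// -nneseriesZl//.
  rewrite eseries_mkcond [RHS]eseries_mkcond; apply: eq_eseriesr => k _.
  rewrite diracT mule1 /n !ffunE.
  by case: (act k t); case: (tnth _ _); rewrite ?mulr1 ?mulr0.
Qed.

(** At almost every feature the weight of nonzero past marks has a finite integral. Where [kappa] is
    not positive this integral is 0, so atoms with such marks and features contribute nothing to the
    exponent of the void probability. *)
Lemma ae_kappa_gt0 : {ae P, forall t k, act k t -> ~~ unselected (marks k t) ->
  (0 < kappa M rho (mark_count (past (marks k t))) (omega k t))%R}.
Proof.
pose bad (x : X) (m : mark) := ~~ unselected m && (kappa M rho (mark_count (past m)) x.2 <= 0)%R.
have mbad m : measurable_fun setT (bad ^~ m).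
  rewrite /bad; case: (unselected m) => /=; first exact: measurable_cst.
  apply: measurable_fun_ler => //.
  exact: (measurableT_comp (measurable_kappa _ q_gt0 levy _) measurable_snd).
suff h : {ae P, forall t k, act k t -> ~~ bad (p k t, omega k t) (marks k t)}.
  by apply: filterS h => t h k ak sk; have := h k ak; rewrite /bad sk/= -ltNge.
apply: ae_good => // m.
pose f (x : X) := (mark_weight x.1 m * (bad x m)%:R)%:E.
have mf : measurable_fun setT f.
  apply/measurable_EFinP; apply: measurable_funM.
    exact: (measurableT_comp (measurable_mark_weight _) measurable_fst).
  rewrite (_ : (fun x => _) = (fun x => if bad x m then 1 else 0)%R); last first.
    by apply/funext => x; case: (bad x m).
  exact: measurable_fun_ifT.
have f0 x : 0 <= f x by rewrite lee_fin mulr_ge0// mark_weight_ge0.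
rewrite integral_levy// -(integral0 B0 setT); apply: ge0_ae_eq_integral => //.
- exact: (measurable_integral_mixture (levy_section q_gt0 levy) mf f0).
- by move=> v _; apply: integral_ge0 => s _; exact: f0.
apply: filterS (ae_fin_weight M fi) => v fin _.
rewrite /f /bad; case: (boolP (unselected m)) => [_|sel] /=.
  by apply: integral0_eq => s _; rewrite mulr0.
case: (leP (kappa M rho (mark_count (past m)) v) 0%R) => [k0|_]; last first.
  by apply: integral0_eq => s _; rewrite mulr0.
apply/eqP; rewrite eq_le; apply/andP; split; last first.
  by apply: integral_ge0 => s _; rewrite mulr1 lee_fin mark_weight_ge0.
have sel' : ~~ [forall i, past m i == one_hot None] by rewrite -unselected_past.
have [m1|] := boolP [forall i, (btot (past m i) <= 1)%N]; last first.
  move=> /forallPn[i]; rewrite -ltnNge => mi.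
  by rewrite integral0_eq// => s _; rewrite mark_weight_past (mark_weight_gt1 _ mi) !mul0r.
apply: (@le_trans _ _ (\int[rho v]_s (mark_weight s (past m))%:E)).
  apply: ge0_le_integral => //.
  - by move=> s _; rewrite mulr1 lee_fin mark_weight_ge0.
  - by apply/measurable_EFinP; apply: measurable_funM => //; exact: measurable_mark_weight.
  - by apply/measurable_EFinP; exact: measurable_mark_weight.
  - move=> s _; rewrite mulr1 lee_fin mark_weight_past.
    have [ss|ns] := pselect (S s); last by rewrite mark_weight_out// mul0r.
    by rewrite ler_piMr ?mark_weight_ge0// mpmf_le1.
have /= := fin _ sel'; under eq_integral do rewrite (mark_weightE _ (forallP m1)).
rewrite integral_indic_simplex => fin'.
rewrite -[leLHS]fineK; first by rewrite lee_fin.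
rewrite ge0_fin_numE//; apply: integral_ge0 => s ss; rewrite lee_fin; exact: weight_ge0.
Qed.

Lemma esum_selected (h : ('I_q -> nat) -> W -> \bar R) t : (forall c v, 0 <= h c v) ->
  (forall k l, act k t -> act l t -> omega k t = omega l t -> k = l) ->
  \esum_(v in selected Zpast t) h (feature_count Zpast t v) v =
  \sum_(0 <= k <oo | act k t) (if unselected (marks k t) then 0
    else h (mark_count (past (marks k t))) (omega k t)).
Proof.
move=> h0 inj; pose A := [set k | act k t && ~~ unselected (marks k t)].
have injA : set_inj A (omega ^~ t).
  by move=> k l /set_mem/andP[ak _] /set_mem/andP[al _]; exact: inj.
rewrite selectedE (esum_image _ _ _ injA).
rewrite nneseries_esum; last first.
  by move=> k _; case: ifP.
rewrite (_ : A = [set k | act k t] `&` [set k | ~~ unselected (marks k t)]); last first.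
  by apply/seteqP; split => k /andP.
rewrite esum_mkcondr; apply: eq_esum => k /= ak.
rewrite feature_countE//; case: (boolP (unselected _)) => uk.
  by rewrite memNset//= uk.
by rewrite mem_set.
Qed.

End posterior_draws.

Lemma sigma_of_family_measurable I d (T : measurableType d) dY (Y : measurableType dY)
    (f : I -> T -> Y) : (forall i, measurable_fun setT (f i)) ->
  sigma_of_family f `<=` measurable.
Proof.
move=> mf; apply: smallest_sub; first exact: sigma_algebra_measurable.
by move=> _ [i _ [B mB <-]]; exact: mf.
Qed.

(** * Joint void probabilities *)

Section core_identity.
Context (R : realType) (q M : nat) (Omega : completePseudoMetricType R).
Hypothesis q_gt0 : (0 < q)%N.
Local Notation V := (q.-tuple R).
Local Notation W := (borel Omega).
Local Notation X := (V * W)%type.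
Local Notation S := (simplex R q).
Local Notation mark := {ffun 'I_M.+1 -> q.-tuple bool}.
Variables (U : nat -> set W).
Hypothesis mU : forall n, measurable (U n).
Hypothesis sepU : separated_on U setT.
Variables (rho : R.-sigmafker W ~> V) (B0 : probability W R).
Hypothesis levy : levy_kernel rho.
Local Notation nu := (levy_intensity q_gt0 B0 levy).
Local Notation nuM := (tilt_intensity q_gt0 B0 levy M).
Hypothesis fi : feature_intensity nu.
Context d (T : measurableType d) (P : probability T R).
Variable N : T -> rmeasure X R.
Hypothesis prmN : is_PRM P nu N.
Variable Z : 'I_M.+1 -> T -> q.-tuple (rmeasure W R).
Variables (act : nat -> T -> bool) (p : nat -> T -> V) (omega : nat -> T -> W)
  (b : 'I_M.+1 -> nat -> T -> q.-tuple bool).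
Let atom k t := (act k t, (p k t, omega k t)).
Hypothesis matom : forall k, measurable_fun setT (atom k).
Hypothesis mb : forall i k, measurable_fun setT (b i k).
Hypothesis NE : forall t A, measurable A ->
  N t A = \sum_(0 <= k <oo | act k t) \d_(p k t, omega k t) A.
Hypothesis ZE : forall i j t A, measurable A -> tnth (Z i t) j A =
  \sum_(0 <= k <oo | act k t && tnth (b i k t) j) \d_(omega k t) A.
Hypothesis condb : forall (m : nat) (beta : 'I_M.+1 -> 'I_m -> q.-tuple bool),
  cond_prob P (sigma_of_family atom)
    [set t | forall i (k : 'I_m), act k t -> b i k t = beta i k]
    (fun t => (\prod_(i < M.+1) \prod_(k < m | act k t) mpmf (p k t) (beta i k))%:E).

Hypothesis mZ : forall i, measurable_fun setT (Z i).


Local Notation Zp := (Zpast Z).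
Local Notation pmark := {ffun 'I_M -> q.-tuple bool}.
Local Notation marks := (marks b).
Let simp := ae_simplex_atoms fi prmN NE.
Let dist := ae_distinct_features q_gt0 fi mU sepU prmN NE.

Variable chi : X -> q.-tuple bool -> bool.
Hypothesis mchi : forall beta, measurable_fun setT (chi ^~ beta).
Variable D : 'I_M -> 'I_q -> set W.
Hypothesis mD : forall i j, measurable (D i j).

(** The mean of the test [chi] over the last draw. One test serves both conditional laws: absence of
    the atom from a set, blind to the bits, for [N]; [avoids] for the next draw. *)
Definition chi_hat (x : X) : R := (\sum_beta mpmf x.1 beta * (chi x beta)%:R)%R.

Definition chi_factor c v : R := jump_factor M rho c v (fun s => chi_hat (s, v)).

Let hit (v : W) (m : pmark) : bool := [exists i, [exists j, tnth (m i) j && `[< D i j v >]]].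

Let past_event := [set t | forall i j, tnth (Zp i t) j (D i j) = 0].

Let chi_event := [set t | forall k, act k t -> chi (p k t, omega k t) (b ord_max k t)].

Lemma measurable_chi_hat : measurable_fun setT chi_hat.
Proof.
apply: measurable_sum => beta; apply: measurable_funM.
  exact: (measurableT_comp (measurable_mpmf (R := R) beta) measurable_fst).
rewrite (_ : (fun x => _) = (fun x => if chi x beta then 1 else 0)%R); last first.
  by apply/funext => x; case: (chi x beta).
exact: measurable_fun_ifT.
Qed.

Lemma chi_hat01 x : S x.1 -> (0 <= chi_hat x <= 1)%R.
Proof.
move=> sx; apply/andP; split.
  by apply: sumr_ge0 => beta _; rewrite mulr_ge0 ?mpmf_ge0.
rewrite -(sum_mpmf1 x.1); apply: ler_sum => beta _.
by rewrite ler_piMr ?mpmf_ge0// lern1 leq_b1.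
Qed.

Lemma chi_factor01 c v : (0 <= chi_factor c v <= 1)%R.
Proof. by apply: jump_factor01 => s ss; apply: chi_hat01. Qed.

Lemma measurable_chi_factor c : measurable_fun setT (chi_factor c).
Proof.
apply: (measurable_jump_factor _ q_gt0 levy); first exact: measurable_chi_hat.
exact: chi_hat01.
Qed.

Let measurable_hit m : measurable_fun setT (hit ^~ m).
Proof.
apply: (measurable_fun_bool true); rewrite setTI.
rewrite (_ : _ @^-1` _ = \bigcup_(ij in [set ij : 'I_M * 'I_q | tnth (m ij.1) ij.2]) D ij.1 ij.2).
  by apply: fin_bigcup_measurable => // ij _.
apply/seteqP; split => [v /existsP[i /existsP[j /andP[mij /asboolP Dv]]]|v [[i j] /= mij Dv]].
  by exists (i, j).
by apply/existsP; exists i; apply/existsP; exists j; rewrite mij; apply/asboolP.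
Qed.

Let hit_unselected v (m : mark) : unselected m -> hit v (past m) = false.
Proof.
rewrite unselected_past => /forallP h; apply/negbTE/existsPn => i; apply/existsPn => j.
by rewrite (eqP (h i)) tnth_one_hot.
Qed.

Let h c v := lnN (chi_factor c v).
(** A function of the past marks alone whose Laplace functional is the side to compare with: [+oo]
    forbids atoms hitting [D], unselected atoms are ignored, and each selected feature contributes
    the factor [chi_factor]. *)
Let f (x : X) (m : mark) : \bar R := if hit x.2 (past m) then +oo
  else if unselected m then 0 else h (mark_count (past m)) x.2.
Let bad (x : X) (m : mark) : bool := ~~ chi x (m ord_max) || hit x.2 (past m).
Let sel (m : pmark) := ~~ [forall i, m i == one_hot None].
Let C : \bar R := \int[nuM]_x (\1_S x.1 * \sum_beta mpmf x.1 beta * (~~ chi x beta)%:R)%:E.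

Let h0 c v : 0 <= h c v.
Proof. by apply: lnN_ge0; have /andP[] := chi_factor01 c v. Qed.

Let mh c : measurable_fun setT (h c).
Proof. exact: (measurableT_comp (@measurable_lnN R) (measurable_chi_factor c)). Qed.

Let expN_h c v : expN (h c v) = chi_factor c v.
Proof. by apply: lnNK; have /andP[] := chi_factor01 c v. Qed.

(** The common shape of both exponents on selected marks: [g] is the mean of [chi] at the jump
    itself, or its average over the jump law. *)
Let past_factor (g : R) (x : X) (m : pmark) : R :=
  (if sel m then mark_weight x.1 m * (if hit x.2 m then 1 else 1 - g) else 0)%R.

Let bad_sum x : (\sum_m mark_weight x.1 m * (bad x m)%:R =
  fine (tilt_density M x) * (\sum_beta mpmf x.1 beta * (~~ chi x beta)%:R) +
  \sum_m past_factor (chi_hat x) x m)%R.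
Proof.
rewrite -(sum_mark_unselected M x.1 (fun beta => (~~ chi x beta)%:R)).
transitivity (\sum_(m : mark) (mark_weight x.1 m * (if unselected m then (~~ chi x (m ord_max))%:R else 0) +
    (if sel (past m) then mark_weight x.1 (past m) * mpmf x.1 (m ord_max) *
       (~~ chi x (m ord_max) || hit x.2 (past m))%:R else 0)))%R.
  apply: eq_bigr => m _; rewrite /sel -unselected_past /bad.
  case: (boolP (unselected m)) => um; first by rewrite hit_unselected// orbF addr0.
  by rewrite mulr0 add0r mark_weight_past.
rewrite big_split/=; congr (_ + _)%R.
rewrite (sum_past_last (fun m' beta => if sel m' then mark_weight x.1 m' * mpmf x.1 beta *
       (~~ chi x beta || hit x.2 m')%:R else 0)%R).
apply: eq_bigr => m _; rewrite /past_factor; case: (sel m); last by rewrite big1.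
under eq_bigr do rewrite -mulrA.
rewrite -mulr_sumr; congr (_ * _)%R; case: (hit x.2 m).
  by under eq_bigr do rewrite orbT mulr1; exact: sum_mpmf1.
rewrite -[X in (X - chi_hat x)%R](sum_mpmf1 x.1) -sumrB; apply: eq_bigr => beta _.
by rewrite orbF; case: (chi x beta); rewrite ?mulr1 ?mulr0 ?subrr ?subr0.
Qed.

Let f_sum x : (\sum_m mark_weight x.1 m * (1 - expN (f x m)) =
  \sum_m past_factor (chi_factor (mark_count m) x.2) x m)%R.
Proof.
transitivity (\sum_(m : mark) (if sel (past m) then mark_weight x.1 (past m) * mpmf x.1 (m ord_max) *
       (if hit x.2 (past m) then 1 else 1 - chi_factor (mark_count (past m)) x.2) else 0))%R.
  apply: eq_bigr => m _; rewrite /sel -unselected_past /f.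
  case: (boolP (unselected m)) => um; first by rewrite hit_unselected// expN0 subrr mulr0.
  rewrite mark_weight_past; congr (_ * _)%R; case: (hit _ _); first by rewrite subr0.
  by rewrite expN_h.
rewrite (sum_past_last (fun m' beta => if sel m' then mark_weight x.1 m' * mpmf x.1 beta *
       (if hit x.2 m' then 1 else 1 - chi_factor (mark_count m') x.2) else 0)%R).
apply: eq_bigr => m _; rewrite /past_factor; case: (sel m); last by rewrite big1.
under eq_bigr do rewrite mulrAC.
by rewrite -mulr_sumr sum_mpmf1 mulr1.
Qed.

Let past_factor_ge0 g (x : X) m : (S x.1 -> (g <= 1)%R) -> (0 <= past_factor g x m)%R.
Proof.
move=> g1; rewrite /past_factor; case: (sel m) => //.
have [sx|nx] := pselect (S x.1); last by rewrite mark_weight_out// mul0r.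
by rewrite mulr_ge0 ?mark_weight_ge0//; case: ifP; rewrite // subr_ge0 g1.
Qed.

Let measurable_past_factor (g : X -> R) m : measurable_fun setT g ->
  measurable_fun setT (fun x => (past_factor (g x) x m)%:E).
Proof.
move=> mg; apply/measurable_EFinP; rewrite /past_factor.
case: (sel m); last exact: measurable_cst.
apply: measurable_funM.
  exact: (measurableT_comp (measurable_mark_weight _) measurable_fst).
apply: measurable_fun_ifT => //; last exact: measurable_funB.
exact: (measurableT_comp (measurable_hit m) measurable_snd).
Qed.

Let measurable_factor_at c : measurable_fun setT (fun x : X => chi_factor c x.2).
Proof. exact: (measurableT_comp (measurable_chi_factor c) measurable_snd). Qed.

(** At fixed feature and marks, a hit makes both integrands the same weight. Otherwise the integrals
    over the jump agree by [jump_exchange], at almost every feature, namely where the weights are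
    integrable. *)
Let past_factor_exchange m :
  \int[nu]_x (past_factor (chi_hat x) x m)%:E =
  \int[nu]_x (past_factor (chi_factor (mark_count m) x.2) x m)%:E.
Proof.
have m1 := measurable_past_factor m measurable_chi_hat.
have m2 := measurable_past_factor m (measurable_factor_at (mark_count m)).
have p1 (x : X) : 0 <= (past_factor (chi_hat x) x m)%:E.
  by rewrite lee_fin past_factor_ge0// => /chi_hat01/andP[].
have p2 (x : X) : 0 <= (past_factor (chi_factor (mark_count m) x.2) x m)%:E.
  by rewrite lee_fin past_factor_ge0// => _; have /andP[] := chi_factor01 (mark_count m) x.2.
rewrite (integral_levy q_gt0 B0 levy m1 p1) (integral_levy q_gt0 B0 levy m2 p2).
apply: ge0_ae_eq_integral => //.
- exact: (measurable_integral_mixture (levy_section q_gt0 levy) m1 p1).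
- exact: (measurable_integral_mixture (levy_section q_gt0 levy) m2 p2).
- by move=> v _; apply: integral_ge0 => s _; exact: (p1 (s, v)).
- by move=> v _; apply: integral_ge0 => s _; exact: (p2 (s, v)).
apply: filterS (ae_fin_weight M fi) => v fin _.
rewrite /past_factor /=; case: (boolP (sel m)) => // selm.
case: (hit v m) => //.
have [w1|] := boolP [forall i, (btot (m i) <= 1)%N]; last first.
  move=> /forallPn[i]; rewrite -ltnNge => mi.
  by apply: eq_integral => s _; rewrite (mark_weight_gt1 _ mi) !mul0r.
have fin' : \int[rho v]_s (\1_S s * weight M (mark_count m) s)%:E < +oo.
  have := fin _ selm; under eq_integral do rewrite (mark_weightE _ (forallP w1)).
  exact.
under eq_integral do rewrite (mark_weightE _ (forallP w1)).
under [RHS]eq_integral do rewrite (mark_weightE _ (forallP w1)).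
apply: (jump_exchange (phi := fun s => chi_hat (s, v)) _ _ fin').
  by apply: measurable_fun_pair1; exact: measurable_chi_hat.
by move=> s ss; exact: chi_hat01.
Qed.

Let exponents : \int[nu]_x (\sum_m mark_weight x.1 m * (bad x m)%:R)%:E =
  C + \int[nu]_x (\sum_m mark_weight x.1 m * (1 - expN (f x m)))%:E.
Proof.
pose G (x : X) := (\sum_beta mpmf x.1 beta * (~~ chi x beta)%:R)%R.
have mG : measurable_fun setT G.
  apply: measurable_sum => beta; apply: measurable_funM.
    exact: (measurableT_comp (measurable_mpmf (R := R) beta) measurable_fst).
  rewrite (_ : (fun x => _) = (fun x => if chi x beta then 0 else 1)%R); last first.
    by apply/funext => x; case: (chi x beta).
  exact: measurable_fun_ifT.
have mS : measurable_fun setT (fun x : X => \1_S x.1 : R).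
  exact: (measurableT_comp (@measurable_indic_simplex R q) measurable_fst).
have sG0 (x : X) : (0 <= \1_S x.1 * G x)%R.
  rewrite indicE; case: (boolP (_ \in _)) => [/set_mem sx|_]; last by rewrite mul0r.
  by rewrite mul1r sumr_ge0// => beta _; rewrite mulr_ge0 ?mpmf_ge0.
have mSG : measurable_fun setT (fun x => (\1_S x.1 * G x)%:E).
  by apply/measurable_EFinP; exact: measurable_funM.
have CE : C = \int[nu]_x (fine (tilt_density M x) * G x)%:E.
  rewrite /C integral_mdens//.
  apply: eq_integral => x _; rewrite /tilt_density -EFinM/= -/(G x); congr EFin.
  by rewrite indicE; case: (_ \in _); rewrite ?mul0r// !mul1r mulrC.
have tG0 (x : X) : 0 <= (fine (tilt_density M x) * G x)%:E.
  rewrite lee_fin /tilt_density/= -mulrA [(_ ^+ _ * _)%R]mulrC mulrA.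
  rewrite indicE; case: (boolP (x.1 \in _)) => [/set_mem sx|_]; last by rewrite !mul0r.
  have := sG0 x; rewrite indicE mem_set// => h'.
  by rewrite mulr_ge0// exprn_ge0// subr_ge0 ltW//; case: sx.
rewrite (eq_integral (fun x => (fine (tilt_density M x) * G x)%:E +
    \sum_m (past_factor (chi_hat x) x m)%:E)); last first.
  by move=> x _; rewrite bad_sum EFinD sumEFin.
rewrite ge0_integralD//; last 3 first.
- apply/measurable_EFinP; apply: measurable_funM => //.
  exact: (measurableT_comp (fine_measurable measurableT) (measurable_tilt_density M)).
- move=> x _; apply: sume_ge0 => m _; rewrite lee_fin past_factor_ge0//.
  by move=> /chi_hat01/andP[].
- by apply: emeasurable_sum => m; exact: (measurable_past_factor m measurable_chi_hat).
rewrite CE; congr (_ + _).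
rewrite ge0_integral_sum//; last 2 first.
- by move=> m; exact: (measurable_past_factor m measurable_chi_hat).
- by move=> m x _; rewrite lee_fin past_factor_ge0// => /chi_hat01/andP[].
under eq_bigr do rewrite past_factor_exchange.
rewrite -ge0_integral_sum//; last 2 first.
- by move=> m; exact: (measurable_past_factor m (measurable_factor_at _)).
- move=> m x _; rewrite lee_fin past_factor_ge0// => _.
  by have /andP[] := chi_factor01 (mark_count m) x.2.
by apply: eq_integral => x _; rewrite f_sum sumEFin.
Qed.

Let past_hit t : past_event t <->
  forall k, act k t -> ~~ hit (omega k t) (past (marks k t)).
Proof.
split => [h' k ak|h' i j].
  apply/existsPn => i; apply/existsPn => j; apply/negP => /andP[mij /asboolP Dk].
  by have /(Zpast_set0 ZE i j t (mD i j)) := h' i j; move=> /(_ k ak mij).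
apply/(Zpast_set0 ZE i j t (mD i j)) => k ak mij Dk.
have /existsPn/(_ i)/existsPn/(_ j) := h' k ak.
by rewrite mij/= => /negP; apply; apply/asboolP.
Qed.

Let chi_bad t : (past_event `&` chi_event) t <->
  forall k, act k t -> ~~ bad (p k t, omega k t) (marks k t).
Proof.
split => [[/past_hit hp hc] k ak|hb].
  by rewrite /bad negb_or negbK /= hp// ffunE hc.
split; first by apply/past_hit => k ak; have := hb k ak; rewrite negb_or => /andP[].
by move=> k ak; have := hb k ak; rewrite negb_or negbK ffunE => /andP[].
Qed.

Let mf m : measurable_fun setT (f ^~ m).
Proof.
apply: measurable_fun_ifT => //.
  exact: (measurableT_comp (measurable_hit _) measurable_snd).
case: (unselected m) => //.
exact: (measurableT_comp (mh _) measurable_snd).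
Qed.

Let f0 x m : 0 <= f x m.
Proof. by rewrite /f; case: ifP => // _; case: ifP. Qed.

Let mZp i : measurable_fun setT (Zp i) := mZ _.

Lemma measurable_chi_feature_sum :
  measurable_fun setT (fun t : T => feature_sum Zp h t).
Proof.
move=> _ B mB; rewrite setTI; apply: (sigma_of_family_measurable mZp).
have := measurable_feature_sum mU sepU (Zpast_atoms mU sepU ZE) mh h0 measurableT mB.
by rewrite setTI.
Qed.

(* Both sides are exponentials of an integral over [nu]. The unselected atoms
   contribute the same integral against the tilted intensity to both exponents; for
   the selected ones, integrating the jump out at a fixed feature and fixed past
   marks replaces the indicator of [chi] by its mean under the posterior jump law. *)
Theorem past_draw_prob : P (past_event `&` chi_event) =
  \int[P]_(t in past_event) (expN C * expN (feature_sum Zp h t))%:E.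
Proof.
have mA : measurable past_event.
  rewrite (_ : past_event = \bigcap_(ij in [set: 'I_M * 'I_q])
      ((fun t => tnth (Zp ij.1 t) ij.2 (D ij.1 ij.2)) @^-1` [set 0])).
    apply: fin_bigcap_measurable => // ij _.
    apply: (preimage_measurable (f := fun t => tnth (Zp ij.1 t) ij.2 (D ij.1 ij.2))) => //.
    exact: (measurableT_comp (measurable_rmeasure_ev (mD _ _))
      (measurableT_comp (measurable_tnth ij.2) (mZp ij.1))).
  by apply/seteqP; split => [t h' ij _|t h' i j]; [exact: h'|exact: (h' (i, j))].
have mbad m : measurable_fun setT (bad ^~ m).
  apply: measurable_or; first by apply: measurable_neg; exact: mchi.
  exact: (measurableT_comp (measurable_hit _) measurable_snd).
have -> : past_event `&` chi_event =
    [set t | forall k, act k t -> ~~ bad (p k t, omega k t) (marks k t)].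
  by apply/seteqP; split => t /chi_bad.
rewrite (marked_void matom mb condb simp prmN NE (fi_simplex fi) mbad) exponents.
have C0 : 0 <= C.
  apply: integral_ge0 => x _; rewrite lee_fin indicE; case: (boolP (_ \in _)) => [/set_mem sx|_].
    by rewrite mul1r sumr_ge0// => beta _; rewrite mulr_ge0 ?mpmf_ge0.
  by rewrite mul0r.
rewrite expND//; last first.
  apply: integral_ge0 => x _; rewrite lee_fin sumr_ge0// => m _.
  by rewrite mulr_ge0 ?mark_weight_ge0// subr_ge0 expN_le1.
rewrite EFinM -(marked_laplace matom mb condb simp prmN NE (fi_simplex fi) mf f0).
under [RHS]eq_integral do rewrite EFinM.
rewrite ge0_integralZl_EFin//; last 3 first.
- by move=> t _; rewrite lee_fin expN_ge0.
- apply/measurable_EFinP; apply: measurable_funTS.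
  exact: (measurableT_comp (@measurable_expN R) measurable_chi_feature_sum).
- exact: expN_ge0.
congr (_ * _); rewrite [RHS]integral_mkcond; apply: ge0_ae_eq_integral => //.
- apply/measurable_EFinP; apply: (measurableT_comp (@measurable_expN R)).
  apply: (measurable_cond_series matom) => [k|k t]; last exact: f0.
  exact: (measurable_mark_eval matom mb _ mf).
- apply/(measurable_restrictT _ mA); apply/measurable_EFinP; apply: measurable_funTS.
  exact: (measurableT_comp (@measurable_expN R) measurable_chi_feature_sum).
- by move=> t _; rewrite lee_fin expN_ge0.
- by move=> t _; apply: erestrict_ge0 => t' _; rewrite lee_fin expN_ge0.
apply: filterS (filterI dist (ae_finitely_many fi prmN matom mb NE ZE condb mZ)) => t [inj fin] _.
rewrite patchE; case: (boolP (t \in _)) => [/set_mem /past_hit hp|/negP np].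
  congr (expN _)%:E; rewrite /feature_sum asboolT//.
  rewrite (esum_selected mU sepU ZE h0 inj).
  rewrite eseries_mkcond [RHS]eseries_mkcond; apply: eq_eseriesr => k _.
  by case: (boolP (act k t)) => // ak; rewrite /f /= (negbTE (hp k ak)).
(* Off the past event some atom is hit, the exponent is [+oo] and its exponential 0: this is the
   restriction of the integral to the event. *)
have [k [ak hk]] : exists k, act k t /\ hit (omega k t) (past (marks k t)).
  apply: contrapT => nk; apply: np; apply: mem_set; apply/past_hit => k ak.
  by apply/negP => hk; apply: nk; exists k.
rewrite (@nneseriesD1 R _ k)//.
rewrite [f _ _](_ : _ = +oo); last by rewrite /f ifT.
by rewrite addye// -ltNye (lt_le_trans (ltNyr 0))// nneseries_ge0.
Qed.

End core_identity.

Definition measure_pushforward d1 d2 (T1 : measurableType d1) (T2 : measurableType d2)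
    (R : realType) (m : {measure set T1 -> \bar R}) (f : T1 -> T2)
    (mf : measurable_fun setT f) : {measure set T2 -> \bar R} :=
  measure_function_pushforward__canonical__measure_function_Measure m mf.

(** * Conditional laws *)

Section simple_sets.
Context d (X : measurableType d) (R : realType) (U : nat -> set X).
Hypothesis mU : forall n, measurable (U n).
Context d' (Y : measurableType d') (J : finType) (ev : J -> Y -> rmeasure X R).
Hypothesis mev : forall j A, measurable A -> measurable_fun setT (fun y => ev j y A).

Lemma measurable_not_simple j A : measurable A ->
  measurable [set y | ev j y A <> hits_limit U (ev j y) A].
Proof.
move=> mA; have mh : measurable_fun setT (fun y => hits_limit U (ev j y) A).
  move=> _ B mB; rewrite setTI.
  apply: (sigma_sub_measurable (measurable_void_system mev)).
  exact: hits_limit_void.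
rewrite (_ : [set y | _] = [set y | ev j y A != hits_limit U (ev j y) A]); last first.
  by apply/seteqP; split => y /= /eqP.
by rewrite -[X in measurable X]setTI; apply: measurable_neqe => //; exact: mev.
Qed.

Lemma ae_simpleP (m : {measure set Y -> \bar R}) : ae_simple U ev m <->
  forall j A, measurable A -> m [set y | ev j y A <> hits_limit U (ev j y) A] = 0.
Proof.
split => h j A mA; first by apply: measure_negligible; [exact: measurable_not_simple|exact: h].
by apply/negligibleP; [exact: measurable_not_simple|exact: h].
Qed.

Lemma ae_simple_dominated (m m' : {measure set Y -> \bar R}) :
  (forall A, measurable A -> m A = 0 -> m' A = 0) -> ae_simple U ev m -> ae_simple U ev m'.
Proof.
move=> mm' /ae_simpleP h; apply/ae_simpleP => j A mA.
by apply: mm'; [exact: measurable_not_simple|exact: h].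
Qed.

End simple_sets.

Section void_conditional_law.
Context (R : realType) d (T : measurableType d) (P : probability T R).
Context (I : Type) dZ (ZT : measurableType dZ) (Zp : I -> T -> ZT).
Hypothesis mZp : forall i, measurable_fun setT (Zp i).
Local Notation F := (sigma_of_family Zp).
Local Notation TF := (g_sigma_algebraType (\bigcup_i sigma_of (Zp i))).
Context dV (V : measurableType dV) (UV : nat -> set V).
Hypothesis mUV : forall n, measurable (UV n).
Variables (J0 : finType) (pev : J0 -> T -> rmeasure V R).
Hypothesis mpev : forall j A, measurable A -> measurable_fun setT (fun t => pev j t A).
Hypothesis Fpev : F `<=` evals_sigma pev.
Hypothesis spev : ae_simple UV pev P.
Context dX (X : measurableType dX) (U : nat -> set X).
Hypothesis mU : forall n, measurable (U n).
Context dY (Y : measurableType dY) (J : finType) (ev : J -> Y -> rmeasure X R).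
Hypothesis mev : forall j A, measurable A -> measurable_fun setT (fun y => ev j y A).
Hypothesis evE : measurable `<=` evals_sigma ev.
Variables (Xf : T -> Y) (Q : T -> probability Y R).
Hypothesis mXf : measurable_fun setT Xf.
Hypothesis sX : ae_simple U ev (pushforward P Xf).
Hypothesis sQ : forall t, ae_simple U ev (Q t).
Hypothesis mQ : forall D, (forall j, measurable (D j)) ->
  measurable_fun setT (fun t : TF => Q t (void_event ev D)).
Hypothesis void_eq : forall D' D, (forall j, measurable (D' j)) -> (forall j, measurable (D j)) ->
  P (void_event pev D' `&` Xf @^-1` void_event ev D) =
  \int[P]_(t in void_event pev D') Q t (void_event ev D).

Let Fm : F `<=` measurable := sigma_of_family_measurable mZp.

Let measurable_void D : (forall j, measurable (D j)) -> measurable (void_event ev D).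
Proof. by move=> mD; apply: (measurable_void_system mev); exists D. Qed.

Let toT f : measurable_fun setT (f : TF -> \bar R) -> measurable_fun setT (f : T -> \bar R).
Proof.
move=> mf _ B mB; rewrite setTI; apply: Fm.
by have := mf measurableT B mB; rewrite setTI.
Qed.

(** By [void_approx], [E] may be replaced for all [t] at once by an event generated by the void
    events; a Dynkin argument then starts from the void probabilities, which are measurable by
    hypothesis. *)
Let measurable_Q E : measurable E -> measurable_fun setT (fun t : TF => Q t E).
Proof.
move=> mE; have [E' sE' QE'] := void_approx mU mev (evE mE).
rewrite (_ : (fun t => _) = (fun t => Q t E')); last by apply/funext => t; exact: (QE' (Q t) (sQ t)).
have sm := sigma_sub_measurable (measurable_void_system mev).
move: E' sE' {QE'}; apply: (@dynkin_induction _ (g_sigma_algebraType (void_system ev))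
  (void_system ev) (fun E => measurable_fun setT (fun t : TF => Q t E))).
- by [].
- exact: void_systemI.
- rewrite (_ : (fun t => _) = (fun=> 1)); first exact: measurable_cst.
  by apply/funext => t; exact: probability_setT.
- by move=> _ [D mD <-]; exact: mQ.
- move=> S mS h; rewrite (_ : (fun t => _) = (fun t => 1 - Q t S)).
    by apply: emeasurable_funB => //; exact: measurable_cst.
  by apply/funext => t; exact: (@probability_setC _ _ _ (Q t) _ (sm _ mS)).
- move=> G mG tG h; rewrite (_ : (fun t => _) = (fun t => \sum_(n <oo) Q t (G n))).
    by apply: ge0_emeasurable_sum.
  apply/funext => t; apply: measure_semi_bigcup => //.
    by move=> n; exact: (sm _ (mG n)).
  by apply: bigcup_measurable => n _; exact: (sm _ (mG n)).
Qed.

Let past_void A D : F A -> (forall j, measurable (D j)) ->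
  P (A `&` Xf @^-1` void_event ev D) = \int[P]_(t in A) Q t (void_event ev D).
Proof.
move=> FA mD; have mv := measurable_void mD.
have mB : measurable (Xf @^-1` void_event ev D) by exact: preimage_measurable.
pose m1 : {measure set T -> \bar R} := mrestr P mB.
pose m2 := mdens P (toT (mQ mD)) (fun t => measure_ge0 (Q t) _).
apply: (@void_laws_equal _ _ _ _ mUV _ _ _ pev mpev m1 m2).
- apply: (@le_lt_trans _ _ (P setT)); last by rewrite probability_setT ltry.
  by apply: le_measure; rewrite ?inE//; apply: measurableI.
- apply: ae_simple_dominated spev => // B mB' PB; apply/eqP.
  by rewrite -measure_le0 -PB; apply: le_measure; rewrite ?inE//; exact: measurableI.
- apply: ae_simple_dominated spev => // B mB' PB.
  by rewrite /m2 mdensE; apply: null_set_integral => //; apply: measurable_funTS; exact: toT (mQ mD).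
- by move=> D' mD'; exact: void_eq.
- exact: Fpev.
Qed.

(* The events of the conditioning sigma-algebra and of the target space are both
   determined by void events, up to null sets; so the defining identity of a
   conditional law is extended from void events first in the former, then in the
   latter. *)
Theorem void_cond_law : cond_law P F Xf Q.
Proof.
move=> E mE; split.
  by move=> B mB; have := measurable_Q mE measurableT mB; rewrite setTI.
move=> A FA; have mA := Fm FA.
pose k t : {measure set Y -> \bar R} := Q t.
have mk (B : set (Y * T)) : measurable B -> measurable_fun setT (fun t : T => k t [set y | B (y, t)]).
  move=> mB; have := @finite_kernel_section _ _ Y T R k _ setT B measurableT _ mB.
  have mk0 : forall C, measurable C -> measurable_fun setT (fun w => k w C).
    by move=> C mC; exact: toT (measurable_Q mC).
  have kfin w : k w setT < +oo.
    exact: (le_lt_trans (probability_le1 (Q w) measurableT) (ltry _)).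
  by move=> /(_ mk0 kfin); apply: eq_measurable_fun => t _; rewrite setIT.
pose m1 : {measure set Y -> \bar R} := measure_pushforward (mrestr P mA) mXf.
have mind : measurable_fun setT (fun t : T => (\1_A t)%:E : \bar R).
  by apply/measurable_EFinP; exact: measurable_indic.
have ind0 t : 0 <= (\1_A t)%:E :> \bar R by rewrite lee_fin indicE ler0n.
pose l := mdens P mind (fun t => ind0 t).
(* The averaged law, integral of [Q t] over [A], obtained as a marginal of a mixture so that it is a
   measure by construction. *)
pose m2 : {measure set Y -> \bar R} := measure_pushforward (mmixture l mk) measurable_fst.
have m2E B : measurable B -> m2 B = \int[P]_(t in A) Q t B.
  move=> mB; rewrite -[LHS]/(\int[l]_t Q t B) integral_mdens//; last first.
    exact: toT (measurable_Q mB).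
  rewrite [RHS]integral_mkcond; apply: eq_integral => t _.
  by rewrite patchE indicE; case: (t \in A); rewrite ?mule1 ?mule0.
rewrite -(m2E _ mE) -[LHS]/(P (A `&` Xf @^-1` E)) setIC -[LHS]/(m1 E).
apply: (@void_laws_equal _ _ _ _ mU _ _ _ ev mev m1 m2).
- apply: (@le_lt_trans _ _ (P setT)); last by rewrite probability_setT ltry.
  rewrite -[leLHS]/(P (Xf @^-1` setT `&` A)); apply: le_measure; rewrite ?inE//.
  by apply: measurableI; rewrite ?preimage_setT.
- apply: ae_simple_dominated sX => // B mB PB; apply/eqP.
  rewrite -measure_le0 -[leRHS]PB; apply: le_measure; rewrite ?inE//.
    by apply: measurableI => //; exact: preimage_measurable.
  exact: preimage_measurable.
- apply/(ae_simpleP mU mev) => j B mB; rewrite m2E; last exact: measurable_not_simple.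
  apply: integral0_eq => t _; have /(ae_simpleP mU mev (Q t)) h := @sQ t.
  exact: h.
- by move=> D mD; rewrite m2E; [rewrite -past_void// setIC|exact: measurable_void].
- exact: evE.
Qed.

End void_conditional_law.

Lemma integral_indicT d (Y : measurableType d) (R : realType) (m : {measure set Y -> \bar R})
    (A : set Y) : measurable A -> \int[m]_y (\1_A y)%:E = m A.
Proof. by move=> mA; rewrite integral_indic// setIT. Qed.

Section avoids_mpmf.
Context (R : realType) (q : nat).

Lemma indic_mpmf_ge0 (s : q.-tuple R) beta : (0 <= \1_(simplex R q) s * mpmf s beta)%R.
Proof.
rewrite indicE; case: (boolP (s \in _)) => [/set_mem ss|_]; last by rewrite mul0r.
by rewrite mul1r mpmf_ge0.
Qed.

Lemma measurable_indic_mpmf beta :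
  measurable_fun setT (fun s : q.-tuple R => \1_(simplex R q) s * mpmf s beta)%R.
Proof. by apply: measurable_funM; [exact: measurable_indic_simplex|exact: measurable_mpmf]. Qed.

Lemma measurable_avoids dW (W : measurableType dW) (D : 'I_q -> set W) beta :
  (forall j, measurable (D j)) ->
  measurable_fun setT (fun x : q.-tuple R * W => avoids D x.2 beta).
Proof.
move=> mD; apply: (measurable_fun_bool true); rewrite setTI.
rewrite (_ : _ @^-1` _ = \bigcap_(j in [set j | tnth beta j]) (setT `*` ~` D j)).
  apply: fin_bigcap_measurable => [|j _]; first exact: finite_finset.
  by apply: measurableX => //; exact: measurableC.
apply/seteqP; split => [x /= /avoidsP h j bj|x h /=]; first by split => //; exact: h.
by apply/avoidsP => j bj; have [] := h j bj.
Qed.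

End avoids_mpmf.

Section simple_coordinates.
Context (R : realType) dX (X : measurableType dX) (U : nat -> set X).
Hypothesis mU : forall n, measurable (U n).

(** A random measure seen as a family with a single coordinate, the counterpart of [coord] for the
    void events of [N]. *)
Definition whole (_ : unit) (mu : rmeasure X R) : rmeasure X R := mu.

Definition coord q (j : 'I_q) (z : q.-tuple (rmeasure X R)) : rmeasure X R := tnth z j.

Lemma measurable_whole j A : measurable A -> measurable_fun setT (fun y => whole j y A).
Proof. exact: measurable_rmeasure_ev. Qed.

Lemma measurable_coord q (j : 'I_q) A : measurable A ->
  measurable_fun setT (fun y => coord j y A).
Proof.
by move=> mA; exact: (measurableT_comp (measurable_rmeasure_ev mA) (measurable_tnth j)).
Qed.

Lemma hits_limit_mzero A : measurable A -> hits_limit U (mzero : rmeasure X R) A = 0.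
Proof.
move=> mA; rewrite (hits_limitE (mu := (mzero : rmeasure X R)))//; apply: hits_cvg => //.
apply: (simple_dirac_series (B := xpred0) (x := fun=> point)) => // B mB.
by rewrite eseries0.
Qed.

Lemma ae_simple_dirac_whole : ae_simple U whole (\d_(mzero : rmeasure X R) : {measure set _ -> \bar R}).
Proof.
apply/(ae_simpleP mU measurable_whole (\d_(mzero : rmeasure X R))) => j A mA.
rewrite /= /dirac indicE memNset//= => h.
by apply: h; rewrite hits_limit_mzero.
Qed.

Lemma ae_simple_dirac_coord q :
  ae_simple U (@coord q) (\d_[tuple (mzero : rmeasure X R) | j < q] : {measure set _ -> \bar R}).
Proof.
apply/(ae_simpleP mU (@measurable_coord q) (\d_[tuple (mzero : rmeasure X R) | j < q])) => j A mA.
rewrite /= /dirac indicE memNset//= => h.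
by apply: h; rewrite /coord tnth_mktuple hits_limit_mzero.
Qed.

Lemma dirac_void_whole D : \d_(mzero : rmeasure X R) (void_event whole D) = 1 :> \bar R.
Proof. by rewrite diracE mem_set. Qed.

Lemma dirac_void_coord q D :
  \d_[tuple (mzero : rmeasure X R) | j < q] (void_event (@coord q) D) = 1 :> \bar R.
Proof. by rewrite diracE mem_set// => j; rewrite /coord tnth_mktuple. Qed.

End simple_coordinates.

Lemma pushforward_probability d1 d2 (T1 : measurableType d1) (T2 : measurableType d2)
    (R : realType) (P : probability T1 R) (f : T1 -> T2) : measurable_fun setT f ->
  exists Q : probability T2 R, (Q : set T2 -> \bar R) = pushforward P f.
Proof. by move=> mf; exists (distribution P (mfun_Sub (mem_set mf))). Qed.

Lemma finite_set_enum (Y : choiceType) (A : set Y) : finite_set A ->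
  exists K (w : 'I_K -> Y), injective w /\ range w = A.
Proof.
move=> fA; pose s := finmap.enum_fset (fset_set A).
have sE y : (y \in s) = (y \in A) by exact: mem_enum_fset_set.
exists (size s), (fun l => tnth (in_tuple s) l); split.
  by apply/tuple_uniqP; exact: finmap.fset_uniq.
apply/seteqP; split => [_ [l _ <-]|y Ay].
  by apply: set_mem; rewrite -sE mem_tnth.
have ys : y \in in_tuple s by rewrite /= sE mem_set.
by have /tnthP[l ->] := ys; exists l.
Qed.

Lemma esum_range (R : realType) (Y : choiceType) K (w : 'I_K -> Y) (a : Y -> \bar R) :
  injective w -> (forall y, 0 <= a y) -> \esum_(y in range w) a y = \sum_(l < K) a (w l).
Proof.
move=> winj a0; rewrite (esum_image [set: 'I_K] w a); last by move=> l l' _ _; exact: winj.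
transitivity (\sum_(l <- enum 'I_K) a (w l)); last by rewrite big_enum.
rewrite esum_fset//; last by exact: finite_finset.
rewrite [RHS]fsbig_seq ?enum_uniq//.
rewrite (_ : [set` enum 'I_K] = setT)//.
by apply/seteqP; split => l _ //=; rewrite mem_enum.
Qed.

Section conditional_laws.
Context (R : realType) (q M : nat) (Omega : completePseudoMetricType R).
Hypothesis q_gt0 : (0 < q)%N.
Local Notation V := (q.-tuple R).
Local Notation W := (borel Omega).
Local Notation X := (V * W)%type.
Local Notation S := (simplex R q).
Local Notation mark := {ffun 'I_M.+1 -> q.-tuple bool}.
Variables (U : nat -> set W).
Hypothesis mU : forall n, measurable (U n).
Hypothesis sepU : separated_on U setT.
Variables (rho : R.-sigmafker W ~> V) (B0 : probability W R).
Hypothesis levy : levy_kernel rho.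
Local Notation nu := (levy_intensity q_gt0 B0 levy).
Local Notation nuM := (tilt_intensity q_gt0 B0 levy M).
Hypothesis fi : feature_intensity nu.
Context d (T : measurableType d) (P : probability T R).
Variable N : T -> rmeasure X R.
Hypothesis prmN : is_PRM P nu N.
Variable Z : 'I_M.+1 -> T -> q.-tuple (rmeasure W R).
Variables (act : nat -> T -> bool) (p : nat -> T -> V) (omega : nat -> T -> W)
  (b : 'I_M.+1 -> nat -> T -> q.-tuple bool).
Let atom k t := (act k t, (p k t, omega k t)).
Hypothesis matom : forall k, measurable_fun setT (atom k).
Hypothesis mb : forall i k, measurable_fun setT (b i k).
Hypothesis NE : forall t A, measurable A ->
  N t A = \sum_(0 <= k <oo | act k t) \d_(p k t, omega k t) A.
Hypothesis ZE : forall i j t A, measurable A -> tnth (Z i t) j A =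
  \sum_(0 <= k <oo | act k t && tnth (b i k t) j) \d_(omega k t) A.
Hypothesis condb : forall (m : nat) (beta : 'I_M.+1 -> 'I_m -> q.-tuple bool),
  cond_prob P (sigma_of_family atom)
    [set t | forall i (k : 'I_m), act k t -> b i k t = beta i k]
    (fun t => (\prod_(i < M.+1) \prod_(k < m | act k t) mpmf (p k t) (beta i k))%:E).

Hypothesis mZ : forall i, measurable_fun setT (Z i).


Local Notation Zp := (Zpast Z).
Local Notation TF := (g_sigma_algebraType (\bigcup_i sigma_of (Zp i))).
Let simp := ae_simplex_atoms fi prmN NE.
Let dist := ae_distinct_features q_gt0 fi mU sepU prmN NE.
Let nuME A : measurable A -> intensity (tilt M rho) B0 A = nuM A.
Proof. by move=> mA; rewrite -(tilt_intensityE q_gt0 B0 levy M mA). Qed.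
Let fiM : feature_intensity nuM.
Proof.
exact: (feature_intensity_mdens q_gt0 _ _ mU sepU (fun x => (tilt_density_bound q_gt0 M x).2) fi).
Qed.

(** Stated through the draws alone, without the enumeration of the atoms, so that it is an event of
    the past. *)
Definition good (t : T) : Prop := finitely_many Zp t /\
  forall v, selected Zp t v -> (0 < kappa M rho (feature_count Zp t v) v)%R.

Lemma ae_good : {ae P, forall t, good t}.
Proof.
apply: filterS (filterI dist (filterI (ae_finitely_many fi prmN matom mb NE ZE condb mZ)
  (ae_kappa_gt0 fi prmN matom mb NE condb))) => t [inj [fin k0]]; split => // v.
rewrite (selectedE mU sepU ZE) => -[k /= /andP[ak sk] <-].
by rewrite (feature_countE mU sepU ZE inj ak) k0.
Qed.

Let Zatoms := Zpast_atoms mU sepU ZE.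

(** The number of selected features with [kappa <= 0] is a [feature_sum], and positivity at all of
    them says that this number is 0. *)
Lemma measurable_good : measurable (good : set TF).
Proof.
pose h (c : 'I_q -> nat) v : \bar R := if (kappa M rho c v <= 0)%R then 1 else 0.
have mh c : measurable_fun setT (h c).
  apply: measurable_fun_ifT => //; apply: measurable_fun_ler => //.
  exact: (measurable_kappa _ q_gt0 levy).
have h0 c v : 0 <= h c v by rewrite /h; case: ifP.
have mfs := measurable_feature_sum mU sepU Zatoms mh h0.
rewrite (_ : good = finitely_many Zp `&` feature_sum Zp h @^-1` [set 0]).
  apply: measurableI; first exact: measurable_finitely_many.
  exact: (preimage_measurable mfs (B := [set 0])).
apply/seteqP; split => t [fin k0]; split => //; rewrite /= /feature_sum asboolT// in k0 *.
  by apply: esum1 => v /k0; rewrite /h leNgt => ->.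
move=> v sv; rewrite ltNge; apply/negP => kv.
have : \esum_(v in [set v]) h (feature_count Zp t v) v <= \esum_(v in selected Zp t) h (feature_count Zp t v) v.
  rewrite esum_mkcond [leRHS]esum_mkcond; apply: le_esum => y _.
  by case: ifPn => [/set_mem ->|_]; [rewrite mem_set|case: ifP].
by rewrite k0 esum_set1// /h kv lee_fin ler10.
Qed.

(** The conditional probability, given the past, that all atoms with their last marks pass the test
    [chi]: the factor of the unselected atoms times that of the selected features. *)
Definition chi_void (chi : X -> q.-tuple bool -> bool) (t : T) : \bar R :=
  (expN (\int[nuM]_x (\1_S x.1 * \sum_beta mpmf x.1 beta * (~~ chi x beta)%:R)%:E) *
   expN (feature_sum Zp (fun c v => lnN (chi_factor M rho chi c v)) t))%:E.

Section chi.
Variable chi : X -> q.-tuple bool -> bool.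
Hypothesis mchi : forall beta, measurable_fun setT (chi ^~ beta).

Let h0 c v : 0 <= lnN (chi_factor M rho chi c v).
Proof. by apply: lnN_ge0; have /andP[] := chi_factor01 M rho chi c v. Qed.

Lemma chi_factorE c v : (0 < kappa M rho c v)%R ->
  (chi_factor M rho chi c v)%:E = \int[jump_measure rho M c v]_s (\1_S s * chi_hat chi (s, v))%:E.
Proof.
apply: jump_factorE => [|s ss]; last exact: chi_hat01.
by apply: measurable_fun_pair1; exact: measurable_chi_hat.
Qed.

Lemma measurable_chi_void : measurable_fun setT (chi_void chi : TF -> \bar R).
Proof.
apply/measurable_EFinP; apply: measurable_funM; first exact: measurable_cst.
apply: (measurableT_comp (@measurable_expN R)).
apply: (measurable_feature_sum mU sepU Zatoms) => // c.
exact: (measurableT_comp (@measurable_lnN R) (measurable_chi_factor _ q_gt0 levy mchi c)).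
Qed.

Lemma chi_void_prod t K (w : 'I_K -> W) : good t -> injective w -> range w = selected Zp t ->
  chi_void chi t = (expN (\int[nuM]_x (\1_S x.1 *
     \sum_beta mpmf x.1 beta * (~~ chi x beta)%:R)%:E))%:E *
  \prod_(l < K) (chi_factor M rho chi (feature_count Zp t (w l)) (w l))%:E.
Proof.
move=> [fin _] winj wsel; rewrite /chi_void EFinM; congr (_ * _).
rewrite /feature_sum asboolT// -wsel esum_range// expN_sum// prodEFin; congr EFin.
apply: eq_bigr => l _; rewrite lnNK//.
by have /andP[] := chi_factor01 M rho chi (feature_count Zp t (w l)) (w l).
Qed.

End chi.

Lemma thinned_IBP_draws :
  IBP_draws P (thinned act p omega b) (fun _ : 'I_1 => thinned_draw R act omega b).
Proof.
exists (thin act b), p, omega, (fun _ k => b ord_max k); split.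
- by move=> k; exact: (measurable_thinned_atom matom mb).
- by move=> _ k; exact: mb.
- by move=> t A mA; exact: atoms_measureE.
- by move=> _ j t A mA; rewrite tnth_mktuple; exact: atoms_measureE.
- move=> m beta; have := thinned_cond_prob matom mb condb simp (beta ord0).
  rewrite (_ : [set t | forall i (k : 'I_m), thin act b k t -> b ord_max k t = beta i k] =
    [set t | forall k : 'I_m, thin act b k t -> b ord_max k t = beta ord0 k]); last first.
    by apply/seteqP; split => t h => [k|i k]; [exact: h|rewrite (ord1 i); exact: h].
  rewrite (_ : (fun t => (\prod_(i < 1) _)%:E) = (fun t =>
    (\prod_(k < m | thin act b k t) mpmf (p k t) (beta ord0 k))%:E)) //.
  by apply/funext => t; rewrite big_ord1.
Qed.

Lemma thinned_tilt_PRM : is_PRM P (intensity (tilt M rho) B0) (thinned act p omega b).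
Proof.
apply: (is_PRM_eq (nu := nuM)); first by move=> A mA; rewrite nuME.
apply: (thinned_PRM matom mb condb simp prmN NE (fi_simplex fi)) => f mf f0.
exact: integral_mdens.
Qed.

Section models.
Variables (t : T) (K : nat) (w : 'I_K -> W).
Hypothesis goodt : good t.
Hypotheses (winj : injective w) (wsel : range w = selected Zp t).
Let c l := feature_count Zp t (w l).

Let kappa_gt0 l : (0 < kappa M rho (c l) (w l))%R.
Proof. by apply: goodt.2; rewrite -wsel; exists l. Qed.

Lemma model_exists : exists d' (T' : measurableType d') (P' : probability T' R) NM J Zt bt,
  predictive_parts M rho B0 w c P' NM J Zt bt.
Proof. exact: (predictive_parts_exist thinned_tilt_PRM thinned_IBP_draws kappa_gt0). Qed.

Context d' (T' : measurableType d') (P' : probability T' R).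
Variables (NM : T' -> rmeasure X R) (J : 'I_K -> T' -> V).

(** The test ignores the bits, so [chi_hat] is the indicator of the complement of [D], and its mean
    under the jump law is the probability that the jump keeps the atom out of [D]. *)
Lemma posterior_chi_void D : posterior_parts M rho B0 w c P' NM J -> measurable D ->
  P' [set t' | add_atoms (NM t') xpredT (fun l => (J l t', w l)) D = 0] =
  chi_void (fun x _ => ~~ `[< D x >]) t.
Proof.
move=> pp mD; rewrite (posterior_void nuME kappa_gt0 pp mD).
have mchi : forall beta : q.-tuple bool, measurable_fun setT (fun x => ~~ `[< D x >]).
  move=> _; apply: (measurable_fun_bool false); rewrite setTI.
  rewrite (_ : _ @^-1` _ = D)//.
  by apply/seteqP; split => x /=; [move=> /negbFE/asboolP|move=> Dx; rewrite asboolT].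
have hatE x : chi_hat (fun x _ => ~~ `[< D x >]) x = \1_(~` D) x.
  rewrite /chi_hat -mulr_suml sum_mpmf1 mul1r indicE; congr (nat_of_bool _)%:R.
  by apply/negP/idP => [nD|/set_mem nD /asboolP//]; apply: mem_set => Dx; apply: nD; apply/asboolP.
have mS := @measurable_simplex R q.
rewrite (chi_void_prod _ goodt winj wsel); congr ((expN _)%:E * _).
  have mSD : measurable (S `*` setT `&` D) by apply: measurableI => //; exact: measurableX.
  transitivity (nuM (S `*` setT `&` D)).
    apply: measure_ae_set => //; exists (~` S `*` setT); split.
    - by apply: measurableX => //; exact: measurableC.
    - exact: (fi_simplex fiM).
    - by move=> x /= h; split=> // sx; apply: h; split => [|[]//]; split.
  rewrite -integral_indicT//; apply: eq_integral => x _; congr EFin.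
  rewrite -mulr_suml sum_mpmf1 mul1r !indicE negbK -natrM mulnb; congr (nat_of_bool _)%:R.
  apply/idP/andP => [/set_mem[[sx _] Dx]|[/set_mem sx /asboolP Dx]]; last exact: mem_set.
  by split; [exact: mem_set|exact/asboolP].
apply: eq_bigr => l _; rewrite (chi_factorE mchi); last exact: (kappa_gt0 l).
have mDw : measurable (~` [set s | D (s, w l)]).
  by apply: measurableC; exact: measurable_section.
transitivity (jump_measure rho M (c l) (w l) (S `&` ~` [set s | D (s, w l)])).
  apply: measure_ae_set => //; first exact: measurableI.
  exists (~` S); split; [exact: measurableC|exact: jump_measure_out|].
  by move=> s /= h ss; apply: h; split => [|[]].
rewrite -integral_indicT; last exact: measurableI.
apply: eq_integral => s _; rewrite hatE !indicE in_setI -natrM mulnb.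
by [].
Qed.

(** At a fixed feature the test depends only on the bits, so [chi_hat] is a combination of the
    functions [mpmf s beta], whose means are the values of [mpmf] at the mean jump. *)
Lemma predictive_chi_void Zt bt (D : 'I_q -> set W) :
  predictive_parts M rho B0 w c P' NM J Zt bt -> (forall j, measurable (D j)) ->
  P' [set t' | forall j, tnth [tuple add_atoms (tnth (Zt t') j)
      (fun l => tnth (bt l t') j) w | j < q] j (D j) = 0] =
  chi_void (fun x beta => avoids D x.2 beta) t.
Proof.
move=> pr mD; rewrite (predictive_void nuME fiM kappa_gt0 pr mD).
rewrite (chi_void_prod _ goodt winj wsel); congr (_ * _).
have mchi (beta : q.-tuple bool) : measurable_fun setT (fun x : X => avoids D x.2 beta).
  exact: measurable_avoids.
apply: eq_bigr => l _; rewrite (chi_factorE mchi); last exact: (kappa_gt0 l).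
transitivity (\int[jump_measure rho M (c l) (w l)]_s \sum_beta
    ((avoids D (w l) beta)%:R%:E * (\1_S s * mpmf s beta)%:E)).
  rewrite ge0_integral_sum//.
  - rewrite -sumEFin; apply: eq_bigr => beta _; rewrite mulrC EFinM.
    rewrite -(integral_jump_mpmf (kappa_gt0 l)) ge0_integralZl_EFin//.
    + by move=> s _; rewrite lee_fin indic_mpmf_ge0.
    + by apply/measurable_EFinP; exact: measurable_indic_mpmf.
  - by move=> beta; apply: emeasurable_funM => //; apply/measurable_EFinP; exact: measurable_indic_mpmf.
  - by move=> beta s _; rewrite mule_ge0// lee_fin ?indic_mpmf_ge0.
apply: eq_integral => s _; rewrite sumEFin /chi_hat mulr_sumr; congr EFin.
by apply: eq_bigr => beta _; rewrite mulrC -mulrA.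
Qed.

End models.

Local Notation not_in D := (fun (x : X) (_ : q.-tuple bool) => ~~ `[< D x >]).
Local Notation avoid D := (fun (x : X) beta => avoids D x.2 beta).
Let mUX : forall n, measurable (UX U n : set X) := measurable_UX mU.

(* Off the null event that [good] fails the conditional laws are set to a Dirac mass
   at the zero measure. *)
Definition gated_void chi t : \bar R := if `[< good t >] then chi_void chi t else 1.

(** Both laws are pinned down by data depending on [t] only, without reference to an enumeration of
    the selected features or to a model; any enumeration and any model must then give the same
    laws. *)
Definition has_laws t (Q : probability (rmeasure X R) R * probability (q.-tuple (rmeasure W R)) R) : Prop :=
  [/\ ae_simple (UX U) (@whole R _ X) Q.1, ae_simple U (@coord R _ W q) Q.2,
      forall D, (forall j, measurable (D j)) ->
        Q.1 (void_event (@whole R _ X) D) = gated_void (not_in (D tt)) t &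
      forall D, (forall j, measurable (D j)) ->
        Q.2 (void_event (@coord R _ W q) D) = gated_void (avoid D) t].

Section model_laws.
Variables (t : T) (K : nat) (w : 'I_K -> W).
Hypothesis goodt : good t.
Hypotheses (winj : injective w) (wsel : range w = selected Zp t).
Local Notation c := (fun l => feature_count Zp t (w l)).
Context d' (T' : measurableType d') (P' : probability T' R).
Variables (NM : T' -> rmeasure X R) (J : 'I_K -> T' -> V).

Let post t' := add_atoms (NM t') xpredT (fun l => (J l t', w l)).

Let whole_void D : post @^-1` void_event (@whole R _ X) D = [set t' | post t' (D tt) = 0].
Proof. by apply/seteqP; split => t' /= h; [exact: h|case]. Qed.

Lemma posterior_simple : posterior_parts M rho B0 w c P' NM J ->
  ae_simple (UX U) (@whole R _ X) (pushforward P' post).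
Proof.
move=> pp; apply: (ae_simple_pushforward mUX (@measurable_whole _ _ _)).
  exact: (measurable_posterior nuME pp).
by move=> j A mA; exact: (posterior_hits q_gt0 mU sepU nuME fiM winj pp mA).
Qed.

(** The model is arbitrary: its law and [Q.1] are both simple and have the same void
    probabilities. *)
Lemma posterior_law Q : has_laws t Q -> posterior_parts M rho B0 w c P' NM J ->
  forall E, measurable E -> Q.1 E = P' [set t' | E (post t')].
Proof.
move=> [s1 _ v1 _] pp E mE.
apply: (void_laws_equal mUX (@measurable_whole _ _ _) (m1 := Q.1)
  (m2 := measure_pushforward P' (measurable_posterior nuME pp))) => //.
- exact: (le_lt_trans (probability_le1 Q.1 measurableT) (ltry _)).
- exact: posterior_simple.
- move=> D mD; transitivity (gated_void (not_in (D tt)) t); first exact: v1.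
  rewrite /gated_void asboolT// -(posterior_chi_void goodt winj wsel pp (mD tt)).
  by rewrite -whole_void.
- exact: measurable_rmeasure_sub.
Qed.

Variables (Zt : T' -> q.-tuple (rmeasure W R)) (bt : 'I_K -> T' -> q.-tuple bool).

Let pred t' : q.-tuple (rmeasure W R) :=
  [tuple add_atoms (tnth (Zt t') j) (fun l => tnth (bt l t') j) w | j < q].

Lemma predictive_simple : predictive_parts M rho B0 w c P' NM J Zt bt ->
  ae_simple U (@coord R _ W q) (pushforward P' pred).
Proof.
move=> pr; apply: (ae_simple_pushforward mU (@measurable_coord _ _ _ q)).
  exact: (measurable_predictive pr).
by move=> j A mA; exact: (predictive_hits q_gt0 mU sepU nuME fiM winj pr j mA).
Qed.

Lemma predictive_law Q : has_laws t Q -> predictive_parts M rho B0 w c P' NM J Zt bt ->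
  forall E, measurable E -> Q.2 E = P' [set t' | E (pred t')].
Proof.
move=> [_ s2 _ v2] pr E mE.
apply: (void_laws_equal mU (@measurable_coord _ _ _ q) (m1 := Q.2)
  (m2 := measure_pushforward P' (measurable_predictive pr))) => //.
- exact: (le_lt_trans (probability_le1 Q.2 measurableT) (ltry _)).
- exact: predictive_simple.
- move=> D mD; transitivity (gated_void (avoid D) t); first exact: v2.
  rewrite /gated_void asboolT//.
  by rewrite -(predictive_chi_void goodt winj wsel pr mD).
- exact: measurable_tuple_rmeasure_sub.
Qed.

Lemma model_has_laws : predictive_parts M rho B0 w c P' NM J Zt bt ->
  exists Q, has_laws t Q.
Proof.
move=> pr; have pp := pr_parts pr.
have [Q1 Q1E] := pushforward_probability P' (measurable_posterior nuME pp).
have [Q2 Q2E] := pushforward_probability P' (measurable_predictive pr).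
exists (Q1, Q2); split => /=.
- by rewrite Q1E; exact: posterior_simple.
- by rewrite Q2E; exact: predictive_simple.
- move=> D mD; rewrite Q1E /gated_void asboolT//.
  rewrite -(posterior_chi_void goodt winj wsel pp (mD tt)).
  by rewrite -[LHS]/(P' (post @^-1` void_event (@whole R _ X) D)) whole_void.
- move=> D mD; rewrite Q2E /gated_void asboolT//.
  by rewrite -(predictive_chi_void goodt winj wsel pr mD).
Qed.

End model_laws.

Lemma laws_exist t : exists Q, has_laws t Q.
Proof.
have [gt|ngt] := pselect (good t).
  have [K [w [winj wsel]]] := finite_set_enum (Zatoms gt.1).1.
  have [d' [T' [P' [NM [J [Zt [bt pr]]]]]]] := model_exists gt wsel.
  exact: (model_has_laws gt winj wsel pr).
exists ((\d_(mzero : rmeasure X R) : probability _ R),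
  (\d_[tuple (mzero : rmeasure W R) | j < q] : probability _ R)); split => /=.
- exact: ae_simple_dirac_whole.
- exact: ae_simple_dirac_coord.
- by move=> D mD; rewrite /gated_void asboolF// dirac_void_whole.
- by move=> D mD; rewrite /gated_void asboolF// dirac_void_coord.
Qed.

(** The choice is made separately for each [t]; measurability in [t] is recovered from the void
    probabilities by [void_cond_law]. *)
Definition laws t := projT1 (cid (laws_exist t)).

Lemma lawsP t : has_laws t (laws t).
Proof. exact: (projT2 (cid (laws_exist t))). Qed.

Lemma draws_hits i j A : measurable A ->
  {ae P, forall t, tnth (Z i t) j A = hits_limit U (tnth (Z i t) j) A}.
Proof.
move=> mA; apply: filterS dist => t inj; apply/esym/hits_limitE/hits_cvg => //.
apply: (simple_dirac_series (B := fun k => act k t && tnth (b i k t) j) (x := omega ^~ t)).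
  by move=> k l /andP[ak _] /andP[al _] h; apply: inj => //; exact: sepU.
by move=> B mB; exact: ZE.
Qed.

Let pev (ij : 'I_M * 'I_q) t : rmeasure W R := tnth (Zp ij.1 t) ij.2.

Let mZp i : measurable_fun setT (Zp i) := mZ _.

Let mpev ij A : measurable A -> measurable_fun setT (fun t => pev ij t A).
Proof. by move=> mA; exact: (measurableT_comp (measurable_coord ij.2 mA) (mZp ij.1)). Qed.

Let Fpev : sigma_of_family Zp `<=` evals_sigma pev.
Proof.
apply: smallest_sub; first exact: smallest_sigma_algebra.
move=> _ [i _ [B mB <-]]; rewrite setTI; have := measurable_tuple_rmeasure_sub mB.
move: B {mB}; apply: smallest_sub.
  split.
  - by rewrite /= preimage_set0; exact: sigma_algebra0.
  - by move=> B hB; rewrite /= setTD preimage_setC; exact: sigma_algebraC.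
  - move=> F hF; rewrite /= preimage_bigcup; exact: sigma_algebra_bigcup.
move=> _ [[j A] _ [B mB <-]]; apply: sub_sigma_algebra.
by exists ((i, j), A) => //; exists B => //; rewrite !setTI.
Qed.

Let spev : ae_simple U pev P.
Proof. by move=> ij A mA; exact: draws_hits. Qed.

Let mN : measurable_fun setT N := prm_measurable prmN.

Let measurable_gated_void chi : (forall beta, measurable_fun setT (chi ^~ beta)) ->
  measurable_fun setT (fun t : TF => gated_void chi t).
Proof.
move=> mchi; apply: measurable_fun_ifT; last exact: measurable_cst; last exact: measurable_chi_void.
apply: (measurable_fun_bool true); rewrite setTI (_ : _ @^-1` _ = good).
  exact: measurable_good.
by apply/seteqP; split => t /= /asboolP.
Qed.

Let gated_void_eq (chi : X -> q.-tuple bool -> bool) (D' : 'I_M * 'I_q -> set W) : (forall beta, measurable_fun setT (chi ^~ beta)) ->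
  (forall ij, measurable (D' ij)) ->
  P (void_event pev D' `&` [set t | forall k, act k t -> chi (p k t, omega k t) (b ord_max k t)]) =
  \int[P]_(t in void_event pev D') gated_void chi t.
Proof.
move=> mchi mD'; have mvoid : measurable (void_event pev D').
  by apply: (measurable_void_system mpev); exists D'.
have toT f : measurable_fun setT (f : TF -> \bar R) -> measurable_fun setT (f : T -> \bar R).
  move=> mf _ B mB; rewrite setTI; apply: (sigma_of_family_measurable mZp).
  by have := mf measurableT B mB; rewrite setTI.
rewrite (_ : void_event pev D' = [set t | forall i j, tnth (Zp i t) j (D' (i, j)) = 0]); last first.
  by apply/seteqP; split => [t h i j|t h [i j]]; [exact: (h (i, j))|exact: h].
rewrite (past_draw_prob mU sepU fi prmN matom mb NE ZE condb mZ mchi (D := fun i j => D' (i, j))); last first.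
  by move=> i j; exact: mD'.
rewrite -(_ : void_event pev D' = [set t | forall i j, tnth (Zp i t) j (D' (i, j)) = 0]); last first.
  by apply/seteqP; split => [t h i j|t h [i j]]; [exact: (h (i, j))|exact: h].
apply: ge0_ae_eq_integral => //.
- by apply: measurable_funTS; apply: toT; exact: measurable_chi_void.
- by apply: measurable_funTS; apply: toT; exact: measurable_gated_void.
- by move=> t _; rewrite lee_fin mulr_ge0 ?expN_ge0.
- by move=> t _; rewrite /gated_void; case: ifP => // _; rewrite lee_fin mulr_ge0 ?expN_ge0.
apply: filterS ae_good => t gt _.
by rewrite /gated_void asboolT.
Qed.

Let measurable_not_in (D : set X) (beta : q.-tuple bool) : measurable D ->
  measurable_fun setT (fun x => not_in D x beta).
Proof.
move=> mD; apply: (measurable_fun_bool false); rewrite setTI.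
rewrite (_ : _ @^-1` _ = D)//.
by apply/seteqP; split => x /=; [move=> /negbFE/asboolP|move=> Dx; rewrite asboolT].
Qed.

Theorem posterior_cond_law : cond_law P (sigma_of_family Zp) N (fun t => (laws t).1).
Proof.
apply: (@void_cond_law _ _ _ P _ _ _ _ mZp _ _ _ mU _ _ mpev Fpev spev _ _ _ mUX _ _ _ _
  (@measurable_whole _ _ _)).
- exact: measurable_rmeasure_sub.
- exact: mN.
- apply: (ae_simple_pushforward mUX (@measurable_whole _ _ _) mN) => j A mA.
  exact: (PRM_hits_limit mUX prmN (fi_atom_class fi sepU) (fi_sigma_finite q_gt0 fi) mA).
- by move=> t; have [] := lawsP t.
- move=> D mD; rewrite (_ : (fun t => _) = (fun t => gated_void (not_in (D tt)) t)).
    by apply: measurable_gated_void => beta; exact: measurable_not_in.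
  by apply/funext => t; have [_ _ h _] := lawsP t; exact: h.
move=> D' D mD' mD.
transitivity (\int[P]_(t in void_event pev D') gated_void (not_in (D tt)) t); last first.
  by apply: eq_integral => t _; have [_ _ h _] := lawsP t; exact/esym/h.
rewrite -gated_void_eq//; last by move=> beta; exact: measurable_not_in.
congr (P (_ `&` _)); apply/seteqP; split => t /= h.
  move=> k ak; have := h tt; rewrite /whole NE// => /dirac_series0 nD.
  by apply/negP => /asboolP; exact: nD.
move=> [] /=; rewrite /whole NE//; apply/dirac_series0 => k ak Dk.
by have := h k ak; rewrite asboolT.
Qed.

Theorem predictive_cond_law : cond_law P (sigma_of_family Zp) (Z ord_max) (fun t => (laws t).2).
Proof.
apply: (@void_cond_law _ _ _ P _ _ _ _ mZp _ _ _ mU _ _ mpev Fpev spev _ _ _ mU _ _ _ _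
  (@measurable_coord _ _ _ q)).
- exact: measurable_tuple_rmeasure_sub.
- exact: mZ.
- apply: (ae_simple_pushforward mU (@measurable_coord _ _ _ q) (mZ _)) => j A mA.
  exact: draws_hits.
- by move=> t; have [] := lawsP t.
- move=> D mD; rewrite (_ : (fun t => _) = (fun t => gated_void (avoid D) t)).
    by apply: measurable_gated_void => beta; exact: measurable_avoids.
  by apply/funext => t; have [_ _ _ h] := lawsP t; exact: h.
move=> D' D mD' mD.
transitivity (\int[P]_(t in void_event pev D') gated_void (avoid D) t); last first.
  by apply: eq_integral => t _; have [_ _ _ h] := lawsP t; exact/esym/h.
rewrite -gated_void_eq//; last by move=> beta; exact: measurable_avoids.
congr (P (_ `&` _)); apply/seteqP; split => t /= h.
  move=> k ak; apply/avoidsP => j bj /= Dk.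
  by have := h j; rewrite /coord ZE// => /dirac_series0 /(_ k); rewrite ak bj; apply.
move=> j; rewrite /coord ZE//; apply/dirac_series0 => k /andP[ak bj] Dk.
by have /avoidsP/(_ j bj) := h k ak.
Qed.

End conditional_laws.

Theorem proposition5p1 (R : realType) (q M : nat) (q_gt0 : (0 < q)%N)
  (Omega : completePseudoMetricType R) (polO : polish Omega)
  (B0 : probability (borel Omega) R) (naB0 : nonatomic B0)
  (rho : R.-sigmafker (borel Omega) ~> (q.-tuple R)) (levy : levy_kernel rho)
  (meanfin : \int[B0]_w \int[rho w]_(s in simplex R q) (tot s)%:E < +oo)
  (d : measure_display) (T : measurableType d) (P : probability T R)
  (N : T -> rmeasure (q.-tuple R * borel Omega)%type R)
  (prmN : is_PRM P (intensity (fun w => rho w) B0) N)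
  (Z : 'I_M.+1 -> T -> q.-tuple (rmeasure (borel Omega) R))
  (ibpZ : IBP_draws P N Z) :
  let Zpast : 'I_M -> T -> q.-tuple (rmeasure (borel Omega) R) :=
    fun i => Z (widen_ord (leqnSn M) i) in
  let F : set_system T := sigma_of_family Zpast in
  exists (Q1 : T -> probability (rmeasure (q.-tuple R * borel Omega)%type R) R)
         (Q2 : T -> probability (q.-tuple (rmeasure (borel Omega) R)) R),
  [/\ cond_law P F N Q1,
      cond_law P F (Z ord_max) Q2 &
      {ae P, forall t, finite_set (selected Zpast t) /\
        forall (K : nat) (w : 'I_K -> borel Omega),
        injective w -> range w = selected Zpast t ->
        let c l := feature_count Zpast t (w l) in
        let r l := rvec M rho (c l) (w l) in
        [/\ (* such N_M, J, Zt, b exist *)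
            (exists (d' : measure_display) (T' : measurableType d')
               (P' : probability T' R) NM J Zt b,
               predictive_parts M rho B0 w c P' NM J Zt b),
            (* (1) *)
            (forall (d' : measure_display) (T' : measurableType d')
               (P' : probability T' R) NM J,
               posterior_parts M rho B0 w c P' NM J ->
               forall E, measurable E ->
                 Q1 t E =
                 P' [set t' | E (add_atoms (NM t') xpredT
                                   (fun l => (J l t', w l)))]) &
            (forall (d' : measure_display) (T' : measurableType d')
               (P' : probability T' R) NM J Zt b,
               predictive_parts M rho B0 w c P' NM J Zt b ->
               [/\ (* (2) *)
                   (forall E, measurable E ->
                      Q2 t E =
                      P' [set t' | E [tuple add_atoms (tnth (Zt t') j)
                                        (fun l => tnth (b l t') j) w
                                     | j < q]]),
                   (* (3) *)
                   (forall l,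
                      [/\ forall k, 'E_P'[fun t' => tnth (J l t') k]
                                    = (tnth (r l) k)%:E,
                          simplex R q (r l) &
                          forall beta, P' (b l @^-1` [set beta])
                                       = (mpmf (r l) beta)%:E]) &
                   (* (4) *)
                   (forall l,
                      (forall U : set nat,
                         P' [set t' | U (btot (b l t'))] =
                         bernoulli_prob (tot (r l))
                           [set x : bool | U (nat_of_bool x)]) /\
                      (forall beta,
                         (fine (P' [set t' | b l t' = beta
                                             /\ btot (b l t') = 1%N])
                          / fine (P' [set t' | btot (b l t') = 1%N]))%R =
                         (if btot beta == 1%N then
                            \prod_(j < q)
                              (tnth (r l) j / tot (r l)) ^+ tnth beta j
                          else 0)%R))])]}].
Proof.
move=> Zpast F.
have [U [mU sepU]] := polish_separating polO.
have fi := levy_feature_intensity q_gt0 levy mU sepU naB0 meanfin.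
have mZ := IBP_draws_measurable ibpZ.
have [act [p [omega [b [matom mb NE ZE condb]]]]] := ibpZ.
have prm : is_PRM P (levy_intensity q_gt0 B0 levy) N := prmN.
pose Q := laws mU sepU fi prm matom mb NE ZE condb.
exists (fun t => (Q t).1), (fun t => (Q t).2); split.
- exact: posterior_cond_law.
- exact: predictive_cond_law.
apply: filterS (ae_good mU sepU fi prm matom mb NE ZE condb mZ) => t gt.
have Qt := lawsP mU sepU fi prm matom mb NE ZE condb t.
split; first exact: (Zpast_atoms mU sepU ZE gt.1).1.
move=> K w winj wsel.
have k0 l : (0 < kappa M rho (feature_count Zpast t (w l)) (w l))%R by apply: gt.2; rewrite -[selected _ _]wsel; exists l.
split.
- exact: (model_exists fi prm matom mb NE condb gt wsel).
- by move=> d' T' P' NM J pp E mE; exact: (posterior_law mU sepU fi gt winj wsel Qt pp mE).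
move=> d' T' P' NM J Zt bt pr; split.
- by move=> E mE; exact: (predictive_law mU sepU fi gt winj wsel Qt pr mE).
- move=> l; split.
  + by move=> k; exact: (jump_mean k0 pr).
  + exact: rvec_simplex.
  + by move=> beta; exact: (bits_law k0 pr).
- move=> l; split.
  + by move=> B; exact: (btot_bernoulli k0 pr).
  + by move=> beta; exact: (bits_given_btot q_gt0 k0 pr).
Qed.
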